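(* Let $A(\mathsf{w})$ be a $3$-Calabi-Yau algebra with superpotential $\mathsf{w}\in V^{\otimes(m+1)}$, and let $\mathcal{D}$ be the sheaf of graded $\mathcal{O}_{\mathbb{P}(V)}$-algebras on $\mathbb{P}(V)$ defined in the context. Then for every open affine $\mathrm{Spec}(R)=U\subseteq\mathbb{P}(V)$, the $R$-linear abelian category $\mathsf{QGr}(\mathcal{D}_U)$ is flat over $R$ in the sense of Lowen and Van den Bergh. (This is expressed by saying that $\mathsf{QGr}(\mathcal{D})$ is flat over $\mathbb{P}(V)$.)
   Context: Fix a field $\Bbbk$ and an $n$-dimensional vector space $V$ with basis $x_1,\ldots,x_n$ and dual basis $c_1,\ldots,c_n$ of $V^*$; $m\geq 2$. A superpotential $\mathsf{w}\in V^{\otimes(m+1)}$ is an element invariant under $v_1\otimes\cdots\otimes v_{m+1}\mapsto v_{m+1}\otimes v_1\otimes\cdots\otimes v_m$. Write $\mathsf{w}=x_1\mathsf{w}_1+\cdots+x_n\mathsf{w}_n$ with $\mathsf{w}_i\in V^{\otimes m}$; $A(\mathsf{w})=TV/(\mathsf{w}_1,\ldots,\mathsf{w}_n)$, where $TV$ is the tensor algebra with $V$ in degree one. A graded algebra $A$ is $d$-Calabi-Yau if $A$ has a finite-length resolution by finitely generated projective left modules over $A^e=A\otimes A^\circ$ and $\mathrm{Ext}^i_{A^e}(A,A^e)$ is $0$ for $i\neq d$ and $\cong A(\ell)$ as graded bimodules for $i=d$, for some $\ell\in\mathbb{Z}$. The sheaf $\mathcal{D}$: let $S=\Bbbk[c_1,\ldots,c_n]$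 be the polynomial ring with each $c_i$ in degree one, so $\mathbb{P}(V)=\mathrm{Proj}(S)$. Let $E$ be the $S$-algebra generated by $x_1,\ldots,x_n$ modulo the relations $c_i\mathsf{w}_j-c_j\mathsf{w}_i=0$ and $[x_i,\mathsf{w}_j]=0$ for $1\le i,j\le n$. Viewing $E$ as a graded $S$-module via the grading by the $c_i$, $\mathcal{D}$ is the quasi-coherent sheaf of algebras on $\mathbb{P}(V)$ whose sections over $\mathrm{Spec}(S[f^{-1}]_0)$ are $E[f^{-1}]_0$; it is graded by placing $x_1,\ldots,x_n$ in degree one. For an open subscheme $U$, $\mathcal{D}_U$ is the restriction of $\mathcal{D}$ to $U$. Fibers: the fiber of a quasi-coherent sheaf at a point $x$ is its pullback along $\mathrm{Spec}(\Bbbk(x))\to\mathbb{P}(V)$, where $\Bbbk(x)$ is the residue field. The fiber of $\mathcal{D}$ at $x$ is denoted $D_x$. At a $\Bbbk$-point $x$, represented by a non-zero vector $x\in V$, it is the algebra $D_x=TV/I_x$, where $I_x$ is the ideal generated by the elements $\langle\psi,\mathsf{w}\rangle$ with $\psi\in V^*$, $\psi(x)=0$, and the commutators $[y,\langle\psi,\mathsf{w}\rangle]$ with $y\in V$, $\psi\in V^*$; here $\langle\psi,\mathsf{w}\rangle=(\psi\otimes\mathrm{id}^{\otimes m})(\mathsf{w})$. For a connected graded algebra $D$ over a field, $\mathsf{Gr}(D)$ is the category of $\mathbb{Z}$-graded left $D$-modules and $\mathsf{Tors}(D)$ is its full subcategory of graded modules that are the sum of their finite-dimensional submodules. Similarly,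 $\mathsf{Gr}(\mathcal{D}_U)$ is the category of graded quasi-coherent sheaves of (left) $\mathcal{D}_U$-modules, $\mathsf{Tors}(\mathcal{D}_U)$ is the subcategory consisting of the modules whose fibers are in $\mathsf{Tors}(D_x)$ for all $x\in\mathbb{P}(V)$, and $\mathsf{QGr}(\mathcal{D}_U)$ is the quotient category $\mathsf{Gr}(\mathcal{D}_U)/\mathsf{Tors}(\mathcal{D}_U)$. Flatness (Lowen-Van den Bergh), for an $R$-linear abelian category $\mathcal{C}$ over a coherent commutative ring $R$: for $X\in\mathrm{mod}(R)$ (finitely presented modules) and $C\in\mathcal{C}$ let $\mathrm{Hom}_R(X,C)\in\mathcal{C}$ be the object representing $C'\mapsto\mathrm{Hom}_R(X,\mathrm{Hom}_{\mathcal{C}}(C',C))$, and let $\mathrm{Ext}^i_R(X,C)$ be the derived functors in $X$. $\mathcal{C}$ is flat over $R$ if for each $X\in\mathrm{mod}(R)$ and $i>0$ the functor $\mathrm{Ext}^i_R(X,-)\colon\mathcal{C}\to\mathcal{C}$ is effaceable; if $\mathcal{C}$ has enough injectives this means that for every injective $I\in\mathcal{C}$ the functor $\mathrm{Hom}_R(-,I)\colon\mathrm{mod}(R)\to\mathcal{C}$ is exact.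
   Formalization: Tors(D_U), defined by fibers, is not closed under submodules (e.g. (R[1/t]/R)⊗D has zero fibers but contains D/tD), so QGr(D_U) is taken as the quotient of Gr(D_U) by the largest Serre subcategory contained in Tors(D_U). *)

(* Defs.v *)
From HB Require Import structures.
From mathcomp Require Import all_boot all_algebra.
From mathcomp Require Import boolp.
From mathcomp.multinomials Require Import monalg mpoly.
From mathcomp Require Import ring.

Set Implicit Arguments.
Unset Strict Implicit.
Unset Printing Implicit Defensive.

Import GRing.Theory.
Local Open Scope quotient_scope.
Local Open Scope ring_scope.

(** * Algebras given by generators and relations *)

Section QuotientRing.
Variables (T : nzRingType) (G : T -> Prop).

Inductive two_sided_ideal : T -> Prop :=
| tsi0 : two_sided_ideal 0
| tsiD a b : two_sided_ideal a -> two_sided_ideal b -> two_sided_ideal (a + b)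
| tsiM a g b : G g -> two_sided_ideal (a * g * b).

Lemma tsiMl c a : two_sided_ideal a -> two_sided_ideal (c * a).
Proof.
elim=> [|a1 b1 _ IH1 _ IH2|a1 g b1 Gg].
- by rewrite mulr0; exact: tsi0.
- by rewrite mulrDr; exact: tsiD.
- by rewrite !mulrA; exact: tsiM.
Qed.

Lemma tsiMr c a : two_sided_ideal a -> two_sided_ideal (a * c).
Proof.
elim=> [|a1 b1 _ IH1 _ IH2|a1 g b1 Gg].
- by rewrite mul0r; exact: tsi0.
- by rewrite mulrDl; exact: tsiD.
- by rewrite -mulrA; exact: tsiM.
Qed.

Lemma tsiN a : two_sided_ideal a -> two_sided_ideal (- a).
Proof. by rewrite -mulN1r; exact: tsiMl. Qed.

Definition tsi_rel : rel T := fun a b => `[< two_sided_ideal (a - b) >].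

Lemma tsi_refl : reflexive tsi_rel.
Proof. by move=> a; apply/asboolP; rewrite subrr; exact: tsi0. Qed.

Lemma tsi_sym : ssrbool.symmetric tsi_rel.
Proof. by move=> a b; apply/asboolP/asboolP=> /tsiN; rewrite opprB. Qed.

Lemma tsi_trans : transitive tsi_rel.
Proof.
move=> b a c /asboolP ab /asboolP bc; apply/asboolP.
by have := tsiD ab bc; rewrite addrA subrK.
Qed.

Canonical tsi_equiv := EquivRel tsi_rel tsi_refl tsi_sym tsi_trans.

Definition quot_ring := {eq_quot tsi_equiv}.
HB.instance Definition _ := Choice.on quot_ring.

Definition quot_pi (a : T) : quot_ring := \pi_quot_ring a.

Lemma quot_piP a b : quot_pi a = quot_pi b <-> two_sided_ideal (a - b).
Proof. by split=> [/eqmodP/asboolP|h]; [|apply/eqmodP/asboolP]. Qed.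

Lemma quot_pi_surj (x : quot_ring) : exists a, x = quot_pi a.
Proof. by exists (repr x); rewrite /quot_pi reprK. Qed.

Lemma quot_repr a : two_sided_ideal (repr (quot_pi a) - a).
Proof. by apply/quot_piP; rewrite /quot_pi reprK. Qed.

Definition quot_add (x y : quot_ring) := quot_pi (repr x + repr y).
Definition quot_opp (x : quot_ring) := quot_pi (- repr x).
Definition quot_mul (x y : quot_ring) := quot_pi (repr x * repr y).

Lemma quot_addE a b : quot_add (quot_pi a) (quot_pi b) = quot_pi (a + b).
Proof.
apply/quot_piP; rewrite opprD addrACA; apply: tsiD; exact: quot_repr.
Qed.

Lemma quot_oppE a : quot_opp (quot_pi a) = quot_pi (- a).
Proof. by apply/quot_piP; rewrite -opprD; apply/tsiN; exact: quot_repr. Qed.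

Lemma quot_mulE a b : quot_mul (quot_pi a) (quot_pi b) = quot_pi (a * b).
Proof.
apply/quot_piP.
rewrite [X in two_sided_ideal X](_ : _ =
  (repr (quot_pi a) - a) * repr (quot_pi b) + a * (repr (quot_pi b) - b)).
  by apply: tsiD; [apply: tsiMr|apply: tsiMl]; exact: quot_repr.
by rewrite mulrBl mulrBr addrA subrK.
Qed.

Fact quot_addA : associative quot_add.
Proof.
move=> x y z; have [a ->] := quot_pi_surj x; have [b ->] := quot_pi_surj y.
by have [c ->] := quot_pi_surj z; rewrite !quot_addE addrA.
Qed.

Fact quot_addC : commutative quot_add.
Proof.
move=> x y; have [a ->] := quot_pi_surj x; have [b ->] := quot_pi_surj y.
by rewrite !quot_addE addrC.
Qed.

Fact quot_add0 : left_id (quot_pi 0) quot_add.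
Proof. by move=> x; have [a ->] := quot_pi_surj x; rewrite quot_addE add0r. Qed.

Fact quot_addN : left_inverse (quot_pi 0) quot_opp quot_add.
Proof.
by move=> x; have [a ->] := quot_pi_surj x; rewrite quot_oppE quot_addE addNr.
Qed.

HB.instance Definition _ := GRing.isZmodule.Build quot_ring
  quot_addA quot_addC quot_add0 quot_addN.

Fact quot_mulA : associative quot_mul.
Proof.
move=> x y z; have [a ->] := quot_pi_surj x; have [b ->] := quot_pi_surj y.
by have [c ->] := quot_pi_surj z; rewrite !quot_mulE mulrA.
Qed.

Fact quot_mul1 : left_id (quot_pi 1) quot_mul.
Proof. by move=> x; have [a ->] := quot_pi_surj x; rewrite quot_mulE mul1r. Qed.

Fact quot_mulr1 : right_id (quot_pi 1) quot_mul.
Proof. by move=> x; have [a ->] := quot_pi_surj x; rewrite quot_mulE mulr1. Qed.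

Fact quot_mulDl : left_distributive quot_mul quot_add.
Proof.
move=> x y z; have [a ->] := quot_pi_surj x; have [b ->] := quot_pi_surj y.
by have [c ->] := quot_pi_surj z; rewrite !(quot_mulE, quot_addE) mulrDl.
Qed.

Fact quot_mulDr : right_distributive quot_mul quot_add.
Proof.
move=> x y z; have [a ->] := quot_pi_surj x; have [b ->] := quot_pi_surj y.
by have [c ->] := quot_pi_surj z; rewrite !(quot_mulE, quot_addE) mulrDr.
Qed.

HB.instance Definition _ := GRing.Zmodule_isPzRing.Build quot_ring
  quot_mulA quot_mul1 quot_mulr1 quot_mulDl quot_mulDr.

Fact quot_pi_zmod_morphism : zmod_morphism quot_pi.
Proof.
by move=> a b; rewrite -[LHS]quot_addE -quot_oppE.
Qed.
HB.instance Definition _ :=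
  GRing.isZmodMorphism.Build T quot_ring quot_pi quot_pi_zmod_morphism.

Fact quot_pi_monoid_morphism : monoid_morphism quot_pi.
Proof. by split=> // a b; rewrite -[LHS]quot_mulE. Qed.
HB.instance Definition _ :=
  GRing.isMonoidMorphism.Build T quot_ring quot_pi quot_pi_monoid_morphism.

End QuotientRing.

Section FreeAlgebra.
Variables (K : comNzRingType) (I : choiceType).

Definition free_alg := {malg K[{fmonom I}]}.
HB.instance Definition _ := GRing.NzRing.on free_alg.

Definition word (s : seq I) : free_alg := << FMonom s >>.

Definition free_cst : {rmorphism K -> free_alg} := @malgC {fmonom I} K.

Lemma free_cstC c t : free_cst c * t = t * free_cst c.
Proof.
rewrite /free_cst /= [RHS]malgM_def [LHS]malgM_def fgmulUg fgmulgU.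
by apply: eq_bigr=> u _; rewrite mul1m mulm1 mulrC.
Qed.

(* Elements all of whose words have length [d]; [d] is an integer so that the
   components of negative degree are [0]. *)
Definition length_homog (d : int) (t : free_alg) : Prop :=
  forall u : {fmonom I}, monalg.mcoeff u t != 0 -> (size u)%:Z = d.

End FreeAlgebra.

Arguments free_cst {K I}.

(** * Superpotentials and the algebra [A(w)] *)

Section Superpotential.
Variables (k : fieldType) (n m : nat).

(* [w t] is the coefficient of [x_(t_1) ... x_(t_(m+1))]. *)
Definition potential := {ffun m.+1.-tuple 'I_n -> k}.
Implicit Type w : potential.

Definition superpotential w : Prop :=
  forall t : m.+1.-tuple 'I_n, w [tuple of rotr 1 t] = w t.

(* The element [w_i] with [w = x_1 w_1 + ... + x_n w_n], with its coefficients
   sent to [K] along [f]. *)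
Definition slice (K : comNzRingType) (f : k -> K) w (i : 'I_n) :
    free_alg K 'I_n :=
  \sum_(t : m.-tuple 'I_n) free_cst (f (w [tuple of i :: t])) * word K t.

Definition A_relations w (g : free_alg k 'I_n) : Prop :=
  exists i, g = slice id w i.

Definition A w := quot_ring (A_relations w).
HB.instance Definition _ w := GRing.PzRing.on (A w).

Definition A_cst w (c : k) : A w := quot_pi (A_relations w) (free_cst c).

Definition A_deg w (d : int) (a : A w) : Prop :=
  exists2 t, a = quot_pi (A_relations w) t & length_homog d t.

End Superpotential.

(** * The enveloping algebra [A (x) A^op] *)

Section Enveloping.
Variables (k : comNzRingType) (A : pzRingType) (cst : k -> A).

Local Notation lw a := (word k [:: inl (a : A)] : free_alg k (A + A)%type).
Local Notation rw a := (word k [:: inr (a : A)] : free_alg k (A + A)%type).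

(* [lw a] stands for [a (x) 1] and [rw a] for [1 (x) a]; the relations say that
   both maps are homomorphisms of algebras, from [A] and [A^op], with commuting
   images. *)
Inductive env_relations : free_alg k (A + A)%type -> Prop :=
| env_lD a b : env_relations (lw (a + b) - (lw a + lw b))
| env_lM a b : env_relations (lw (a * b) - lw a * lw b)
| env_lC c : env_relations (lw (cst c) - free_cst c)
| env_rD a b : env_relations (rw (a + b) - (rw a + rw b))
| env_rM a b : env_relations (rw (a * b) - rw b * rw a)
| env_rC c : env_relations (rw (cst c) - free_cst c)
| env_lr a b : env_relations (lw a * rw b - rw b * lw a).

Definition env := quot_ring env_relations.
HB.instance Definition _ := GRing.PzRing.on env.

Definition env_l (a : A) : env := quot_pi env_relations (lw a).
Definition env_r (a : A) : env := quot_pi env_relations (rw a).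

Definition env_deg (deg : int -> A -> Prop) (d : int) (u : env) : Prop :=
  exists (N : nat) (a b : 'I_N -> A) (i j : 'I_N -> int),
    [/\ forall r, deg (i r) (a r), forall r, deg (j r) (b r),
        forall r, i r + j r = d
      & u = \sum_(r < N) env_l (a r) * env_r (b r)].

End Enveloping.

(** * Projective resolutions and graded modules *)

Section Modules.
Variable B : pzRingType.

Definition projective (P : lmodType B) : Prop :=
  forall (M N : lmodType B) (g : {linear M -> N}) (h : {linear P -> N}),
    (forall y, exists x, g x = y) ->
    exists l : {linear P -> M}, forall p, g (l p) = h p.

Definition fin_gen (P : lmodType B) : Prop :=
  exists (N : nat) (s : 'I_N -> P),
    forall x, exists c : 'I_N -> B, x = \sum_(r < N) c r *: s r.

(* The part [... -> P 2 -> P 1 -> P 0] of a resolution by finitely generated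
   projective modules. *)
Record resolution := Resolution {
  rmod :> nat -> lmodType B;
  rmap : forall i, {linear rmod i.+1 -> rmod i};
  rmap_exact : forall i (x : rmod i.+1),
    rmap i x = 0 <-> exists y, x = rmap i.+1 y;
  rmod_proj : forall i, projective (rmod i);
  rmod_fin_gen : forall i, fin_gen (rmod i)
}.

(* [eps] is the augmentation onto the resolved module. *)
Definition resolves (P : resolution) (X : zmodType) (eps : P 0 -> X) : Prop :=
  (forall y, exists x, eps x = y) /\
  (forall x, eps x = 0 <-> exists y, x = rmap P 0 y).

Section Dual.
Variable P : resolution.

Definition is_hom (i : nat) (f : P i -> B) : Prop :=
  forall b x y, f (b *: x + y) = b * f x + f y.

Definition cocycle (i : nat) (f : P i -> B) : Prop :=
  is_hom f /\ forall x, f (rmap P i x) = 0.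

Definition coboundary (i : nat) : (P i -> B) -> Prop :=
  match i return (P i -> B) -> Prop with
  | 0 => fun f => forall x, f x = 0
  | j.+1 => fun f =>
      exists g : P j -> B, is_hom g /\ forall x, f x = g (rmap P j x)
  end.

End Dual.

Variable deg : int -> B -> Prop.

(* A grading is given by its projections onto the homogeneous components. *)
Record grading (M : lmodType B) := Grading {
  gpart : int -> M -> M;
  gpartD : forall i x y, gpart i (x + y) = gpart i x + gpart i y;
  gpartK : forall i j x, gpart i (gpart j x) = if i == j then gpart j x else 0;
  gpart_sum : forall x,
    exists2 s : seq int, uniq s & x = \sum_(i <- s) gpart i x;
  gpart_act : forall i j b x,
    deg i b -> gpart j x = x -> gpart (i + j) (b *: x) = b *: x
}.

End Modules.

(** * Calabi-Yau algebras *)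

Section CalabiYau.
Variables (k : comNzRingType) (A : pzRingType) (cst : k -> A).
Variable deg : int -> A -> Prop.
Local Notation Ae := (env cst).
Local Notation Ae_deg := (@env_deg k A cst deg).
Local Notation l := (env_l cst).
Local Notation r := (env_r cst).

(* A finite resolution of the graded bimodule [A]; the left [Ae]-module
   structure of [A] is [(a (x) b) c = a c b]. *)
Record bimod_resolution := BimodResolution {
  bres :> resolution Ae;
  bgr : forall i, grading Ae_deg (bres i);
  bgr_map : forall i j x,
    gpart (bgr i) j (rmap bres i x) = rmap bres i (gpart (bgr i.+1) j x);
  beps : {additive bres 0 -> A};
  beps_act : forall a b x, beps (l a * r b *: x) = a * beps x * b;
  beps_deg : forall j x, gpart (bgr 0) j x = x -> deg j (beps x);
  beps_res : resolves beps;
  bres_finite : exists N, forall i, (N <= i)%N -> forall x : bres i, x = 0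
}.

(* [Ext^i_Ae(A, Ae)] is the quotient of the cocycles by the coboundaries; its
   bimodule structure comes from right multiplication on [Ae]:
   [a (p (x) q) b = p b (x) a q]. *)
Definition ext_zero (P : bimod_resolution) (i : nat) : Prop :=
  forall f : P i -> Ae, cocycle f -> coboundary f.

(* [Phi] induces an isomorphism of graded bimodules from [Ext^i_Ae(A, Ae)] onto
   the shift [A(e)], where [A(e)_j = A_(e + j)]. *)
Definition ext_iso_shift (P : bimod_resolution) (i : nat) (e : int)
    (Phi : (P i -> Ae) -> A) : Prop :=
  [/\ forall f g, cocycle f -> cocycle g -> Phi (f \+ g) = Phi f + Phi g,
      forall a b f, cocycle f ->
        Phi (fun x => f x * (l b * r a)) = a * Phi f * b,
      forall j f, cocycle f ->
        (forall h x, gpart (bgr P i) h x = x ->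
           Ae_deg (h + j) (f x)) ->
        deg (e + j) (Phi f),
      forall a, exists2 f, cocycle f & Phi f = a
    & forall f, cocycle f -> (Phi f = 0 <-> coboundary f)].

Definition calabi_yau (d : nat) : Prop :=
  exists P : bimod_resolution,
    (forall i, i <> d -> ext_zero P i) /\
    exists (e : int) (Phi : (P d -> Ae) -> A), ext_iso_shift e Phi.

End CalabiYau.

(** * [R]-linear categories *)

(* Morphisms are taken up to the equivalence relation [heq]. *)
Record lincat (R : comPzRingType) := Lincat {
  ob :> Type;
  hom : ob -> ob -> Type;
  heq : forall a b, hom a b -> hom a b -> Prop;
  idm : forall a, hom a a;
  comp : forall a b c, hom b c -> hom a b -> hom a c;
  hzero : forall a b, hom a b;
  hadd : forall a b, hom a b -> hom a b -> hom a b;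
  hopp : forall a b, hom a b -> hom a b;
  hscale : forall a b, R -> hom a b -> hom a b;
  heq_refl : forall a b (f : hom a b), heq f f;
  heq_sym : forall a b (f g : hom a b), heq f g -> heq g f;
  heq_trans : forall a b (f g h : hom a b), heq f g -> heq g h -> heq f h;
  comp_heq : forall a b c (g g' : hom b c) (f f' : hom a b),
    heq g g' -> heq f f' -> heq (comp g f) (comp g' f');
  hadd_heq : forall a b (f f' g g' : hom a b),
    heq f f' -> heq g g' -> heq (hadd f g) (hadd f' g');
  hopp_heq : forall a b (f f' : hom a b), heq f f' -> heq (hopp f) (hopp f');
  hscale_heq : forall a b r (f f' : hom a b),
    heq f f' -> heq (hscale r f) (hscale r f');
  compA : forall a b c d (h : hom c d) (g : hom b c) (f : hom a b),
    heq (comp h (comp g f)) (comp (comp h g) f);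
  comp_idl : forall a b (f : hom a b), heq (comp (idm b) f) f;
  comp_idr : forall a b (f : hom a b), heq (comp f (idm a)) f;
  haddA : forall a b (f g h : hom a b),
    heq (hadd f (hadd g h)) (hadd (hadd f g) h);
  haddC : forall a b (f g : hom a b), heq (hadd f g) (hadd g f);
  hadd0 : forall a b (f : hom a b), heq (hadd (hzero a b) f) f;
  haddN : forall a b (f : hom a b), heq (hadd (hopp f) f) (hzero a b);
  hscaleDr : forall a b r (f g : hom a b),
    heq (hscale r (hadd f g)) (hadd (hscale r f) (hscale r g));
  hscaleDl : forall a b r s (f : hom a b),
    heq (hscale (r + s) f) (hadd (hscale r f) (hscale s f));
  hscaleA : forall a b r s (f : hom a b),
    heq (hscale r (hscale s f)) (hscale (r * s) f);
  hscale1 : forall a b (f : hom a b), heq (hscale 1 f) f;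
  compDl : forall a b c (g g' : hom b c) (f : hom a b),
    heq (comp (hadd g g') f) (hadd (comp g f) (comp g' f));
  compDr : forall a b c (g : hom b c) (f f' : hom a b),
    heq (comp g (hadd f f')) (hadd (comp g f) (comp g f'));
  compZl : forall a b c r (g : hom b c) (f : hom a b),
    heq (comp (hscale r g) f) (hscale r (comp g f));
  compZr : forall a b c r (g : hom b c) (f : hom a b),
    heq (comp g (hscale r f)) (hscale r (comp g f))
}.
Arguments hzero {R l} a b.
Arguments idm {R l} a.

Local Notation "f =~ g" := (heq f g) (at level 70, no associativity).
Local Notation "g 'oo' f" := (comp g f) (at level 40, left associativity).

Section Abelian.
Variables (R : comPzRingType) (C : lincat R).
Implicit Types a b c d : C.

Definition mono a b (f : hom a b) : Prop :=
  forall d (g h : hom d a), f oo g =~ f oo h -> g =~ h.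

Definition epi a b (f : hom a b) : Prop :=
  forall d (g h : hom b d), g oo f =~ h oo f -> g =~ h.

Definition is_kernel a b c (g : hom b c) (f : hom a b) : Prop :=
  [/\ g oo f =~ hzero a c, mono f
    & forall d (h : hom d b), g oo h =~ hzero d c ->
        exists h' : hom d a, f oo h' =~ h].

Definition is_cokernel a b c (f : hom a b) (g : hom b c) : Prop :=
  [/\ g oo f =~ hzero a c, epi g
    & forall d (h : hom b d), h oo f =~ hzero a d ->
        exists h' : hom c d, h' oo g =~ h].

Definition short_exact a b c (f : hom a b) (g : hom b c) : Prop :=
  is_kernel g f /\ is_cokernel f g.

Definition is_biproduct a b c (i : hom a c) (j : hom b c) (p : hom c a)
    (q : hom c b) : Prop :=
  [/\ p oo i =~ idm a, q oo j =~ idm b, p oo j =~ hzero b a,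
      q oo i =~ hzero a b & hadd (i oo p) (j oo q) =~ idm c].

Record abelian : Prop := Abelian {
  ab_zero : exists z : C, idm z =~ hzero z z;
  ab_biproduct : forall a b, exists c (i : hom a c) (j : hom b c) p q,
    is_biproduct i j p q;
  ab_kernel : forall b c (g : hom b c), exists a (f : hom a b), is_kernel g f;
  ab_cokernel : forall a b (f : hom a b), exists c (g : hom b c),
    is_cokernel f g;
  ab_mono : forall a b (f : hom a b), mono f ->
    exists c (g : hom b c), is_kernel g f;
  ab_epi : forall b c (g : hom b c), epi g ->
    exists a (f : hom a b), is_cokernel f g
}.

Definition serre_subcategory (T : C -> Prop) : Prop :=
  forall a b c (f : hom a b) (g : hom b c),
    short_exact f g -> (T b <-> T a /\ T c).

(* The largest Serre subcategory contained in [T]. *)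
Definition serre_core (T : C -> Prop) (a : C) : Prop :=
  exists P : C -> Prop,
    [/\ serre_subcategory P, forall b, P b -> T b & P a].

Definition serre_iso (T : C -> Prop) a b (s : hom a b) : Prop :=
  (exists z (i : hom z a), is_kernel s i /\ T z) /\
  (exists z (q : hom b z), is_cokernel s q /\ T z).

End Abelian.

(** ** Localizations and quotient categories *)

(* The [R]-linear category obtained from [C] by freely inverting the morphisms
   satisfying [Sigma]: its morphisms are the formal expressions [lterm] in the
   morphisms of [C] and the inverses of those in [Sigma], modulo the congruence
   [lcong] generated by the axioms of [R]-linear categories and the relations
   making [C -> C[Sigma^-1]] an [R]-linear functor. *)
Section Localize.
Variables (R : comPzRingType) (C : lincat R).
Variable Sigma : forall a b : C, hom a b -> Prop.

Inductive lterm : C -> C -> Type :=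
| lhom a b (f : hom a b) : lterm a b
| linv a b (s : hom a b) : Sigma s -> lterm b a
| lcomp a b c : lterm b c -> lterm a b -> lterm a c
| lzero a b : lterm a b
| ladd a b : lterm a b -> lterm a b -> lterm a b
| lopp a b : lterm a b -> lterm a b
| lscale a b : R -> lterm a b -> lterm a b.

Inductive lcong : forall a b, lterm a b -> lterm a b -> Prop :=
| lc_refl a b (f : lterm a b) : lcong f f
| lc_sym a b (f g : lterm a b) : lcong f g -> lcong g f
| lc_trans a b (f g h : lterm a b) : lcong f g -> lcong g h -> lcong f h
| lc_comp a b c (g g' : lterm b c) (f f' : lterm a b) :
    lcong g g' -> lcong f f' -> lcong (lcomp g f) (lcomp g' f')
| lc_add a b (f f' g g' : lterm a b) :
    lcong f f' -> lcong g g' -> lcong (ladd f g) (ladd f' g')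
| lc_opp a b (f f' : lterm a b) : lcong f f' -> lcong (lopp f) (lopp f')
| lc_scale a b r (f f' : lterm a b) :
    lcong f f' -> lcong (lscale r f) (lscale r f')
| lc_compA a b c d (h : lterm c d) (g : lterm b c) (f : lterm a b) :
    lcong (lcomp h (lcomp g f)) (lcomp (lcomp h g) f)
| lc_idl a b (f : lterm a b) : lcong (lcomp (lhom (idm b)) f) f
| lc_idr a b (f : lterm a b) : lcong (lcomp f (lhom (idm a))) f
| lc_addA a b (f g h : lterm a b) :
    lcong (ladd f (ladd g h)) (ladd (ladd f g) h)
| lc_addC a b (f g : lterm a b) : lcong (ladd f g) (ladd g f)
| lc_add0 a b (f : lterm a b) : lcong (ladd (lzero a b) f) f
| lc_addN a b (f : lterm a b) : lcong (ladd (lopp f) f) (lzero a b)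
| lc_scaleDr a b r (f g : lterm a b) :
    lcong (lscale r (ladd f g)) (ladd (lscale r f) (lscale r g))
| lc_scaleDl a b r s (f : lterm a b) :
    lcong (lscale (r + s) f) (ladd (lscale r f) (lscale s f))
| lc_scaleA a b r s (f : lterm a b) :
    lcong (lscale r (lscale s f)) (lscale (r * s) f)
| lc_scale1 a b (f : lterm a b) : lcong (lscale 1 f) f
| lc_compDl a b c (g g' : lterm b c) (f : lterm a b) :
    lcong (lcomp (ladd g g') f) (ladd (lcomp g f) (lcomp g' f))
| lc_compDr a b c (g : lterm b c) (f f' : lterm a b) :
    lcong (lcomp g (ladd f f')) (ladd (lcomp g f) (lcomp g f'))
| lc_compZl a b c r (g : lterm b c) (f : lterm a b) :
    lcong (lcomp (lscale r g) f) (lscale r (lcomp g f))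
| lc_compZr a b c r (g : lterm b c) (f : lterm a b) :
    lcong (lcomp g (lscale r f)) (lscale r (lcomp g f))
| lc_hom a b (f f' : hom a b) : f =~ f' -> lcong (lhom f) (lhom f')
| lc_hom_comp a b c (g : hom b c) (f : hom a b) :
    lcong (lhom (g oo f)) (lcomp (lhom g) (lhom f))
| lc_hom_add a b (f g : hom a b) :
    lcong (lhom (hadd f g)) (ladd (lhom f) (lhom g))
| lc_hom_scale a b r (f : hom a b) :
    lcong (lhom (hscale r f)) (lscale r (lhom f))
| lc_invl a b (s : hom a b) (Ss : Sigma s) :
    lcong (lcomp (linv Ss) (lhom s)) (lhom (idm a))
| lc_invr a b (s : hom a b) (Ss : Sigma s) :
    lcong (lcomp (lhom s) (linv Ss)) (lhom (idm b)).

Definition localize : lincat R :=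
  @Lincat R C lterm lcong (fun a => lhom (idm a)) lcomp lzero ladd lopp lscale
    lc_refl lc_sym lc_trans lc_comp lc_add lc_opp lc_scale lc_compA lc_idl
    lc_idr lc_addA lc_addC lc_add0 lc_addN lc_scaleDr lc_scaleDl lc_scaleA
    lc_scale1 lc_compDl lc_compDr lc_compZl lc_compZr.

End Localize.

(* The quotient of the abelian category [C] by the objects satisfying [T]: the
   localization of [C] at the morphisms whose kernel and cokernel belong to the
   Serre subcategory [serre_core T], which is [T] itself when [T] is a Serre
   subcategory. *)
Definition quotient_category (R : comPzRingType) (C : lincat R)
    (T : C -> Prop) : lincat R :=
  localize (@serre_iso R C (serre_core T)).

(** ** Flatness of abelian categories *)

Definition fin_pres (R : pzRingType) (X : lmodType R) : Prop :=
  exists (a b : nat) (psi : {linear 'rV[R]_a -> 'rV[R]_b})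
         (phi : {linear 'rV[R]_b -> X}),
    (forall x, exists v, phi v = x) /\
    (forall v, phi v = 0 <-> exists u, v = psi u).

Section Flat.
Variables (R : comPzRingType) (C : lincat R).

(* [(H, ev)] represents the functor [c |-> Hom_R(X, Hom_C(c, a))]. *)
Definition linear_to_hom (X : lmodType R) (a c : C) (g : X -> hom c a) : Prop :=
  forall r x y, g (r *: x + y) =~ hadd (hscale r (g x)) (g y).

Definition is_Hom (X : lmodType R) (a H : C) (ev : X -> hom H a) : Prop :=
  linear_to_hom ev /\
  forall c (g : X -> hom c a), linear_to_hom g ->
    exists2 h : hom c H, (forall x, ev x oo h =~ g x) &
      forall h', (forall x, ev x oo h' =~ g x) -> h' =~ h.

(* [Ext^(i+1)_R(X, a)] for the [R]-module [X] resolved by [P]: the cohomology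
   at the middle of [Hom_R(P_i, a) -> Hom_R(P_(i+1), a) -> Hom_R(P_(i+2), a)],
   where [Z] is the object of cocycles. *)
Record ext_object (P : resolution R) (i : nat) (a : C) := ExtObject {
  xH : nat -> C;
  xev : forall j, P j -> hom (xH j) a;
  xevP : forall j, is_Hom (@xev j);
  xd : forall j, hom (xH j) (xH j.+1);
  xdP : forall j (y : P j.+1), xev y oo xd j =~ xev (rmap P j y);
  xZ : C;
  xin : hom xZ (xH i.+1);
  xinP : is_kernel (xd i.+1) xin;
  xB : hom (xH i) xZ;
  xBP : xin oo xB =~ xd i;
  xE : C;
  xpr : hom xZ xE;
  xprP : is_cokernel xB xpr
}.

(* [e] is the morphism induced on [Ext^(i+1)_R(X, -)] by [u]. *)
Definition ext_induced (P : resolution R) (i : nat) (a a' : C) (u : hom a a')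
    (X : ext_object P i a) (X' : ext_object P i a') (e : hom (xE X) (xE X')) :
    Prop :=
  exists2 h : hom (xH X i.+1) (xH X' i.+1),
    (forall x, xev X' x oo h =~ u oo xev X x) &
    exists2 z : hom (xZ X) (xZ X'),
      xin X' oo z =~ h oo xin X & e oo xpr X =~ xpr X' oo z.

Definition flat : Prop :=
  abelian C /\
  forall (X : lmodType R) (P : resolution R) (eps : {linear P 0 -> X}),
    fin_pres X -> resolves eps ->
    forall (i : nat) (a : C),
      exists (a' : C) (u : hom a a'), mono u /\
        forall (x : ext_object P i a) (x' : ext_object P i a')
               (e : hom (xE x) (xE x')),
          ext_induced u e -> e =~ hzero _ _.

End Flat.

(** * Algebras over [S = k[c_1, ..., c_n]] and the algebra [E] *)

Section Geometry.
Variables (k : fieldType) (n : nat).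
Local Notation S := (mpoly n k).

(* An [S]-algebra with a grading compatible with the grading of [S] by degree;
   [cdeg d] is the homogeneous component of degree [d]. *)
Record galg := Galg {
  gcar :> pzRingType;
  gcst : {rmorphism S -> gcar};
  gcstC : forall s a, gcst s * a = a * gcst s;
  cdeg : nat -> gcar -> Prop;
  cdegB : forall d a b, cdeg d a -> cdeg d b -> cdeg d (a - b);
  cdegM : forall d e a b, cdeg d a -> cdeg e b -> cdeg (d + e) (a * b);
  cdeg_cst : forall d (s : S), s \is d.-homog -> cdeg d (gcst s)
}.

Definition S_galg : galg.
Proof.
apply: (@Galg S idfun _ (fun d s => s \is d.-homog)) => //=.
- by move=> s a; rewrite mulrC.
- by move=> d a b; exact: rpredB.
- by move=> d e a b; exact: dhomogM.
Defined.

Section AlgebraE.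
Variables (m : nat) (w : potential k n m).
Local Notation SX := (free_alg S 'I_n).
Local Notation w_ i := (slice (fun a => a%:MP_[n]) w i : SX).

Inductive E_relations : SX -> Prop :=
| E_rel_cw i j : E_relations (free_cst 'X_i * w_ j - free_cst 'X_j * w_ i)
| E_rel_xw i j : E_relations (word S [:: i] * w_ j - w_ j * word S [:: i]).

Definition E := quot_ring E_relations.
HB.instance Definition _ := GRing.PzRing.on E.

Definition E_pi : {rmorphism SX -> E} := quot_pi E_relations.
Definition E_cst : {rmorphism S -> E} := E_pi \o free_cst.

(* The grading by the degree in the [c_i] ... *)
Definition E_cdeg (d : nat) (a : E) : Prop :=
  exists2 t, a = E_pi t & forall u, monalg.mcoeff u t \is d.-homog.

(* ... and the bigrading in which [x_1, ..., x_n] have degree [(0, 1)]. *)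
Definition E_bideg (d : nat) (j : int) (a : E) : Prop :=
  exists t, [/\ a = E_pi t, forall u, monalg.mcoeff u t \is d.-homog
    & length_homog j t].

Definition E_galg : galg.
Proof.
apply: (@Galg E E_cst _ E_cdeg).
- move=> s a; have [t ->] := quot_pi_surj a.
  by rewrite /E_cst /= -!rmorphM /= free_cstC.
- move=> d _ _ [t -> ht] [t' -> ht']; exists (t - t'); first by rewrite rmorphB.
  by move=> u; rewrite monalg.mcoeffB rpredB.
- move=> d e _ _ [t -> ht] [t' -> ht'].
  exists (t * t'); first by rewrite rmorphM.
  move=> u; rewrite monalg.mcoeffMl; apply: rpred_sum => v _.
  by apply: rpred_sum => v' _; apply: rpredMn; exact: dhomogM.
- move=> d s hs; exists (free_cst s) => // u.
  by rewrite /free_cst /= monalg.mcoeffC; apply: rpredMn.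
Defined.

End AlgebraE.

(** * The scheme [P(V) = Proj S] and the sheaf of a graded [S]-algebra *)

Record prime_ideal (B : comPzRingType) (p : B -> Prop) : Prop := PrimeIdeal {
  prime0 : p 0;
  primeD : forall a b, p a -> p b -> p (a + b);
  primeMl : forall a b, p b -> p (a * b);
  prime1 : ~ p 1;
  primeM : forall a b, p (a * b) -> p a \/ p b
}.

Record point := Point {
  pt_ideal :> S -> Prop;
  pt_prime : prime_ideal pt_ideal;
  pt_homog : forall s d, pt_ideal s -> pt_ideal (pihomog mdeg d s);
  pt_relevant : exists i, ~ pt_ideal 'X_i
}.

(* The sets [D(s) = {p | s not in p}] with [s] homogeneous form a basis of the
   Zariski topology. *)
Definition zariski_open (W : point -> Prop) : Prop :=
  forall p, W p -> exists d (s : S),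
    [/\ s \is d.-homog, ~ p s & forall q : point, ~ q s -> W q].

Record opn := Opn { opn_set :> point -> Prop; opn_open : zariski_open opn_set }.

Lemma primeM_out (p : point) a b : ~ p a -> ~ p b -> ~ p (a * b).
Proof. by move=> ha hb /(primeM (pt_prime p))[]. Qed.

Lemma homog1 : (1 : S) \is 0.-homog.
Proof. exact: dhomog1. Qed.

Definition opn_cap (W W' : opn) : opn.
Proof.
apply: (@Opn (fun p => W p /\ W' p)) => p [].
move=> /(opn_open (o := W))[d [s [hs ps sW]]].
move=> /(opn_open (o := W'))[d' [s' [hs' ps' sW']]].
exists (d + d')%N, (s * s'); split; [exact: dhomogM|exact: primeM_out|].
move=> q qss'; split; [apply: sW|apply: sW'] => qs; apply: qss'.
  by rewrite mulrC; exact: primeMl (pt_prime q) _ _ qs.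
exact: primeMl (pt_prime q) _ _ qs.
Defined.

(* The homogeneous localization [A_(p)]: fractions [a / s] with [a] and [s]
   homogeneous of the same degree and [s] not in [p]. *)
Section Localization.
Variables (A : galg) (p : point).

Record frac := Frac {
  num : A;
  den : S;
  frac_deg : nat;
  num_deg : cdeg frac_deg num;
  den_deg : den \is frac_deg.-homog;
  den_out : ~ p den
}.
HB.instance Definition _ := gen_eqMixin frac.
HB.instance Definition _ := gen_choiceMixin frac.

Local Notation c := (gcst A).

Definition frac_eq (x y : frac) : Prop :=
  exists d (s : S), [/\ s \is d.-homog, ~ p s
    & c s * (c (den y) * num x) = c s * (c (den x) * num y)].

Definition frac_rel : rel frac := fun x y => `[< frac_eq x y >].

Lemma frac_refl : reflexive frac_rel.
Proof.
move=> x; apply/asboolP; exists 0%N, 1; split=> //.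
  exact: homog1.
exact: prime1 (pt_prime p).
Qed.

Lemma frac_sym : ssrbool.symmetric frac_rel.
Proof.
by move=> x y; apply/asboolP/asboolP=> -[d [s [? ? ?]]]; exists d, s.
Qed.

Lemma frac_trans : transitive frac_rel.
Proof.
move=> y x z /asboolP[d [s [hs ps e]]] /asboolP[d' [s' [hs' ps' e']]].
apply/asboolP; exists (d + d' + frac_deg y)%N, (s * s' * den y); split.
- by rewrite !dhomogM // den_deg.
- by apply: primeM_out; [exact: primeM_out|exact: den_out].
rewrite (_ : _ * _ = c (s' * den z) * (c s * (c (den y) * num x))); last first.
  by rewrite !mulrA -!rmorphM; congr (c _ * _); ring.
rewrite e (_ : _ * _ = c (s * den x) * (c s' * (c (den z) * num y)));
  last first.
  by rewrite !mulrA -!rmorphM; congr (c _ * _); ring.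
rewrite e' !mulrA -!rmorphM; congr (c _ * _); ring.
Qed.

Canonical frac_equiv := EquivRel frac_rel frac_refl frac_sym frac_trans.

Definition loc := {eq_quot frac_equiv}.
HB.instance Definition _ := Choice.on loc.

Definition loc_pi (x : frac) : loc := \pi_loc x.

Lemma loc_piP x y : loc_pi x = loc_pi y <-> frac_eq x y.
Proof. by split=> [/eqmodP/asboolP|h]; [|apply/eqmodP/asboolP]. Qed.

Lemma loc_surj (z : loc) : exists x, z = loc_pi x.
Proof. by exists (repr z); rewrite /loc_pi reprK. Qed.

Lemma loc_repr x : frac_eq (repr (loc_pi x)) x.
Proof. by apply/loc_piP; rewrite /loc_pi reprK. Qed.

Lemma frac_eqW (x y : frac) : c (den y) * num x = c (den x) * num y ->
  loc_pi x = loc_pi y.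
Proof.
move=> e; apply/loc_piP; exists 0%N, 1; rewrite e; split=> //.
  exact: homog1.
exact: prime1 (pt_prime p).
Qed.

Lemma cdeg0 d : cdeg d (0 : A).
Proof. by rewrite -(rmorph0 c); apply/cdeg_cst/dhomog0. Qed.

Lemma cdegN d (a : A) : cdeg d a -> cdeg d (- a).
Proof. by rewrite -sub0r; apply/cdegB/cdeg0. Qed.

Lemma cdegD d (a b : A) : cdeg d a -> cdeg d b -> cdeg d (a + b).
Proof. by move=> ha /cdegN hb; rewrite -[b]opprK; exact: cdegB. Qed.

Lemma cdeg_cross x y :
  cdeg (frac_deg x + frac_deg y) (c (den y) * num x + c (den x) * num y).
Proof.
apply: cdegD; last exact: cdegM (cdeg_cst _ (den_deg x)) (num_deg y).
by rewrite addnC; exact: cdegM (cdeg_cst _ (den_deg y)) (num_deg x).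
Qed.

Definition frac0 := Frac (cdeg0 0) homog1 (prime1 (pt_prime p)).
Definition frac1 :=
  Frac (cdeg_cst A homog1) homog1 (prime1 (pt_prime p)).
Definition frac_add x y := Frac (cdeg_cross x y)
  (dhomogM (den_deg x) (den_deg y)) (primeM_out (@den_out x) (@den_out y)).
Definition frac_opp x := Frac (cdegN (num_deg x)) (den_deg x) (@den_out x).
Definition frac_mul x y := Frac (cdegM (num_deg x) (num_deg y))
  (dhomogM (den_deg x) (den_deg y)) (primeM_out (@den_out x) (@den_out y)).

Definition loc_add (x y : loc) := loc_pi (frac_add (repr x) (repr y)).
Definition loc_opp (x : loc) := loc_pi (frac_opp (repr x)).
Definition loc_mul (x y : loc) := loc_pi (frac_mul (repr x) (repr y)).

Lemma gcst_swap s t (a b : A) : (c s * a) * (c t * b) = c (s * t) * (a * b).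
Proof. by rewrite rmorphM -!mulrA; congr (_ * _); rewrite !mulrA gcstC. Qed.

Lemma gcstMl s t (a : A) : c s * (c t * a) = c (s * t) * a.
Proof. by rewrite mulrA rmorphM. Qed.

Lemma gcstMr s (a b : A) : a * (c s * b) = c s * (a * b).
Proof. by rewrite !mulrA gcstC. Qed.

Lemma gcst_eq s t (a : A) : s = t -> c s * a = c t * a.
Proof. by move->. Qed.

Lemma loc_addE x y : loc_add (loc_pi x) (loc_pi y) = loc_pi (frac_add x y).
Proof.
have [d [s [hs ps e]]] := loc_repr x; have [d' [s' [hs' ps' e']]] := loc_repr y.
apply/loc_piP; exists (d + d')%N, (s * s').
split; [exact: dhomogM|exact: primeM_out|].
move: (repr (loc_pi x)) (repr (loc_pi y)) e e' => x1 y1 /= e e'.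
rewrite !mulrDr !gcstMl; congr (_ + _).
  transitivity (c (s' * den y * den y1) * (c s * (c (den x) * num x1))).
    by rewrite !gcstMl; apply: gcst_eq; ring.
  by rewrite e !gcstMl; apply: gcst_eq; ring.
transitivity (c (s * den x * den x1) * (c s' * (c (den y) * num y1))).
  by rewrite !gcstMl; apply: gcst_eq; ring.
by rewrite e' !gcstMl; apply: gcst_eq; ring.
Qed.

Lemma loc_oppE x : loc_opp (loc_pi x) = loc_pi (frac_opp x).
Proof.
have [d [s [hs ps e]]] := loc_repr x.
by apply/loc_piP; exists d, s; split; rewrite //= !mulrN e.
Qed.

Lemma loc_mulE x y : loc_mul (loc_pi x) (loc_pi y) = loc_pi (frac_mul x y).
Proof.
have [d [s [hs ps e]]] := loc_repr x; have [d' [s' [hs' ps' e']]] := loc_repr y.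
apply/loc_piP; exists (d + d')%N, (s * s').
split; [exact: dhomogM|exact: primeM_out|].
move: (repr (loc_pi x)) (repr (loc_pi y)) e e' => x1 y1 /= e e'.
transitivity ((c s * (c (den x) * num x1)) * (c s' * (c (den y) * num y1))).
  by rewrite !gcstMl gcst_swap; apply: gcst_eq; ring.
by rewrite e e' !gcstMl gcst_swap; apply: gcst_eq; ring.
Qed.

Fact loc_addA : associative loc_add.
Proof.
move=> x y z; have [a ->] := loc_surj x; have [b ->] := loc_surj y.
have [d ->] := loc_surj z; rewrite !loc_addE; apply: frac_eqW => /=.
rewrite !mulrDr !gcstMl !addrA.
by congr (_ + _ + _); apply: gcst_eq; ring.
Qed.

Fact loc_addC : commutative loc_add.
Proof.
move=> x y; have [a ->] := loc_surj x; have [b ->] := loc_surj y.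
rewrite !loc_addE; apply: frac_eqW => /=.
by rewrite addrC [den b * _]mulrC.
Qed.

Fact loc_add0 : left_id (loc_pi frac0) loc_add.
Proof.
move=> x; have [a ->] := loc_surj x; rewrite loc_addE; apply: frac_eqW => /=.
by rewrite mulr0 add0r rmorph1 !mul1r.
Qed.

Fact loc_addN : left_inverse (loc_pi frac0) loc_opp loc_add.
Proof.
move=> x; have [a ->] := loc_surj x; rewrite loc_oppE loc_addE.
by apply: frac_eqW => /=; rewrite mulrN addNr !mulr0.
Qed.

HB.instance Definition _ :=
  GRing.isZmodule.Build loc loc_addA loc_addC loc_add0 loc_addN.

Fact loc_mulA : associative loc_mul.
Proof.
move=> x y z; have [a ->] := loc_surj x; have [b ->] := loc_surj y.
have [d ->] := loc_surj z; rewrite !loc_mulE; apply: frac_eqW => /=.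
by rewrite !mulrA.
Qed.

Fact loc_mul1 : left_id (loc_pi frac1) loc_mul.
Proof.
move=> x; have [a ->] := loc_surj x; rewrite loc_mulE; apply: frac_eqW => /=.
by rewrite rmorph1 !mul1r.
Qed.

Fact loc_mulr1 : right_id (loc_pi frac1) loc_mul.
Proof.
move=> x; have [a ->] := loc_surj x; rewrite loc_mulE; apply: frac_eqW => /=.
by rewrite rmorph1 !mulr1.
Qed.

Fact loc_mulDl : left_distributive loc_mul loc_add.
Proof.
move=> x y z; have [a ->] := loc_surj x; have [b ->] := loc_surj y.
have [d ->] := loc_surj z; rewrite !(loc_addE, loc_mulE); apply: frac_eqW => /=.
rewrite mulrDl !mulrDr -!(mulrA (c _)) !gcstMl.
by congr (_ + _); apply: gcst_eq; ring.
Qed.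

Fact loc_mulDr : right_distributive loc_mul loc_add.
Proof.
move=> x y z; have [a ->] := loc_surj x; have [b ->] := loc_surj y.
have [d ->] := loc_surj z; rewrite !(loc_addE, loc_mulE); apply: frac_eqW => /=.
rewrite !mulrDr ![num a * (_ * _)]gcstMr !gcstMl.
by congr (_ + _); apply: gcst_eq; ring.
Qed.

HB.instance Definition _ := GRing.Zmodule_isPzRing.Build loc
  loc_mulA loc_mul1 loc_mulr1 loc_mulDl loc_mulDr.

End Localization.

(* The sheaf on [P(V)] associated with [A]: its sections are the functions with
   values in the homogeneous localizations that are locally fractions. *)
Section Sections.
Variables (A : galg) (W : opn).

Definition locally_fraction (s : forall p, W p -> loc A p) : Prop :=
  forall p, W p ->
    exists (W' : opn) d (a : A) (b : S) (ha : cdeg d a) (hb : b \is d.-homog),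
      W' p /\ forall q (Wq : W q), W' q ->
        exists qb : ~ q b, s q Wq = loc_pi (Frac ha hb qb).

Record sect := Sect {
  sval : forall p, W p -> loc A p;
  sval_local : locally_fraction sval
}.
HB.instance Definition _ := gen_eqMixin sect.
HB.instance Definition _ := gen_choiceMixin sect.

Lemma sect_ext (s t : sect) :
  (forall p (Wp : W p), sval s Wp = sval t Wp) -> s = t.
Proof.
case: s t => [s hs] [t ht] /= e.
have {}e : s = t by do 2!apply: functional_extensionality_dep => ?.
by rewrite e in hs *; rewrite (Prop_irrelevance hs ht).
Qed.

Fact zero_local : locally_fraction (fun p _ => 0).
Proof.
move=> p Wp; exists W, 0%N, 0, 1, (cdeg0 A 0), homog1; split=> // q Wq _.
by exists (prime1 (pt_prime q)); apply: frac_eqW.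
Qed.

Fact one_local : locally_fraction (fun p _ => 1).
Proof.
move=> p Wp; exists W, 0%N, (gcst A 1), 1, (cdeg_cst A homog1), homog1.
by split=> // q Wq _; exists (prime1 (pt_prime q)); apply: frac_eqW.
Qed.

Fact add_local (s t : sect) :
  locally_fraction (fun p Wp => sval s Wp + sval t Wp).
Proof.
move=> p Wp.
have [W1 [d [a [b [ha [hb [W1p h1]]]]]]] := sval_local s Wp.
have [W2 [d' [a' [b' [ha' [hb' [W2p h2]]]]]]] := sval_local t Wp.
have hc : cdeg (d + d') (gcst A b' * a + gcst A b * a').
  apply: cdegD; last exact: cdegM (cdeg_cst A hb) ha'.
  by rewrite addnC; exact: cdegM (cdeg_cst A hb') ha.
exists (opn_cap W1 W2), (d + d')%N, _, _, hc, (dhomogM hb hb').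
split=> // q Wq [W1q W2q].
have [qb ->] := h1 q Wq W1q; have [qb' ->] := h2 q Wq W2q.
by exists (primeM_out qb qb'); rewrite [LHS]loc_addE; apply: frac_eqW.
Qed.

Fact mul_local (s t : sect) :
  locally_fraction (fun p Wp => sval s Wp * sval t Wp).
Proof.
move=> p Wp.
have [W1 [d [a [b [ha [hb [W1p h1]]]]]]] := sval_local s Wp.
have [W2 [d' [a' [b' [ha' [hb' [W2p h2]]]]]]] := sval_local t Wp.
exists (opn_cap W1 W2), (d + d')%N, _, _, (cdegM ha ha'), (dhomogM hb hb').
split=> // q Wq [W1q W2q].
have [qb ->] := h1 q Wq W1q; have [qb' ->] := h2 q Wq W2q.
by exists (primeM_out qb qb'); rewrite [LHS]loc_mulE; apply: frac_eqW.
Qed.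

Fact opp_local (s : sect) : locally_fraction (fun p Wp => - sval s Wp).
Proof.
move=> p Wp; have [W1 [d [a [b [ha [hb [W1p h1]]]]]]] := sval_local s Wp.
exists W1, d, _, _, (cdegN ha), hb; split=> // q Wq W1q.
have [qb ->] := h1 q Wq W1q.
by exists qb; rewrite [LHS]loc_oppE; apply: frac_eqW.
Qed.

Definition sect_add s t := Sect (add_local s t).
Definition sect_opp s := Sect (opp_local s).
Definition sect_mul s t := Sect (mul_local s t).

Fact sect_addA : associative sect_add.
Proof. by move=> s t u; apply: sect_ext => p Wp; exact: addrA. Qed.
Fact sect_addC : commutative sect_add.
Proof. by move=> s t; apply: sect_ext => p Wp; exact: addrC. Qed.
Fact sect_add0 : left_id (Sect zero_local) sect_add.
Proof. by move=> s; apply: sect_ext => p Wp; exact: add0r. Qed.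
Fact sect_addN : left_inverse (Sect zero_local) sect_opp sect_add.
Proof. by move=> s; apply: sect_ext => p Wp; exact: addNr. Qed.
HB.instance Definition _ :=
  GRing.isZmodule.Build sect sect_addA sect_addC sect_add0 sect_addN.

Fact sect_mulA : associative sect_mul.
Proof. by move=> s t u; apply: sect_ext => p Wp; exact: mulrA. Qed.
Fact sect_mul1 : left_id (Sect one_local) sect_mul.
Proof. by move=> s; apply: sect_ext => p Wp; exact: mul1r. Qed.
Fact sect_mulr1 : right_id (Sect one_local) sect_mul.
Proof. by move=> s; apply: sect_ext => p Wp; exact: mulr1. Qed.
Fact sect_mulDl : left_distributive sect_mul sect_add.
Proof. by move=> s t u; apply: sect_ext => p Wp; exact: mulrDl. Qed.
Fact sect_mulDr : right_distributive sect_mul sect_add.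
Proof. by move=> s t u; apply: sect_ext => p Wp; exact: mulrDr. Qed.
HB.instance Definition _ := GRing.Zmodule_isPzRing.Build sect
  sect_mulA sect_mul1 sect_mulr1 sect_mulDl sect_mulDr.

End Sections.

Definition opn_sub (W' W : opn) : Prop := forall p, W' p -> W p.
Local Notation "W' `<=` W" := (opn_sub W' W) (at level 70, no associativity).

Section Restriction.
Variable A : galg.

Fact res_local (W W' : opn) (h : W' `<=` W) (s : sect A W) :
  locally_fraction (fun p (Wp : W' p) => sval s (h p Wp)).
Proof.
move=> p Wp; have [W1 [d [a [b [ha [hb [W1p h1]]]]]]] := sval_local s (h p Wp).
exists W1, d, a, b, ha, hb.
by split=> // q Wq; exact: (h1 q (h q Wq)).
Qed.

Definition sres (W W' : opn) (h : W' `<=` W) (s : sect A W) : sect A W' :=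
  Sect (res_local h s).

End Restriction.

(* The structure sheaf. *)
Definition O (W : opn) := sect S_galg W.
HB.instance Definition _ W := GRing.PzRing.on (O W).

Lemma S_locC p : commutative (@GRing.mul (loc S_galg p)).
Proof.
move=> x y; have [a ->] := loc_surj x; have [b ->] := loc_surj y.
rewrite [LHS]loc_mulE [RHS]loc_mulE; apply: frac_eqW => /=.
by rewrite [den b * _]mulrC [num b * _]mulrC.
Qed.

Fact O_mulC W : commutative (@GRing.mul (O W)).
Proof. by move=> s t; apply: sect_ext => p Wp; exact: S_locC. Qed.
HB.instance Definition _ W :=
  GRing.PzRing_hasCommutativeMul.Build (O W) (@O_mulC W).

(* [z] lies in the maximal ideal of the local ring at [p]. *)
Definition vanishes p (z : loc S_galg p) : Prop :=
  exists2 x : frac S_galg p, z = loc_pi x & p (num x).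

(* The structure map from [O] to the sheaf associated with [A]. *)
Section StructureMap.
Variable A : galg.

Definition frac_str p (x : frac S_galg p) : frac A p :=
  Frac (cdeg_cst A (num_deg x)) (den_deg x) (@den_out S_galg p x).

Definition loc_str p (z : loc S_galg p) : loc A p :=
  loc_pi (frac_str (repr z)).

Lemma loc_strE p (x : frac S_galg p) : loc_str (loc_pi x) = loc_pi (frac_str x).
Proof.
have [d [s [hs ps e]]] := loc_repr x; apply/loc_piP; exists d, s.
by split=> //=; rewrite -!rmorphM; congr (gcst A _).
Qed.

Lemma loc_strD p : {morph @loc_str p : x y / x + y}.
Proof.
move=> x y; have [a ->] := loc_surj x; have [b ->] := loc_surj y.
rewrite [_ + _]loc_addE !loc_strE [RHS]loc_addE; apply: frac_eqW => /=.
by rewrite !(rmorphD, rmorphM).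
Qed.

Lemma loc_strM p : {morph @loc_str p : x y / x * y}.
Proof.
move=> x y; have [a ->] := loc_surj x; have [b ->] := loc_surj y.
rewrite [_ * _]loc_mulE !loc_strE [RHS]loc_mulE; apply: frac_eqW => /=.
by rewrite !(rmorphD, rmorphM).
Qed.

Lemma loc_str1 p : @loc_str p 1 = 1.
Proof.
rewrite [X in loc_str X](_ : 1 = loc_pi (frac1 S_galg p)) // loc_strE.
exact: frac_eqW.
Qed.

Lemma loc_strC p (z : loc S_galg p) x : loc_str z * x = x * loc_str z.
Proof.
have [a ->] := loc_surj z; have [b ->] := loc_surj x.
rewrite loc_strE [LHS]loc_mulE [RHS]loc_mulE; apply: frac_eqW => /=.
by congr (gcst A _ * _); [exact: mulrC|exact: gcstC].
Qed.

Fact str_local W (s : O W) :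
  locally_fraction (fun p (Wp : W p) => loc_str (sval s Wp)).
Proof.
move=> p Wp; have [W1 [d [a [b [ha [hb [W1p h1]]]]]]] := sval_local s Wp.
exists W1, d, (gcst A a), b, (cdeg_cst A ha), hb.
split=> // q Wq W1q.
have [qb ->] := h1 q Wq W1q.
by exists qb; rewrite loc_strE; apply: frac_eqW.
Qed.

Definition ostr W (s : O W) : sect A W := Sect (str_local s).

Lemma ostrD W : {morph @ostr W : s t / s + t}.
Proof. by move=> s t; apply: sect_ext => p Wp; exact: loc_strD. Qed.
Lemma ostrM W : {morph @ostr W : s t / s * t}.
Proof. by move=> s t; apply: sect_ext => p Wp; exact: loc_strM. Qed.
Lemma ostr1 W : @ostr W 1 = 1.
Proof. by apply: sect_ext => p Wp; exact: loc_str1. Qed.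
Lemma ostrC W (f : O W) s : ostr f * s = s * ostr f.
Proof. by apply: sect_ext => p Wp; exact: loc_strC. Qed.
Lemma ostr_res W W' (h : W' `<=` W) (f : O W) :
  ostr (sres h f) = sres h (ostr f).
Proof. by apply: sect_ext. Qed.

End StructureMap.

(* [rho] exhibits its target as the localization of its source at the powers of
   an element acting by [f], respectively [f'], which is bijective. *)
Definition is_localization (M M' : zmodType) (f : M -> M) (f' : M' -> M')
    (rho : M -> M') : Prop :=
  (forall s, rho s = 0 -> exists N, iter N f s = 0) /\
  (forall t, exists N s, rho s = iter N f' t).

(* [W' = W_f], the locus in [W] where [f] does not vanish. *)
Definition nonvanishing_locus (W : opn) (f : O W) (W' : opn) : Prop :=
  forall p, W' p <-> exists Wp : W p, ~ vanishes (sval f Wp).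

(* The canonical morphism [W -> Spec O(W)] is an isomorphism: it is a
   homeomorphism and [O(W_f) = O(W)_f] for all [f]. *)
Record affine (W : opn) : Prop := Affine {
  affine_bij : forall q : O W -> Prop, prime_ideal q ->
    exists p, exists2 Wp : W p, (forall f, q f <-> vanishes (sval f Wp)) &
      forall p' (Wp' : W p'),
        (forall f, q f <-> vanishes (sval f Wp')) -> p' = p;
  affine_basis : forall (W' : opn) p (Wp : W p), W' p ->
    exists2 f : O W, ~ vanishes (sval f Wp) &
      forall q (Wq : W q), ~ vanishes (sval f Wq) -> W' q;
  affine_loc : forall (f : O W) (W' : opn) (h : W' `<=` W),
    nonvanishing_locus f W' ->
    is_localization ( *%R f) ( *%R (sres h f)) (sres h)
}.

(** * Fibers of sheaves of [O]-modules on an open subscheme *)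

Record subopn (U : opn) := Subopn { so_opn :> opn; so_sub : so_opn `<=` U }.

Definition subopn_top (U : opn) : subopn U :=
  @Subopn U U (fun p (Up : U p) => Up).

Definition subopn_cap U (W W' : subopn U) : subopn U :=
  @Subopn U (opn_cap W W') (fun p h => so_sub (proj1 h)).

Lemma cap_subl U (W W' : subopn U) : subopn_cap W W' `<=` W.
Proof. by move=> p []. Qed.

Lemma cap_subr U (W W' : subopn U) : subopn_cap W W' `<=` W'.
Proof. by move=> p []. Qed.

Lemma sub_trans (W1 W2 W3 : opn) : W2 `<=` W1 -> W3 `<=` W2 -> W3 `<=` W1.
Proof. by move=> h h' p /h' /h. Qed.

Record Omod (U : opn) := OMod {
  osec :> subopn U -> zmodType;
  ores : forall W W' : subopn U, W' `<=` W -> osec W -> osec W';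
  oresB : forall (W W' : subopn U) (h : W' `<=` W) s t,
    ores h (s - t) = ores h s - ores h t;
  ores_id : forall (W : subopn U) (h : W `<=` W) s, ores h s = s;
  ores_comp : forall (W1 W2 W3 : subopn U) (h : W2 `<=` W1) (h' : W3 `<=` W2)
    (h'' : W3 `<=` W1) s, ores h' (ores h s) = ores h'' s;
  oact : forall W : subopn U, O W -> osec W -> osec W;
  oact_res : forall (W W' : subopn U) (h : W' `<=` W) f s,
    ores h (oact f s) = oact (sres h f) (ores h s)
}.

Record ptin (U : opn) := Ptin { ptin_pt :> point; ptin_in : U ptin_pt }.

Section Fiber.
Variables (U : opn) (x : ptin U).

(* [m_x F] over the neighbourhood [W] of [x]. *)
Inductive max_ideal_span (F : Omod U) (W : subopn U) (Wx : W x) :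
    F W -> Prop :=
| mis0 : max_ideal_span Wx 0
| misB s t : max_ideal_span Wx s -> max_ideal_span Wx t ->
    max_ideal_span Wx (s - t)
| mis_act f s : vanishes (sval f Wx) -> max_ideal_span Wx (oact f s).

Lemma misN (F : Omod U) (W : subopn U) (Wx : W x) (s : F W) :
  max_ideal_span Wx s -> max_ideal_span Wx (- s).
Proof. by rewrite -sub0r; apply/misB/mis0. Qed.

Lemma misD (F : Omod U) (W : subopn U) (Wx : W x) (s t : F W) :
  max_ideal_span Wx s -> max_ideal_span Wx t -> max_ideal_span Wx (s + t).
Proof. by move=> hs /misN ht; rewrite -[t]opprK; exact: misB. Qed.

Lemma ores0 (F : Omod U) (W W' : subopn U) (h : W' `<=` W) :
  ores h (0 : F W) = 0.
Proof. by rewrite -(subrr 0) oresB subrr. Qed.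

Lemma oresN (F : Omod U) (W W' : subopn U) (h : W' `<=` W) (s : F W) :
  ores h (- s) = - ores h s.
Proof. by rewrite -sub0r oresB ores0 sub0r. Qed.

Lemma oresD (F : Omod U) (W W' : subopn U) (h : W' `<=` W) (s t : F W) :
  ores h (s + t) = ores h s + ores h t.
Proof. by rewrite -[t]opprK oresB oresN !opprK. Qed.

Lemma mis_res (F : Omod U) (W W' : subopn U) (h : W' `<=` W) (Wx : W x)
  (W'x : W' x) (s : F W) :
  max_ideal_span Wx s -> max_ideal_span W'x (ores h s).
Proof.
elim=> [|{}s t _ IHs _ IHt|f {}s hf].
- by rewrite ores0; exact: mis0.
- by rewrite oresB; exact: misB.
- rewrite oact_res; apply: mis_act => /=.
  by rewrite (Prop_irrelevance (h x W'x) Wx).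
Qed.

Section FiberType.
Variable F : Omod U.

Record germ := Germ { germ_opn : subopn U; germ_in : germ_opn x;
  germ_sec : F germ_opn }.
HB.instance Definition _ := gen_eqMixin germ.
HB.instance Definition _ := gen_choiceMixin germ.

Definition germ_eq (g h : germ) : Prop :=
  exists (W : subopn U) (Wx : W x) (hg : W `<=` germ_opn g)
         (hh : W `<=` germ_opn h),
    max_ideal_span Wx (ores hg (germ_sec g) - ores hh (germ_sec h)).

Definition germ_rel : rel germ := fun g h => `[< germ_eq g h >].

Lemma germ_refl : reflexive germ_rel.
Proof.
move=> [W Wx s]; apply/asboolP.
by exists W, Wx, (fun p Wp => Wp), (fun p Wp => Wp); rewrite subrr; exact: mis0.
Qed.

Lemma germ_sym : ssrbool.symmetric germ_rel.
Proof.
by move=> g h; apply/asboolP/asboolP => -[W [Wx [hg [hh /misN e]]]];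
  exists W, Wx, hh, hg; rewrite -opprB.
Qed.

Lemma germ_trans : transitive germ_rel.
Proof.
move=> h g l /asboolP[W [Wx [hg [hh e]]]] /asboolP[W' [W'x [hh' [hl e']]]].
apply/asboolP; pose V := subopn_cap W W'; have Vx : V x by [].
have lV := @cap_subl U W W'; have rV := @cap_subr U W W'.
exists V, Vx, (sub_trans hg lV), (sub_trans hl rV).
have := misD (mis_res lV Vx e) (mis_res rV Vx e').
rewrite !oresB (ores_comp _ _ (sub_trans hg lV)).
rewrite (ores_comp _ _ (sub_trans hh lV)) (ores_comp _ _ (sub_trans hl rV)).
rewrite (ores_comp _ _ (sub_trans hh' rV)).
rewrite (Prop_irrelevance (sub_trans hh' rV) (sub_trans hh lV)).
by rewrite addrA subrK.
Qed.

Canonical germ_equiv := EquivRel germ_rel germ_refl germ_sym germ_trans.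

(* The fiber [F_x / m_x F_x] at [x]. *)
Definition fiber := {eq_quot germ_equiv}.
HB.instance Definition _ := Choice.on fiber.

Definition germ_class (W : subopn U) (Wx : W x) (s : F W) : fiber :=
  \pi_fiber (Germ Wx s).

Lemma germ_classP (W : subopn U) (Wx : W x) s (W' : subopn U) (W'x : W' x) s' :
  germ_class Wx s = germ_class W'x s' <-> germ_eq (Germ Wx s) (Germ W'x s').
Proof. by split=> [/eqmodP/asboolP|h]; [|apply/eqmodP/asboolP]. Qed.

Lemma germ_repr (W : subopn U) (Wx : W x) s :
  germ_eq (repr (germ_class Wx s)) (Germ Wx s).
Proof. by apply/asboolP/(eqmodP germ_equiv); rewrite reprK. Qed.

Lemma germ_res (W W' : subopn U) (h : W' `<=` W) (Wx : W x) (W'x : W' x) s :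
  germ_class Wx s = germ_class W'x (ores h s).
Proof.
apply/germ_classP; exists W', W'x, h, (fun p Wp => Wp) => /=.
by rewrite ores_id subrr; exact: mis0.
Qed.

Lemma germ_surj (u : fiber) :
  exists (W : subopn U) (Wx : W x) s, u = @germ_class W Wx s.
Proof.
exists (germ_opn (repr u)), (germ_in (repr u)), (germ_sec (repr u)).
by rewrite /germ_class -[LHS]reprK; case: (repr u).
Qed.

Lemma germ_span (W : subopn U) (Wx : W x) s t :
  max_ideal_span Wx (s - t) -> germ_class Wx s = germ_class Wx t.
Proof.
move=> h; apply/germ_classP; exists W, Wx, (fun p Wp => Wp), (fun p Wp => Wp).
by rewrite !ores_id.
Qed.

End FiberType.

Lemma germ_surj2 (F G : Omod U) (u : fiber F) (v : fiber G) :
  exists (W : subopn U) (Wx : W x) s t,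
    u = @germ_class F W Wx s /\ v = @germ_class G W Wx t.
Proof.
have [W [Wx [s ->]]] := germ_surj u; have [W' [W'x [t ->]]] := germ_surj v.
exists (subopn_cap W W'), (conj Wx W'x), (ores (@cap_subl _ _ _) s),
  (ores (@cap_subr _ _ _) t).
by split; exact: germ_res.
Qed.

Lemma germ_surj3 (F G H : Omod U) (u : fiber F) (v : fiber G) (z : fiber H) :
  exists (W : subopn U) (Wx : W x) s t r,
    [/\ u = @germ_class F W Wx s, v = @germ_class G W Wx t
    & z = @germ_class H W Wx r].
Proof.
have [W [Wx [s [t [-> ->]]]]] := germ_surj2 u v.
have [W' [W'x [r ->]]] := germ_surj z.
exists (subopn_cap W W'), (conj Wx W'x), (ores (@cap_subl _ _ _) s),
  (ores (@cap_subl _ _ _) t), (ores (@cap_subr _ _ _) r).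
by split; exact: germ_res.
Qed.

(* Operations on fibers induced by operations on sections. *)
Section FiberOp.
Variables (F G H : Omod U) (b : forall W : subopn U, F W -> G W -> H W).
Hypothesis b_res : forall (W W' : subopn U) (h : W' `<=` W) s t,
  ores h (@b W s t) = b (ores h s) (ores h t).
Hypothesis b_span : forall (W : subopn U) (Wx : W x) s s' t t',
  max_ideal_span Wx (s - s') -> max_ideal_span Wx (t - t') ->
  max_ideal_span Wx (@b W s t - b s' t').

Definition fiber_op (u : fiber F) (v : fiber G) : fiber H :=
  let g := repr u in let h := repr v in
  @germ_class H (subopn_cap (germ_opn g) (germ_opn h))
    (conj (germ_in g) (germ_in h))
    (b (ores (@cap_subl _ _ _) (germ_sec g))
       (ores (@cap_subr _ _ _) (germ_sec h))).

Lemma fiber_opE (W : subopn U) (Wx : W x) s t :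
  fiber_op (germ_class Wx s) (germ_class Wx t) = germ_class Wx (b s t).
Proof.
have := germ_repr Wx s; have := germ_repr Wx t; rewrite /fiber_op.
move: (repr (germ_class Wx t)) (repr (germ_class Wx s)) =>
  [W2 W2x t2] [W1 W1x s1] /=.
move=> [V2 [V2x [h2 [h2' e2]]]] [V1 [V1x [h1 [h1' e1]]]].
rewrite /= in h1 h1' e1 h2 h2' e2 *.
pose V := subopn_cap V1 V2; have Vx : V x by [].
have lV : V `<=` V1 := @cap_subl U V1 V2.
have rV : V `<=` V2 := @cap_subr U V1 V2.
have hV : V `<=` subopn_cap W1 W2 by move=> p [/h1 ? /h2 ?]; split.
rewrite (germ_res hV _ Vx) (germ_res (sub_trans h1' lV) Wx Vx) !b_res.
apply/germ_span/b_span.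
  have := mis_res lV Vx e1; rewrite oresB.
  rewrite (ores_comp _ _ (sub_trans h1 lV)) (ores_comp _ _ (sub_trans h1' lV)).
  by rewrite (ores_comp _ _ (sub_trans h1 lV)).
have := mis_res rV Vx e2; rewrite oresB.
rewrite (ores_comp _ _ (sub_trans h2 rV)) (ores_comp _ _ (sub_trans h2' rV)).
rewrite (ores_comp _ _ (sub_trans h2 rV)).
by rewrite (Prop_irrelevance (sub_trans h1' lV) (sub_trans h2' rV)).
Qed.

End FiberOp.

Section FiberZmod.
Variable F : Omod U.

Definition fiber_add := fiber_op (fun W (s t : F W) => s + t).

Lemma fiber_addE (W : subopn U) (Wx : W x) (s t : F W) :
  fiber_add (germ_class Wx s) (germ_class Wx t) = germ_class Wx (s + t).
Proof.
apply: fiber_opE => [W' W'' h s' t'|W' W'x s' s'' t' t'' hs ht].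
  exact: oresD.
by rewrite opprD addrACA; exact: misD.
Qed.

Definition fiber_opp (u : fiber F) : fiber F :=
  germ_class (germ_in (repr u)) (- germ_sec (repr u)).

Lemma fiber_oppE (W : subopn U) (Wx : W x) (s : F W) :
  fiber_opp (germ_class Wx s) = germ_class Wx (- s).
Proof.
have := germ_repr Wx s; rewrite /fiber_opp.
move: (repr _) => [W1 W1x s1] [V [Vx [h [h' e]]]]; rewrite /= in h h' e *.
apply/germ_classP; exists V, Vx, h, h' => /=.
by rewrite !oresN -opprD; exact: misN.
Qed.

Definition fiber0 : fiber F :=
  @germ_class F (subopn_top U) (ptin_in x) 0.

Lemma fiber0E (W : subopn U) (Wx : W x) : fiber0 = germ_class Wx (0 : F W).
Proof.
have hW : W `<=` subopn_top U by exact: so_sub.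
by rewrite /fiber0 (germ_res hW _ Wx) ores0.
Qed.

Fact fiber_addA : associative fiber_add.
Proof.
move=> u v z; have [W [Wx [s [t [r [-> -> ->]]]]]] := germ_surj3 u v z.
by rewrite !fiber_addE addrA.
Qed.

Fact fiber_addC : commutative fiber_add.
Proof.
move=> u v; have [W [Wx [s [t [-> ->]]]]] := germ_surj2 u v.
by rewrite !fiber_addE addrC.
Qed.

Fact fiber_add0 : left_id fiber0 fiber_add.
Proof.
move=> u; have [W [Wx [s ->]]] := germ_surj u.
by rewrite (fiber0E Wx) fiber_addE add0r.
Qed.

Fact fiber_addN : left_inverse fiber0 fiber_opp fiber_add.
Proof.
move=> u; have [W [Wx [s ->]]] := germ_surj u.
by rewrite (fiber0E Wx) fiber_oppE fiber_addE addNr.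
Qed.

HB.instance Definition _ := GRing.isZmodule.Build (fiber F)
  fiber_addA fiber_addC fiber_add0 fiber_addN.

End FiberZmod.
End Fiber.

(** ** The fibers of the sheaf of algebras associated with [A] *)

Section AlgebraFiber.
Variables (A : galg) (U : opn).

Definition galg_Omod : Omod U.
Proof.
refine (@OMod U (fun W => sect A W) (fun W W' h s => sres h s) _ _ _
  (fun W f s => ostr A f * s) _).
- by move=> W W' h s t; apply: sect_ext.
- move=> W h s; apply: sect_ext => p Wp /=.
  by rewrite (Prop_irrelevance (h p Wp) Wp).
- move=> W1 W2 W3 h h' h'' s; apply: sect_ext => p Wp /=.
  by rewrite (Prop_irrelevance (h p (h' p Wp)) (h'' p Wp)).
- by move=> W W' h f s; apply: sect_ext.
Defined.

Variable x : ptin U.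

Definition afiber := fiber x galg_Omod.
HB.instance Definition _ := GRing.Zmodule.on afiber.

Lemma afiber_mul_span (W : subopn U) (Wx : W x) (s s' t t' : galg_Omod W) :
  max_ideal_span Wx (s - s') -> max_ideal_span Wx (t - t') ->
  max_ideal_span Wx ((s : sect A W) * t - s' * t' : galg_Omod W).
Proof.
move=> hs ht; rewrite (_ : _ - _ = (s - s' : sect A W) * t + s' * (t - t'));
  last first.
  by rewrite mulrBl mulrBr addrA subrK.
apply: misD.
  elim: hs => [|a b _ IHa _ IHb|f a hf].
  - by rewrite mul0r; exact: mis0.
  - by rewrite mulrBl; exact: misB.
  - by rewrite -mulrA; exact: (@mis_act U x galg_Omod).
elim: ht => [|a b _ IHa _ IHb|f a hf].
- by rewrite mulr0; exact: mis0.
- by rewrite mulrBr; exact: misB.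
- by rewrite mulrA -ostrC -mulrA; exact: (@mis_act U x galg_Omod).
Qed.

Definition afiber_mul : afiber -> afiber -> afiber :=
  @fiber_op U x galg_Omod galg_Omod galg_Omod (fun W => @GRing.mul (sect A W)).

Lemma afiber_mulE (W : subopn U) (Wx : W x) (s t : galg_Omod W) :
  afiber_mul (germ_class Wx s) (germ_class Wx t) =
  germ_class Wx ((s : sect A W) * t : galg_Omod W).
Proof.
apply: fiber_opE => [W' W'' h s' t'|W' W'x s' s'' t' t''].
  by apply: sect_ext.
exact: afiber_mul_span.
Qed.

Definition afiber1 : afiber :=
  @germ_class U x galg_Omod (subopn_top U) (ptin_in x) (1 : sect A _).

Lemma afiber1E (W : subopn U) (Wx : W x) :
  afiber1 = @germ_class U x galg_Omod W Wx (1 : sect A W).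
Proof.
have hW : W `<=` subopn_top U by exact: so_sub.
by rewrite /afiber1 (germ_res hW _ Wx); congr germ_class; apply: sect_ext.
Qed.

Fact afiber_mulA : associative afiber_mul.
Proof.
move=> u v z; have [W [Wx [s [t [r [-> -> ->]]]]]] := germ_surj3 u v z.
by rewrite !afiber_mulE mulrA.
Qed.
Fact afiber_mul1 : left_id afiber1 afiber_mul.
Proof.
move=> u; have [W [Wx [s ->]]] := germ_surj u.
by rewrite (afiber1E Wx) afiber_mulE mul1r.
Qed.
Fact afiber_mulr1 : right_id afiber1 afiber_mul.
Proof.
move=> u; have [W [Wx [s ->]]] := germ_surj u.
by rewrite (afiber1E Wx) afiber_mulE mulr1.
Qed.
Fact afiber_mulDl : left_distributive afiber_mul +%R.
Proof.
move=> u v z; have [W [Wx [s [t [r [-> -> ->]]]]]] := germ_surj3 u v z.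
by rewrite [_ + _]fiber_addE !afiber_mulE [RHS]fiber_addE mulrDl.
Qed.
Fact afiber_mulDr : right_distributive afiber_mul +%R.
Proof.
move=> u v z; have [W [Wx [s [t [r [-> -> ->]]]]]] := germ_surj3 u v z.
by rewrite [_ + _]fiber_addE !afiber_mulE [RHS]fiber_addE mulrDr.
Qed.
HB.instance Definition _ := GRing.Zmodule_isPzRing.Build afiber
  afiber_mulA afiber_mul1 afiber_mulr1 afiber_mulDl afiber_mulDr.

End AlgebraFiber.

(* The residue field at [x] and its map to the fiber of the algebra. *)
Definition residue U (x : ptin U) := afiber S_galg x.
HB.instance Definition _ U (x : ptin U) := GRing.PzRing.on (residue x).

Definition residue_str (A : galg) U (x : ptin U) (u : residue x) : afiber A x :=
  @germ_class U x (galg_Omod A U) _ (germ_in (repr u))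
    (ostr A (germ_sec (repr u) : O _)).

(** * Graded quasi-coherent modules over the sheaf [D] *)

Section DModules.
Variables (m : nat) (w : potential k n m) (U : opn).

Definition D (W : opn) := sect (E_galg w) W.
HB.instance Definition _ W := GRing.PzRing.on (D W).

(* Sections of degree [j] for the grading of [D] by the degree in the [x_i]. *)
Definition D_deg (W : opn) (j : int) (a : D W) : Prop :=
  forall p (Wp : W p), exists2 y : frac (E_galg w) p,
    sval a Wp = loc_pi y & E_bideg (frac_deg y) j (num y).

(* As [P(V)] is a noetherian space, the sections of a direct sum of sheaves over
   an open subset are the finite sums of sections, so that a grading of a sheaf
   is the same as a compatible grading of its sections. *)
Record gmod := Gmod {
  gsec :> forall W : subopn U, lmodType (D W);
  gres : forall W W' : subopn U, W' `<=` W -> gsec W -> gsec W';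
  gresB : forall (W W' : subopn U) (h : W' `<=` W) s t,
    gres h (s - t) = gres h s - gres h t;
  gres_act : forall (W W' : subopn U) (h : W' `<=` W) (a : D W) s,
    gres h (a *: s) = (sres h a : D W') *: gres h s;
  gres_id : forall (W : subopn U) (h : W `<=` W) s, gres h s = s;
  gres_comp : forall (W1 W2 W3 : subopn U) (h : W2 `<=` W1) (h' : W3 `<=` W2)
    (h'' : W3 `<=` W1) s, gres h' (gres h s) = gres h'' s;
  gsheaf_sep : forall (W : subopn U) (I : Type) (C : I -> subopn U)
    (hC : forall i, C i `<=` W), (forall p, W p -> exists i, C i p) ->
    forall s, (forall i, gres (hC i) s = 0) -> s = 0;
  gsheaf_glue : forall (W : subopn U) (I : Type) (C : I -> subopn U)
    (hC : forall i, C i `<=` W), (forall p, W p -> exists i, C i p) ->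
    forall t : forall i, gsec (C i),
      (forall i j (V : subopn U) (hi : V `<=` C i) (hj : V `<=` C j),
         gres hi (t i) = gres hj (t j)) ->
      exists s, forall i, gres (hC i) s = t i;
  gquasi_coherent : forall p, U p ->
    exists W : subopn U, [/\ W p, affine W &
      forall (f : O W) (W' : subopn U) (h : W' `<=` W),
        nonvanishing_locus f W' ->
        is_localization (fun s : gsec W => (ostr _ f : D W) *: s)
          (fun s : gsec W' => (ostr _ (sres h f) : D W') *: s) (gres h)];
  ggr : forall W : subopn U, grading (@D_deg W) (gsec W);
  ggr_res : forall (W W' : subopn U) (h : W' `<=` W) j s,
    gres h (gpart (ggr W) j s) = gpart (ggr W') j (gres h s)
}.

Definition gmod_Omod (M : gmod) : Omod U.
Proof.
refine (@OMod U (fun W => M W) (@gres M) _ _ _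
  (fun W f s => (ostr _ f : D W) *: s) _).
- exact: gresB.
- exact: gres_id.
- exact: gres_comp.
- by move=> W W' h f s; rewrite gres_act -ostr_res.
Defined.

(** ** Fibers of modules and torsion modules *)

Section ModuleFiber.
Variables (M : gmod) (x : ptin U).

(* The fiber of [D] at [x], and that of [M] as a module over it. *)
Definition Dfiber := afiber (E_galg w) x.
HB.instance Definition _ := GRing.PzRing.on Dfiber.

Definition mfiber := fiber x (gmod_Omod M).
HB.instance Definition _ := GRing.Zmodule.on mfiber.

Lemma mfiber_scale_span (W : subopn U) (Wx : W x)
    (a a' : galg_Omod (E_galg w) U W) (s s' : gmod_Omod M W) :
  max_ideal_span Wx (a - a') -> max_ideal_span Wx (s - s') ->
  max_ideal_span Wx
    ((a : D W) *: (s : M W) - (a' : D W) *: (s' : M W) : gmod_Omod M W).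
Proof.
move=> ha hs; rewrite (_ : _ - _ =
  (a - a' : D W) *: (s : M W) + (a' : D W) *: (s - s' : M W)); last first.
  by rewrite scalerBl scalerBr addrA subrK.
apply: misD.
  elim: ha => [|b c _ IHb _ IHc|f b hf].
  - by rewrite scale0r; exact: mis0.
  - by rewrite scalerBl; exact: misB.
  - by rewrite -scalerA; exact: (@mis_act U x (gmod_Omod M)).
elim: hs => [|b c _ IHb _ IHc|f b hf].
- by rewrite scaler0; exact: mis0.
- by rewrite scalerBr; exact: misB.
- rewrite scalerA -ostrC -scalerA; exact: (@mis_act U x (gmod_Omod M)).
Qed.

Definition mfiber_scale : Dfiber -> mfiber -> mfiber :=
  @fiber_op U x (galg_Omod (E_galg w) U) (gmod_Omod M) (gmod_Omod M)
    (fun W a s => (a : D W) *: (s : M W)).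

Lemma mfiber_scaleE (W : subopn U) (Wx : W x)
    (a : galg_Omod (E_galg w) U W) (s : gmod_Omod M W) :
  mfiber_scale (germ_class Wx a) (germ_class Wx s) =
  germ_class Wx ((a : D W) *: (s : M W) : gmod_Omod M W).
Proof.
apply: fiber_opE => [W' W'' h a' s'|W' W'x a' a'' s' s''].
  exact: gres_act.
exact: mfiber_scale_span.
Qed.

Fact mfiber_scaleA a b v :
  mfiber_scale a (mfiber_scale b v) = mfiber_scale (a * b) v.
Proof.
have [W [Wx [s [t [r [-> -> ->]]]]]] := germ_surj3 a b v.
by rewrite [_ * _]afiber_mulE !mfiber_scaleE scalerA.
Qed.
Fact mfiber_scale1 : left_id 1 mfiber_scale.
Proof.
move=> v; have [W [Wx [s ->]]] := germ_surj v.
by rewrite [1](afiber1E (E_galg w) Wx) mfiber_scaleE scale1r.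
Qed.
Fact mfiber_scaleDr : right_distributive mfiber_scale +%R.
Proof.
move=> a u v; have [W [Wx [s [t [r [-> -> ->]]]]]] := germ_surj3 a u v.
by rewrite [_ + _]fiber_addE !mfiber_scaleE [RHS]fiber_addE scalerDr.
Qed.
Fact mfiber_scaleDl v : {morph mfiber_scale^~ v : a b / a + b}.
Proof.
move=> a b; have [W [Wx [s [t [r [-> -> ->]]]]]] := germ_surj3 a b v.
by rewrite [_ + _]fiber_addE !mfiber_scaleE [RHS]fiber_addE scalerDl.
Qed.
HB.instance Definition _ := GRing.Zmodule_isLmodule.Build Dfiber mfiber
  mfiber_scaleA mfiber_scale1 mfiber_scaleDr mfiber_scaleDl.

(* A [D_x]-submodule of the fiber of finite dimension over the residue field. *)
Definition fin_dim_submodule (N : mfiber -> Prop) : Prop :=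
  [/\ N 0, forall (a : Dfiber) u v, N u -> N v -> N (a *: u + v)
    & exists (r : nat) (v : 'I_r -> mfiber), (forall i, N (v i)) /\
        forall u, N u -> exists c : 'I_r -> residue x,
          u = \sum_(i < r) (residue_str (E_galg w) (c i) : Dfiber) *: v i].

(* The fiber is the sum of its finite-dimensional submodules. *)
Definition tors_fiber : Prop :=
  forall u : mfiber, exists (r : nat) (v : 'I_r -> mfiber)
      (N : 'I_r -> mfiber -> Prop),
    (forall i, fin_dim_submodule (N i) /\ N i (v i)) /\ u = \sum_(i < r) v i.

End ModuleFiber.

Definition Tors (M : gmod) : Prop := forall x : ptin U, tors_fiber M x.

(** ** The category [Gr(D_U)] *)

Record gmor (M N : gmod) := Gmor {
  gfun :> forall W : subopn U, M W -> N W;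
  gfun_lin : forall (W : subopn U) (a : D W) s t,
    gfun (a *: s + t) = a *: gfun s + gfun t;
  gfun_res : forall (W W' : subopn U) (h : W' `<=` W) (s : M W),
    gfun (gres h s) = gres h (gfun s);
  gfun_gr : forall (W : subopn U) j (s : M W),
    gfun (gpart (ggr M W) j s) = gpart (ggr N W) j (gfun s)
}.

Section GrOperations.
Variables M N : gmod.

Lemma gmor_add_subproof (f : gmor M N) (W : subopn U) (s t : M W) :
  f W (s + t) = f W s + f W t.
Proof. by have := gfun_lin f 1 s t; rewrite !scale1r. Qed.

Lemma gmor0_subproof (f : gmor M N) (W : subopn U) : f W 0 = 0.
Proof. by apply: (@addrI _ (f W 0)); rewrite -gmor_add_subproof !addr0. Qed.

Lemma gmor_act_subproof (f : gmor M N) (W : subopn U) (a : D W) (s : M W) :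
  f W (a *: s) = a *: f W s.
Proof. by rewrite -[a *: s]addr0 gfun_lin gmor0_subproof addr0. Qed.

Lemma gres_add_subproof (L : gmod) (W W' : subopn U) (h : W' `<=` W)
  (s t : L W) : gres h (s + t) = gres h s + gres h t.
Proof. exact: (@oresD U (gmod_Omod L)). Qed.

Lemma gres0_subproof (L : gmod) (W W' : subopn U) (h : W' `<=` W) :
  gres h (0 : L W) = 0.
Proof. exact: (@ores0 U (gmod_Omod L)). Qed.

Lemma gpart0_subproof (L : gmod) (W : subopn U) j :
  gpart (ggr L W) j 0 = 0.
Proof. by apply: (@addrI _ (gpart (ggr L W) j 0)); rewrite -gpartD !addr0. Qed.

Lemma gpartN_subproof (L : gmod) (W : subopn U) j s :
  gpart (ggr L W) j (- s) = - gpart (ggr L W) j s.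
Proof.
apply: (@addrI _ (gpart (ggr L W) j s)).
by rewrite -gpartD !subrr gpart0_subproof.
Qed.

Definition gzero : gmor M N.
Proof.
exists (fun W _ => 0) => [W a s t|W W' h s|W j s].
- by rewrite scaler0 addr0.
- by rewrite gres0_subproof.
- by rewrite gpart0_subproof.
Defined.

Definition gadd (f g : gmor M N) : gmor M N.
Proof.
exists (fun W s => f W s + g W s) => [W a s t|W W' h s|W j s].
- by rewrite !gfun_lin scalerDr addrACA.
- by rewrite !gfun_res gres_add_subproof.
- by rewrite !gfun_gr gpartD.
Defined.

Definition gopp (f : gmor M N) : gmor M N.
Proof.
exists (fun W s => - f W s) => [W a s t|W W' h s|W j s].
- by rewrite !gfun_lin opprD scalerN.
- rewrite gfun_res; symmetry; exact: (@oresN U (gmod_Omod N)).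
- by rewrite !gfun_gr gpartN_subproof.
Defined.

Lemma D_deg_ostr (W : opn) (f : O W) : @D_deg W 0 (ostr _ f).
Proof.
move=> p Wp; have [y ey] := loc_surj (sval f Wp).
exists (frac_str (E_galg w) y); first by rewrite /= ey loc_strE.
exists (free_cst (num y)); split=> // u; rewrite /free_cst /= monalg.mcoeffC.
  by apply: rpredMn; exact: (num_deg y).
by case: (u =P mone) => [->|_]; [rewrite fm1|rewrite mulr0n eqxx].
Qed.

Lemma gpart_scale0 (L : gmod) (W : subopn U) (a : D W) j (s : L W) :
  D_deg 0 a -> gpart (ggr L W) j (a *: s) = a *: gpart (ggr L W) j s.
Proof.
move=> ha; have [l ul es] := gpart_sum (ggr L W) s.
have gsum (v : seq int) (F : int -> L W) : gpart (ggr L W) j (\sum_(i <- v) F i)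
    = \sum_(i <- v) gpart (ggr L W) j (F i).
  elim: v => [|i v IH]; first by rewrite !big_nil gpart0_subproof.
  by rewrite !big_cons gpartD IH.
rewrite [in LHS]es [in RHS]es scaler_sumr !gsum scaler_sumr.
apply: eq_bigr => i _; rewrite [in RHS]gpartK.
have hi : gpart (ggr L W) i (gpart (ggr L W) i s) = gpart (ggr L W) i s.
  by rewrite gpartK eqxx.
have := gpart_act ha hi; rewrite add0r => e; rewrite -{1}e gpartK.
by case: eqP => _; rewrite ?e ?scaler0.
Qed.

Definition gscale (r : O U) (f : gmor M N) : gmor M N.
Proof.
exists (fun (W : subopn U) s =>
    (ostr _ (sres (so_sub (s := W)) r) : D W) *: f W s) =>
  [W a s t|W W' h s|W j s].
- by rewrite gfun_lin scalerDr !scalerA ostrC.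
- by rewrite gfun_res gres_act -ostr_res; congr ((_ : D W') *: _);
    apply: sect_ext => p Wp /=;
    rewrite (Prop_irrelevance (so_sub (h p Wp)) (so_sub Wp)).
- by rewrite gfun_gr gpart_scale0 //; exact: D_deg_ostr.
Defined.

End GrOperations.

Definition gid (M : gmod) : gmor M M.
Proof. by exists (fun W s => s). Defined.

Definition gcomp (M N L : gmod) (g : gmor N L) (f : gmor M N) : gmor M L.
Proof.
exists (fun W s => g W (f W s)) => [W a s t|W W' h s|W j s].
- by rewrite !gfun_lin.
- by rewrite !gfun_res.
- by rewrite !gfun_gr.
Defined.

Definition Gr : lincat (O U).
Proof.
refine (@Lincat (O U) gmod gmor
  (fun M N f g => forall (W : subopn U) (s : M W), f W s = g W s)
  gid gcomp gzero gadd gopp gscale _ _ _ _ _ _ _ _ _ _ _ _ _ _ _ _ _ _ _ _ _ _).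
- by [].
- by move=> M N f g e W s.
- by move=> M N f g h e e' W s; rewrite e.
- by move=> M N L g g' f f' e e' W s /=; rewrite e' e.
- by move=> M N f f' g g' e e' W s /=; rewrite e e'.
- by move=> M N f f' e W s /=; rewrite e.
- by move=> M N r f f' e W s /=; rewrite e.
- by [].
- by [].
- by [].
- by move=> M N f g h W s /=; rewrite addrA.
- by move=> M N f g W s /=; rewrite addrC.
- by move=> M N f W s /=; rewrite add0r.
- by move=> M N f W s /=; rewrite addNr.
- by move=> M N r f g W s /=; rewrite scalerDr.
- move=> M N r r' f W s /=; rewrite -scalerDl -ostrD.
  by congr ((ostr _ _ : D W) *: _); apply: sect_ext.
- move=> M N r r' f W s /=; rewrite scalerA -ostrM.
  by congr ((ostr _ _ : D W) *: _); apply: sect_ext.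
- move=> M N f W s /=; rewrite (_ : sres _ 1 = 1) ?ostr1 ?scale1r //.
  exact: sect_ext.
- by [].
- by move=> M N L g f f' W s /=; rewrite gmor_add_subproof.
- by [].
- by move=> M N L r g f W s /=; rewrite gmor_act_subproof.
Defined.

(* Passing to fibers is not left exact, so that a submodule of an arbitrary
   quasi-coherent module in [Tors] need not be in [Tors]; [quotient_category]
   uses the largest Serre subcategory contained in [Tors], which consists of the
   modules all of whose submodules are in [Tors]. *)
Definition QGr : lincat (O U) := @quotient_category (O U) Gr Tors.

End DModules.
End Geometry.

(* Main.v *)
Require Import Defs.
From HB Require Import structures.
From Stdlib Require Import Setoid Morphisms.
From mathcomp Require Import all_boot all_order all_algebra.
From mathcomp Require classical_sets.
From mathcomp Require Import boolp.
From mathcomp Require finmap.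
From mathcomp.multinomials Require monalg.
From mathcomp.multinomials Require Import mpoly.
From mathcomp Require Import ring.

Set Implicit Arguments.
Unset Strict Implicit.
Unset Printing Implicit Defensive.

Import GRing.Theory.
Local Open Scope quotient_scope.
Local Open Scope ring_scope.

(* The Calabi-Yau property enters through [Ext^1_{A^e}(A, A^e) = 0]: every
   derivation of [A(w)] into [A (x) A] is inner, and therefore the syzygies of the
   relations [w_j] over the free algebra are generated by the evident ones and the
   cyclic one coming from [w]. It follows that [z] is regular in
   [S<x>[z] / (w_j - c_j z)], so that over the chart [c_i <> 0] the algebra [E] has
   the basis [u z^r], where [z = w_i / c_i] and [u] runs over the normal words of
   [A(w)]. Hence over an affine [U = Spec R] the sheaf [D] corresponds to a graded
   [R]-algebra [B] whose components are flat, and [Gr(D_U)] is the category of graded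
   [B]-modules.

   A graded [B]-module [M] embeds into a module [M'] of characters with values in
   [Q/Z] coinduced from the integers. Given a resolution [P] of an [R]-module and a
   cocycle [P_(i+1) -> Hom(c, M')], the flatness of [B] and the divisibility of [Q/Z]
   extend it to [P_i] elementwise; as [P_i] is finitely generated, it becomes a
   coboundary after pulling back along an epimorphism [c' -> c].

   The objects of the largest Serre subcategory contained in [Tors] are the modules
   whose homogeneous elements have annihilators [I] such that the fibers of [B / (I : b)]
   are finite dimensional for all homogeneous [b]. These ideals form a Gabriel
   topology, from which the quotient category gets a two-sided calculus of fractions.
   It is therefore abelian, and since the projective modules [P_i] are finitely
   generated, a cocycle in the quotient category has a common denominator and lifts to
   a cocycle in [Gr(D_U)]. *)

(** * Free algebras *)

(** Syzygies are tested against arbitrary abelian groups: that a kernel is generated by given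
    elements is expressed by saying that every family of biadditive maps [theta_j] respecting these
    generators vanishes on the kernel. No tensor product over the free algebra has to be built. The
    cyclic symmetry of [w] allows the two marked letters of a cyclic word to be exchanged, which
    turns a relation between the [w_j] into a derivation of [A(w)]. What innerness leaves over is a
    sum of products of two elements of the ideal, which the weak algorithm controls. Affineness of
    [U] enters mostly in one form: the functions after multiplication by which a statement holds
    form an ideal, and this ideal contains a power of any [f] whose nonvanishing locus is covered by
    those of its members. Flatness is reduced to a statement about cocycles with values in morphisms
    because [QGr] is given by generators and relations, with no injective objects at hand; that
    statement speaks only of monomorphisms, epimorphisms and finitely many values, all of which pass
    to the localization. *)

Section CstScale.
Variables (K : nmodType) (B : pzRingType) (cst : {additive K -> B}) (b : B).
Definition cst_scale (c : K) : B := cst c * b.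
Fact cst_scale_is_nmod_morphism : nmod_morphism cst_scale.
Proof. by split=> [|c c']; rewrite /cst_scale ?raddf0 ?mul0r // raddfD mulrDl. Qed.
HB.instance Definition _ :=
  GRing.isNmodMorphism.Build K B cst_scale cst_scale_is_nmod_morphism.
End CstScale.

(* An abstract interface to [free_alg]: on the concrete ring, unification
   unfolds the products and does not terminate in reasonable time. *)
Record falg (K : comNzRingType) (I : choiceType) := Falg {
  fcar :> nzRingType;
  fcst : {rmorphism K -> fcar};
  fword : seq I -> fcar;
  fcoef : seq I -> fcar -> K;
  fsupp : fcar -> seq (seq I);
  fcstC : forall c t, fcst c * t = t * fcst c;
  fword0 : fword [::] = 1;
  fwordM : forall s t, fword (s ++ t) = fword s * fword t;
  fcoefB : forall u, zmod_morphism (fcoef u);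
  fcoefE : forall c s u, fcoef u (fcst c * fword s) = if s == u then c else 0;
  fsupp_uniq : forall t, uniq (fsupp t);
  fsuppP : forall t u, (u \in fsupp t) = (fcoef u t != 0);
  fsum : forall t, t = \sum_(u <- fsupp t) fcst (fcoef u t) * fword u
}.

Section MalgFalg.
Import finmap monalg.
Variables (K : comNzRingType) (I : choiceType).
Local Notation T := (free_alg K I).

Let cw c s : free_cst c * word K s = << c *g FMonom s >>%R :> T.
Proof. by rewrite /free_cst /= malgM_def fgmulUU mulr1 mul1m. Qed.

Let coef (u : seq I) (t : T) : K := monalg.mcoeff (FMonom u) t.
Let supp (t : T) := [seq fmonom_val u | u <- monalg.msupp t].

Let w0 : word K [::] = 1 :> T.
Proof. by rewrite /word -fmoneE. Qed.
Let wM s t : word K (s ++ t) = word K s * word K t :> T.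
Proof. by rewrite /word malgM_def fgmulUU mulr1 -(fmmulE (FMonom s) (FMonom t)). Qed.
Let coefB u : zmod_morphism (coef u).
Proof. by move=> a b; rewrite /coef mcoeffB. Qed.
Let coefE c s u : coef u (free_cst c * word K s) = if s == u then c else 0.
Proof.
rewrite /coef cw mcoeffU.
by rewrite (_ : (FMonom s == FMonom u) = (s == u)) ?fmP //; case: eqP.
Qed.
Let supp_uniq t : uniq (supp t).
Proof. by rewrite map_inj_uniq ?fset_uniq // => -[u] [v] /= ->. Qed.
Let suppP t u : (u \in supp t) = (coef u t != 0).
Proof.
rewrite mcoeff_neq0; apply/mapP/idP => [[[v] /= ? ->]//|ut].
by exists (FMonom u).
Qed.
Let sumE t : t = \sum_(u <- supp t) free_cst (coef u t) * word K u.
Proof.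
rewrite {1}(monalgE t) big_map; apply: eq_bigr => -[u] _ /=.
by rewrite cw.
Qed.

Definition malg_falg : falg K I :=
  Falg (@free_cstC K I) w0 wM coefB coefE supp_uniq suppP sumE.

End MalgFalg.

Section FreeAlgebraTheory.
Variables (K : comNzRingType) (I : choiceType) (T : falg K I).
Local Notation cst := (fcst T).
Local Notation word := (fword T).

HB.instance Definition _ u :=
  GRing.isZmodMorphism.Build T K (fcoef u) (@fcoefB K I T u).

Lemma cwordM c c' s s' :
  (cst c * word s) * (cst c' * word s') = cst (c * c') * word (s ++ s').
Proof. by rewrite rmorphM fwordM -!mulrA; congr (_ * _); rewrite !mulrA fcstC. Qed.

Lemma free_ind (P : T -> Prop) : P 0 -> (forall a b, P a -> P b -> P (a + b)) ->
  (forall c s, P (cst c * word s)) -> forall t, P t.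
Proof.
move=> P0 PD PM t; rewrite (fsum t).
elim: (X in \sum_(k <- X) _) => [|u l IH]; first by rewrite big_nil.
by rewrite big_cons; apply: PD.
Qed.

Section Zlext.
Variables (Z : zmodType) (h : seq I -> {additive K -> Z}).

(* [h s c] is the image of [c s], for [c] in [K] and a word [s]. *)
Definition zlext (t : T) : Z := \sum_(u <- fsupp t) h u (fcoef u t).

Lemma zlextEw (t : T) (d : seq (seq I)) : uniq d -> {subset fsupp t <= d} ->
  zlext t = \sum_(u <- d) h u (fcoef u t).
Proof.
move=> ud le; rewrite /zlext [RHS](bigID (fun u => u \in fsupp t)) /= [X in _ = _ + X]big1.
  rewrite addr0 -[RHS]big_filter; apply: perm_big; apply: uniq_perm.
  - exact: fsupp_uniq.
  - exact: filter_uniq.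
  - by move=> u; rewrite mem_filter; case: (boolP (u \in fsupp t)) => // /le ->.
by move=> u; rewrite fsuppP negbK => /eqP ->; rewrite raddf0.
Qed.

Fact zlext_is_zmod_morphism : zmod_morphism zlext.
Proof.
move=> a b; pose d := undup (fsupp a ++ fsupp b ++ fsupp (a - b)).
have ud : uniq d by exact: undup_uniq.
rewrite !(zlextEw ud).
- by rewrite -sumrB; apply: eq_bigr => u _; rewrite !raddfB.
all: by move=> u hu; rewrite mem_undup !mem_cat hu ?orbT.
Qed.
HB.instance Definition _ :=
  GRing.isZmodMorphism.Build T Z zlext zlext_is_zmod_morphism.

Lemma zlextE c s : zlext (cst c * word s) = h s c.
Proof.
rewrite (@zlextEw _ [:: s]) //; first by rewrite big_seq1 fcoefE eqxx.
move=> u; rewrite fsuppP fcoefE inE; case: (s =P u) => [->|_]; first by rewrite eqxx.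
by rewrite eqxx.
Qed.

End Zlext.

Definition whomog (d : nat) (t : T) : Prop := forall u, fcoef u t != 0 -> size u = d.

Lemma whomog_ind d (P : T -> Prop) : P 0 -> (forall a b, P a -> P b -> P (a + b)) ->
  (forall c s, size s = d -> P (cst c * word s)) -> forall t, whomog d t -> P t.
Proof.
move=> P0 PD PM t ht; rewrite (fsum t) big_seq.
by elim/big_rec: _ => // u a; rewrite fsuppP => /ht su Pa; apply/PD/Pa/PM.
Qed.

Lemma whomog_word c s : whomog (size s) (cst c * word s).
Proof. by move=> u; rewrite fcoefE; case: (s =P u) => [->|_] //; rewrite eqxx. Qed.

Lemma whomogB d a b : whomog d a -> whomog d b -> whomog d (a - b).
Proof.
move=> ha hb u; rewrite fcoefB => hu.
have [e|/ha//] := eqVneq (fcoef u a) 0; apply: hb.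
by apply: contraNneq hu => e'; rewrite e e' subr0.
Qed.

Lemma whomog0 d : whomog d 0.
Proof. by move=> u; rewrite raddf0 eqxx. Qed.

Lemma whomogD d a b : whomog d a -> whomog d b -> whomog d (a + b).
Proof.
move=> ha hb; rewrite -[b]opprK; apply: whomogB => //.
by rewrite -sub0r; apply: whomogB => //; exact: whomog0.
Qed.

Lemma whomogM d e a b : whomog d a -> whomog e b -> whomog (d + e) (a * b).
Proof.
move=> ha hb; move: a ha; apply: whomog_ind => [|a a' ea ea'|c s <-].
- by rewrite mul0r; exact: whomog0.
- by rewrite mulrDl; exact: whomogD.
move: b hb; apply: whomog_ind => [|b b' eb eb'|c' s' <-].
- by rewrite mulr0; exact: whomog0.
- by rewrite mulrDr; exact: whomogD.
by rewrite cwordM -size_cat; exact: whomog_word.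
Qed.

(* The right quotient by [u]: words [v u] go to [v], the other ones to [0]. *)
Definition strip_word (u v : seq I) : T :=
  if suffix u v then word (take (size v - size u) v) else 0.
Definition strip (u : seq I) : {additive T -> T} :=
  zlext (fun v => cst_scale cst (strip_word u v)).

Lemma stripE u c s : strip u (cst c * word s) = cst c * strip_word u s.
Proof. exact: zlextE. Qed.

Lemma strip_homog u d t : whomog d t -> whomog (d - size u) (strip u t).
Proof.
move: t; apply: whomog_ind => [|a b ha hb|c s hs].
- by rewrite raddf0; exact: whomog0.
- by rewrite raddfD; exact: whomogD.
rewrite stripE /strip_word; case: ifP => [us|_]; last by rewrite mulr0; exact: whomog0.
have := @whomog_word c (take (size s - size u) s).
by rewrite size_takel ?leq_subr // hs.
Qed.

(** All words of [b] are at least as long as [u], so whether a word of [a * b] ends in [u] is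
    decided inside the factor [b]. *)
Lemma strip_mul u d a b : whomog d b -> (size u <= d)%N ->
  strip u (a * b) = a * strip u b.
Proof.
move=> hb le; move: b hb; apply: whomog_ind => [|b b' eb eb'|c s hs].
- by rewrite mulr0 !raddf0 mulr0.
- by rewrite mulrDr !raddfD mulrDr eb eb'.
move: a; apply: free_ind => [|a a' ea ea'|c' s'].
- by rewrite mul0r raddf0 mul0r.
- by rewrite mulrDl raddfD mulrDl ea ea'.
rewrite cwordM !stripE.
have suf : suffix u (s' ++ s) = suffix u s.
  rewrite !suffixE size_cat drop_cat -addnBA hs // ifN; last by rewrite -leqNgt leq_addr.
  by rewrite addKn.
rewrite /strip_word suf; case: ifP => _; last by rewrite !mulr0.
rewrite size_cat take_cat -addnBA hs // ifN; last by rewrite -leqNgt leq_addr.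
by rewrite addKn cwordM.
Qed.

Lemma strip_top u t : whomog (size u) t -> strip u t = cst (fcoef u t).
Proof.
move: t; apply: whomog_ind => [|a b ea eb|c s hs].
- by rewrite !raddf0.
- by rewrite !raddfD ea eb.
rewrite stripE fcoefE /strip_word suffixE hs subnn drop0.
by case: eqP => _; rewrite ?mulr0 ?raddf0 // take0 fword0 mulr1.
Qed.

End FreeAlgebraTheory.

(** * Relations between products in a free algebra *)

Section WeakAlgorithm.
Variables (k : fieldType) (I : choiceType) (T : falg k I) (Z : zmodType).
Variables (J : T -> Prop) (beta : T -> T -> Z).
Hypothesis JD : forall a b, J a -> J b -> J (a + b).
Hypothesis JMl : forall c a, J a -> J (c * a).
Hypothesis JMr : forall c a, J a -> J (a * c).
Hypothesis betaDl : forall a a' b, J a -> J a' -> J b ->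
  beta (a + a') b = beta a b + beta a' b.
Hypothesis betaDr : forall a b b', J a -> J b -> J b' ->
  beta a (b + b') = beta a b + beta a b'.
Hypothesis beta_bal : forall a t b, J a -> J b -> beta (a * t) b = beta a (t * b).

(* This is the injectivity of the product on [J (x)_T J], by Cohn's weak
   algorithm: if [sum a b = 0] then stripping a word [u] of a [b] of minimal
   degree writes the corresponding [a] as a right combination of the others. *)
Lemma weak_algorithm (L : seq (T * T)) :
  (forall p, p \in L -> [/\ J p.1, J p.2 & exists d, whomog d p.2]) ->
  \sum_(p <- L) p.1 * p.2 = 0 -> \sum_(p <- L) beta p.1 p.2 = 0.
Proof.
have [m] := ubnP (size L); elim: m L => // m IH L sL JL e0.
have [z|] := boolP (all (fun p => p.2 == 0) L).
  rewrite big_seq big1 // => p pL; have [Jp1 Jp2 _] := JL p pL.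
  move/allP: z => /(_ p pL)/eqP e; rewrite e in Jp2 *.
  by apply: (@addrI _ (beta p.1 0)); rewrite -betaDr // !addr0.
case/allPn => p0 p0L p0nz.
(* Pick [p] with [p.2] nonzero of least degree [e], and a word [u] of [p.2]: stripping [u] from
   [q.1 * q.2] then acts on [q.2] alone for every [q]. *)
pose Q d := `[< exists2 p, p \in L & p.2 != 0 /\ whomog d p.2 >].
have exQ : exists d, Q d.
  have [_ _ [d hd]] := JL _ p0L; exists d; apply/asboolP; by exists p0.
case: (ex_minnP exQ) => e /asboolP[p pL [pnz hp]] emin {p0 p0L p0nz exQ}.
have [u uP] : exists u, fcoef u p.2 != 0.
  apply/not_existsP => h; case/eqP: pnz; rewrite (fsum p.2) big1_seq // => u.
  by rewrite fsuppP => /h.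
have su : size u = e by exact: hp.
set l := fcoef u p.2 in uP.
have {}emin q : q \in L -> exists d, [/\ whomog d q.2 & (e <= d)%N \/ q.2 = 0].
  move=> qL; have [_ _ [d hd]] := JL q qL; exists d; split=> //.
  have [->|nz] := eqVneq q.2 0; [by right|left].
  by apply: emin; apply/asboolP; exists q.
have strq q : q \in L -> strip T u (q.1 * q.2) = q.1 * strip T u q.2.
  move=> /emin[d [hd [le|->]]]; last by rewrite mulr0 !raddf0 mulr0.
  by apply: strip_mul hd _; rewrite su.
have [L1 [L2 eL]] : exists L1 L2, L = L1 ++ p :: L2.
  by case/splitPr: pL => L1 L2; exists L1, L2.
(* Stripping [u] from the relation expresses [p.1] through the other first factors, with right
   coefficients [t q]. Balancedness moves these coefficients onto [p.2], so replacing [q.2] by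
   [q.2 - t q * p.2] removes [p] from the list without changing either sum. *)
pose t (q : T * T) := fcst T l^-1 * strip T u q.2 : T.
pose q' (q : T * T) := (q.1, q.2 - t q * p.2).
have LL q : q \in L1 ++ L2 -> q \in L.
  by rewrite eL !mem_cat inE => /orP[->|->]; rewrite ?orbT.
have sumL (F : T * T -> Z) : \sum_(q <- L) F q = F p + \sum_(q <- L1 ++ L2) F q.
  by rewrite eL !big_cat big_cons /= addrCA.
have sumT (F : T * T -> T) : \sum_(q <- L) F q = F p + \sum_(q <- L1 ++ L2) F q.
  by rewrite eL !big_cat big_cons /= addrCA.
have [Jp1 Jp2 _] := JL p pL.
have J0 : J 0 by rewrite -(mul0r p.2); exact: JMl.
have ep : p.1 = - \sum_(q <- L1 ++ L2) q.1 * t q.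
  have := congr1 (strip T u) e0; rewrite raddf_sum raddf0 big_seq.
  under eq_bigr => q qL do rewrite strq //.
  rewrite -big_seq sumT strip_top ?su // -fcstC => /(congr1 (fun x => fcst T l^-1 * x)).
  rewrite mulr0 mulrDr mulrA -rmorphM mulVf // rmorph1 mul1r => /eqP.
  rewrite addr_eq0 => /eqP ->; rewrite mulr_sumr; congr (- _).
  by apply: eq_bigr => q _; rewrite /t !mulrA fcstC.
have Jt q : J (t q * p.2) by apply: JMl.
have JN a : J a -> J (- a) by rewrite -mulN1r; exact: JMl.
have bN a b : J a -> J b -> beta (- a) b = - beta a b.
  by move=> Ja Jb; apply: (@addrI _ (beta a b)); rewrite -betaDl ?subrr //;
    [apply: (@addrI _ (beta 0 b)); rewrite -betaDl // !addr0|exact: JN].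
have bNr a b : J a -> J b -> beta a (- b) = - beta a b.
  by move=> Ja Jb; rewrite -mulN1r -beta_bal // mulrN1 bN.
have bp : beta p.1 p.2 = - \sum_(q <- L1 ++ L2) beta q.1 (t q * p.2).
  have h M : (forall q, q \in M -> J q.1) -> J (\sum_(q <- M) q.1 * t q) /\
      beta (\sum_(q <- M) q.1 * t q) p.2 = \sum_(q <- M) beta q.1 (t q * p.2).
    elim: M => [|q M IHM] JM.
      rewrite !big_nil; split=> //; apply: (@addrI _ (beta 0 p.2)).
      by rewrite -betaDl // !addr0.
    have [|J' e'] := IHM; first by move=> r rM; apply: JM; rewrite inE rM orbT.
    have Jq : J q.1 by apply: JM; rewrite inE eqxx.
    rewrite !big_cons betaDl // ?e' ?beta_bal //; last by exact: JMr.
    by split=> //; apply: JD => //; exact: JMr.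
  have [|Js es] := h (L1 ++ L2); first by move=> q /LL/JL[].
  by rewrite ep bN // es.
rewrite sumL bp addrC -sumrB.
have := IH [seq q' q | q <- L1 ++ L2].
rewrite !big_map => IHL; apply: etrans (IHL _ _ _).
- rewrite [LHS]big_seq [RHS]big_seq /=; apply: eq_bigr => q /LL/JL[Jq1 Jq2 _].
  by rewrite /q' /= betaDr ?bNr //; exact: JN.
- rewrite size_map; move: sL; rewrite eL !size_cat /= addnS ltnS => le.
  exact: le.
- move=> _ /mapP[q /LL qL ->] /=; have [Jq1 Jq2 _] := JL q qL; split=> //.
    by apply: JD => //; exact: JN.
  have [d [hd le]] := emin q qL; exists d; apply: whomogB => //.
  case: le => [le|e2]; last by rewrite /t e2 raddf0 mulr0 mul0r; exact: whomog0.
  rewrite -(subnK le) -{2}su; apply: whomogM; last by rewrite su.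
  rewrite -[(d - e)%N]add0n; apply: whomogM.
    rewrite -[fcst T _]mulr1 -fword0; exact: whomog_word.
  by rewrite -su; exact: strip_homog.
under eq_bigr => q _ do rewrite /q' /= mulrBr mulrA.
rewrite sumrB -mulr_suml -[X in _ - X * _]opprK -ep mulNr opprK addrC.
by rewrite -sumT.
Qed.

End WeakAlgorithm.

(** * The enveloping algebra and derivations *)

Section QuotientExt.
Variables (K : comNzRingType) (I : choiceType) (T : falg K I) (G : T -> Prop).
Variables (Z : zmodType) (h : seq I -> {additive K -> Z}).
Hypothesis h0 : forall c s g t, G g ->
  zlext (T := T) h (fcst T c * fword T s * g * fword T t) = 0.

Lemma zlext_ideal a : two_sided_ideal G a -> zlext h a = 0.
Proof.
elim=> [|{}a b _ ea _ eb|{}a g b Gg]; first exact: raddf0.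
  by rewrite raddfD /= ea eb addr0.
move: b; apply: free_ind => [|b b' eb eb'|c s].
- by rewrite mulr0 raddf0.
- by rewrite mulrDr raddfD /= eb eb' addr0.
move: a; apply: free_ind => [|a a' ea ea'|c' s'].
- by rewrite !mul0r raddf0.
- by rewrite !mulrDl raddfD /= ea ea' addr0.
rewrite mulrA -(fcstC c (_ * _ * g)) !mulrA -rmorphM; exact: h0.
Qed.

Definition qext (x : quot_ring G) : Z := zlext h (repr x).

Lemma qextE a : qext (quot_pi G a) = zlext h a.
Proof.
apply/eqP; rewrite -subr_eq0 -raddfB; apply/eqP/zlext_ideal; exact: quot_repr.
Qed.

Fact qext_is_zmod_morphism : zmod_morphism qext.
Proof.
move=> x y; have [a ->] := quot_pi_surj x; have [b ->] := quot_pi_surj y.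
by rewrite -raddfB !qextE raddfB.
Qed.

End QuotientExt.

(* Same content as [env_relations], for an abstract free algebra. *)
Inductive envrel (k : comNzRingType) (A : pzRingType) (cst : k -> A)
    (F : falg k (A + A)%type) : F -> Prop :=
| er_lD a b : envrel cst (fword F [:: inl (a + b)] - (fword F [:: inl a] + fword F [:: inl b]))
| er_lM a b : envrel cst (fword F [:: inl (a * b)] - fword F [:: inl a] * fword F [:: inl b])
| er_lC c : envrel cst (fword F [:: inl (cst c)] - fcst F c)
| er_rD a b : envrel cst (fword F [:: inr (a + b)] - (fword F [:: inr a] + fword F [:: inr b]))
| er_rM a b : envrel cst (fword F [:: inr (a * b)] - fword F [:: inr b] * fword F [:: inr a])
| er_rC c : envrel cst (fword F [:: inr (cst c)] - fcst F c)
| er_lr a b : envrel cst (fword F [:: inl a] * fword F [:: inr b] - fword F [:: inr b] * fword F [:: inl a]).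

(** By the universal property of the tensor product over [k], these are the additive maps from
    [A (x) A] to a mere abelian group [Z]. *)
Record balanced (k : comNzRingType) (A : pzRingType) (cst : k -> A)
    (Z : zmodType) := Balanced {
  bmu :> A -> A -> Z;
  bmuDl : forall a a' b, bmu (a + a') b = bmu a b + bmu a' b;
  bmuDr : forall a b b', bmu a (b + b') = bmu a b + bmu a b';
  bmuC : forall c a b, bmu (cst c * a) b = bmu a (cst c * b)
}.

Section Env.
Variables (k : comNzRingType) (A : pzRingType) (cst : {rmorphism k -> A}).
Hypothesis cstC : forall c a, cst c * a = a * cst c.
Variables (F : falg k (A + A)%type) (G : F -> Prop).
Hypothesis GE : forall g, G g <-> envrel cst g.
Local Notation Q := (quot_ring G).
Local Notation pi := (quot_pi G).
Local Notation W := (fword F).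

Definition qel (a : A) : Q := pi (W [:: inl a]).
Definition qer (a : A) : Q := pi (W [:: inr a]).

Lemma pi_rel a b : G (a - b) -> pi a = pi b.
Proof.
by move=> Gab; apply/quot_piP; rewrite -[_ - _]mul1r -[_ * _]mulr1; exact: tsiM.
Qed.

Lemma qelD a b : qel (a + b) = qel a + qel b.
Proof. by rewrite /qel -raddfD; apply/pi_rel/GE/er_lD. Qed.
Lemma qelM a b : qel (a * b) = qel a * qel b.
Proof. by rewrite /qel -rmorphM; apply/pi_rel/GE/er_lM. Qed.
Lemma qerD a b : qer (a + b) = qer a + qer b.
Proof. by rewrite /qer -raddfD; apply/pi_rel/GE/er_rD. Qed.
Lemma qerM a b : qer (a * b) = qer b * qer a.
Proof. by rewrite /qer -rmorphM; apply/pi_rel/GE/er_rM. Qed.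
Lemma qelr a b : qel a * qer b = qer b * qel a.
Proof. by rewrite /qel /qer -!rmorphM; apply/pi_rel/GE/er_lr. Qed.
Lemma qelC c : qel (cst c) = pi (fcst F c).
Proof. by apply/pi_rel/GE/er_lC. Qed.
Lemma qerC c : qer (cst c) = pi (fcst F c).
Proof. by apply/pi_rel/GE/er_rC. Qed.
Lemma qel1 : qel 1 = 1.
Proof. by rewrite -(rmorph1 cst) qelC !rmorph1. Qed.
Lemma qer1 : qer 1 = 1.
Proof. by rewrite -(rmorph1 cst) qerC !rmorph1. Qed.

(** Normal form of a word in the enveloping algebra: letters of the two kinds commute, so the left
    ones multiply in order to [pL s], and the right ones, living in the opposite algebra, in reverse
    order to [pR s]. *)
Fixpoint pL (s : seq (A + A)) : A :=
  match s with [::] => 1 | inl a :: s' => a * pL s' | inr _ :: s' => pL s' end.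
Fixpoint pR (s : seq (A + A)) : A :=
  match s with [::] => 1 | inl _ :: s' => pR s' | inr a :: s' => pR s' * a end.

Lemma pL_cat s t : pL (s ++ t) = pL s * pL t.
Proof. by elim: s => [|[a|a] s IH] /=; rewrite ?mul1r // IH mulrA. Qed.
Lemma pR_cat s t : pR (s ++ t) = pR t * pR s.
Proof. by elim: s => [|[a|a] s IH] /=; rewrite ?mulr1 // IH mulrA. Qed.

Lemma pi_word c s : pi (fcst F c * W s) = qel (cst c * pL s) * qer (pR s).
Proof.
rewrite rmorphM /= -qelC qelM -mulrA; congr (_ * _).
elim: s => [|[a|a] s IH] /=; first by rewrite fword0 qel1 qer1 mulr1 rmorph1.
  by rewrite -cat1s fwordM rmorphM /= IH qelM mulrA.
by rewrite -cat1s fwordM rmorphM /= IH qerM !mulrA qelr.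
Qed.

Lemma qenv_ind (P : Q -> Prop) : P 0 -> (forall x y, P x -> P y -> P (x + y)) ->
  (forall a b, P (qel a * qer b)) -> forall x, P x.
Proof.
move=> P0 PD PM x; have [t ->] := quot_pi_surj x; move: t.
apply: free_ind => [|a b Pa Pb|c s]; first by rewrite rmorph0.
  by rewrite rmorphD; exact: PD.
by rewrite pi_word.
Qed.



Section BalancedExt.
Variables (Z : zmodType) (mu : balanced cst Z).

Definition bal_cst (s : seq (A + A)) (c : k) : Z := mu (cst c * pL s) (pR s).
Fact bal_cst_additive s : nmod_morphism (bal_cst s).
Proof.
split=> [|c c']; rewrite /bal_cst.
  by rewrite rmorph0 mul0r; apply: (@addrI _ (mu 0 (pR s))); rewrite -bmuDl !addr0.
by rewrite rmorphD mulrDl bmuDl.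
Qed.
HB.instance Definition _ s :=
  GRing.isNmodMorphism.Build k Z (bal_cst s) (bal_cst_additive s).

Lemma bal_cst0 c s g t : G g ->
  zlext (T := F) bal_cst (fcst F c * W s * g * W t) = 0.
Proof.
have zw v : zlext (T := F) bal_cst (fcst F c * W s * W v * W t) =
    mu (cst c * pL s * pL v * pL t) (pR t * pR v * pR s).
  have c1 s' : W s' = fcst F 1 * W s' by rewrite rmorph1 mul1r.
  rewrite [W v]c1 [W t]c1 !cwordM zlextE /= /bal_cst !mulr1.
  by rewrite !(pL_cat, pR_cat) !mulrA.
have zc d : zlext (T := F) bal_cst (fcst F c * W s * fcst F d * W t) =
    mu (cst c * pL s * cst d * pL t) (pR t * pR s).
  rewrite -(fcstC d) mulrA -rmorphM -mulrA -fwordM zlextE /= /bal_cst.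
  by rewrite !(pL_cat, pR_cat) rmorphM !mulrA -cstC -!mulrA; congr (mu (_ * _) _); rewrite !mulrA cstC.
have w2 x y : W [:: x; y] = W [:: x] * W [:: y] by rewrite -fwordM.
move=> /GE[a b|a b|d|a b|a b|d|a b];
  rewrite -?w2 mulrBr mulrBl raddfB /= ?mulrDr ?mulrDl ?raddfD /= ?zw ?zc /= ?mulr1 ?mul1r.
- by rewrite mulrDr mulrDl bmuDl -opprD subrr.
- by rewrite subrr.
- by rewrite subrr.
- by rewrite mulrDr mulrDl bmuDr -opprD subrr.
- by rewrite subrr.
- have -> : pR t * cst d * pR s = cst d * (pR t * pR s) by rewrite -cstC mulrA.
  have -> : cst c * pL s * cst d * pL t = cst d * (cst c * pL s * pL t).
    by rewrite -[_ * cst d]cstC !mulrA.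
  by rewrite bmuC subrr.
- exact: subrr.
Qed.

Definition qbal_ext : Q -> Z := qext (G := G) bal_cst.
HB.instance Definition _ := GRing.isZmodMorphism.Build Q Z qbal_ext
  (qext_is_zmod_morphism bal_cst0).

Lemma qbal_extE a b : qbal_ext (qel a * qer b) = mu a b.
Proof.
rewrite /qbal_ext /qel /qer -rmorphM -fwordM qextE; last exact: bal_cst0.
rewrite -[fword _ _]mul1r -(rmorph1 (fcst F)) zlextE /= /bal_cst /=.
by rewrite rmorph1 !(mul1r, mulr1).
Qed.

Lemma qbal_extD : {morph qbal_ext : x y / x + y}.
Proof. by move=> x y; rewrite raddfD. Qed.

End BalancedExt.
End Env.

(* The universal property of [A (x) A^op]; the results below are stated for it
   because conversion is slow on the concrete quotient ring. *)
Record envalg (k : comNzRingType) (A : pzRingType) (cst : k -> A) := Envalg {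
  ecar :> pzRingType;
  einl : A -> ecar;
  einr : A -> ecar;
  elD : forall a b, einl (a + b) = einl a + einl b;
  elM : forall a b, einl (a * b) = einl a * einl b;
  el1 : einl 1 = 1;
  erD : forall a b, einr (a + b) = einr a + einr b;
  erM : forall a b, einr (a * b) = einr b * einr a;
  er1 : einr 1 = 1;
  elr : forall a b, einl a * einr b = einr b * einl a;
  erC : forall c, einr (cst c) = einl (cst c);
  env_ind : forall P : ecar -> Prop, P 0 -> (forall x y, P x -> P y -> P (x + y)) ->
    (forall a b, P (einl a * einr b)) -> forall x, P x;
  bal_ext : forall Z : zmodType, balanced cst Z -> ecar -> Z;
  bal_extD : forall Z (mu : balanced cst Z), {morph bal_ext mu : x y / x + y};
  bal_extE : forall Z (mu : balanced cst Z) a b, bal_ext mu (einl a * einr b) = mu a b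
}.

Section EnvalgTheory.
Variables (k : comNzRingType) (A : pzRingType) (cst : k -> A) (E : envalg cst).

Lemma el0 : einl E 0 = 0.
Proof. by apply: (@addrI _ (einl E 0)); rewrite -elD !addr0. Qed.
Lemma er0 : einr E 0 = 0.
Proof. by apply: (@addrI _ (einr E 0)); rewrite -erD !addr0. Qed.
Lemma bal_ext0 (Z : zmodType) (mu : balanced cst Z) : bal_ext (e := E) mu 0 = 0.
Proof. by apply: (@addrI _ (bal_ext (e := E) mu 0)); rewrite -bal_extD !addr0. Qed.

End EnvalgTheory.

Section ConcreteEnv.
Variables (k : comNzRingType) (A : pzRingType) (cst : {rmorphism k -> A}).
Hypothesis cstC : forall c a, cst c * a = a * cst c.
Let F := malg_falg k (A + A)%type.
Let G : F -> Prop := env_relations cst.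

Lemma env_relationsE g : G g <-> envrel cst g.
Proof.
split=> h; case: h => [a b|a b|c|a b|a b|c|a b].
- exact: (@er_lD k A cst F).
- exact: (@er_lM k A cst F).
- exact: (@er_lC k A cst F).
- exact: (@er_rD k A cst F).
- exact: (@er_rM k A cst F).
- exact: (@er_rC k A cst F).
- exact: (@er_lr k A cst F).
- exact: env_lD.
- exact: env_lM.
- exact: env_lC.
- exact: env_rD.
- exact: env_rM.
- exact: env_rC.
- exact: env_lr.
Qed.
Local Notation GE := env_relationsE.

Definition env_envalg : envalg cst.
Proof.
apply: (@Envalg k A cst (env cst) (env_l cst) (env_r cst) _ _ _ _ _ _ _ _ _
  (fun Z mu => qbal_ext (G := G) mu)).
- exact: (qelD GE).
- exact: (qelM GE).
- exact: (qel1 GE).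
- exact: (qerD GE).
- exact: (qerM GE).
- exact: (qer1 GE).
- exact: (qelr GE).
- by move=> c; apply: (etrans (qerC GE c)); apply/esym; exact: (qelC GE c).
- exact: (qenv_ind GE).
- by move=> Z mu; exact: (qbal_extD cstC GE mu).
- by move=> Z mu; exact: (qbal_extE cstC GE mu).
Defined.

End ConcreteEnv.

(** * Bimodules as modules over the enveloping algebra, and inner derivations *)

Record bimod (k : comNzRingType) (A : pzRingType) (cst : k -> A) := Bimod {
  bcar : zmodType;
  bL : A -> bcar -> bcar;
  bR : A -> bcar -> bcar;
  bLDr : forall a x y, bL a (x + y) = bL a x + bL a y;
  bLDl : forall a b x, bL (a + b) x = bL a x + bL b x;
  bLM : forall a b x, bL (a * b) x = bL a (bL b x);
  bL1 : forall x, bL 1 x = x;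
  bRDr : forall a x y, bR a (x + y) = bR a x + bR a y;
  bRDl : forall a b x, bR (a + b) x = bR a x + bR b x;
  bRM : forall a b x, bR (a * b) x = bR b (bR a x);
  bR1 : forall x, bR 1 x = x;
  bLR : forall a b x, bL a (bR b x) = bR b (bL a x);
  bLC : forall c x, bL (cst c) x = bR (cst c) x
}.

Section EnvModule.
Variables (k : comNzRingType) (A : pzRingType) (cst : {rmorphism k -> A}).
Hypothesis cstC : forall c a, cst c * a = a * cst c.
Variable E : envalg cst.
Local Notation Q := (ecar E).
Local Notation l := (einl E).
Local Notation r := (einr E).

Section Action.
Variable M : bimod cst.

Definition bim_bal (x : bcar M) : balanced cst (bcar M).
Proof.
exists (fun a b => bL a (bR b x)) => [a a' b|a b b'|c a b].
- exact: bLDl.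
- by rewrite bRDl bLDr.
- by rewrite cstC bLM bLC -bRM cstC.
Defined.

(* The dependency on [cstC] and [E] makes the module structure canonical. *)
Definition envmod of (forall c a, cst c * a = a * cst c) & envalg cst : Type := bcar M.
Local Notation EM := (envmod cstC E).
HB.instance Definition _ := GRing.Zmodule.copy EM (bcar M).

Definition env_scale (e : Q) (x : EM) : EM := bal_ext (bim_bal x) e.

Lemma env_scaleE a b x : env_scale (l a * r b) x = bL a (bR b x).
Proof. exact: (bal_extE E (bim_bal x) a b). Qed.

Lemma env_scaleDl x : {morph env_scale^~ x : a b / a + b}.
Proof. by move=> a b; exact: (bal_extD (e := E) (bim_bal x)). Qed.

Lemma env_scale0l x : env_scale 0 x = 0.
Proof. exact: (bal_ext0 E (bim_bal x)). Qed.

Lemma env_scaleDr : right_distributive env_scale +%R.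
Proof.
move=> e x y; move: e; apply: (env_ind (e := E)) => [|e e' h h'|a b].
- by rewrite !env_scale0l addr0.
- by rewrite !env_scaleDl h h' addrACA.
- by rewrite !env_scaleE bRDr bLDr.
Qed.

Lemma env_scale1 : left_id 1 env_scale.
Proof. by move=> x; rewrite -[1]mulr1 -{1}(el1 E) -(er1 E) env_scaleE bR1 bL1. Qed.

Lemma env_scaleA e e' x : env_scale e (env_scale e' x) = env_scale (e * e') x.
Proof.
move: e'; apply: (env_ind (e := E)) => [|f f' h h'|a b].
- rewrite mulr0 env_scale0l; apply: (@addrI _ (env_scale e 0)).
  by rewrite -env_scaleDr !addr0.
- by rewrite mulrDr !env_scaleDl env_scaleDr h h'.
move: e; apply: (env_ind (e := E)) => [|f f' h h'|a' b'].
- by rewrite mul0r !env_scale0l.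
- by rewrite mulrDl !env_scaleDl h h'.
rewrite mulrA -(mulrA (l a')) -(elr E) !mulrA -(elM E) -mulrA -(erM E).
by rewrite !env_scaleE bLM bRM -(bLR a).
Qed.

HB.instance Definition _ := GRing.Zmodule_isLmodule.Build Q EM
  env_scaleA env_scale1 env_scaleDr env_scaleDl.

End Action.
Local Notation EM M := (envmod M cstC E).

Lemma envmodE (M : bimod cst) a b (x : EM M) : l a * r b *: x = bL a (bR b x) :> EM M.
Proof. exact: env_scaleE. Qed.

Definition self_bimod : bimod cst.
Proof.
apply: (@Bimod _ _ cst A (fun a x => a * x) (fun a x => x * a)).
- by move=> a x y; rewrite mulrDr.
- by move=> a b x; rewrite mulrDl.
- by move=> a b x; rewrite mulrA.
- by move=> x; rewrite mul1r.
- by move=> a x y; rewrite mulrDl.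
- by move=> a b x; rewrite mulrDr.
- by move=> a b x; rewrite mulrA.
- by move=> x; rewrite mulr1.
- by move=> a b x; rewrite mulrA.
- by move=> c x; exact: cstC.
Defined.

Section Derivation.
Variable dl : A -> Q.
Hypothesis dlD : forall a b, dl (a + b) = dl a + dl b.
Hypothesis dlM : forall a b, dl (a * b) = l a * dl b + r b * dl a.
Hypothesis dlC : forall c, dl (cst c) = 0.

Lemma lr_rl a b (x : Q) : l a * (r b * x) = r b * (l a * x).
Proof. by rewrite mulrA (elr E) mulrA. Qed.

(* The extension of [A] by [A (x) A] whose splittings are the elements [v] such
   that the derivation is the commutator with [v]. *)
Definition der_bimod : bimod cst.
Proof.
apply: (@Bimod _ _ cst (Q * A)%type
  (fun a x => (l a * x.1 + r x.2 * dl a, a * x.2))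
  (fun a x => (r a * x.1, x.2 * a))) => /=.
- move=> a [x x'] [y y'] /=; congr (_, _); last by rewrite mulrDr.
  by rewrite mulrDr (erD E) mulrDl addrACA.
- move=> a b [x x'] /=; congr (_, _); last by rewrite mulrDl.
  by rewrite (elD E) mulrDl dlD mulrDr addrACA.
- move=> a b [x x'] /=; congr (_, _); last by rewrite mulrA.
  rewrite (elM E) dlM (erM E) !mulrDr addrA; congr (_ + _ + _).
  - by rewrite mulrA.
  - by rewrite lr_rl.
  - by rewrite mulrA.
- move=> [x x'] /=; rewrite (el1 E) !mul1r -(rmorph1 cst) dlC.
  by rewrite mulr0 addr0.
- by move=> a [x x'] [y y'] /=; rewrite mulrDr mulrDl.
- by move=> a b [x x'] /=; rewrite (erD E) mulrDl mulrDr.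
- by move=> a b [x x'] /=; rewrite (erM E) !mulrA.
- by move=> [x x'] /=; rewrite (er1 E) mul1r mulr1.
- move=> a b [x x'] /=; congr (_, _); last by rewrite mulrA.
  by rewrite (erM E) mulrDr lr_rl !mulrA.
- move=> c [x x'] /=; rewrite dlC mulr0 addr0 -(erC E).
  by rewrite cstC.
Defined.

Variables (P : resolution Q) (eps : {additive P 0%N -> A}).
Hypothesis eps_act : forall a b x, eps (l a * r b *: x) = a * eps x * b.
Hypothesis eps_res : resolves eps.
Hypothesis ext1 : forall f : P 1%N -> Q, cocycle f -> coboundary f.

(** The augmentation lifts to [l0] from [P 0] into the extension [der_bimod]. On boundaries its
    first component is a 1-cocycle, hence equal to some [f0] composed with the differential. For [p]
    over [1], the element [l a *: p - r a *: p] is a boundary, and comparing the two formulas there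
    gives [v = (l0 p).1 - f0 p]. *)
Lemma derivation_inner : exists v, forall a, dl a = r a * v - l a * v.
Proof.
pose h (x : P 0%N) : EM self_bimod := eps x.
have h_lin : linear h.
  move=> e x y; rewrite /h raddfD; congr (_ + _); move: e.
  apply: (env_ind (e := E)) => [|e e' ee ee'|a b].
  - by rewrite !scale0r raddf0.
  - by rewrite !scalerDl raddfD ee ee'.
  - by rewrite eps_act envmodE /= mulrA.
pose hL := GRing.isLinear.Build Q _ _ _ h h_lin.
pose h' : {linear P 0%N -> EM self_bimod} := HB.pack h hL.
pose g (x : EM der_bimod) : EM self_bimod := x.2.
have g_lin : linear g.
  move=> e x y; rewrite /g; congr (_ + _); move: e.
  apply: (env_ind (e := E)) => [|e e' ee ee'|a b].
  - by rewrite !scale0r.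
  - by rewrite !scalerDl /= ee ee'.
  - by rewrite !envmodE /=.
pose gL := GRing.isLinear.Build Q _ _ _ g g_lin.
pose g' : {linear EM der_bimod -> EM self_bimod} := HB.pack g gL.
have [|l0 l0P] := @rmod_proj _ P 0%N _ _ g' h'.
  by move=> y; exists (0, y).
(* The first projection is linear only on the submodule with second component [0], which contains
   the images of boundaries. *)
have fst_act e (x : EM der_bimod) : x.2 = 0 -> (e *: x).1 = e * x.1.
  move=> x2; move: e; apply: (env_ind (e := E)) => [|e e' ee ee'|a b].
  - by rewrite scale0r mul0r.
  - by rewrite scalerDl mulrDl /= ee ee'.
  - by rewrite envmodE /= x2 mul0r er0 mul0r addr0 mulrA.
have [eps_surj eps_ker] := eps_res.
have l02 x : (l0 x).2 = eps x by exact: l0P.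
have epsd y : eps (rmap P 0 y) = 0 by apply/eps_ker; exists y.
pose f (y : P 1%N) : Q := (l0 (rmap P 0 y)).1.
have [|f0 [f0_hom ef0]] := ext1 (f := f).
  split=> [b x y|x].
    rewrite /f !linearP /=; congr (_ + _); apply: fst_act.
    by rewrite l02 epsd.
  rewrite /f (_ : rmap P 0 _ = 0) ?raddf0 //.
  by apply/rmap_exact; exists x.
have [p ep] := eps_surj 1.
exists ((l0 p).1 - f0 p) => a.
have l1 : l a = l a * r 1 by rewrite (er1 E) mulr1.
have r1 : r a = l 1 * r a by rewrite (el1 E) mul1r.
have [y ey] : exists y, l a *: p - r a *: p = rmap P 0 y.
  apply/eps_ker; rewrite raddfB /= l1 r1 !eps_act ep.
  by rewrite !mulr1 mul1r subrr.
have := ef0 y; rewrite /f -ey.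
have f0B b b' x : f0 (b *: x - b' *: x) = b * f0 x - b' * f0 x.
  have f00 : f0 0 = 0.
    by have := f0_hom 1 0 0; rewrite scale1r addr0 mul1r => /eqP;
      rewrite -subr_eq0 opprD addrA subrr sub0r oppr_eq0 => /eqP.
  rewrite f0_hom -[- (b' *: x)]addr0 -scaleNr f0_hom f00 addr0.
  by rewrite mulNr.
have e1 : (l0 (l a *: p)).1 = l a * (l0 p).1 + dl a.
  by rewrite linearZ /= {1}l1 envmodE /= l02 ep mulr1 (er1 E) !mul1r.
have e2 : (l0 (r a *: p)).1 = r a * (l0 p).1.
  have dl1 : dl 1 = 0 by rewrite -(rmorph1 cst) dlC.
  by rewrite linearZ /= {1}r1 envmodE /= (el1 E) dl1 mulr0 mul1r addr0.
rewrite f0B raddfB /= e1 e2 => e.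
have {}e : dl a = l a * f0 p - r a * f0 p - (l a * (l0 p).1 - r a * (l0 p).1).
  by rewrite -e opprB addrA subrK addrAC subrr add0r.
rewrite e !mulrBr !opprB [LHS]addrACA [RHS]addrACA; congr (_ + _).
exact: addrC.
Qed.

End Derivation.
End EnvModule.

(** * Quotients of modules *)

Section QuotientZmodule.
Variables (V : zmodType) (P : V -> Prop).
Hypotheses (P0 : P 0) (PB : forall x y, P x -> P y -> P (x - y)).

Definition zq_rel : rel V := fun x y => `[< P (x - y) >].

Lemma zq_refl : reflexive zq_rel.
Proof. by move=> x; apply/asboolP; rewrite subrr. Qed.

Lemma zq_sym : ssrbool.symmetric zq_rel.
Proof.
by move=> x y; apply/asboolP/asboolP => h; rewrite -opprB -sub0r; exact: PB.
Qed.

Lemma zq_trans : transitive zq_rel.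
Proof.
move=> y x z /asboolP hxy /asboolP hyz; apply/asboolP.
have := PB hxy (PB P0 hyz); rewrite sub0r opprK addrA subrK; exact.
Qed.

Canonical zq_equiv := EquivRel zq_rel zq_refl zq_sym zq_trans.
Definition zquot := {eq_quot zq_equiv}.
HB.instance Definition _ := Choice.on zquot.
Definition zq_pi (x : V) : zquot := \pi_zquot x.

Lemma zq_piP x y : zq_pi x = zq_pi y <-> P (x - y).
Proof. by split=> [/eqmodP/asboolP|h]; [|apply/eqmodP/asboolP]. Qed.

Lemma zq_surj (z : zquot) : exists x, z = zq_pi x.
Proof. by exists (repr z); rewrite /zq_pi reprK. Qed.

Lemma zq_repr x : P (repr (zq_pi x) - x).
Proof. by apply/zq_piP; rewrite /zq_pi reprK. Qed.

Definition zq_add (x y : zquot) := zq_pi (repr x + repr y).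
Definition zq_opp (x : zquot) := zq_pi (- repr x).

Lemma zq_addE x y : zq_add (zq_pi x) (zq_pi y) = zq_pi (x + y).
Proof.
apply/zq_piP; rewrite opprD addrACA -[_ - y]opprK; apply: PB; first exact: zq_repr.
by rewrite -sub0r; apply: PB => //; exact: zq_repr.
Qed.

Lemma zq_oppE x : zq_opp (zq_pi x) = zq_pi (- x).
Proof.
by apply/zq_piP; rewrite -opprD -sub0r; apply/PB/zq_repr.
Qed.

Fact zq_addA : associative zq_add.
Proof.
move=> x y z; have [a ->] := zq_surj x; have [b ->] := zq_surj y.
by have [c ->] := zq_surj z; rewrite !zq_addE addrA.
Qed.
Fact zq_addC : commutative zq_add.
Proof.
move=> x y; have [a ->] := zq_surj x; have [b ->] := zq_surj y.
by rewrite !zq_addE addrC.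
Qed.
Fact zq_add0 : left_id (zq_pi 0) zq_add.
Proof. by move=> x; have [a ->] := zq_surj x; rewrite zq_addE add0r. Qed.
Fact zq_addN : left_inverse (zq_pi 0) zq_opp zq_add.
Proof.
by move=> x; have [a ->] := zq_surj x; rewrite zq_oppE zq_addE addNr.
Qed.
HB.instance Definition _ :=
  GRing.isZmodule.Build zquot zq_addA zq_addC zq_add0 zq_addN.

Fact zq_pi_is_zmod_morphism : zmod_morphism zq_pi.
Proof. by move=> x y; rewrite -[LHS]zq_addE -zq_oppE. Qed.
HB.instance Definition _ :=
  GRing.isZmodMorphism.Build V zquot zq_pi zq_pi_is_zmod_morphism.

Lemma zq_pi_eq0 x : zq_pi x = 0 <-> P x.
Proof. by rewrite -[X in _ <-> P X]subr0; exact: zq_piP. Qed.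

End QuotientZmodule.

(** * Relations between the relations of [A(w)] *)

Lemma big_tuple_cons (R : nmodType) (n m : nat) (f : m.+1.-tuple 'I_n -> R) :
  \sum_(t : m.+1.-tuple 'I_n) f t =
  \sum_(j < n) \sum_(t : m.-tuple 'I_n) f [tuple of j :: t].
Proof.
rewrite pair_big /=.
rewrite (reindex (fun p : 'I_n * m.-tuple 'I_n => [tuple of p.1 :: p.2])) //=.
exists (fun t : m.+1.-tuple 'I_n => (thead t, behead_tuple t)) => [[j t] _|t _] /=.
  by congr (_, _); apply: val_inj.
by rewrite [RHS]tuple_eta; apply: val_inj.
Qed.

Section Koszul.
Variables (k : fieldType) (n m : nat) (w : potential k n m).
Hypothesis hw : superpotential w.
Variables (T : falg k 'I_n) (GA : T -> Prop).

Definition slT (i : 'I_n) : T :=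
  \sum_(t : m.-tuple 'I_n) fcst T (w [tuple of i :: t]) * fword T t.
Hypothesis GAE : forall g, GA g <-> exists i, g = slT i.

Lemma superpot_rot p (t : m.+1.-tuple 'I_n) :
  (p <= m.+1)%N -> w [tuple of rot p t] = w t.
Proof.
elim: p => [|p IH] lp; first by congr (w _); apply: val_inj; rewrite /= rot0.
rewrite -(IH (ltnW lp)) -(hw [tuple of rot p.+1 t]); congr (w _); apply: val_inj.
by rewrite /= rotS ?size_tuple // rotK.
Qed.

(** The left side is [w] as an element of the tensor algebra, split by first letters; the right side
    is its rotation, and cyclic invariance identifies the two. *)
Lemma slT_sum_comm : \sum_i fword T [:: i] * slT i = \sum_i slT i * fword T [:: i].
Proof.
under eq_bigr => i _ do rewrite /slT mulr_sumr.
under [RHS]eq_bigr => i _ do rewrite /slT mulr_suml.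
pose f (t : m.+1.-tuple 'I_n) := fcst T (w t) * fword T t.
pose g (t : m.+1.-tuple 'I_n) := fcst T (w t) * fword T (rot 1 t).
transitivity (\sum_t f t).
  rewrite big_tuple_cons; apply: eq_bigr => i _; apply: eq_bigr => t _.
  by rewrite mulrA -fcstC -mulrA -fwordM.
transitivity (\sum_t g t); last first.
  rewrite big_tuple_cons; apply: eq_bigr => i _; apply: eq_bigr => t _.
  by rewrite -mulrA -fwordM /g /= rot1_cons cats1.
rewrite (reindex (fun t : m.+1.-tuple 'I_n => [tuple of rot 1 t])).
  by apply: eq_bigr => t _; rewrite /f /g superpot_rot.
exists (fun t : m.+1.-tuple 'I_n => [tuple of rotr 1 t]) => t _; apply: val_inj.
  by rewrite /= rotK.
by rewrite /= rotrK.
Qed.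

Local Notation A := (quot_ring GA).
Local Notation pa := (quot_pi GA).
Local Notation J := (two_sided_ideal GA).
Variable cst : {rmorphism k -> A}.
Hypothesis cstE : forall c, cst c = pa (fcst T c).

Lemma cst_central c a : cst c * a = a * cst c.
Proof.
by have [t ->] := quot_pi_surj a; rewrite cstE -!rmorphM fcstC.
Qed.

Variable E : envalg cst.
Local Notation Q := (ecar E).
Local Notation l := (einl E).
Local Notation r := (einr E).
Local Notation pw s := (pa (fword T s)).
Definition kQ (c : k) : Q := l (cst c).
Fact kQ_additive : nmod_morphism kQ.
Proof. by split=> [|c c']; rewrite /kQ ?rmorph0 ?el0 // rmorphD elD. Qed.
HB.instance Definition _ := GRing.isNmodMorphism.Build k Q kQ kQ_additive.

Lemma kQC c (x : Q) : kQ c * x = x * kQ c.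
Proof.
move: x; apply: (env_ind (e := E)) => [|x y ex ey|a b].
- by rewrite mulr0 mul0r.
- by rewrite mulrDr mulrDl ex ey.
- by rewrite /kQ mulrA -(elM E) cst_central (elM E) -!mulrA (elr E).
Qed.

Lemma kQM c c' : kQ (c * c') = kQ c * kQ c'.
Proof. by rewrite /kQ rmorphM elM. Qed.

Lemma l_cw c s : l (pa (fcst T c * fword T s)) = kQ c * l (pw s).
Proof. by rewrite rmorphM /= (elM E) -cstE. Qed.

Lemma r_cw c s : r (pa (fcst T c * fword T s)) = kQ c * r (pw s).
Proof. by rewrite rmorphM /= (erM E) -cstE (erC E) -[einl E _]/(kQ c) -kQC. Qed.

Lemma pi_ideal a : J a -> pa a = 0.
Proof. by move=> Ja; rewrite -(rmorph0 pa); apply/quot_piP; rewrite subr0. Qed.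

Lemma slT_ideal i : J (slT i).
Proof. by rewrite -[slT i]mul1r -[_ * _]mulr1; apply/tsiM/GAE; exists i. Qed.

Section Leibniz.
Variable u : 'I_n -> Q.

(** The derivation of the free algebra into [A (x) A^op] with [x_i |-> u i], where [a] acts on the
    left through [l a] and on the right through [r a]. *)
Fixpoint dw (s : seq 'I_n) : Q :=
  if s is x :: s' then r (pw s') * u x + l (pw [:: x]) * dw s' else 0.

Definition dtl : {additive T -> Q} := zlext (fun s => cst_scale kQ (dw s)).

Lemma dtlE c s : dtl (fcst T c * fword T s) = kQ c * dw s.
Proof. exact: zlextE. Qed.

Lemma dw_cat s t : dw (s ++ t) = l (pw s) * dw t + r (pw t) * dw s.
Proof.
elim: s => [|x s IH] /=.
  by rewrite fword0 rmorph1 (el1 E) mul1r mulr0 addr0.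
rewrite IH -[x :: s]cat1s !fwordM !rmorphM /= (erM E) (elM E) !mulrDr.
rewrite -!mulrA addrCA [RHS]addrA [_ + r _ * (r _ * _)]addrC -[RHS]addrA.
rewrite addrCA; congr (_ + (_ + _)).
by rewrite !mulrA (elr E).
Qed.

Lemma dtlM a b : dtl (a * b) = l (pa a) * dtl b + r (pa b) * dtl a.
Proof.
move: b; apply: free_ind => [|b b' eb eb'|c' s'].
- by rewrite mulr0 !raddf0 er0 ?rmorph0 mulr0 mul0r addr0.
- by rewrite mulrDr !raddfD /= eb eb' (erD E) mulrDr mulrDl addrACA.
move: a; apply: free_ind => [|a a' ea ea'|c s].
- by rewrite mul0r !raddf0 el0 ?rmorph0 mulr0 mul0r addr0.
- by rewrite mulrDl !raddfD /= ea ea' (elD E) mulrDr mulrDl addrACA.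
rewrite cwordM !dtlE dw_cat kQM l_cw r_cw mulrDr; congr (_ + _).
  by rewrite -!mulrA; congr (_ * _); rewrite !mulrA; congr (_ * _); exact: kQC.
rewrite -!mulrA [kQ c * _]mulrA kQC -mulrA; congr (_ * _).
by rewrite !mulrA; congr (_ * _); exact: kQC.
Qed.

(** In the Leibniz expansion of [a * w_i * b], every term except the one with [dtl (w_i)] contains
    the class of [w_i] in [A], which is [0]. *)
Lemma dtl_ideal : (forall i, dtl (slT i) = 0) -> forall a, J a -> dtl a = 0.
Proof.
move=> h a; elim=> [|{}a b _ ea _ eb|{}a g b /GAE[i ->]].
- by rewrite raddf0.
- by rewrite raddfD /= ea eb addr0.
rewrite !dtlM h mulr0 add0r [pa (a * _)]rmorphM /= (pi_ideal (slT_ideal i)).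
by rewrite !mulr0 el0 er0 !mul0r mulr0 addr0.
Qed.

End Leibniz.

Section Partial.
Variable i : 'I_n.

(** The double partial derivative with respect to [x_i]: each occurrence of [x_i] in the word
    contributes the part behind it in the left factor and the part before it in the right factor. *)
Fixpoint pd (s : seq 'I_n) : Q :=
  if s is x :: s' then pd s' * r (pw [:: x]) + (if x == i then l (pw s') else 0)
  else 0.

Definition pdt : {additive T -> Q} := zlext (fun s => cst_scale kQ (pd s)).

Lemma pdtE c s : pdt (fcst T c * fword T s) = kQ c * pd s.
Proof. exact: zlextE. Qed.

Lemma pd_cat s t : pd (s ++ t) = pd t * r (pw s) + pd s * l (pw t).
Proof.
elim: s => [|x s IH] /=.
  by rewrite fword0 rmorph1 (er1 E) mulr1 mul0r addr0.
rewrite IH -[x :: s]cat1s !fwordM !rmorphM /= (erM E) !mulrDl -!mulrA.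
rewrite (elr E) -addrA; congr (_ + (_ + _)).
by case: eqP => _; rewrite ?mul0r // (elM E).
Qed.

Lemma pdtM a b : pdt (a * b) = pdt b * r (pa a) + pdt a * l (pa b).
Proof.
move: b; apply: free_ind => [|b b' eb eb'|c' s'].
- by rewrite mulr0 !raddf0 el0 ?rmorph0 mulr0 mul0r addr0.
- by rewrite mulrDr !raddfD /= eb eb' (elD E) mulrDr mulrDl addrACA.
move: a; apply: free_ind => [|a a' ea ea'|c s].
- by rewrite mul0r !raddf0 er0 ?rmorph0 mulr0 mul0r addr0.
- by rewrite mulrDl !raddfD /= ea ea' (erD E) mulrDr mulrDl addrACA.
rewrite cwordM !pdtE pd_cat kQM l_cw r_cw mulrDr; congr (_ + _).
  by rewrite (kQC c) -!mulrA; congr (_ * _); rewrite mulrA kQC -mulrA.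
by rewrite -!mulrA; congr (_ * _); rewrite !mulrA; congr (_ * _); exact: kQC.
Qed.

End Partial.

Section Expand.
Variables (u : 'I_n -> Q) (i0 : 'I_n).

Lemma l_cons x s : l (pw (x :: s)) = l (pw [:: x]) * l (pw s).
Proof. by rewrite -cat1s fwordM rmorphM /= (elM E). Qed.

Lemma r_cons x s : r (pw (x :: s)) = r (pw s) * r (pw [:: x]).
Proof. by rewrite -cat1s fwordM rmorphM /= (erM E). Qed.

Lemma dw_sum s : dw u s = \sum_(p < size s)
  l (pw (take p s)) * (r (pw (drop p.+1 s)) * u (nth i0 s p)).
Proof.
elim: s => [|x s IH] /=; first by rewrite big_ord0.
rewrite big_ord_recl /= ?drop0 ?take0 fword0 rmorph1 (el1 E) mul1r; congr (_ + _).
rewrite IH mulr_sumr; apply: eq_bigr => p _.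
by rewrite [in RHS]l_cons /bump leq0n add1n !add0n !mulrA.
Qed.

Lemma pd_sum i s : pd i s = \sum_(p < size s) (if nth i0 s p == i then
  l (pw (drop p.+1 s)) * r (pw (take p s)) else 0).
Proof.
elim: s => [|x s IH] /=; first by rewrite big_ord0.
rewrite big_ord_recl /= ?drop0 ?take0 fword0 rmorph1 (er1 E) mulr1 addrC; congr (_ + _).
rewrite IH mulr_suml; apply: eq_bigr => p _ /=; rewrite /bump /= add1n /=.
case: eqP => _; last by rewrite mul0r.
by rewrite [in RHS]r_cons mulrA.
Qed.

(* Both sides are sums over the cyclic words of [w] with two marked letters. *)
Lemma dtl_slT i : dtl u (slT i) = \sum_j pdt i (slT j) * u j.
Proof.
(* In a word of length [m + 1], [L] marks the letter [x_i] at position [0] and the letter replaced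
   by [u] at position [p + 1]; [Rt] has the two marks interchanged. *)
pose L (s : seq 'I_n) (p : nat) := if nth i0 s 0 == i then
  l (pw (take p (behead s))) * (r (pw (drop p.+1 (behead s))) * u (nth i0 s p.+1))
  else 0.
pose Rt (s : seq 'I_n) (p : nat) := if nth i0 s p.+1 == i then
  l (pw (drop p.+2 s)) * (r (pw (take p (behead s))) * u (nth i0 s 0)) else 0.
have osize (t : m.-tuple 'I_n) (f : nat -> Q) :
    \sum_(p < size t) f p = \sum_(p < m) f p by rewrite size_tuple.
have eL : dtl u (slT i) = \sum_(t : m.+1.-tuple 'I_n) kQ (w t) * \sum_(p < m) L t p.
  rewrite big_tuple_cons (bigD1 i) //= [X in _ = _ + X]big1 ?addr0.
    rewrite raddf_sum; apply: eq_bigr => t _; rewrite dtlE dw_sum.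
    congr (_ * _); rewrite (osize t (fun p => l (pw (take p t)) *
      (r (pw (drop p.+1 t)) * u (nth i0 t p)))).
    by apply: eq_bigr => p _; rewrite /L /= eqxx.
  move=> j ji; apply: big1 => t _; rewrite big1 ?mulr0 // => p _.
  by rewrite /L /= (negPf ji).
have eR : \sum_j pdt i (slT j) * u j =
    \sum_(t : m.+1.-tuple 'I_n) kQ (w t) * \sum_(p < m) Rt t p.
  rewrite big_tuple_cons; apply: eq_bigr => j _.
  rewrite raddf_sum mulr_suml; apply: eq_bigr => t _.
  rewrite pdtE pd_sum -mulrA; congr (_ * _).
  rewrite (osize t (fun p => if nth i0 t p == i then
    l (pw (drop p.+1 t)) * r (pw (take p t)) else 0)) mulr_suml.
  apply: eq_bigr => p _; rewrite /Rt /=; case: eqP => _; rewrite ?mul0r //.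
  by rewrite mulrA.
rewrite eL eR; under eq_bigr => t _ do rewrite mulr_sumr.
under [RHS]eq_bigr => t _ do rewrite mulr_sumr.
(* Rotation by [p + 1] brings the mark at position [p + 1] to the front and the front mark to
   position [m - p], which is the successor of the reversed index [m - (p + 1)]. *)
rewrite exchange_big [RHS]exchange_big /= (reindex_inj rev_ord_inj) /=.
apply: eq_bigr => p _.
rewrite (reindex (fun t : m.+1.-tuple 'I_n => [tuple of rot p.+1 t])) /=; last first.
  exists (fun t : m.+1.-tuple 'I_n => [tuple of rotr p.+1 t]) => t _;
    apply: val_inj; rewrite /= ?rotK ?rotrK //.
have lp := ltn_ord p.
apply: eq_bigr => t _; rewrite superpot_rot; last exact: ltnW.
congr (_ * _).
have st := size_tuple t; move: (tval t) st => s st {t}.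
have sd : size (drop p.+1 s) = (m - p)%N by rewrite size_drop st subSS.
case ed : (drop p.+1 s) => [|b q]; first by move: lp; rewrite -subn_gt0 -sd ed.
case et : (take p.+1 s) => [|a p'].
  by move: (congr1 size et); rewrite size_take st ltnS lp.
have sp' : size p' = p by have := congr1 size et; rewrite size_takel ?st 1?ltnW //= => -[].
have sq : size q = (m - p.+1)%N by move: sd; rewrite ed /= => e; rewrite subnS -e.
have es : s = (a :: p') ++ b :: q by rewrite -et -ed cat_take_drop.
rewrite /L /Rt /rot ed et es /= !nth_cat sp' ltnn subnn /= take_size_cat //.
rewrite -sq ltnn subnn /= take_size_cat // -[(size q).+1]add1n -drop_drop drop_size_cat //=.
by rewrite -[p.+1]add1n -drop_drop drop_size_cat //= !drop0.
Qed.

End Expand.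

(* The kernel of [T (x) W (x) T -> T] is generated by the evident relations and
   the one given by the superpotential. *)
Section Syzygies.
Hypothesis inner : forall u : 'I_n -> Q, (forall i, dtl u (slT i) = 0) ->
  exists v, forall j, u j = r (pw [:: j]) * v - l (pw [:: j]) * v.
Variables (Z : zmodType) (theta : 'I_n -> T -> T -> Z).
Hypothesis thDl : forall j a a' b, theta j (a + a') b = theta j a b + theta j a' b.
Hypothesis thDr : forall j a b b', theta j a (b + b') = theta j a b + theta j a b'.
Hypothesis thC : forall j c a b, theta j (a * fcst T c) b = theta j a (fcst T c * b).
Hypothesis th_triv : forall i j a b c,
  theta j (a * slT i * b) c = theta i a (b * slT j * c).
Hypothesis th_pot : forall a b, \sum_j theta j (a * fword T [:: j]) b =
  \sum_j theta j a (fword T [:: j] * b).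

Lemma th0l j b : theta j 0 b = 0.
Proof. by apply: (@addrI _ (theta j 0 b)); rewrite -thDl !addr0. Qed.
Lemma th0r j a : theta j a 0 = 0.
Proof. by apply: (@addrI _ (theta j a 0)); rewrite -thDr !addr0. Qed.
Lemma thNl j a b : theta j (- a) b = - theta j a b.
Proof. by apply: (@addrI _ (theta j a b)); rewrite -thDl !subrr th0l. Qed.
Lemma thNr j a b : theta j a (- b) = - theta j a b.
Proof. by apply: (@addrI _ (theta j a b)); rewrite -thDr !subrr th0r. Qed.
Lemma th_suml j (S : Type) (s : seq S) (f : S -> T) b :
  theta j (\sum_(x <- s) f x) b = \sum_(x <- s) theta j (f x) b.
Proof. by elim: s => [|x s IH]; rewrite ?big_nil ?th0l // !big_cons thDl IH. Qed.
Lemma th_sumr j (S : Type) (s : seq S) (f : S -> T) a :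
  theta j a (\sum_(x <- s) f x) = \sum_(x <- s) theta j a (f x).
Proof. by elim: s => [|x s IH]; rewrite ?big_nil ?th0r // !big_cons thDr IH. Qed.

Local Notation pres := (seq (T * 'I_n * T)).
Definition pev (L : pres) : T := \sum_(q <- L) q.1.1 * slT q.1.2 * q.2.
Definition pth (a : T) (L : pres) : Z := \sum_(q <- L) theta q.1.2 (a * q.1.1) q.2.

Lemma slT_homog j : whomog m (slT j).
Proof.
rewrite /slT; elim/big_rec: _ => [|t x _ hx]; first exact: whomog0.
apply: whomogD => //; rewrite -{1}(size_tuple t); exact: whomog_word.
Qed.

Lemma cst_homog c : whomog 0 (fcst T c).
Proof. by rewrite -[fcst T c]mulr1 -fword0; exact: whomog_word. Qed.

Lemma word_homog s : whomog (size s) (fword T s).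
Proof. by rewrite -[fword T s]mul1r -(rmorph1 (fcst T)); exact: whomog_word. Qed.

Lemma pres_exists a : J a -> exists L, pev L = a /\
  forall q, q \in L -> exists d, whomog d (q.1.1 * slT q.1.2 * q.2).
Proof.
elim=> [|{}a b _ [L [<- hL]] _ [L' [<- hL']]|{}a g b /GAE[i ->]].
- by exists [::]; split=> //; rewrite /pev big_nil.
- exists (L ++ L'); split; first by rewrite /pev big_cat.
  by move=> q; rewrite mem_cat => /orP[/hL|/hL'].
exists [seq (fcst T (fcoef u a) * fword T u, i, fcst T (fcoef v b) * fword T v)
  | u <- fsupp a, v <- fsupp b]; split.
  rewrite /pev big_allpairs_dep /= [X in _ = X * _ * _](fsum a) !mulr_suml.
  apply: eq_bigr => u _.
  by rewrite [X in _ = _ * X](fsum b) mulr_sumr.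
move=> q /allpairsP[[u v] [_ _ ->]] /=; exists (size u + m + size v)%N.
apply: whomogM; last exact: whomog_word.
by apply: whomogM; [exact: whomog_word|exact: slT_homog].
Qed.

Lemma pth_pev L' L :
  pth (pev L') L = \sum_(q <- L') theta q.1.2 q.1.1 (q.2 * pev L).
Proof.
transitivity (\sum_(q <- L) \sum_(q' <- L')
    theta q.1.2 (q'.1.1 * slT q'.1.2 * q'.2 * q.1.1) q.2).
  by apply: eq_bigr => q _; rewrite /pev mulr_suml th_suml.
rewrite exchange_big; apply: eq_bigr => q' _.
rewrite /pev mulr_sumr th_sumr; apply: eq_bigr => q _.
by rewrite -[_ * q'.2 * q.1.1]mulrA th_triv !mulrA.
Qed.

(** Expanding [a] as a combination of the [w_i], [th_triv] shifts the marked relation from [L] to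
    [a], after which [L] enters only through [pev L]. So [beta] is well defined on pairs of elements
    of the ideal. *)
Lemma pth_ext a L L' : J a -> pev L = pev L' -> pth a L = pth a L'.
Proof. by move=> /pres_exists[L0 [<- _]] e; rewrite !pth_pev e. Qed.

Definition the_pres (b : T) : pres :=
  if pselect (exists L, pev L = b) is left h then projT1 (cid h) else [::].
Definition beta a b := pth a (the_pres b).

Lemma the_presE b : J b -> pev (the_pres b) = b.
Proof.
move=> /pres_exists[L [eL _]]; rewrite /the_pres.
by case: pselect => [h|[]]; [case: cid|exists L].
Qed.

Lemma betaE a b L : J a -> J b -> pev L = b -> beta a b = pth a L.
Proof. by move=> Ja Jb e; apply: pth_ext; rewrite // the_presE. Qed.

Lemma beta_weak (L : seq (T * T)) :
  (forall p, p \in L -> [/\ J p.1, J p.2 & exists d, whomog d p.2]) ->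
  \sum_(p <- L) p.1 * p.2 = 0 -> \sum_(p <- L) beta p.1 p.2 = 0.
Proof.
apply: weak_algorithm.
- by move=> a b; exact: tsiD.
- by move=> c a; exact: tsiMl.
- by move=> c a; exact: tsiMr.
- move=> a a' b Ja Ja' Jb; rewrite /beta /pth -big_split; apply: eq_bigr => q _.
  by rewrite mulrDl thDl.
- move=> a b b' Ja Jb Jb'.
  rewrite (@betaE _ _ (the_pres b ++ the_pres b')) //; first by rewrite /pth big_cat.
    exact: tsiD.
  by rewrite /pev big_cat /= -!/(pev _) !the_presE.
- move=> a t b Ja Jb.
  rewrite (@betaE a (t * b) [seq (t * q.1.1, q.1.2, q.2) | q <- the_pres b]) //.
  + rewrite /beta /pth big_map; apply: eq_bigr => q _ /=.
    by rewrite mulrA.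
  + exact: tsiMl.
  rewrite -{2}(the_presE Jb) /pev big_map mulr_sumr; apply: eq_bigr => q _ /=.
  by rewrite !mulrA.
Qed.

(* The pairs [(theta_j(a, b), a w_j b)] with [a] or [b] in the ideal. *)
Inductive thG : Z * T -> Prop :=
| thG0 : thG 0
| thGD x y : thG x -> thG y -> thG (x + y)
| thGl j a b : J a -> thG (theta j a b, a * slT j * b)
| thGr j a b : J b -> thG (theta j a b, a * slT j * b).

Lemma thGN x : thG x -> thG (- x).
Proof.
elim=> [|{}x y _ hx _ hy|j a b Ja|j a b Jb]; first by rewrite oppr0; exact: thG0.
- by rewrite opprD; exact: thGD.
- rewrite (_ : - _ = (theta j (- a) b, - a * slT j * b)); last first.
    by rewrite thNl !mulNr.
  by apply: thGl; exact: tsiN.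
- rewrite (_ : - _ = (theta j a (- b), a * slT j * (- b))); last first.
    by rewrite thNr !mulrN.
  by apply: thGr; exact: tsiN.
Qed.

Lemma thGB x y : thG x -> thG y -> thG (x - y).
Proof. by move=> hx /thGN; exact: thGD. Qed.

(** If [a] lies in the ideal, [a * w_j * b] is the product of [a] and [w_j * b], both in the ideal,
    and [theta_j(a, b)] is the value of [beta] there; symmetrically for [b]. The second factors are
    split into homogeneous ones, as the weak algorithm demands. *)
Lemma thG_pairs x : thG x -> exists L : seq (T * T),
  [/\ forall p, p \in L -> [/\ J p.1, J p.2 & exists d, whomog d p.2],
      \sum_(p <- L) p.1 * p.2 = x.2 & \sum_(p <- L) beta p.1 p.2 = x.1].
Proof.
elim=> [|{}x y _ [L [hL e1 e2]] _ [L' [hL' e1' e2']]|j a b Ja|j a b Jb].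
- by exists [::]; rewrite !big_nil.
- exists (L ++ L'); rewrite !big_cat /= e1 e2 e1' e2'; split=> // p.
  by rewrite mem_cat => /orP[/hL|/hL'].
- have Jw s : J (slT j * (fcst T (fcoef s b) * fword T s)) by apply/tsiMr/slT_ideal.
  exists [seq (a, slT j * (fcst T (fcoef s b) * fword T s)) | s <- fsupp b]; split.
  + move=> _ /mapP[s _ ->] /=; split=> //; exists (m + size s)%N.
    by apply: whomogM; [exact: slT_homog|exact: whomog_word].
  + rewrite big_map /= [X in _ = _ * X](fsum b) mulr_sumr.
    by apply: eq_bigr => s _; rewrite mulrA.
  + rewrite big_map /= [X in _ = theta j a X](fsum b) th_sumr.
    apply: eq_bigr => s _.
    rewrite (@betaE a _ [:: (1, j, fcst T (fcoef s b) * fword T s)]) //.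
      by rewrite /pth big_seq1 /= mulr1.
    by rewrite /pev big_seq1 /= mul1r.
- have [L [eL hL]] := pres_exists Jb.
  have Jw q : J (q.1.1 * slT q.1.2 * q.2) by apply/tsiMr/tsiMl/slT_ideal.
  have Jaj : J (a * slT j) by apply/tsiMl/slT_ideal.
  exists [seq (a * slT j, q.1.1 * slT q.1.2 * q.2) | q : T * 'I_n * T <- L]; split.
  + by move=> _ /mapP[q qL ->] /=; split=> //; exact: hL.
  + by rewrite big_map /= -eL /pev mulr_sumr.
  + rewrite big_map /= -eL /pev th_sumr; apply: eq_bigr => q _.
    rewrite (@betaE _ _ [:: q]) //; last by rewrite /pev big_seq1.
    by rewrite /pth big_seq1 th_triv.
Qed.

Local Notation X := (zquot thG0 thGB).
(** Modulo the pairs with [a] or [b] in the ideal, [(theta_j(a, b), a w_j b)] depends only on the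
    classes in [A]. Keeping the product as second component remembers that the relation holds in the
    free algebra and not only in [A]. *)
Definition tau j (a b : A) : X :=
  zq_pi thG0 thGB (theta j (repr a) (repr b), repr a * slT j * repr b).

Lemma tauE j a b :
  tau j (pa a) (pa b) = zq_pi thG0 thGB (theta j a b, a * slT j * b).
Proof.
apply/zq_piP.
have Ja := quot_repr GA a; have Jb := quot_repr GA b.
move: (repr (pa a)) (repr (pa b)) Ja Jb => a' b' Ja Jb.
have := thGD (thGl j b' Ja) (thGr j a Jb).
rewrite thDl thDr thNl thNr !mulrBl !mulrBr => h.
rewrite (_ : _ - _ = (theta j a' b' - theta j a b' + (theta j a b' - theta j a b),
  a' * slT j * b' - a * slT j * b' + (a * slT j * b' - a * slT j * b))) //.
by congr (_, _); rewrite addrA subrK.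
Qed.

Definition tau_bal (j : 'I_n) : balanced cst X.
Proof.
exists (fun b a => tau j a b) => [a a' b|a b b'|c a b].
- have [x ->] := quot_pi_surj a; have [x' ->] := quot_pi_surj a'.
  have [y ->] := quot_pi_surj b; rewrite -raddfD !tauE -raddfD thDr mulrDr.
  by congr (zq_pi _ _ _).
- have [x ->] := quot_pi_surj a; have [y' ->] := quot_pi_surj b'.
  have [y ->] := quot_pi_surj b; rewrite -raddfD !tauE -raddfD thDl !mulrDl.
  by congr (zq_pi _ _ _).
- have [x ->] := quot_pi_surj a; have [y ->] := quot_pi_surj b.
  rewrite cstE -!rmorphM !tauE (fcstC c y) thC.
  congr (zq_pi _ _ (_, _)); rewrite -!mulrA; congr (_ * _).
  by rewrite mulrA -fcstC -mulrA.
Defined.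

Lemma syzygies (S : Type) (s : seq S) (a b : S -> T) (j : S -> 'I_n) :
  \sum_(x <- s) a x * slT (j x) * b x = 0 ->
  \sum_(x <- s) theta (j x) (a x) (b x) = 0.
Proof.
(* [u i] collects the coefficients of [w_i]. Applying [pdt i] to the relation kills the terms that
   differentiate [a] or [b], since they retain a factor [w_j]; by [dtl_slT] what is left says that
   [dtl u (w_i) = 0]. *)
move=> e0; pose u i := \sum_(x <- s | j x == i) l (pa (b x)) * r (pa (a x)).
have split_j (V : zmodType) (f : 'I_n -> S -> V) :
    \sum_(x <- s) f (j x) x = \sum_i \sum_(x <- s | j x == i) f i x.
  rewrite (exchange_big_dep predT) //=; apply: eq_bigr => x _.
  by rewrite (big_pred1 (j x)) // => i; rewrite eq_sym.
have [i|v vP] := inner (u := u).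
  rewrite (dtl_slT u i).
  have : \sum_(x <- s) pdt i (slT (j x)) * (l (pa (b x)) * r (pa (a x))) = 0.
    transitivity (pdt i (\sum_(x <- s) a x * slT (j x) * b x)).
      rewrite raddf_sum; apply: eq_bigr => x _.
      rewrite !pdtM [pa (_ * slT _)]rmorphM /= (pi_ideal (slT_ideal _)).
      rewrite mulr0 er0 mulr0 add0r el0 mulr0 addr0.
      by rewrite -!mulrA (elr E).
    by rewrite e0 raddf0.
  by rewrite (split_j _ (fun i' x => pdt i (slT i') * (l (pa (b x)) * r (pa (a x)))));
    under eq_bigr => i' _ do rewrite -mulr_sumr.
(* Read in [X], the relation is the sum of the [Psi i (u i)]. As [u] is inner, this is a difference
   of two terms whose first components agree by [th_pot] and whose second components agree by
   [slT_sum_comm]. *)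
have eX : zq_pi thG0 thGB (\sum_(x <- s) theta (j x) (a x) (b x), 0) = 0.
  pose Psi i : Q -> X := bal_ext (tau_bal i).
  have PsiD i : {morph Psi i : x y / x + y}.
    exact: bal_extD.
  have Psi0 i : Psi i 0 = 0 by exact: bal_ext0.
  have PsiB i x y : Psi i (x - y) = Psi i x - Psi i y.
    by apply/eqP; rewrite eq_sym subr_eq -PsiD subrK.
  have Psis i (L : seq S) (Pr : pred S) f :
      Psi i (\sum_(x <- L | Pr x) f x) = \sum_(x <- L | Pr x) Psi i (f x).
    by apply: (big_morph _ (PsiD i) (Psi0 i)).
  have PsiE i x y : Psi i (l (pa y) * r (pa x)) =
      zq_pi thG0 thGB (theta i x y, x * slT i * y).
    by rewrite -tauE; exact: bal_extE.
  transitivity (\sum_i Psi i (u i)).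
    rewrite -e0; transitivity (\sum_(x <- s) zq_pi thG0 thGB
        (theta (j x) (a x) (b x), a x * slT (j x) * b x)).
      rewrite -raddf_sum; congr (zq_pi _ _ _).
      elim: (s) => [|x s' IH]; first by rewrite !big_nil.
      by rewrite !big_cons -IH.
    rewrite (split_j _ (fun i x => zq_pi thG0 thGB
      (theta i (a x) (b x), a x * slT i * b x))).
    by apply: eq_bigr => i _; rewrite Psis; apply: eq_bigr => x _; rewrite PsiE.
  under eq_bigr => i _ do rewrite vP PsiB.
  rewrite sumrB; apply/eqP; rewrite subr_eq0; apply/eqP; move: {vP} v.
  apply: (env_ind (e := E)) => [|x y ex ey|p q].
  - by under eq_bigr => i _ do rewrite mulr0 Psi0;
      under [RHS]eq_bigr => i _ do rewrite mulr0 Psi0.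
  - by under eq_bigr => i _ do rewrite mulrDr PsiD;
      under [RHS]eq_bigr => i _ do rewrite mulrDr PsiD;
      rewrite !big_split /= ex ey.
  have [x ->] := quot_pi_surj q; have [y ->] := quot_pi_surj p.
  transitivity (zq_pi thG0 thGB (\sum_i theta i (x * fword T [:: i]) y,
      \sum_i x * fword T [:: i] * slT i * y)).
    transitivity (\sum_i zq_pi thG0 thGB (theta i (x * fword T [:: i]) y,
        x * fword T [:: i] * slT i * y)).
      apply: eq_bigr => i _.
      by rewrite mulrA -(elr E) -mulrA -(erM E) -(rmorphM pa) PsiE.
    rewrite -raddf_sum; congr (zq_pi _ _ _).
    elim: (index_enum _) => [|i s' IH]; first by rewrite !big_nil.
    by rewrite !big_cons IH.
  transitivity (\sum_i zq_pi thG0 thGB (theta i x (fword T [:: i] * y),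
        x * slT i * (fword T [:: i] * y))); last first.
    apply: eq_bigr => i _.
    by rewrite [in RHS]mulrA -(elM E) -(rmorphM pa) PsiE.
  rewrite -raddf_sum; congr (zq_pi _ _ _).
  transitivity (\sum_i theta i x (fword T [:: i] * y),
        \sum_i x * slT i * (fword T [:: i] * y)).
    congr (_, _); first exact: th_pot.
    transitivity (x * (\sum_i fword T [:: i] * slT i) * y).
      by rewrite mulr_sumr mulr_suml; apply: eq_bigr => i _; rewrite !mulrA.
    rewrite slT_sum_comm mulr_sumr mulr_suml.
    by apply: eq_bigr => i _; rewrite !mulrA.
  elim: (index_enum _) => [|i s' IH]; first by rewrite !big_nil.
  by rewrite !big_cons -IH.
have /zq_pi_eq0/thG_pairs[L [hL e1 e2]] := eX.
by rewrite -[LHS]e2; apply: beta_weak.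
Qed.

End Syzygies.
End Koszul.

(** * The deformation [T[z] / (w_j - c_j z)] *)

Section InnerOfExt.
Variables (k : fieldType) (n m : nat) (w : potential k n m).
Variables (T : falg k 'I_n) (GA : T -> Prop).
Hypothesis GAE : forall g, GA g <-> exists i, g = slT w T i.
Local Notation A := (quot_ring GA).
Local Notation pa := (quot_pi GA).
Variable cst : {rmorphism k -> A}.
Hypothesis cstE : forall c, cst c = pa (fcst T c).
Variable E : envalg cst.
Local Notation Q := (ecar E).
Variables (P : resolution Q) (eps : {additive P 0%N -> A}).
Hypothesis eps_act : forall a b x, eps (einl E a * einr E b *: x) = a * eps x * b.
Hypothesis eps_res : resolves eps.
Hypothesis ext1 : forall f : P 1%N -> Q, cocycle f -> coboundary f.

Lemma inner_of_ext (u : 'I_n -> Q) : (forall i, dtl u (slT w T i) = 0) ->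
  exists v, forall j, u j = einr E (pa (fword T [:: j])) * v - einl E (pa (fword T [:: j])) * v.
Proof.
move=> h0; have hI := dtl_ideal GAE cstE h0.
pose dl (a : A) := dtl (GA := GA) (cst := cst) (E := E) u (repr a).
have dlE t : dl (pa t) = dtl (GA := GA) (cst := cst) (E := E) u t.
  by apply/eqP; rewrite -subr_eq0 -raddfB; apply/eqP/hI; exact: quot_repr.
have [|||v vP] := @derivation_inner _ _ cst (cst_central cstE) E dl _ _ _ P eps eps_act eps_res ext1.
- move=> a b; have [x ->] := quot_pi_surj a; have [y ->] := quot_pi_surj b.
  by rewrite -raddfD !dlE raddfD.
- move=> a b; have [x ->] := quot_pi_surj a; have [y ->] := quot_pi_surj b.
  by rewrite -(rmorphM pa) !dlE (dtlM cstE).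
- move=> c; rewrite cstE dlE -[fcst T c]mulr1 -fword0 dtlE /=.
  by rewrite mulr0.
exists v => j; rewrite -vP dlE -[fword T _]mul1r -(rmorph1 (fcst T)) dtlE /=.
by rewrite mulr0 addr0 fword0 !rmorph1 er1 !mul1r /kQ rmorph1 el1 mul1r.
Qed.

End InnerOfExt.

(* The conclusion of [syzygies], as a property of [w]. *)
Definition syz (k : fieldType) (n m : nat) (w : potential k n m) (T : falg k 'I_n) :=
  forall (Z : zmodType) (theta : 'I_n -> T -> T -> Z),
  (forall j a a' b, theta j (a + a') b = theta j a b + theta j a' b) ->
  (forall j a b b', theta j a (b + b') = theta j a b + theta j a b') ->
  (forall j c a b, theta j (a * fcst T c) b = theta j a (fcst T c * b)) ->
  (forall i j a b c, theta j (a * slT w T i * b) c = theta i a (b * slT w T j * c)) ->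
  (forall a b, \sum_j theta j (a * fword T [:: j]) b =
     \sum_j theta j a (fword T [:: j] * b)) ->
  forall (S : Type) (s : seq S) (a b : S -> T) (j : S -> 'I_n),
  \sum_(x <- s) a x * slT w T (j x) * b x = 0 ->
  \sum_(x <- s) theta (j x) (a x) (b x) = 0.

Lemma calabi_yau_syz (k : fieldType) (n m : nat) (w : potential k n m) :
  superpotential w -> calabi_yau (@A_cst k n m w) (@A_deg k n m w) 3 ->
  syz w (malg_falg k 'I_n).
Proof.
move=> hw [P [Pext _]] Z theta h1 h2 h3 h4 h5 S s a b j e0.
pose T := malg_falg k 'I_n.
pose GA : T -> Prop := A_relations w.
have GAE g : GA g <-> exists i, g = slT w T i by split=> -[i ->]; exists i.
pose cst : {rmorphism k -> quot_ring GA} := quot_pi GA \o fcst T.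
have cstE c : cst c = quot_pi GA (fcst T c) by [].
pose E : envalg cst := env_envalg (cst_central cstE).
have n13 : 1%N <> 3%N by [].
have inner := @inner_of_ext k n m w T GA GAE cst cstE E (bres P) (beps P)
  (@beps_act _ _ _ _ P) (@beps_res _ _ _ _ P) (Pext 1%N n13).
exact: (@syzygies k n m w hw T GA GAE cst cstE E inner Z theta h1 h2 h3 h4 h5 S s a b j e0).
Qed.

(** * Extension of coefficients to [S] and regularity of the central variable [z] *)

Section PBW.
Variables (k : fieldType) (n m : nat) (w : potential k n m).
Local Notation S := {mpoly k[n]}.
Variables (T : falg k 'I_n) (TS : falg S 'I_n).

Lemma mpolyEw (s : S) (d : seq 'X_{1..n}) : uniq d ->
    (forall u, u \in msupp s -> u \in d) ->
  s = \sum_(mu <- d) s@_mu *: 'X_[mu].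
Proof.
move=> ud le; rewrite {1}(mpolyE s) [RHS](bigID (fun u => u \in msupp s)) /= [X in _ = _ + X]big1.
  rewrite addr0 -[RHS]big_filter; apply: perm_big; apply: uniq_perm.
  - exact: msupp_uniq.
  - exact: filter_uniq.
  - by move=> u; rewrite mem_filter; case: (boolP (u \in msupp s)) => // /le ->.
by move=> u; rewrite mcoeff_msupp negbK => /eqP ->; rewrite scale0r.
Qed.

Definition emb : {additive T -> TS} :=
  zlext (fun s => cst_scale (fcst TS \o @mpolyC n k) (fword TS s)).

Lemma embE c s : emb (fcst T c * fword T s) = fcst TS c%:MP * fword TS s.
Proof. exact: zlextE. Qed.

Lemma emb_word s : emb (fword T s) = fword TS s.
Proof. by rewrite -[fword T s]mul1r -(rmorph1 (fcst T)) embE !rmorph1 mul1r. Qed.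

Lemma emb_cst c : emb (fcst T c) = fcst TS c%:MP.
Proof. by rewrite -[fcst T c]mulr1 -(fword0 T) embE fword0 mulr1. Qed.

Lemma embM a b : emb (a * b) = emb a * emb b.
Proof.
move: b; apply: free_ind => [|b b' eb eb'|c' s'].
- by rewrite mulr0 !raddf0 mulr0.
- by rewrite mulrDr !raddfD /= mulrDr eb eb'.
move: a; apply: free_ind => [|a a' ea ea'|c s].
- by rewrite mul0r !raddf0 mul0r.
- by rewrite mulrDl !raddfD /= mulrDl ea ea'.
by rewrite cwordM !embE cwordM -mpolyCM.
Qed.

Definition slTS (i : 'I_n) : TS :=
  \sum_(t : m.-tuple 'I_n) fcst TS (w [tuple of i :: t])%:MP * fword TS t.

Lemma emb_slT i : emb (slT w T i) = slTS i.
Proof. by rewrite raddf_sum; apply: eq_bigr => t _; rewrite embE. Qed.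

Definition cfm (mu : 'X_{1..n}) : {additive TS -> T} :=
  zlext (fun s => cst_scale (fcst T \o @mcoeff n k mu) (fword T s)).

Lemma cfmE mu c s : cfm mu (fcst TS c * fword TS s) = fcst T c@_mu * fword T s.
Proof. exact: zlextE. Qed.

Lemma cfm_emb mu s t : cfm mu (fcst TS s * emb t) = fcst T s@_mu * t.
Proof.
move: t; apply: free_ind => [|a b ea eb|c u].
- by rewrite !raddf0 !mulr0 raddf0.
- by rewrite raddfD !mulrDr raddfD ea eb.
rewrite embE !mulrA -!rmorphM cfmE /= [_ * c%:MP]mulrC mul_mpolyC mcoeffZ.
by rewrite [c * _]mulrC.
Qed.

Definition gz (j : 'I_n) : {poly TS} := (slTS j)%:P - (fcst TS 'X_j)%:P * 'X.
Definition Gz (g : {poly TS}) : Prop := exists j, g = gz j.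
Local Notation Jz := (two_sided_ideal Gz).
Local Notation piz := (quot_pi Gz).

Lemma cstPC d (p : {poly TS}) : (fcst TS d)%:P * p = p * (fcst TS d)%:P.
Proof. by apply/polyP => i; rewrite coefCM coefMC fcstC. Qed.

Lemma polyXC (p : {poly TS}) : 'X * p = p * 'X.
Proof. exact/esym/commr_polyX. Qed.

Lemma gz_ideal j : Jz (gz j).
Proof. by rewrite -[gz j]mul1r -[_ * _]mulr1; apply: tsiM; exists j. Qed.

Lemma piz_slTS j : piz (slTS j)%:P = piz ((fcst TS 'X_j)%:P * 'X).
Proof. by apply/quot_piP; exact: gz_ideal. Qed.

Lemma polyMX_inj (p q : {poly TS}) : p * 'X = q * 'X -> p = q.
Proof.
by move=> e; apply/polyP => i; move/polyP: e => /(_ i.+1); rewrite !coefMX.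
Qed.

Local Notation nfi := (S * nat * seq 'I_n * 'I_n * seq 'I_n)%type.
Definition nft (q : nfi) : {poly TS} :=
  let: (s, r, a, j, b) := q in
  (fcst TS s * fword TS a)%:P * gz j * (fword TS b)%:P * 'X^r.
Definition NF (p : {poly TS}) : Prop := exists L : seq nfi, p = \sum_(q <- L) nft q.

Lemma NF0 : NF 0. Proof. by exists [::]; rewrite big_nil. Qed.
Lemma NFD p q : NF p -> NF q -> NF (p + q).
Proof. by move=> [L ->] [L' ->]; exists (L ++ L'); rewrite big_cat. Qed.
Lemma NFX p : NF p -> NF (p * 'X).
Proof.
move=> [L ->]; exists [seq (q.1.1.1.1, q.1.1.1.2.+1, q.1.1.2, q.1.2, q.2) | q : nfi <- L].
rewrite big_map mulr_suml; apply: eq_bigr => -[[[[s r] a] j] b] _ /=.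
by rewrite exprSr mulrA.
Qed.

(** [S] and [z] are central, so scalars and powers of [z] can be gathered, leaving only words on the
    two sides of a generator. *)
Lemma Jz_NF p : Jz p -> NF p.
Proof.
elim=> [|a b _ ha _ hb|a g b [j ->]]; [exact: NF0|exact: NFD|].
elim/poly_ind: b => [|b c hb]; first by rewrite mulr0; exact: NF0.
rewrite mulrDr; apply: NFD; first by rewrite mulrA; exact: NFX.
elim/poly_ind: a {b hb} => [|a d ha]; first by rewrite !mul0r; exact: NF0.
rewrite !mulrDl; apply: NFD.
  by rewrite -(mulrA a) polyXC mulrA -(mulrA _ 'X) polyXC mulrA; exact: NFX.
move: c {a ha}; apply: free_ind => [|c c' hc hc'|c s].
- by rewrite mulr0; exact: NF0.
- by rewrite rmorphD mulrDr; exact: NFD.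
move: d; apply: free_ind => [|d d' hd hd'|d t].
- by rewrite !mul0r; exact: NF0.
- by rewrite rmorphD !mulrDl; exact: NFD.
exists [:: (c * d, 0%N, t, j, s)]; rewrite big_seq1 /= expr0 mulr1.
rewrite !rmorphM /= mulrA -(cstPC c) -!mulrA; congr (_ * _).
Qed.

Lemma coef0_nft q : (nft q)`_0 = if q.1.1.1.2 == 0%N then
  fcst TS q.1.1.1.1 * emb (fword T q.1.1.2 * slT w T q.1.2 * fword T q.2) else 0.
Proof.
case: q => [[[[s r] a] j] b] /=; rewrite /gz !coef0M coefXn coefB !coefC coefMX /= subr0.
case: r => [|r]; last by rewrite mulr0.
by rewrite mulr1 !embM !emb_word emb_slT !mulrA.
Qed.

Hypothesis hsyz : syz w T.

(** In a normal form of [f z], the constant terms of the summands without a factor [z] add up to a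
    relation between the [w_j]. By the syzygies, the same sum with [c_j] in place of [w_j] lies in
    the ideal. These summands therefore contribute [z] times an element of the ideal, as do all the
    others. *)
Lemma Jz_regular f : Jz (f * 'X) -> Jz f.
Proof.
move=> /Jz_NF[L eL].
pose L0 := [seq q <- L | q.1.1.1.2 == 0%N].
pose L1 := [seq q <- L | q.1.1.1.2 != 0%N].
have e0 : \sum_(q <- L0) fcst TS q.1.1.1.1 *
    emb (fword T q.1.1.2 * slT w T q.1.2 * fword T q.2) = 0.
  have := congr1 (coefp 0) eL; rewrite /= coefMX /= coef_sum => /esym; apply: etrans.
  by rewrite big_filter big_mkcond /=; apply: eq_bigr => q _; rewrite coef0_nft.
(* [w_j] is replaced by [c_j]. This respects the evident syzygies because [w_i = c_i z] in the
   quotient, so that [a w_i b c_j c] and [a c_i b w_j c] both become [c_i c_j z a b c]. *)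
pose th j (a b : T) : quot_ring Gz := piz (emb a * fcst TS 'X_j * emb b)%:P.
have cent j (a b : TS) : piz (a * fcst TS 'X_j * b)%:P = piz (fcst TS 'X_j * (a * b))%:P.
  by rewrite -(fcstC 'X_j a) mulrA.
have hmu mu : \sum_(q <- L0) piz (fcst TS (q.1.1.1.1@_mu)%:MP *
    (fword TS q.1.1.2 * fcst TS 'X_(q.1.2) * fword TS q.2))%:P = 0.
  have := congr1 (cfm mu) e0; rewrite raddf0 raddf_sum /=.
  under eq_bigr => q _ do rewrite cfm_emb !mulrA.
  move=> /(hsyz (theta := th)) => h.
  rewrite -[RHS]h.
  - apply: eq_bigr => q _; rewrite /th embE emb_word.
    by rewrite !mulrA.
  - by move=> j a a' b; rewrite /th raddfD !mulrDl !raddfD.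
  - by move=> j a b b'; rewrite /th raddfD !mulrDr !raddfD.
  - move=> j c a b; rewrite /th !embM emb_cst -!mulrA; congr (piz (_ * _)%:P).
    by rewrite !mulrA [_ * fcst TS 'X_j]fcstC.
  - move=> i j a b c; rewrite /th !embM !emb_slT; move: (emb a) (emb b) (emb c) => {}a {}b {}c.
    have cZ x : piz 'X * x = x * piz 'X.
      by have [p ->] := quot_pi_surj x; rewrite -!(rmorphM piz) polyXC.
    rewrite !rmorphM /= !piz_slTS !rmorphM /= -!mulrA; congr (_ * (_ * _)).
    by rewrite !mulrA (cZ (piz b%:P)) -(mulrA _ (piz 'X)) cZ !mulrA.
  - move=> a b; apply: eq_bigr => j _; rewrite /th !embM !emb_word.
    by rewrite -!mulrA; congr (piz (_ * _)%:P); rewrite !mulrA fcstC.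
pose G0 (q : nfi) : TS := fcst TS (q.1.1.1.1 * 'X_(q.1.2)) * (fword TS q.1.1.2 * fword TS q.2).
have hG0 : Jz (\sum_(q <- L0) G0 q)%:P.
  rewrite -[X in Jz X]subr0; apply/quot_piP; rewrite [RHS]rmorph0.
  pose d := undup (flatten [seq msupp q.1.1.1.1 | q : nfi <- L0]).
  transitivity (\sum_(mu <- d) piz (fcst TS 'X_[mu])%:P *
    \sum_(q <- L0) piz (fcst TS (q.1.1.1.1@_mu)%:MP *
    (fword TS q.1.1.2 * fcst TS 'X_(q.1.2) * fword TS q.2))%:P); last first.
    by apply: big1 => mu _; rewrite hmu mulr0.
  under [RHS]eq_bigr => mu _ do rewrite mulr_sumr.
  rewrite exchange_big /= !rmorph_sum big_seq [RHS]big_seq; apply: eq_bigr => q qL /=.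
  have -> : G0 q = \sum_(mu <- d) fcst TS 'X_[mu] * (fcst TS (q.1.1.1.1@_mu)%:MP *
      (fword TS q.1.1.2 * fcst TS 'X_(q.1.2) * fword TS q.2)).
    rewrite /G0 rmorphM [X in fcst TS X * _](@mpolyEw _ d) ?undup_uniq //.
      rewrite rmorph_sum !mulr_suml; apply: eq_bigr => mu _.
      rewrite -mul_mpolyC rmorphM /= (fcstC _ (fcst TS 'X_[mu])) -!mulrA.
      by congr (_ * (_ * _)); rewrite mulrA fcstC -mulrA.
    move=> mu hmu'; rewrite mem_undup; apply/flattenP.
    by exists (msupp q.1.1.1.1) => //; apply/mapP; exists q.
  by rewrite !rmorph_sum; apply: eq_bigr => mu _; rewrite -!rmorphM.
pose g := \sum_(q <- L1) nft (q.1.1.1.1, q.1.1.1.2.-1, q.1.1.2, q.1.2, q.2).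
have hg : Jz g.
  rewrite /g; elim/big_rec: _ => [|q x _ hx]; first exact: tsi0.
  apply: tsiD => //; case: q => [[[[s r] a] j] b] /=.
  by do 2!apply: tsiMr; apply/tsiMl/gz_ideal.
suff -> : f = g - (\sum_(q <- L0) G0 q)%:P by apply: tsiD => //; exact: tsiN.
apply: polyMX_inj; rewrite eL (bigID (fun q : nfi => q.1.1.1.2 == 0%N)) /=.
rewrite -[X in X + _]big_filter -[X in _ + X]big_filter -/L0 -/L1 mulrBl addrC; congr (_ + _).
  rewrite /g mulr_suml [LHS]big_seq [RHS]big_seq; apply: eq_bigr => -[[[[s r] a] j] b].
  by rewrite mem_filter /= => /andP[]; case: r => // r _ _ /=; rewrite exprSr mulrA.
have e0P : \sum_(q <- L0) (fcst TS q.1.1.1.1 *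
    emb (fword T q.1.1.2 * slT w T q.1.2 * fword T q.2))%:P = 0.
  by rewrite -rmorph_sum e0 rmorph0.
rewrite -[RHS]add0r -[X in X - _]e0P rmorph_sum mulr_suml -sumrB /=.
rewrite [LHS]big_seq [RHS]big_seq; apply: eq_bigr => -[[[[s r] a] j] b].
rewrite mem_filter /= => /andP[/eqP -> _]; rewrite expr0 mulr1 /gz mulrBr mulrBl.
congr (_ - _); first by rewrite !embM !emb_word emb_slT -!rmorphM !mulrA.
rewrite /G0 /= !rmorphM /= -!mulrA; congr (_ * _).
by rewrite polyXC !mulrA -cstPC.
Qed.

End PBW.

(** * Normal words and the structure of [E] *)

Section NormalWords.
Variables (k : fieldType) (n m : nat) (w : potential k n m) (T : falg k 'I_n).
Definition slT_rel (g : T) : Prop := exists i, g = slT w T i.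
Local Notation J := (two_sided_ideal slT_rel).

(** The numbering [pickle] serves as a well-founded total order on words. It has no compatibility
    with products: the basis is found by linear algebra inside each degree. *)
Definition reducible_word (u : seq 'I_n) : Prop := exists2 t : T,
  (forall v, fcoef v t != 0 -> size v = size u /\ (pickle v < pickle u)%N) &
  J (fword T u - t).

Definition normal_word u := ~ reducible_word u.

Lemma normal_span u : exists2 t : T,
  (forall v, fcoef v t != 0 -> normal_word v /\ size v = size u) & J (fword T u - t).
Proof.
have [p] := ubnP (pickle u); elim: p u => // p IH u up.
have [nu|/contrapT[t tP Jt]] := pselect (normal_word u).
  exists (fword T u); last by rewrite subrr; exact: tsi0.
  move=> v; rewrite -[fword T u]mul1r -(rmorph1 (fcst T)) fcoefE.
  by case: (u =P v) => [<-|_]; rewrite ?eqxx.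
suff [t' t'P Jt'] : exists2 t' : T,
    (forall v, fcoef v t' != 0 -> normal_word v /\ size v = size u) & J (t - t').
  by exists t' => //; rewrite -(subrK t (fword T u)) -addrA; exact: tsiD.
have {Jt} : forall v, v \in fsupp t -> size v = size u /\ (pickle v < p)%N.
  by move=> v; rewrite fsuppP => /tP[-> lt]; split=> //; exact: leq_trans lt _.
rewrite [in X in _ -> X](fsum t); elim: (fsupp t) => [|v l IHl] hl.
  exists 0; last by rewrite big_nil subrr; exact: tsi0.
  by move=> v; rewrite raddf0 eqxx.
have [|t1 t1P J1] := IHl; first by move=> v' h; apply: hl; rewrite inE h orbT.
have [sv pv] : size v = size u /\ (pickle v < p)%N by apply: hl; rewrite inE eqxx.
have [t2 t2P J2] := IH v pv; exists (fcst T (fcoef v t) * t2 + t1); last first.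
  rewrite big_cons opprD addrACA -mulrBr; apply: tsiD => //; exact: tsiMl.
move=> v'; rewrite raddfD /=.
have [->|/t1P//] := eqVneq (fcoef v' t1) 0; rewrite addr0.
have cz (c : k) (x : T) : fcoef v' (fcst T c * x) = c * fcoef v' x.
  move: x; apply: free_ind => [|a b ea eb|d s].
  - by rewrite mulr0 !raddf0 mulr0.
  - by rewrite mulrDr !raddfD /= ea eb mulrDr.
  by rewrite mulrA -rmorphM !fcoefE; case: ifP => _ //; rewrite mulr0.
rewrite cz mulf_eq0 negb_or => /andP[_ /t2P[? e]]; split=> //.
by rewrite e.
Qed.

Definition comp_word (d : nat) (s : seq 'I_n) : T := if size s == d then fword T s else 0.
Definition hcomp (d : nat) : {additive T -> T} :=
  zlext (fun s => cst_scale (fcst T) (comp_word d s)).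

Lemma hcompE d c s : hcomp d (fcst T c * fword T s) =
  if size s == d then fcst T c * fword T s else 0.
Proof.
rewrite /hcomp [LHS]zlextE /= /cst_scale /comp_word.
by case: ifP; rewrite ?mulr0.
Qed.

Lemma hcomp_homog d e t : whomog e t -> hcomp d t = if e == d then t else 0.
Proof.
move: t; apply: whomog_ind => [|a b ea eb|c s <-]; last by rewrite hcompE.
  by rewrite raddf0; case: ifP.
by rewrite raddfD /= ea eb; case: ifP => //; rewrite addr0.
Qed.

Lemma fcoef_hcomp d v t : fcoef v (hcomp d t) = if size v == d then fcoef v t else 0.
Proof.
move: t; apply: free_ind => [|a b ea eb|c s].
- by rewrite !raddf0; case: ifP.
- by rewrite !raddfD /= ea eb; case: ifP => //; rewrite addr0.
rewrite hcompE; case: (s =P v) => [<-|ne].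
  by case: ifP => _; rewrite ?raddf0.
have e : fcoef v (fcst T c * fword T s) = 0 by rewrite fcoefE; case: (s =P v).
by rewrite e if_same; case: ifP => _; rewrite ?raddf0.
Qed.

(** The generators are homogeneous of degree [m], so the ideal is graded. The recorded lengths drive
    the induction in [SP_homog]. *)
Lemma ideal_hcomp d t : J t -> exists L : seq (k * seq 'I_n * 'I_n * seq 'I_n),
  (forall q, q \in L -> (size q.1.1.2 + m + size q.2)%N = d) /\
  hcomp d t = \sum_(q <- L) fcst T q.1.1.1 *
     (fword T q.1.1.2 * slT w T q.1.2 * fword T q.2).
Proof.
elim=> [|a b _ [L [hL eL]] _ [L' [hL' eL']]|a g b [j ->]].
- by exists [::]; split=> //; rewrite raddf0 big_nil.
- exists (L ++ L'); split; last by rewrite raddfD big_cat /= eL eL'.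
  by move=> q; rewrite mem_cat => /orP[/hL|/hL'].
move: b; apply: free_ind => [|b b' [L [hL eL]] [L' [hL' eL']]|c s].
- by exists [::]; split=> //; rewrite mulr0 raddf0 big_nil.
- exists (L ++ L'); split; last by rewrite mulrDr raddfD big_cat /= eL eL'.
  by move=> q; rewrite mem_cat => /orP[/hL|/hL'].
move: a; apply: free_ind => [|b b' [L [hL eL]] [L' [hL' eL']]|c' s'].
- by exists [::]; split=> //; rewrite !mul0r raddf0 big_nil.
- exists (L ++ L'); split; last by rewrite !mulrDl raddfD big_cat /= eL eL'.
  by move=> q; rewrite mem_cat => /orP[/hL|/hL'].
have e : fcst T c' * fword T s' * slT w T j * (fcst T c * fword T s) =
    fcst T (c * c') * (fword T s' * slT w T j * fword T s).
  by rewrite rmorphM mulrA -(fcstC c) -!mulrA.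
have hh : whomog (size s' + m + size s) (fcst T (c * c') *
    (fword T s' * slT w T j * fword T s)).
  rewrite -[X in whomog X]add0n; apply: whomogM; first exact: cst_homog.
  apply: whomogM; last exact: word_homog.
  by apply: whomogM; [exact: word_homog|exact: slT_homog].
rewrite e (hcomp_homog _ hh); case: eqP => [<-|_].
  exists [:: (c * c', s', j, s)]; rewrite big_seq1; split=> // q.
  by rewrite inE => /eqP ->.
by exists [::]; rewrite big_nil.
Qed.

Lemma hcomp_ideal d t : J t -> J (hcomp d t).
Proof.
move=> /(ideal_hcomp d)[L [_ ->]]; elim/big_rec: _ => [|q x _]; first exact: tsi0.
apply: tsiD; rewrite mulrA; apply: tsiMr; rewrite mulrA -[_ * slT _ _ _]mulr1.
by apply: tsiM; exists q.1.2.
Qed.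

(** In a nonzero homogeneous component of [t], the word with the largest [pickle] would be congruent
    to a combination of smaller words of the same length, hence reducible. *)
Lemma normal_indep t : J t -> (forall v, fcoef v t != 0 -> normal_word v) -> t = 0.
Proof.
move=> Jt tn; apply/eqP/contraT => tnz.
have [v0 v0P] : exists v, fcoef v t != 0.
  apply/not_existsP => h; case/eqP: tnz; rewrite (fsum t) big1_seq // => u.
  by rewrite fsuppP => /h.
set x := hcomp (size v0) t; have Jx : J x by exact: hcomp_ideal.
have xh v : fcoef v x != 0 -> size v = size v0 /\ fcoef v t != 0.
  by rewrite fcoef_hcomp; case: (size v =P _) => // _; rewrite eqxx.
pose Q p := has (fun v => pickle v == p) (fsupp x).
have exQ : exists p, Q p.
  exists (pickle v0); apply/hasP; exists v0 => //.
  by rewrite fsuppP fcoef_hcomp eqxx.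
have Qb p : Q p -> (p <= \max_(v <- fsupp x) pickle v)%N.
  by move=> /hasP[v vx /eqP <-]; exact: leq_bigmax_seq.
case: (ex_maxnP exQ Qb) => p /hasP[u ux /eqP pu] pmax.
rewrite fsuppP in ux; have [su ut] := xh u ux; case: (tn u ut).
exists (fword T u - fcst T (fcoef u x)^-1 * x); last first.
  by rewrite opprB addrC subrK; exact: tsiMl.
move=> v; rewrite raddfB /= -[fword T u]mul1r -(rmorph1 (fcst T)) fcoefE.
have cz (c : k) (y : T) : fcoef v (fcst T c * y) = c * fcoef v y.
  move: y; apply: free_ind => [|a b ea eb|d s].
  - by rewrite mulr0 !raddf0 mulr0.
  - by rewrite mulrDr !raddfD /= ea eb mulrDr.
  by rewrite mulrA -rmorphM !fcoefE; case: ifP => _ //; rewrite mulr0.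
rewrite cz; case: (u =P v) => [<-|ne]; first by rewrite mulVf ?subrr ?eqxx.
rewrite sub0r oppr_eq0 mulf_eq0 negb_or => /andP[_ vx].
have [-> _] := xh v vx; rewrite su; split=> //.
have : (pickle v <= p)%N by apply: pmax; apply/hasP; exists v; rewrite ?fsuppP.
rewrite leq_eqVlt pu => /orP[/eqP e|//]; case: ne; rewrite -pu in e.
exact/esym/(pcan_inj (@pickleK (seq 'I_n)))/e.
Qed.

End NormalWords.

Lemma mpolyX_neq0 (R : nzRingType) n (i : 'I_n) : ('X_i : {mpoly R[n]}) != 0.
Proof.
apply/eqP => /(congr1 (mcoeff U_(i))).
by rewrite mcoeffX eqxx mcoeff0 => /eqP; rewrite oner_eq0.
Qed.

Lemma map_uniq_inj (A B : eqType) (f : A -> B) (L : seq A) : uniq [seq f q | q <- L] ->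
  forall x y, x \in L -> y \in L -> f x = f y -> x = y.
Proof.
move=> uL x y /(nthP x)[i iL <-] /(nthP x)[j jL <-] e; congr nth; apply/eqP.
by rewrite -(nth_uniq (f x) _ _ uL) ?size_map // !(nth_map x) // e.
Qed.

Section StructureE.
Variables (k : fieldType) (n m : nat) (w : potential k n m).
Local Notation S := {mpoly k[n]}.
Variables (T : falg k 'I_n) (TS : falg S 'I_n).
Local Notation J := (two_sided_ideal (slT_rel w (T := T))).
Local Notation Jz := (two_sided_ideal (Gz w (TS := TS))).
Local Notation sl := (slTS w TS).
Local Notation nw := (normal_word w T).
Hypothesis hsyz : syz w T.
Hypothesis m0 : (0 < m)%N.

Lemma fcoef_cfm mu v t : fcoef v (cfm T TS mu t) = (fcoef v (t : TS))@_mu.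
Proof.
move: t; apply: free_ind => [|a b ea eb|c s].
- by rewrite !raddf0.
- by rewrite !raddfD /= ?mcoeffD ea eb.
by rewrite cfmE !fcoefE; case: ifP => // _; rewrite mcoeff0.
Qed.

Lemma Jz_coef0 mu p : Jz p -> J (cfm T TS mu p`_0).
Proof.
elim=> [|a b _ ha _ hb|a g b [j ->]].
- by rewrite coef0 raddf0; exact: tsi0.
- by rewrite coefD raddfD; exact: tsiD.
rewrite !coef0M coefB coefC coefMX eqxx subr0; move: a`_0 b`_0 => {a b} a b.
move: b; apply: free_ind => [|b b' h h'|c s].
- by rewrite mulr0 raddf0; exact: tsi0.
- by rewrite mulrDr raddfD; exact: tsiD.
move: a; apply: free_ind => [|a a' h h'|c' s'].
- by rewrite !mul0r raddf0; exact: tsi0.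
- by rewrite !mulrDl raddfD; exact: tsiD.
rewrite (_ : _ * sl j * _ = fcst TS (c * c') * emb T TS (fword T s' * slT w T j * fword T s)).
  by rewrite cfm_emb; apply/tsiMl/tsiM; exists j.
by rewrite !embM !emb_word emb_slT rmorphM mulrA -(fcstC c) -!mulrA.
Qed.

(** Setting [z = 0] turns the generators into the [w_j], so the constant term of [p] lies in the
    ideal coefficientwise over [S] and vanishes by [normal_indep]. A factor [z] is then cancelled by
    regularity. *)
Lemma Jz_indep p : Jz p -> (forall i v, fcoef v p`_i != 0 -> nw v) -> p = 0.
Proof.
elim/poly_ind: p => // p c IH Jp hp.
have c0 : c = 0.
  have hc v : fcoef v c != 0 -> nw v.
    by move=> h; apply: (hp 0%N); rewrite coefD coefMX coefC /= add0r.
  have e mu : cfm T TS mu c = 0.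
    apply: (@normal_indep _ _ _ w) => [|v].
      by have := Jz_coef0 mu Jp; rewrite coefD coefMX coefC /= add0r.
    by rewrite fcoef_cfm => h; apply: hc; apply: contraNneq h => ->; rewrite mcoeff0.
  rewrite (fsum c) big1 // => v _; rewrite (_ : fcoef v c = 0) ?rmorph0 ?mul0r //.
  by apply/mpolyP => mu; rewrite mcoeff0 -fcoef_cfm e raddf0.
rewrite c0 addr0 in Jp hp *; rewrite (IH (Jz_regular hsyz Jp)) ?mul0r // => i v h.
by apply: (hp i.+1); rewrite coefMX.
Qed.

Variable Erel : TS -> Prop.
Hypothesis ErelE : forall g, Erel g <->
  (exists i j, g = fcst TS 'X_i * sl j - fcst TS 'X_j * sl i) \/
  (exists i j, g = fword TS [:: i] * sl j - sl j * fword TS [:: i]).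
Local Notation QE := (quot_ring Erel).
Local Notation pE := (quot_pi Erel).
Local Notation IE := (two_sided_ideal Erel).

Lemma pE_rel a b : Erel (a - b) -> pE a = pE b.
Proof. by move=> h; apply/quot_piP; rewrite -[_ - _]mul1r -[_ * _]mulr1; exact: tsiM. Qed.

Lemma pEM a b : pE (a * b) = pE a * pE b. Proof. exact: rmorphM. Qed.
Lemma pED a b : pE (a + b) = pE a + pE b. Proof. exact: rmorphD. Qed.

Lemma pE_cw i j : pE (fcst TS 'X_i * sl j) = pE (fcst TS 'X_j * sl i).
Proof. by apply/pE_rel/ErelE; left; exists i, j. Qed.

Lemma pE_comm j t : pE (t * sl j) = pE (sl j * t).
Proof.
move: t; apply: free_ind => [|a b ea eb|c s].
- by rewrite mulr0 mul0r.
- by rewrite mulrDr mulrDl !pED ea eb.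
rewrite -mulrA [sl j * _]mulrA -fcstC -mulrA !(pEM (fcst TS c)).
congr (_ * _); elim: s => [|x s IH]; first by rewrite fword0 mulr1 mul1r.
rewrite -cat1s fwordM -mulrA pEM IH -pEM mulrA mulrA !(pEM _ (fword TS s)).
by congr (_ * _); apply/pE_rel/ErelE; right; exists x, j.
Qed.

(** In [S<x>[z] / (w_j - c_j z)] each [w_j] equals [c_j z] with [z] central, so both kinds of
    relations of [E] hold there. *)
Lemma IE_Jz t : IE t -> Jz t%:P.
Proof.
elim=> [|a b _ ha _ hb|a g b /ErelE hg]; first by rewrite rmorph0; exact: tsi0.
  by rewrite rmorphD; exact: tsiD.
rewrite !rmorphM; apply/tsiMr/tsiMl; case: hg => -[i [j ->]].
  rewrite [X in Jz X](_ : _ = (fcst TS 'X_i)%:P * gz w TS j - (fcst TS 'X_j)%:P * gz w TS i).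
    by apply: tsiD; [|apply: tsiN]; apply/tsiMl/gz_ideal.
  rewrite /gz !mulrBr opprB !mulrA (cstPC 'X_i (fcst TS 'X_j)%:P) addrA subrK.
  by rewrite -!rmorphM -rmorphB.
rewrite [X in Jz X](_ : _ = (fword TS [:: i])%:P * gz w TS j - gz w TS j * (fword TS [:: i])%:P).
  by apply: tsiD; [|apply: tsiN]; [apply/tsiMl|apply/tsiMr]; exact: gz_ideal.
have e : (fword TS [:: i])%:P * ((fcst TS 'X_j)%:P * 'X) =
    (fcst TS 'X_j)%:P * 'X * (fword TS [:: i])%:P.
  by rewrite mulrA -cstPC -!mulrA polyXC.
by rewrite /gz mulrBr mulrBl opprB e addrA subrK -!rmorphM -rmorphB.
Qed.

Variable i0 : 'I_n.
(* The basis elements [u z^r], with [z = w_i / c_i]. *)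
Definition bel (b : seq 'I_n * nat) : TS := fword TS b.1 * sl i0 ^+ b.2.

(** In the deformation [w_i ^+ r] becomes [c_i^r z^r], so the combination becomes a polynomial in
    [z] supported on normal words, with coefficients multiplied by the nonzero elements [c_i^r] of a
    domain. *)
Lemma bel_indep (L : seq (S * (seq 'I_n * nat))) :
  uniq [seq q.2 | q <- L] -> (forall q, q \in L -> nw q.2.1) ->
  pE (\sum_(q <- L) fcst TS q.1 * bel q.2) = 0 -> forall q, q \in L -> q.1 = 0.
Proof.
move=> uL nL e0.
pose p : {poly TS} := \sum_(q <- L)
  (fcst TS (q.1 * 'X_i0 ^+ (q.2.2)) * fword TS q.2.1)%:P * 'X^(q.2.2).
have pc i v : fcoef v p`_i = \sum_(q <- L) (if q.2 == (v, i) then q.1 * 'X_i0 ^+ i else 0).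
  rewrite coef_sum raddf_sum; apply: eq_bigr => -[s [u r]] _ /=.
  rewrite coefCM coefXn xpair_eqE andbC [i == r]eq_sym; case: (r =P i) => [->|_] /=.
    by rewrite mulr1 fcoefE.
  by rewrite mulr0 raddf0.
pose pz := quot_pi (Gz w (TS := TS)).
have pzM a b : pz (a * b) = pz a * pz b by exact: rmorphM.
have hs r : pz (sl i0 ^+ r)%:P = pz ((fcst TS ('X_i0 ^+ r))%:P * 'X^r).
  elim: r => [|r IH]; first by rewrite !expr0 mulr1 (rmorph1 (fcst TS)).
  rewrite exprS polyCM pzM IH [pz (sl i0)%:P]piz_slTS -pzM; congr (pz _).
  rewrite !exprS rmorphM polyCM -!mulrA; congr (_ * _).
  by rewrite [LHS]mulrA [X in X * _ = _]polyXC -mulrA.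
have Jp : Jz p.
  rewrite -[p]subr0; apply/quot_piP; rewrite [RHS]rmorph0.
  transitivity (quot_pi (Gz w (TS := TS)) (\sum_(q <- L) fcst TS q.1 * bel q.2)%:P).
    rewrite !rmorph_sum; apply: eq_bigr => -[s [u r]] _; rewrite /bel.
    change (pz ((fcst TS (s * 'X_i0 ^+ r) * fword TS u)%:P * 'X^r) = pz (fcst TS s * (fword TS u * sl i0 ^+ r))%:P); apply: esym.
    transitivity (pz ((fcst TS s)%:P * (fword TS u)%:P) * pz (sl i0 ^+ r)%:P).
      by rewrite -pzM -!polyCM mulrA.
    rewrite hs -pzM; congr (pz _); rewrite !polyCM rmorphM polyCM -!mulrA; congr (_ * _).
    by rewrite [LHS]mulrA -cstPC -mulrA.
  rewrite -(rmorph0 (quot_pi (Gz w (TS := TS)))); apply/quot_piP; rewrite subr0.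
  by apply: IE_Jz; rewrite -[X in IE X]subr0; apply/quot_piP; rewrite e0 rmorph0.
have p0 : p = 0.
  apply: Jz_indep => // i v; rewrite pc => h; apply: contrapT => nv; case/eqP: h.
  rewrite big1_seq // => q /= qL; case: eqP => // e; case: nv.
  by have := nL _ qL; rewrite e.
move=> [s [u r]] qL /=.
have := pc r u; rewrite p0 coef0 raddf0 (bigD1_seq (s, (u, r))) //=; last first.
  by move: uL; exact: map_uniq.
rewrite eqxx big1_seq ?addr0.
  move=> /esym/eqP; rewrite mulf_eq0 expf_eq0 (negPf (mpolyX_neq0 _ i0)) andbF orbF.
  exact/eqP.
move=> q /andP[nq q'L]; case: eqP => // e; case/eqP: nq.
by apply: (map_uniq_inj (f := snd) uL).
Qed.

(** Membership in the span of the basis over the chart [c_i <> 0], with the denominator [c_i^N]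
    cleared. Here [e] is the degree of [x] in the [c_i], and [Q] restricts the degrees in the [x_i],
    each [z] counting for [m]. *)
Definition SP (e : nat) (Q : nat -> Prop) (x : TS) : Prop :=
  exists N (L : seq (S * (seq 'I_n * nat))),
  (forall q, q \in L -> [/\ q.1 \is (N + e).-homog, nw q.2.1 & Q (size q.2.1 + m * q.2.2)%N])
  /\ pE (fcst TS ('X_i0 ^+ N) * x) = pE (\sum_(q <- L) fcst TS q.1 * bel q.2).

Lemma Xn_homog (i : 'I_n) N : ('X_i : S) ^+ N \is N.-homog.
Proof.
elim: N => [|N IH]; first by rewrite expr0; exact: dhomog1.
rewrite exprS -add1n; apply: dhomogM => //.
by rewrite dhomogX; apply/eqP; exact: mdeg1.
Qed.

Lemma mpolyC_homog (c : k) : (c%:MP : S) \is 0.-homog.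
Proof. rewrite -[_%:MP]mulr1 mul_mpolyC; exact/rpredZ/dhomog1. Qed.

Lemma SP0 e Q : SP e Q 0.
Proof. by exists 0%N, [::]; split=> //; rewrite mulr0 big_nil. Qed.

Lemma SPD e Q x y : SP e Q x -> SP e Q y -> SP e Q (x + y).
Proof.
move=> [N [L [hL eL]]] [N' [L' [hL' eL']]].
exists (N + N')%N, ([seq ('X_i0 ^+ N' * q.1, q.2) | q <- L] ++
  [seq ('X_i0 ^+ N * q.1, q.2) | q <- L']); split.
  move=> q; rewrite mem_cat => /orP[]/mapP[q' q'L ->] /=.
    by have [? ? ?] := hL q' q'L; split=> //; rewrite addnAC addnC; exact: dhomogM (Xn_homog _ _) _.
  by have [? ? ?] := hL' q' q'L; split=> //; rewrite -addnA; exact: dhomogM (Xn_homog _ _) _.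
rewrite big_cat !big_map mulrDr !pED; congr (_ + _).
  rewrite addnC exprD (rmorphM (fcst TS)) -mulrA pEM eL -pEM mulr_sumr.
  by congr (pE _); apply: eq_bigr => q _; rewrite (rmorphM (fcst TS)) mulrA.
rewrite exprD (rmorphM (fcst TS)) -mulrA pEM eL' -pEM mulr_sumr.
by congr (pE _); apply: eq_bigr => q _; rewrite (rmorphM (fcst TS)) mulrA.
Qed.

Lemma SPZ e e' Q s x : s \is e'.-homog -> SP e Q x -> SP (e + e') Q (fcst TS s * x).
Proof.
move=> hs [N [L [hL eL]]]; exists N, [seq (s * q.1, q.2) | q <- L]; split.
  move=> _ /mapP[q /hL[? ? ?] ->] /=; split=> //.
  by rewrite addnA addnC; exact: dhomogM.
rewrite big_map mulrA -fcstC -mulrA pEM eL -pEM mulr_sumr.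
by congr (pE _); apply: eq_bigr => q _; rewrite (rmorphM (fcst TS)) mulrA.
Qed.

Lemma SPW e Q Q' x : (forall j, Q j -> Q' j) -> SP e Q x -> SP e Q' x.
Proof.
by move=> h [N [L [hL eL]]]; exists N, L; split=> // q /hL[? ? /h].
Qed.

(** Over the chart, [w_j] is [(c_j / c_i) w_i]: one more power of [c_i] trades it for the central
    element [w_i], which raises the exponent of each basis element by one. *)
Lemma SP_step d a b j : SP 0 (eq d) (a * b) -> SP 0 (eq (d + m)%N) (a * sl j * b).
Proof.
move=> [N [L [hL eL]]].
exists N.+1, [seq ('X_j * q.1, (q.2.1, q.2.2.+1)) | q <- L]; split.
  move=> _ /mapP[q /hL[h1 h2 ->] ->] /=; split=> //; last by rewrite mulnS addnA addnAC.
  rewrite -add1n -addnA; apply: dhomogM => //.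
  by have := Xn_homog j 1; rewrite expr1.
have e : pE (fcst TS 'X_i0 * (a * sl j * b)) = pE (fcst TS 'X_j * (a * b * sl i0)).
  transitivity (pE (a * (fcst TS 'X_i0 * sl j) * b)).
    by congr (pE _); rewrite !mulrA fcstC.
  rewrite pEM (pEM a) pE_cw -2!pEM.
  transitivity (pE (fcst TS 'X_j * a) * pE (sl i0 * b)).
    by rewrite -pEM; congr (pE _); rewrite !mulrA fcstC.
  by rewrite -pE_comm -pEM !mulrA.
rewrite big_map exprSr (rmorphM (fcst TS)) -mulrA pEM e -pEM.
transitivity (pE (fcst TS 'X_j) * (pE (fcst TS ('X_i0 ^+ N) * (a * b)) * pE (sl i0))).
  by rewrite -!pEM; congr (pE _); rewrite !mulrA fcstC.
rewrite eL -!pEM mulr_suml mulr_sumr; congr (pE _); apply: eq_bigr => q _; rewrite /bel /= exprSr (rmorphM (fcst TS)).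
by rewrite !mulrA.
Qed.

(** Strong induction on the length: modulo normal words, a word is a combination of elements
    [a w_j b], and there [a b] is shorter by [m > 0], so that [SP_step] applies. *)
Lemma SP_homog d t : whomog d t -> SP 0 (eq d) (emb T TS t).
Proof.
have [e] := ubnP d; elim: e d t => // e IH d t de.
move: t; apply: whomog_ind => [|a b ha hb|c s sd].
- by rewrite raddf0; exact: SP0.
- by rewrite raddfD; exact: SPD.
rewrite embE -(emb_word T TS); apply: (SPZ (e := 0) (e' := 0) (mpolyC_homog _)); have [t tP Jt] := normal_span w T s.
have ht : whomog d t by move=> v /tP[_ ->].
rewrite -(subrK t (fword T s)) raddfD; apply: SPD; last first.
  exists 0%N, [seq ((fcoef v t)%:MP, (v, 0%N)) | v <- fsupp t]; split.
    move=> _ /mapP[v vt ->] /=; rewrite fsuppP in vt; have [nv sv] := tP v vt.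
    by split; rewrite ?muln0 ?addn0 ?sv //; exact: mpolyC_homog.
  rewrite expr0 (rmorph1 (fcst TS)) mul1r big_map; congr (pE _).
    rewrite [in LHS](fsum t) raddf_sum.
  by apply: eq_bigr => v _; rewrite embE /bel expr0 mulr1.
have [L [hL eL]] := ideal_hcomp d Jt.
have e1 : fword T s - t = hcomp T d (fword T s - t).
  rewrite (hcomp_homog d (e := d)) ?eqxx //; apply: whomogB => //.
  by rewrite -sd; exact: word_homog.
rewrite e1 eL raddf_sum big_seq; elim/big_rec: _ => [|q x qL hx]; first exact: SP0.
apply: SPD => //; have dq := hL q qL.
rewrite embM emb_cst; apply: (SPZ (e := 0) (e' := 0) (mpolyC_homog _)); rewrite !embM emb_slT.
have ed : (size q.1.1.2 + size q.2 + m)%N = d by rewrite -dq addnAC.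
rewrite -[in SP _ _]ed; apply: SP_step; rewrite -embM; apply: IH.
  rewrite -ltnS; apply: leq_trans de; rewrite ltnS -dq addnAC -[X in (X < _)%N]addn0.
  by rewrite ltn_add2l.
by apply: whomogM; exact: word_homog.
Qed.

Lemma SP_span e (Q : nat -> Prop) t : (forall u, fcoef u t \is e.-homog) ->
  (forall u, fcoef u t != 0 -> Q (size u)) -> SP e Q t.
Proof.
move=> he hQ; rewrite (fsum t) big_seq; elim/big_rec: _ => [|u x]; first exact: SP0.
rewrite fsuppP => /hQ qu hx; apply: SPD => //; rewrite -[e]add0n.
apply: SPZ => //; apply: (SPW (Q := eq (size u))) => [j <-//|].
rewrite -(emb_word T TS); exact/SP_homog/word_homog.
Qed.

Lemma SP_uniq e (Q : nat -> Prop) x : SP e Q x ->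
  exists N (L : seq (S * (seq 'I_n * nat))), [/\ uniq [seq q.2 | q <- L],
  (forall q, q \in L -> [/\ q.1 \is (N + e).-homog, nw q.2.1 & Q (size q.2.1 + m * q.2.2)%N])
  & pE (fcst TS ('X_i0 ^+ N) * x) = pE (\sum_(q <- L) fcst TS q.1 * bel q.2)].
Proof.
move=> [N [L [hL eL]]]; exists N.
exists [seq (\sum_(q <- L | q.2 == b) q.1, b) | b <- undup [seq q.2 | q <- L]]; split.
- by rewrite -map_comp map_id undup_uniq.
- move=> q' /mapP[b]; rewrite mem_undup => /mapP[q0 q0L ->] -> /=.
  have [_ h2 h3] := hL _ q0L; split=> //.
  by rewrite big_seq_cond; apply: rpred_sum => q /andP[/hL[]].
rewrite eL big_map; congr (pE _).
transitivity (\sum_(b <- undup [seq q.2 | q <- L]) \sum_(q <- L | q.2 == b) fcst TS q.1 * bel q.2).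
  rewrite (exchange_big_dep xpredT) //= [LHS]big_seq [RHS]big_seq; apply: eq_bigr => q qL.
  rewrite (big_rem q.2) /= ?mem_undup ?map_f // eqxx big_seq_cond big_pred0 ?addr0 // => b.
  by rewrite mem_rem_uniq ?undup_uniq // inE eq_sym; case: eqP; rewrite //= andbF.
apply: eq_bigr => b _; rewrite rmorph_sum mulr_suml; apply: eq_bigr => q /eqP -> //.
Qed.

Lemma fcoef_emb u (t : T) : fcoef u (emb T TS t) = (fcoef u t)%:MP.
Proof.
move: t; apply: free_ind => [|a c ea ec|c s].
- by rewrite !raddf0.
- by rewrite !raddfD /= ea ec.
by rewrite embE !fcoefE; case: ifP => // _; rewrite raddf0.
Qed.

Lemma quot_span e (Q : nat -> Prop) t : (forall u, fcoef u t \is e.-homog) ->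
  (forall u, fcoef u t != 0 -> Q (size u)) ->
  exists N (L : seq (S * (seq 'I_n * nat))), [/\ uniq [seq q.2 | q <- L],
  (forall q, q \in L -> [/\ q.1 \is (N + e).-homog, nw q.2.1 & Q (size q.2.1 + m * q.2.2)%N])
  & pE (fcst TS ('X_i0 ^+ N)) * pE t = \sum_(q <- L) pE (fcst TS q.1) * pE (bel q.2)].
Proof.
move=> h1 h2; have [N [L [uL hL eL]]] := SP_uniq (SP_span h1 h2).
exists N, L; split=> //; rewrite -pEM eL rmorph_sum.
by apply: eq_bigr => q _; rewrite -pEM.
Qed.

Lemma quot_indep (L : seq (S * (seq 'I_n * nat))) :
  uniq [seq q.2 | q <- L] -> (forall q, q \in L -> nw q.2.1) ->
  \sum_(q <- L) pE (fcst TS q.1) * pE (bel q.2) = 0 -> forall q, q \in L -> q.1 = 0.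
Proof.
move=> uL nL e0; apply: bel_indep => //; rewrite -[RHS]e0 rmorph_sum.
by apply: eq_bigr => q _; rewrite -pEM.
Qed.

End StructureE.

(** * The algebra [E] *)

Section StructureEw.
Variables (k : fieldType) (n m : nat) (w : potential k n m).
Local Notation S := {mpoly k[n]}.
Local Notation T := (malg_falg k 'I_n).
Local Notation TS := (malg_falg S 'I_n).
Hypothesis hsyz : syz w T.
Hypothesis m0 : (0 < m)%N.

Definition basis_elt := (seq 'I_n * nat)%type.
Definition bdeg (b : basis_elt) : nat := (size b.1 + m * b.2)%N.
Definition bnormal (b : basis_elt) : Prop := normal_word w T b.1.
Definition ebel (i : 'I_n) (b : basis_elt) : E w := E_pi w (bel w TS i b).

Lemma ErelP (g : TS) : E_relations w g <->
  (exists i j, g = fcst TS 'X_i * slTS w TS j - fcst TS 'X_j * slTS w TS i) \/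
  (exists i j, g = fword TS [:: i] * slTS w TS j - slTS w TS j * fword TS [:: i]).
Proof.
split=> [[i j|i j]|[[i [j ->]]|[i [j ->]]]].
- by left; exists i, j.
- by right; exists i, j.
- exact: E_rel_cw.
- exact: E_rel_xw.
Qed.

Lemma E_span i e (Q : nat -> Prop) (t : TS) : (forall u, fcoef u t \is e.-homog) ->
  (forall u, fcoef u t != 0 -> Q (size u)) ->
  exists N (L : seq (S * basis_elt)), [/\ uniq [seq q.2 | q <- L],
  (forall q, q \in L -> [/\ q.1 \is (N + e).-homog, bnormal q.2 & Q (bdeg q.2)])
  & E_cst w ('X_i ^+ N) * E_pi w t = \sum_(q <- L) E_cst w q.1 * ebel i q.2].
Proof. exact: (quot_span T m0 ErelP i). Qed.

Lemma E_indep i (L : seq (S * basis_elt)) : uniq [seq q.2 | q <- L] ->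
  (forall q, q \in L -> bnormal q.2) ->
  \sum_(q <- L) E_cst w q.1 * ebel i q.2 = 0 -> forall q, q \in L -> q.1 = 0.
Proof. exact: (quot_indep hsyz ErelP). Qed.

Lemma bel_homog (TS : falg S 'I_n) i b u : fcoef u (bel w TS i b) \is 0.-homog /\
  (fcoef u (bel w TS i b) != 0 -> size u = bdeg b).
Proof.
have [t [et ht]] : exists t : T, bel w TS i b = emb T TS t /\ whomog (bdeg b) t.
  exists (fword T b.1 * slT w T i ^+ b.2); split.
    rewrite /bel embM emb_word; congr (_ * _).
    elim: b.2 => [|r IH]; first by rewrite !expr0 -(fword0 T) emb_word fword0.
    by rewrite !exprS embM emb_slT IH.
  apply: whomogM; first exact: word_homog.
  elim: b.2 => [|r IH]; first by rewrite expr0 muln0 -fword0; exact: word_homog.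
  by rewrite exprS mulnS; apply: whomogM => //; exact: slT_homog.
rewrite et fcoef_emb; split; first exact: mpolyC_homog.
by rewrite mpolyC_eq0; exact: ht.
Qed.

End StructureEw.

Import Defs.

(** * Affine open subschemes *)

Definition is_ideal (R : comPzRingType) (I : R -> Prop) : Prop :=
  [/\ I 0, forall a b, I a -> I b -> I (a + b) & forall a b, I b -> I (a * b)].

(** An ideal maximal among those that contain [I] and avoid the powers of [f] is prime. *)
Lemma krull (R : comPzRingType) (I : R -> Prop) f : is_ideal I ->
  (forall N, ~ I (f ^+ N)) ->
  exists q, [/\ prime_ideal q, forall x, I x -> q x & ~ q f].
Proof.
move=> [I0 ID IM] fI.
pose good (X : R -> Prop) := [/\ is_ideal X, forall x, I x -> X x & forall N, ~ X (f ^+ N)].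
have [|A [PA maxA]] := @classical_sets.Zorn_bigcup R
    (fun X => good X \/ forall x, ~ X x).
  move=> F FP tot; have [[X [FX [x Xx]]]|none] := pselect (exists X, F X /\ exists x, X x).
    2:{ by right => x [X FX Xx]; apply: none; exists X; split=> //; exists x. }
  have gX Y : F Y -> (exists y, Y y) -> good Y.
    by move=> /FP[//|h] [y /h].
  left; split.
  - split=> [|a b [Y FY Ya] [Z FZ Zb]|a b [Y FY Yb]].
    + by have [[X0 _ _] _ _] := gX X FX (ex_intro _ x Xx); exists X.
    + have [YZ|ZY] := tot Y Z FY FZ.
        have [[_ h _] _ _] := gX Z FZ (ex_intro _ b Zb).
        by exists Z => //; apply: h => //; apply: YZ.
      have [[_ h _] _ _] := gX Y FY (ex_intro _ a Ya).
      by exists Y => //; apply: h => //; apply: ZY.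
    + have [[_ _ h] _ _] := gX Y FY (ex_intro _ b Yb).
      by exists Y => //; apply: h.
  - by move=> y Iy; have [_ h _] := gX X FX (ex_intro _ x Xx); exists X => //; apply: h.
  - by move=> N [Y FY YN]; have [_ _ h] := gX Y FY (ex_intro _ _ YN); apply: (h N).
have gA : good A.
  case: PA => // A0; exfalso; have gI : good I by split.
  apply: (maxA I); last by left.
  by split=> [x /A0//|h]; apply: (A0 0); apply: h.
have [[A0 AD AM] IA fA] := gA.
have big a : ~ A a -> exists N x r, A x /\ f ^+ N = x + r * a.
  move=> nAa; pose X y := exists x r, A x /\ y = x + r * a.
  apply: contrapT => none; apply: (maxA X).
    split=> [x Ax|h]; first by exists x, 0; rewrite mul0r addr0.
    by apply: nAa; apply: h; exists 0, 1; rewrite mul1r add0r.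
  left; split.
  - split=> [|_ _ [x [r [Ax ->]]] [y [s [Ay ->]]]|b _ [x [r [Ax ->]]]].
    + by exists 0, 0; rewrite mul0r addr0.
    + by exists (x + y), (r + s); rewrite mulrDl addrACA; split=> //; exact: AD.
    + by exists (b * x), (b * r); rewrite mulrDr mulrA; split=> //; exact: (AM).
  - by move=> x /IA Ax; exists x, 0; rewrite mul0r addr0.
  - by move=> N [x [r [Ax e]]]; apply: none; exists N, x, r.
exists A; split=> //; last by have := fA 1%N; rewrite expr1.
split=> //; first by have := fA 0%N; rewrite expr0.
move=> a b Aab; apply: contrapT => /not_orP[/big[N [x [r [Ax eN]]]] /big[M [y [s [Ay eM]]]]].
apply: (fA (N + M)%N); rewrite exprD eN eM mulrDl; apply: (AD).
  by rewrite mulrC; exact: (AM).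
rewrite mulrDr; apply: (AD); first exact: (AM).
by rewrite (_ : _ * _ = r * s * (a * b)); [exact: (AM)|ring].
Qed.

(** * Fractions at a point, vanishing, and nonvanishing loci of functions *)

Section Points.
Variables (k : fieldType) (n : nat).
Local Notation S := {mpoly k[n]}.
Local Notation SG := (@S_galg k n).
Implicit Types (p q : point k n).

(* The fraction [a / s], or [0] when it is not an element of [A_(p)]. *)
Definition lfrac (A : galg k n) p (a : A) (s : S) : loc A p :=
  if pselect (exists x : frac A p, num x = a /\ den x = s) is left h
  then loc_pi (projT1 (cid h)) else 0.

Definition isfrac (A : galg k n) p (a : A) (s : S) : Prop :=
  exists d, [/\ cdeg d a, s \is d.-homog & ~ p s].

Section Lfrac.
Variables (A : galg k n) (p : point k n).
Implicit Types (a b : A) (s t : S).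

Lemma lfracE (x : frac A p) : loc_pi x = lfrac p (num x) (den x).
Proof.
rewrite /lfrac; case: pselect => [h|[]]; last by exists x.
by case: (cid h) => y /= [e1 e2]; apply: frac_eqW; rewrite e1 e2.
Qed.

Lemma isfrac_num (x : frac A p) : isfrac p (num x) (den x).
Proof. by exists (frac_deg x); split; [exact: num_deg|exact: den_deg|exact: den_out]. Qed.

Lemma lfracP a s : isfrac p a s -> exists2 x : frac A p, num x = a /\ den x = s & lfrac p a s = loc_pi x.
Proof.
move=> [d [h1 h2 h3]]; exists (Frac h1 h2 h3) => //.
by rewrite (lfracE (Frac h1 h2 h3)).
Qed.

Lemma loc_lfrac (z : loc A p) : exists a s, isfrac p a s /\ z = lfrac p a s.
Proof.
have [x ->] := loc_surj z; exists (num x), (den x).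
by split; [exact: isfrac_num|exact: lfracE].
Qed.

Lemma isfracD a b s : isfrac p a s -> isfrac p b s -> s != 0 -> isfrac p (a + b) s.
Proof.
move=> [d [h1 h2 h3]] [d' [h1' h2' _]] s0; exists d; split=> //.
by apply: cdegD => //; rewrite (dhomog_uniq s0 h2 h2').
Qed.

Lemma out_neq0 s : ~ p s -> s != 0.
Proof. by apply: contra_notN => /eqP ->; exact: prime0 (pt_prime p). Qed.

Lemma isfrac_neq0 a s : isfrac p a s -> s != 0.
Proof. by move=> [d [_ _ /out_neq0]]. Qed.

Lemma lfracD a b s : isfrac p a s -> isfrac p b s ->
  lfrac p a s + lfrac p b s = lfrac p (a + b) s.
Proof.
move=> ha hb; have hab := isfracD ha hb (isfrac_neq0 ha).
have [x [ex dx] ->] := lfracP ha; have [y [ey dy] ->] := lfracP hb.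
have [z [ez dz] ->] := lfracP hab.
rewrite [LHS]loc_addE; apply: frac_eqW => /=; rewrite ex ey ez dx dy dz.
by rewrite !mulrDr !gcstMl.
Qed.

Lemma lfrac0 s : lfrac p (0 : A) s = 0.
Proof.
rewrite /lfrac; case: pselect => // h; case: (cid h) => x /= [ex dx].
rewrite [RHS](_ : 0 = loc_pi (frac0 A p)) //; apply: frac_eqW => /=.
by rewrite ex !mulr0.
Qed.

Lemma lfrac_sum (I : Type) (L : seq I) (F : I -> A) s :
  (forall i, isfrac p (F i) s) ->
  \sum_(i <- L) lfrac p (F i) s = lfrac p (\sum_(i <- L) F i) s.
Proof.
move=> h; case: L => [|i L]; first by rewrite !big_nil lfrac0.
have [_ ] : isfrac p (\sum_(j <- i :: L) F j) s /\
   \sum_(j <- i :: L) lfrac p (F j) s = lfrac p (\sum_(j <- i :: L) F j) s; last by [].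
elim: L i => [|j L IH] i; first by rewrite !big_seq1.
have [h1 h2] := IH j; have h3 := isfracD (h i) h1 (isfrac_neq0 (h i)).
split; first by rewrite big_cons.
by rewrite [LHS]big_cons h2 lfracD // [in RHS]big_cons.
Qed.

Lemma isfracM a b s t : isfrac p a s -> isfrac p b t -> isfrac p (a * b) (s * t).
Proof.
move=> [d [h1 h2 h3]] [e [h1' h2' h3']]; exists (d + e)%N.
by split; [exact: cdegM|exact: dhomogM|exact: primeM_out].
Qed.

Lemma lfracM a b s t : isfrac p a s -> isfrac p b t ->
  lfrac p a s * lfrac p b t = lfrac p (a * b) (s * t).
Proof.
move=> ha hb; have [z [ez dz] ->] := lfracP (isfracM ha hb).
have [x [ex dx] ->] := lfracP ha; have [y [ey dy] ->] := lfracP hb.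
by rewrite [LHS]loc_mulE; apply: frac_eqW => /=; rewrite ex ey ez dx dy dz.
Qed.

Lemma lfrac_eqP a b s t : isfrac p a s -> isfrac p b t ->
  lfrac p a s = lfrac p b t <->
  exists d (u : S), [/\ u \is d.-homog, ~ p u &
    gcst A u * (gcst A t * a) = gcst A u * (gcst A s * b)].
Proof.
move=> ha hb; have [x [ex dx] ->] := lfracP ha; have [y [ey dy] ->] := lfracP hb.
by rewrite loc_piP /frac_eq ex ey dx dy.
Qed.

End Lfrac.

Lemma loc_str_lfrac (A : galg k n) p (a s : S) : isfrac (A := SG) p a s ->
  loc_str A (lfrac (A := SG) p a s) = lfrac p (gcst A a) s /\ isfrac p (gcst A a) s.
Proof.
move=> h; have [x [ex dx] ->] := lfracP h.
by rewrite loc_strE -ex -dx lfracE; split=> //; exact: (isfrac_num (frac_str A x)).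
Qed.

Lemma vanP p (x : frac SG p) : vanishes (loc_pi x) <-> p (num x).
Proof.
split=> [[y /loc_piP[d [s [hs ps e]]] py]|h]; last by exists x.
have pp := pt_prime p; have : p (s * (den y * num x)).
  by rewrite [X in p X]e; do 2!apply: primeMl (pp) _ _ _.
by case/(primeM pp) => // /(primeM pp)[/(den_out (f := y))|].
Qed.

Lemma vanD p (z z' : loc SG p) : vanishes z -> vanishes z' -> vanishes (z + z').
Proof.
have [x ->] := loc_surj z; have [y ->] := loc_surj z'.
rewrite [_ + _]loc_addE => /vanP h /vanP h'; apply/vanP => /=.
by apply: (primeD (pt_prime p)); apply: (primeMl (pt_prime p)).
Qed.

Lemma vanM p (z z' : loc SG p) : vanishes (z * z') <-> vanishes z \/ vanishes z'.
Proof.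
have [x ->] := loc_surj z; have [y ->] := loc_surj z'.
rewrite [_ * _]loc_mulE !vanP /=; split; first exact: (primeM (pt_prime p)).
case=> h; last exact: (primeMl (pt_prime p)).
by rewrite mulrC; exact: (primeMl (pt_prime p)).
Qed.

Lemma van1 p : ~ vanishes (1 : loc SG p).
Proof. by move/(vanP (frac1 SG p)) => /(prime1 (pt_prime p)). Qed.

Lemma van0 p : vanishes (0 : loc SG p).
Proof. by apply/(vanP (frac0 SG p))/(prime0 (pt_prime p)). Qed.

Lemma van_inv p (z : loc SG p) : ~ vanishes z -> exists z', z' * z = 1.
Proof.
have [x ->] := loc_surj z => /vanP px.
exists (loc_pi (@Frac k n SG p (den x) (num x) (frac_deg x) (den_deg x) (num_deg x) px)).
rewrite [LHS]loc_mulE; apply: (frac_eqW (y := frac1 SG p)) => /=.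
by rewrite !mul1r mulr1 mulrC.
Qed.

Section Nz.
Variable (U : opn k n).
Implicit Types f g : O U.

Definition nz f p : Prop := exists Up : U p, ~ vanishes (sval f Up).

Lemma nz_in f p : nz f p -> U p. Proof. by case. Qed.

Lemma nzM f g p : nz (f * g) p <-> nz f p /\ nz g p.
Proof.
split=> [[Up h]|[[Up h] [Up' h']]].
  by split; exists Up => h'; apply/h/vanM; [left|right].
exists Up => /vanM[//|]; by rewrite (Prop_irrelevance Up Up').
Qed.

Lemma nz1 p : U p -> nz 1 p.
Proof. by move=> Up; exists Up; exact: van1. Qed.

Lemma nzX f N p : nz f p -> nz (f ^+ N) p.
Proof.
move=> h; elim: N => [|N IH]; first by rewrite expr0; apply: nz1; exact: nz_in h.
by rewrite exprS; apply/nzM.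
Qed.

Lemma nzD f g p : nz (f + g) p -> nz f p \/ nz g p.
Proof.
move=> [Up h]; apply: contrapT => /not_orP[h1 h2]; apply: h; apply: vanD.
  by apply: contrapT => h; apply: h1; exists Up.
by apply: contrapT => h; apply: h2; exists Up.
Qed.

Lemma nz0 p : ~ nz 0 p. Proof. by move=> [Up]; apply; exact: van0. Qed.

(** A section that equals [a / s] at one point equals it nearby: it suffices to stay where [s] and
    the factor [u] witnessing the equality of fractions do not vanish. *)
Lemma lfrac_local (A : galg k n) (W : opn k n) (t : sect A W) p (Wp : W p) a s : isfrac p a s ->
  sval t Wp = lfrac p a s -> exists V : opn k n, V p /\
  forall q (Wq : W q), V q -> isfrac q a s /\ sval t Wq = lfrac q a s.
Proof.
move=> hf e; have [V [d [a' [b' [ha [hb [Vp hV]]]]]]] := sval_local t Wp.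
have [pb e1] := hV p Wp Vp; have hf' := isfrac_num (Frac ha hb pb).
move: e; rewrite e1 lfracE => /(lfrac_eqP hf' hf)[d' [u [uh pu /= eu]]].
have [ds [hs1 hs2 hs3]] := hf.
have Vop : zariski_open (fun q => V q /\ ~ q (s * u)).
  move=> q [/(opn_open (o := V))[d1 [s1 [h1 h2 h3]]] h4].
  exists (d1 + (ds + d'))%N, (s1 * (s * u)); split.
  - by apply: dhomogM => //; exact: dhomogM.
  - exact: primeM_out.
  move=> r hr; split=> [|h]; first apply: h3 => h; apply: hr.
    by rewrite mulrC; apply: (primeMl (pt_prime r)).
  by apply: (primeMl (pt_prime r)).
exists (Opn Vop); split; first by split=> //; exact: primeM_out.
move=> q Wq [Vq /= qsu]; have [qb ->] := hV q Wq Vq.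
have qu : ~ q u by move=> h; apply: qsu; apply: (primeMl (pt_prime q)).
have qs : ~ q s by move=> h; apply: qsu; rewrite mulrC; apply: (primeMl (pt_prime q)).
have hq : isfrac q a s by exists ds.
split=> //; rewrite lfracE; apply/(lfrac_eqP (isfrac_num _) hq) => /=.
by exists d', u.
Qed.

Lemma nz_open f : zariski_open (nz f).
Proof.
move=> p [Up h]; have [a [s [hf e]]] := loc_lfrac (sval f Up).
have [V [Vp hV]] := lfrac_local hf e.
have [d [hd1 hd2 hd3]] := hf.
have pa : ~ p a.
  move=> pa; apply: h; have [x [ex dx] e'] := lfracP hf.
  by rewrite e e'; apply/vanP; rewrite ex.
have [dV [sV [V1 V2 V3]]] := opn_open Vp; have [dU [sU [U1 U2 U3]]] := opn_open Up.
exists (dV + (dU + d))%N, (sV * (sU * a)); split.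
- by apply: dhomogM => //; apply: dhomogM.
- by apply: primeM_out => //; apply: primeM_out.
move=> q hq; have qp := pt_prime q.
have qV : V q by apply: V3 => h'; apply: hq; rewrite mulrC; apply: (primeMl qp).
have qU : U q.
  by apply: U3 => h'; apply: hq; apply: (primeMl qp); rewrite mulrC; apply: (primeMl qp).
have qa : ~ q a by move=> h'; apply: hq; do 2!apply: (primeMl qp).
exists qU; have [hfq ->] := hV q qU qV; have [x [ex dx] ->] := lfracP hfq.
by move/vanP; rewrite ex.
Qed.

Definition dopn f : opn k n := Opn (nz_open (f := f)).
Lemma dopn_sub f : opn_sub (dopn f) U. Proof. by move=> p /nz_in. Qed.
Definition dsub f : subopn U := Subopn (dopn_sub (f := f)).

Lemma dopn_nvl f : nonvanishing_locus f (dopn f). Proof. by []. Qed.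

Hypothesis aU : affine U.

(** Otherwise some prime ideal contains [I] but not [f], and the point of [U] that it defines
    contradicts the covering. This plays the role of a partition of unity: [I] is taken to be the
    ideal of functions after multiplication by which a statement holds. *)
Lemma ideal_pow (I : O U -> Prop) f : is_ideal I ->
  (forall p, nz f p -> exists2 g, I g & nz g p) -> exists N, I (f ^+ N).
Proof.
move=> iI h; apply: contrapT => none.
have [|q [qp qI qf]] := krull iI (f := f); first by move=> N IN; apply: none; exists N.
have [p [Up hp _]] := affine_bij aU qp.
have [|g Ig [Up' ng]] := h p; first by exists Up => /hp.
by apply: ng; rewrite (Prop_irrelevance Up' Up); apply/hp/qI.
Qed.

Lemma ideal_one (I : O U -> Prop) : is_ideal I ->
  (forall p, U p -> exists2 g, I g & nz g p) -> I 1.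
Proof.
move=> iI h; have [|N] := ideal_pow (f := 1) iI; last by rewrite expr1n.
by move=> p /nz_in /h.
Qed.

Lemma O_local (W : opn k n) (t : O W) p (Wp : W p) : U p -> opn_sub W U ->
  exists f r, [/\ nz f p, forall q, nz f q -> W q &
    forall q (Uq : U q) (Wq : W q), nz f q -> sval r Uq = sval f Uq * sval t Wq].
Proof.
move=> Up WU; have [f0 nf0 fW] := affine_basis aU Up Wp.
have hW : opn_sub (dopn f0) W by move=> q [Uq]; exact: fW.
have hU := dopn_sub (f := f0).
have [_ surj] := affine_loc aU hU (dopn_nvl f0).
have [N [r er]] := surj (sres hW t).
(* The extra factor [f0] keeps the nonvanishing locus inside [W] also when [N = 0]. *)
exists (f0 * f0 ^+ N), (f0 * r); split.
- by rewrite -exprS; apply: nzX; exists Up.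
- by move=> q /nzM[[Uq]] /fW.
move=> q Uq Wq /nzM[nq _]; have nqW : dopn f0 q by [].
have := congr1 (fun s : sect SG (dopn f0) => sval s nqW) er.
have iterE M : sval (iter M ( *%R (sres hU f0)) (sres hW t) : sect SG (dopn f0)) nqW =
    sval f0 Uq ^+ M * sval t Wq.
  elim: M => [|M IH]; first by rewrite expr0 mul1r /= (Prop_irrelevance (hW q nqW) Wq).
  by rewrite iterS /= IH exprS mulrA (Prop_irrelevance (hU q nqW) Uq).
rewrite iterE /= (Prop_irrelevance (hU q nqW) Uq) => ->.
have eX M : sval (f0 ^+ M) Uq = sval f0 Uq ^+ M by elim: M => // M IH; rewrite !exprS /= IH.
by rewrite eX mulrA.
Qed.

End Nz.

Lemma inv_section (U : opn k n) (f : O U) (W : opn k n) (WU : opn_sub W U) :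
  (forall p, W p -> nz f p) -> exists g : O W, g * sres WU f = 1.
Proof.
move=> hW; have h p (Wp : W p) : {z | z * sval f (WU p Wp) = 1}.
  apply: cid; have [Up nv] := hW p Wp; apply: van_inv.
  by rewrite (Prop_irrelevance (WU p Wp) Up).
have loc1 : locally_fraction (A := SG) (fun p (Wp : W p) => projT1 (h p Wp)).
  move=> p Wp; have [V [d [a [b [ha [hb [Vp hV]]]]]]] := sval_local f (WU p Wp).
  exists V, d, b, a, hb, ha; split=> // q Wq Vq.
  have [qb e] := hV q (WU q Wq) Vq; have [Uq nv] := hW q Wq.
  have qa : ~ q a.
    by move=> ha'; apply: nv; rewrite (Prop_irrelevance Uq (WU q Wq)) e; apply/vanP.
  exists qa; case: (h q Wq) => z /=; rewrite e => ez.
  have e2 : loc_pi (Frac ha hb qb) * loc_pi (@Frac k n SG q _ _ _ hb ha qa) = 1.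
    rewrite [LHS]loc_mulE; apply: (frac_eqW (y := frac1 SG q)) => /=.
    by rewrite !mul1r mulr1 mulrC.
  by rewrite -[z]mulr1 -e2 mulrA ez mul1r.
by exists (Sect loc1); apply: sect_ext => p Wp /=; case: (h p Wp).
Qed.

End Points.

Lemma merge_sum (R V : zmodType) (bT : eqType) (act : bT -> {additive R -> V})
  (L : seq (R * bT)) : exists L' : seq (R * bT), [/\ uniq [seq q.2 | q <- L'],
  forall q, q \in L' -> exists2 q0, q0 \in L & q.2 = q0.2
  & \sum_(q <- L') act q.2 q.1 = \sum_(q <- L) act q.2 q.1].
Proof.
exists [seq (\sum_(q <- L | q.2 == b) q.1, b) | b <- undup [seq q.2 | q <- L]]; split.
- by rewrite -map_comp map_id undup_uniq.
- by move=> q' /mapP[b]; rewrite mem_undup => /mapP[q0 q0L ->] ->; exists q0.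
rewrite big_map.
transitivity (\sum_(b <- undup [seq q.2 | q <- L]) \sum_(q <- L | q.2 == b) act q.2 q.1).
  by apply: eq_bigr => b _; rewrite raddf_sum; apply: eq_bigr => q /eqP ->.
rewrite (exchange_big_dep xpredT) //= [LHS]big_seq [RHS]big_seq; apply: eq_bigr => q qL.
rewrite (big_rem q.2) /= ?mem_undup ?map_f // eqxx big_seq_cond big_pred0 ?addr0 // => b.
by rewrite mem_rem_uniq ?undup_uniq // inE eq_sym; case: eqP; rewrite //= andbF.
Qed.

(** * A sheaf of algebras with local bases *)

Module LocalBases.
Section LocalBasis.
Variables (k : fieldType) (n : nat) (A : galg k n) (bT : eqType).
Local Notation S := {mpoly k[n]}.
Local Notation SG := (@S_galg k n).
Variables (nQ : nat -> (int -> Prop) -> A -> Prop) (bdg : bT -> int).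
Variables (nrm : bT -> Prop) (eb : 'I_n -> bT -> A).
Hypothesis nQ0 : forall d Q, nQ d Q 0.
Hypothesis nQB : forall d Q a b, nQ d Q a -> nQ d Q b -> nQ d Q (a - b).
Hypothesis nQM : forall d e Q Q' Q'' a b, (forall i j, Q i -> Q' j -> Q'' (i + j)) ->
  nQ d Q a -> nQ e Q' b -> nQ (d + e) Q'' (a * b).
Hypothesis nQc : forall d s, s \is d.-homog -> nQ d (eq 0) (gcst A s).
Hypothesis nQ_cdeg : forall d Q a, nQ d Q a -> cdeg d a.
Hypothesis cdeg_nQ : forall d a, cdeg d a -> nQ d (fun=> True) a.
Hypothesis nQ_eb : forall i b, nQ 0 (eq (bdg b)) (eb i b).
Hypothesis nQ_span : forall i e Q a, nQ e Q a ->
  exists N (L : seq (S * bT)), [/\ uniq [seq q.2 | q <- L],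
  (forall q, q \in L -> [/\ q.1 \is (N + e).-homog, nrm q.2 & Q (bdg q.2)])
  & gcst A ('X_i ^+ N) * a = \sum_(q <- L) gcst A q.1 * eb i q.2].
Hypothesis eb_indep : forall i (L : seq (S * bT)), uniq [seq q.2 | q <- L] ->
  (forall q, q \in L -> nrm q.2) ->
  \sum_(q <- L) gcst A q.1 * eb i q.2 = 0 -> forall q, q \in L -> q.1 = 0.

(** A set [Q] of degrees instead of a single one treats a homogeneous component ([eq j]), the sum of
    all other components ([i <> j]) and all sections alike. *)
Definition dgQ (W : opn k n) (Q : int -> Prop) (t : sect A W) : Prop :=
  forall p (Wp : W p), exists d a s,
    [/\ nQ d Q a, s \is d.-homog, ~ p s & sval t Wp = lfrac p a s].


Lemma nQD d Q a b : nQ d Q a -> nQ d Q b -> nQ d Q (a + b).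
Proof. by move=> ha hb; rewrite -[b]opprK -[- b]sub0r; do 2!apply: nQB => //. Qed.

Lemma nQZ d e Q s a : s \is e.-homog -> nQ d Q a -> nQ (d + e) Q (gcst A s * a).
Proof.
move=> hs ha; rewrite addnC; apply: nQM (nQc hs) ha => i j <-; by rewrite add0r.
Qed.

Lemma dgQ0 W Q : dgQ Q (0 : sect A W).
Proof.
move=> p Wp; exists 0%N, 0, 1; split; [exact: nQ0|exact: homog1| |by rewrite lfrac0].
exact: prime1 (pt_prime p).
Qed.

Lemma dgQW W Q Q' (t : sect A W) : (forall j, Q j -> Q' j) -> dgQ Q t -> dgQ Q' t.
Proof.
move=> h ht p Wp; have [d [a [s [h1 h2 h3 h4]]]] := ht p Wp; exists d, a, s; split=> //.
rewrite -[d]addn0 -[a]mulr1 -(rmorph1 (gcst A)).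
by apply: nQM h1 (nQc (homog1 k n)) => i j /h ? <-; rewrite addr0.
Qed.

Lemma dgQD W Q (t t' : sect A W) : dgQ Q t -> dgQ Q t' -> dgQ Q (t + t').
Proof.
move=> ht ht' p Wp; have [d [a [s [h1 h2 h3 h4]]]] := ht p Wp.
have [d' [a' [s' [h1' h2' h3' h4']]]] := ht' p Wp.
exists (d + d')%N, (gcst A s' * a + gcst A s * a'), (s * s'); split.
- by apply: nQD; [|rewrite addnC]; apply: nQZ.
- exact: dhomogM.
- exact: primeM_out.
rewrite /= h4 h4'.
have f1 : isfrac p a s by exists d; split=> //; exact: nQ_cdeg h1.
have f2 : isfrac p a' s' by exists d'; split=> //; exact: nQ_cdeg h1'.
have g1 : isfrac p (gcst A s' * a) (s * s').
  exists (d + d')%N; split; [|exact: dhomogM|exact: primeM_out].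
  exact: nQ_cdeg (nQZ h2' h1).
have g2 : isfrac p (gcst A s * a') (s * s').
  exists (d + d')%N; split; [|exact: dhomogM|exact: primeM_out].
  by rewrite addnC; exact: nQ_cdeg (nQZ h2 h1').
have one : exists d0 (u : S), [/\ u \is d0.-homog, ~ p u & u = 1].
  by exists 0%N, 1; split=> //; [exact: homog1|exact: prime1 (pt_prime p)].
have [d0 [u [u1 u2 u3]]] := one.
have -> : lfrac p a s = lfrac p (gcst A s' * a) (s * s').
  apply: (proj2 (lfrac_eqP f1 g1)); exists d0, u; split=> //; rewrite !gcstMl.
  by congr (gcst A _ * _); ring.
have -> : lfrac p a' s' = lfrac p (gcst A s * a') (s * s').
  apply: (proj2 (lfrac_eqP f2 g2)); exists d0, u; split=> //; rewrite !gcstMl.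
  by congr (gcst A _ * _); ring.
by rewrite lfracD.
Qed.

Lemma dgQM W (Q Q' Q'' : int -> Prop) (t t' : sect A W) :
  (forall i j, Q i -> Q' j -> Q'' (i + j)) -> dgQ Q t -> dgQ Q' t' -> dgQ Q'' (t * t').
Proof.
move=> h ht ht' p Wp; have [d [a [s [h1 h2 h3 h4]]]] := ht p Wp.
have [d' [a' [s' [h1' h2' h3' h4']]]] := ht' p Wp.
exists (d + d')%N, (a * a'), (s * s'); split; [exact: nQM h h1 h1'|exact: dhomogM|exact: primeM_out|].
rewrite /= h4 h4' lfracM //; first by exists d; split=> //; exact: nQ_cdeg h1.
by exists d'; split=> //; exact: nQ_cdeg h1'.
Qed.

Lemma dgQ_ostr W (f : O W) : dgQ (eq 0) (ostr A f).
Proof.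
move=> p Wp; have [a [s [hf e]]] := loc_lfrac (sval f Wp).
have [e1 _] := loc_str_lfrac A hf; have [d [h1 h2 h3]] := hf.
by exists d, (gcst A a), s; split=> //; [exact: nQc|rewrite /= e].
Qed.

Lemma dgQT W (t : sect A W) : dgQ (fun=> True) t.
Proof.
move=> p Wp; have [a [s [hf e]]] := loc_lfrac (sval t Wp); have [d [h1 h2 h3]] := hf.
by exists d, a, s; split=> //; exact: cdeg_nQ.
Qed.

Lemma eb_frac q i b : isfrac q (eb i b) 1.
Proof.
by exists 0%N; split; [exact: nQ_cdeg (nQ_eb i b)|exact: homog1|exact: prime1 (pt_prime q)].
Qed.

Fact esec_local (W : opn k n) i b :
  locally_fraction (fun p (_ : opn_set W p) => lfrac p (eb i b) 1).
Proof.
move=> p Wp; exists W, 0%N, (eb i b), 1, (nQ_cdeg (nQ_eb i b)), (homog1 k n); split=> // q Wq _.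
exists (prime1 (pt_prime q)).
by rewrite lfracE.
Qed.
Definition esec (W : opn k n) i b : sect A W := Sect (@esec_local W i b).

Lemma esec_deg W i b : dgQ (eq (bdg b)) (esec W i b).
Proof.
move=> p Wp; exists 0%N, (eb i b), 1; split=> //; [exact: homog1|exact: prime1 (pt_prime p)].
Qed.

Section OnU.
Variable U : opn k n.
Hypothesis aU : affine U.
Local Notation R := (O U).
Local Notation B := (sect A U).
Local Notation os := (@ostr k n A U).

Lemma ostr_zmod : zmod_morphism os.
Proof.
move=> x y; apply/eqP; rewrite eq_sym subr_eq -ostrD subrK //.
Qed.
HB.instance Definition _ := GRing.isZmodMorphism.Build R B os ostr_zmod.

Lemma loc_str_inv p (z : loc SG p) (x : loc A p) : ~ vanishes z -> loc_str A z * x = 0 -> x = 0.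
Proof.
move=> /van_inv[z' e] h; rewrite -[x]mul1r -(loc_str1 A) -e loc_strM -mulrA h.
by rewrite mulr0.
Qed.

Lemma sval_sum (W : opn k n) (I : Type) (L : seq I) (F : I -> sect A W) p (Wp : W p) :
  sval (\sum_(i <- L) F i) Wp = \sum_(i <- L) sval (F i) Wp.
Proof. by elim: L => [|i L IH]; rewrite ?big_nil // !big_cons -IH. Qed.

Lemma nz_common (I : eqType) (L : seq I) (P : I -> R -> Prop) p : U p ->
  (forall i f g, P i f -> P i (g * f)) ->
  (forall i, i \in L -> exists2 f, nz f p & P i f) ->
  exists2 f, nz f p & forall i, i \in L -> P i f.
Proof.
move=> Up hP; elim: L => [|i L IH] hL; first by exists 1 => //; exact: nz1.
have [|f nf hf] := IH; first by move=> j jL; apply: hL; rewrite inE jL orbT.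
have [|g ng hg] := hL i; first by rewrite inE eqxx.
exists (f * g); first by apply/nzM.
by move=> j; rewrite inE => /orP[/eqP ->|jL]; [exact: hP|rewrite mulrC; apply/hP/hf].
Qed.

(** Write [t = a / s] at [p]. The span property expresses [c_i^N a] in the basis, its coefficients
    divided by [c_i^N s] are functions near [p], and a common multiplier [f] turns them into
    functions on [U]. *)
Lemma D_local (W : opn k n) (t : sect A W) p (Wp : W p) i Q : opn_sub W U -> ~ p 'X_i -> dgQ Q t ->
  exists f (L : seq (R * bT)), [/\ nz f p, forall q, nz f q -> W q,
  forall q, q \in L -> nrm q.2 /\ Q (bdg q.2) &
  forall q (Uq : U q) (Wq : W q), nz f q -> loc_str A (sval f Uq) * sval t Wq =
    \sum_(r <- L) loc_str A (sval r.1 Uq) * lfrac q (eb i r.2) 1].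
Proof.
move=> WU pi ht; have [d [a [s [h1 h2 h3 h4]]]] := ht p Wp.
have hf : isfrac p a s by exists d; split=> //; exact: nQ_cdeg h1.
have [V [Vp hV]] := lfrac_local hf h4.
have [N [L [uL hL eL]]] := nQ_span i h1.
have hX : ('X_i ^+ N : S) \is N.-homog.
  have := dhomogMn (N) (p := 'X_i : S) (d := 1); rewrite mul1n; apply.
  by rewrite dhomogX; apply/eqP; exact: mdeg1.
have hcs : ('X_i ^+ N * s : S) \is (N + d).-homog by exact: dhomogM.
have pXn (q : point k n) M : ~ q 'X_i -> ~ q ('X_i ^+ M).
  move=> qi; elim: M => [|M IH]; first by rewrite expr0; exact: prime1 (pt_prime q).
  by rewrite exprS; exact: primeM_out.
have Vop : zariski_open (fun q => [/\ W q, V q & ~ q ('X_i * ('X_i ^+ N * s))]).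
  move=> q [/(opn_open (o := W))[d1 [s1 [k1 k2 k3]]] /(opn_open (o := V))[d2 [s2 [k1' k2' k3']]] k4].
  have [X1 [X2 X3]] : exists e (s3 : S), [/\ s3 \is e.-homog, ~ q s3 & s3 = 'X_i * ('X_i ^+ N * s)].
    exists (1 + (N + d))%N, ('X_i * ('X_i ^+ N * s)); split=> //.
    by apply: dhomogM => //; rewrite dhomogX; apply/eqP; exact: mdeg1.
  move: X3 => [X3 X4 X5].
  exists (d1 + (d2 + X1))%N, (s1 * (s2 * X2)); split.
  - by apply: dhomogM => //; exact: dhomogM.
  - by apply: primeM_out => //; exact: primeM_out.
  move=> r hr; have rp := pt_prime r; split.
  - by apply: k3 => h; apply: hr; rewrite mulrC; apply: (primeMl rp).
  - by apply: k3' => h; apply: hr; apply: (primeMl rp); rewrite mulrC; apply: (primeMl rp).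
  - by rewrite -X5 => h; apply: hr; do 2!apply: (primeMl rp).
pose W1 := Opn Vop.
have W1p : W1 p by split=> //; do 2!apply: primeM_out => //; exact: pXn.
have out q : W1 q -> ~ q ('X_i ^+ N * s).
  by move=> [_ _ h] h'; apply: h; apply: (primeMl (pt_prime q)).
have Lfrac q (x : S * bT) : W1 q -> x \in L -> isfrac (A := SG) q x.1 ('X_i ^+ N * s).
  by move=> W1q /hL[x1 _ _]; exists (N + d)%N; split=> //; exact: out.
have hloc (x : S * bT) : x \in L -> exists t' : O W1, forall q (Wq : W1 q),
    sval t' Wq = lfrac (A := SG) q x.1 ('X_i ^+ N * s).
  move=> xL; have [x1 _ _] := hL x xL.
  have lf : locally_fraction (A := SG) (fun q (_ : W1 q) => lfrac (A := SG) q x.1 ('X_i ^+ N * s)).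
    move=> q Wq; exists W1, (N + d)%N, x.1, ('X_i ^+ N * s), x1, hcs; split=> // r Wr _.
    by exists (out r Wr); rewrite lfracE.
  by exists (Sect lf).
have Up : U p by exact: WU.
have W1U : opn_sub W1 U by move=> q [/WU].
have [f1 nf1 hf1] : exists2 f, nz f p & forall x, x \in L -> (forall q, nz f q -> W1 q) /\
   exists r : R, forall q (Uq : U q), nz f q ->
     sval r Uq = sval f Uq * lfrac (A := SG) q x.1 ('X_i ^+ N * s).
  apply: nz_common => // [x g g' [e1 [r er]]|x /hloc[t' et']].
    split=> [q /nzM[_]|]; first exact: e1.
    by exists (g' * r) => q Uq /nzM[_ nq] /=; rewrite er // mulrA.
  have [f1 [r [n1 n2 n3]]] := O_local aU t' W1p Up W1U.
  exists f1 => //; split=> //; exists r => q Uq nq.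
  by rewrite (n3 q Uq (n2 q nq)) // et'.
have hr0 (x : S * bT) : exists r : R, x \in L -> forall q (Uq : U q), nz f1 q ->
    sval r Uq = sval f1 Uq * lfrac (A := SG) q x.1 ('X_i ^+ N * s).
  have [/hf1[_ [r er]]|] := boolP (x \in L); first by exists r.
  by exists 0.
have [r hr] := choice hr0.
(* [f0] keeps the locus of [f0 * f1] inside [W1] also when [L] is empty. *)
have [f0 [_ [nf0 f0W _]]] := O_local aU (1 : O W1) W1p Up W1U.
exists (f0 * f1), [seq (f0 * r x, x.2) | x <- L]; split.
- by apply/nzM.
- by move=> q /nzM[/f0W[]].
- by move=> _ /mapP[x /hL[_ x2 x3] ->].
move=> q Uq Wq /nzM[n0 n1]; have W1q := f0W q n0; have [_ Vq _] := W1q.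
have [hfq ->] := hV q Wq Vq.
have e1 : isfrac q (gcst A ('X_i ^+ N) * a) ('X_i ^+ N * s).
  exists (N + d)%N; split=> //; last exact: out.
  by apply: cdegM; [exact: cdeg_cst|exact: nQ_cdeg h1].
have e2 : lfrac q a s = lfrac q (gcst A ('X_i ^+ N) * a) ('X_i ^+ N * s).
  apply: (proj2 (lfrac_eqP hfq e1)); exists 0%N, 1; split; [exact: homog1| |].
    exact: prime1 (pt_prime q).
  by rewrite !gcstMl; congr (gcst A _ * _); ring.
rewrite e2 eL big_map /=.
transitivity (loc_str A (sval f0 Uq * sval f1 Uq) * \sum_(x <- L)
    lfrac q (gcst A x.1 * eb i x.2) ('X_i ^+ N * s)).
  congr (_ * _); rewrite big_seq [in RHS]big_seq.
  have fx (x : S * bT) : isfrac q (if x \in L then gcst A x.1 * eb i x.2 else 0) ('X_i ^+ N * s).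
    exists (N + d)%N; split=> //; last exact: out.
    case: ifP => [/hL[x1 _ _]|_]; last exact: cdeg0.
    by rewrite -[(N + d)%N]addn0; apply: cdegM; [exact: cdeg_cst|exact: nQ_cdeg (nQ_eb i x.2)].
  rewrite big_mkcond [in RHS]big_mkcond /= -(lfrac_sum L fx); apply: eq_bigr => x _.
  by case: ifP => // _; rewrite lfrac0.
rewrite mulr_sumr big_seq [in RHS]big_seq; apply: eq_bigr => x xL.
have [l1 l2] := loc_str_lfrac A (Lfrac q x W1q xL).
rewrite (hr x xL q Uq n1) !loc_strM l1 -!mulrA lfracM //; last exact: eb_frac.
by rewrite mulr1.
Qed.

Definition comb i (L : seq (R * bT)) : B := \sum_(r <- L) os r.1 * esec U i r.2.

Lemma sval_comb i L q (Uq : U q) :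
  sval (comb i L) Uq = \sum_(r <- L) loc_str A (sval r.1 Uq) * lfrac q (eb i r.2) 1.
Proof. by rewrite sval_sum. Qed.

Lemma comb_cat i L L' : comb i (L ++ L') = comb i L + comb i L'.
Proof. by rewrite /comb big_cat. Qed.

Lemma comb_scale i f L : os f * comb i L = comb i [seq (f * r.1, r.2) | r <- L].
Proof. by rewrite /comb big_map mulr_sumr; apply: eq_bigr => r _; rewrite ostrM mulrA. Qed.

Definition eact i b (r : R) : B := os r * esec U i b.
Lemma eact_zmod i b : zmod_morphism (eact i b).
Proof. by move=> x y; rewrite /eact raddfB mulrBl. Qed.
HB.instance Definition _ i b := GRing.isZmodMorphism.Build R B (eact i b) (eact_zmod i b).

Lemma comb_merge i (L : seq (R * bT)) : exists L', [/\ uniq [seq q.2 | q <- L'],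
  forall q, q \in L' -> exists2 q0, q0 \in L & q.2 = q0.2 & comb i L' = comb i L].
Proof. exact: (merge_sum (fun b => eact i b)). Qed.

(** * The generic point and linear independence of the basis sections *)

Section Eta.
Variable i0 : 'I_n.

Lemma eta_prime : prime_ideal (fun s : S => s = 0).
Proof.
split=> [//|a b -> ->|a b ->|/eqP|a b /eqP]; rewrite ?addr0 ?mulr0 //.
  by rewrite oner_eq0.
by rewrite mulf_eq0 => /orP[]/eqP; [left|right].
Qed.

Lemma eta_relevant : exists i : 'I_n, 'X_i != 0 :> S.
Proof.
exists i0; apply/eqP => /(congr1 (mcoeff U_(i0))).
by rewrite mcoeffX eqxx mcoeff0 => /eqP; rewrite oner_eq0.
Qed.

(** The zero ideal, which lies in every nonempty open subset. The index [i0] provides the variable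
    outside the ideal that a point requires. *)
Definition eta : point k n.
Proof.
apply: (@Point k n _ eta_prime) => [s d ->|]; first by rewrite raddf0.
by have [i /eqP] := eta_relevant; exists i.
Defined.

Lemma eta_in (V : opn k n) p : V p -> V eta.
Proof.
move=> /(opn_open (o := V))[d [s [_ ps h]]]; apply: h => s0; apply: ps.
by rewrite (s0 : s = 0); exact: prime0 (pt_prime p).
Qed.

Lemma lfrac_eta0 (C : galg k n) (a : C) s : isfrac eta a s -> lfrac eta a s = 0 ->
  exists2 u : S, u != 0 & gcst C u * a = 0.
Proof.
move=> ha; have h0 : isfrac eta (0 : C) 1.
  by exists 0%N; split; [exact: cdeg0|exact: homog1|exact: prime1 eta_prime].
rewrite -(@lfrac0 k n C eta 1) => /(lfrac_eqP ha h0)[d [u [_ u0]]].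
by rewrite rmorph1 mul1r !mulr0 => e; exists u => //; apply/eqP.
Qed.

Lemma O_eta0 (r : R) (Ue : U eta) : sval r Ue = 0 -> r = 0.
Proof.
move=> e; apply: sect_ext => q Uq.
have [a [s [hf er]]] := loc_lfrac (sval r Uq); have [V [Vq hV]] := lfrac_local hf er.
have [hf' e'] := hV eta Ue (eta_in Vq); rewrite er.
have [u u0 /eqP] := lfrac_eta0 hf' (etrans (esym e') e).
by rewrite mulf_eq0 (negPf u0) => /eqP ->; rewrite lfrac0.
Qed.

Lemma common_den (L : seq (R * bT)) (Ue : U eta) : exists (s : S) (h : R -> S),
  (exists d, s \is d.-homog /\ s != 0) /\ forall r, r \in L ->
    isfrac (A := SG) eta (h r.1) s /\ sval r.1 Ue = lfrac (A := SG) eta (h r.1) s.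
Proof.
elim: L => [|r L [s [h [[d [sd s0]] hL]]]].
  by exists 1, (fun=> 0); split=> //; exists 0%N; split; [exact: homog1|exact: oner_neq0].
have [a [s1 [hf er]]] := loc_lfrac (sval r.1 Ue); have [d1 [a1 a2 a3]] := hf.
have s10 : s1 != 0 by apply/eqP.
have sc (x t t' : S) : isfrac (A := SG) eta x t -> (exists d, t' \is d.-homog /\ t' != 0) ->
    isfrac (A := SG) eta (x * t' : S) (t * t') /\
    lfrac (A := SG) eta x t = lfrac (A := SG) eta (x * t' : S) (t * t').
  move=> hx [e [t1 t2]]; have h1 : isfrac (A := SG) eta (x * t' : S) (t * t').
    have [e' [e1 e2 e3]] := hx; exists (e' + e)%N; split; [exact: dhomogM|exact: dhomogM|].
    by move/eqP; rewrite mulf_eq0 (negPf t2) orbF => /eqP.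
  split=> //; apply: (proj2 (lfrac_eqP hx h1)); exists 0%N, 1.
  split; [exact: homog1|exact: prime1 eta_prime|].
  change (1 * ((t * t') * x) = 1 * (t * (x * t')) :> S); ring.
exists (s * s1), (fun x => if x == r.1 then a * s else h x * s1); split.
  by exists (d + d1)%N; split; [exact: dhomogM|rewrite mulf_eq0 negb_or s0].
move=> q; rewrite inE; case: eqP => [e|_ /=].
  move=> _; rewrite e eqxx er [s * s1]mulrC; apply: sc => //; by exists d.
move=> qL; case: eqP => e.
  by rewrite e er [s * s1]mulrC; apply: sc => //; exists d.
by have [h1 ->] := hL q qL; apply: sc => //; exists d1.
Qed.

(** A common denominator turns the relation at the generic point into one over [S], up to a nonzero
    factor [u], where [eb_indep] applies; a function with zero germ at [eta] is zero. *)
Lemma eta_indep i (L : seq (R * bT)) (Ue : U eta) : uniq [seq q.2 | q <- L] ->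
  (forall q, q \in L -> nrm q.2) -> sval (comb i L) Ue = 0 -> forall q, q \in L -> q.1 = 0.
Proof.
move=> uL nL; rewrite sval_comb => e0.
have [s [h [[d [sd s0]] hL]]] := common_den L Ue.
have fx (x : R * bT) : isfrac eta (if x \in L then gcst A (h x.1) * eb i x.2 else 0) s.
  case: ifP => [xL|_].
    have [hx _] := hL x xL; have [_ h2] := loc_str_lfrac A hx.
    by have := isfracM h2 (eb_frac eta i x.2); rewrite mulr1.
  by exists d; split; [exact: cdeg0|by []|exact/eqP].
have e1 : lfrac eta (\sum_(q <- L) gcst A (h q.1) * eb i q.2) s = 0.
  rewrite -[RHS]e0 big_seq big_mkcond /= -(lfrac_sum L fx) [RHS]big_seq [RHS]big_mkcond /=.
  apply: eq_bigr => x _; case: ifP => xL; last by rewrite lfrac0.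
  have [hx ->] := hL x xL; have [-> h2] := loc_str_lfrac A hx.
  by rewrite lfracM ?mulr1 //; exact: eb_frac.
have [|u u0 e2] := lfrac_eta0 _ e1.
  rewrite big_seq big_mkcond /=.
  have fsum (l : seq (R * bT)) :
      isfrac eta (\sum_(x <- l) if x \in L then gcst A (h x.1) * eb i x.2 else 0) s.
    elim: l => [|y l IH]; rewrite ?big_nil.
      by exists d; split; [exact: cdeg0|by []|exact/eqP].
    by rewrite big_cons; apply: isfracD.
  exact: fsum.
have e3 : \sum_(q <- [seq (u * h q.1, q.2) | q <- L]) gcst A q.1 * eb i q.2 = 0.
  by rewrite big_map -[RHS]e2 mulr_sumr; apply: eq_bigr => q _; rewrite rmorphM mulrA.
move=> q qL; have := eb_indep _ _ e3 (q := (u * h q.1, q.2)) => /=.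
rewrite -map_comp => /(_ uL) h1.
have {}h1 : u * h q.1 = 0.
  by apply: h1; [move=> _ /mapP[q' /nL ? ->]|apply/mapP; exists q].
have [_] := hL q qL; move/eqP: h1; rewrite mulf_eq0 (negPf u0) => /eqP ->.
by rewrite lfrac0; exact: O_eta0.
Qed.

End Eta.

Lemma pt_chart (p : point k n) : exists i, ~ p 'X_i. Proof. exact: pt_relevant. Qed.

(** Near any point [f t] is a combination of basis sections. Its germ at the generic point is zero
    because that point lies in [V], so its coefficients vanish, and [f] is invertible at the point
    considered. *)
Lemma B_zero (t : B) (V : opn k n) p0 : V p0 ->
  (forall q (Uq : U q), V q -> sval t Uq = 0) -> t = 0.
Proof.
move=> Vp0 h; apply: sect_ext => p Up; have [i pi] := pt_chart p.
have [f [L [nf _ hL eL]]] := D_local Up (fun q (Uq : U q) => Uq) pi (dgQT t).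
have [L' [uL' sL' cL']] := comb_merge i L.
have Ue := eta_in i Up.
have fe : nz f (eta i) by exact: (eta_in i (V := dopn f) nf).
have e0 : sval (comb i L') Ue = 0.
  by rewrite cL' sval_comb -(eL _ Ue Ue fe) (h _ Ue (eta_in i Vp0)) mulr0.
have z := eta_indep uL' _ e0.
have c0 : comb i L = 0.
  rewrite -cL' /comb big_seq big1 // => q qL.
  by rewrite z ?raddf0 ?mul0r // => q' /sL'[q0 /hL[n0 _] ->].
have [Up' nv] := nf; apply: (loc_str_inv (z := sval f Up)).
  by rewrite (Prop_irrelevance Up Up').
by rewrite (eL p Up Up nf) -sval_comb c0.
Qed.

Lemma B_cancel (t : B) f p : nz f p -> os f * t = 0 -> t = 0.
Proof.
move=> nf e; apply: (B_zero (V := dopn f) nf) => q Uq [Uq' nv].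
apply: (loc_str_inv (z := sval f Uq)); first by rewrite (Prop_irrelevance Uq Uq').
by have := congr1 (fun x : B => sval x Uq) e.
Qed.

Lemma B_local (t : B) p i Q : U p -> ~ p 'X_i -> dgQ Q t -> exists f (L : seq (R * bT)),
  [/\ nz f p, forall q, q \in L -> nrm q.2 /\ Q (bdg q.2) & os f * t = comb i L].
Proof.
move=> Up pi ht; have [f [L [nf _ hL eL]]] := D_local Up (fun q (Uq : U q) => Uq) pi ht.
exists f, L; split=> //; apply/eqP; rewrite -subr_eq0; apply/eqP.
apply: (B_zero (V := dopn f) nf) => q Uq nq.
rewrite [LHS](_ : _ = loc_str A (sval f Uq) * sval t Uq - sval (comb i L) Uq) //.
by rewrite (eL q Uq Uq nq) sval_comb subrr.
Qed.

Lemma comb_indep i L p : U p -> uniq [seq q.2 | q <- L] ->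
  (forall q, q \in L -> nrm q.2) -> comb i L = 0 -> forall q, q \in L -> q.1 = 0.
Proof.
move=> Up uL nL e; apply: (eta_indep (i := i) (Ue := eta_in i Up) uL nL).
by rewrite e.
Qed.

Lemma dgQ_comb i L Q : (forall q, q \in L -> Q (bdg q.2)) -> dgQ Q (comb i L).
Proof.
rewrite /comb big_seq; move=> hL; elim/big_rec: _ => [|q x qL hx]; first exact: dgQ0.
apply: dgQD => //; apply: (@dgQM U (eq 0) (eq (bdg q.2)) Q); last exact: esec_deg.
  by move=> j j' <- <-; rewrite add0r; exact: hL.
exact: dgQ_ostr.
Qed.

Lemma D_extend (W : opn k n) (t : sect A W) p (Wp : W p) Q : opn_sub W U -> dgQ Q t ->
  exists f (b : B), [/\ nz f p, forall q, nz f q -> W q, dgQ Q b &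
  forall q (Uq : U q) (Wq : W q), nz f q -> sval b Uq = loc_str A (sval f Uq) * sval t Wq].
Proof.
move=> WU ht; have [i pi] := pt_chart p.
have [f [L [nf fW hL eL]]] := D_local Wp WU pi ht; exists f, (comb i L); split=> //.
  by apply: dgQ_comb => q /hL[].
by move=> q Uq Wq nq; rewrite (eL q Uq Wq nq) sval_comb.
Qed.

(** Near a point both sections are combinations of basis sections, over disjoint sets of basis
    elements because [Q] and [Q'] separate their degrees. *)
Lemma B_direct (x y : B) (Q Q' : int -> Prop) : (forall j, Q j -> ~ Q' j) ->
  dgQ Q x -> dgQ Q' y -> x + y = 0 -> x = 0.
Proof.
move=> dis hx hy e; have [[p Up]|none] := pselect (exists p, U p); last first.
  by apply: sect_ext => p Up; case: none; exists p.
have [i pi] := pt_chart p.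
have [f [L [nf hL eL]]] := B_local Up pi hx; have [g [L' [ng hL' eL']]] := B_local Up pi hy.
pose M := [seq (g * r.1, r.2) | r <- L]; pose M' := [seq (f * r.1, r.2) | r <- L'].
have [N [uN sN cN]] := comb_merge i M; have [N' [uN' sN' cN']] := comb_merge i M'.
have qN q : q \in N -> nrm q.2 /\ Q (bdg q.2) by move=> /sN[_ /mapP[r /hL ? ->] ->].
have qN' q : q \in N' -> nrm q.2 /\ Q' (bdg q.2) by move=> /sN'[_ /mapP[r /hL' ? ->] ->].
have z : forall q, q \in N ++ N' -> q.1 = 0.
  apply: (comb_indep (i := i) Up).
  - rewrite map_cat cat_uniq uN uN' andbT; apply/hasPn => b /mapP[q /qN'[_ h] ->].
    apply/negP => /mapP[q' /qN[_ h'] eq]; rewrite eq in h; exact: (dis _ h').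
  - by move=> q; rewrite mem_cat => /orP[/qN[]|/qN'[]].
  rewrite comb_cat cN cN' -!comb_scale -eL -eL' !mulrA -!ostrM [g * f]mulrC -mulrDr e.
  by rewrite mulr0.
have nfg : nz (g * f) p by apply/nzM.
apply: (B_cancel nfg); rewrite ostrM -mulrA eL comb_scale -cN /comb big_seq big1 // => q q1.
by rewrite z ?raddf0 ?mul0r // mem_cat q1.
Qed.

(* The equational criterion of flatness for the [R]-module [B_Q]. *)
Lemma B_flat (M N : nat) Q (b : 'I_M -> B) (q : 'I_M -> 'I_N -> R) :
  (forall a, dgQ Q (b a)) -> (forall j, \sum_a os (q a j) * b a = 0) ->
  exists K (e : 'I_K -> B) (r : 'I_M -> 'I_K -> R), [/\ forall c, dgQ Q (e c),
    forall a, b a = \sum_c os (r a c) * e c & forall c j, \sum_a r a c * q a j = 0].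
Proof.
move=> hb hq.
(* The criterion is local on [U]: the [h] for which the elements [h b_a] satisfy it form an ideal,
   two factorizations being added by juxtaposition. *)
pose J h := exists K (e : 'I_K -> B) (r : 'I_M -> 'I_K -> R), [/\ forall c, dgQ Q (e c),
    forall a, os h * b a = \sum_c os (r a c) * e c & forall c j, \sum_a r a c * q a j = 0].
suff [K [e [r [h1 h2 h3]]]] : J 1.
  by exists K, e, r; split=> // a; rewrite -h2 ostr1 mul1r.
apply: (ideal_one aU) => [|p Up].
  split=> [|x y [K [e [r [h1 h2 h3]]]] [K' [e' [r' [h1' h2' h3']]]]|x y [K [e [r [h1 h2 h3]]]]].
  - exists 0%N, (fun=> 0), (fun _ _ => 0); split=> [c|a|c j]; first exact: dgQ0.
      by rewrite raddf0 mul0r big_ord0.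
    by rewrite big1 // => a _; rewrite mul0r.
  - exists (K + K')%N, (fun c => match split c with inl i => e i | inr i => e' i end),
      (fun a c => match split c with inl i => r a i | inr i => r' a i end); split.
    + by move=> c; case: split.
    + move=> a; rewrite raddfD mulrDl h2 h2' big_split_ord /=.
      by congr (_ + _); apply: eq_bigr => i _;
        [rewrite (unsplitK (inl i))|rewrite (unsplitK (inr i))].
    by move=> c j; case: split.
  - exists K, e, (fun a c => x * r a c); split=> // [a|c j].
      by rewrite ostrM -mulrA h2 mulr_sumr; apply: eq_bigr => c _; rewrite ostrM mulrA.
    transitivity (x * \sum_a r a c * q a j); last by rewrite h3 mulr0.
    by rewrite mulr_sumr; apply: eq_bigr => a _; rewrite mulrA.
have [i pi] := pt_chart p.
have [f nf hf] : exists2 f, nz f p & forall a, a \in enum 'I_M -> exists L : seq (R * bT),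
    (forall q, q \in L -> nrm q.2 /\ Q (bdg q.2)) /\ os f * b a = comb i L.
  apply: nz_common => // [a f g [L [hL eL]]|a _].
    exists [seq (g * r.1, r.2) | r <- L]; split; first by move=> _ /mapP[r /hL ? ->].
    by rewrite -comb_scale -eL ostrM mulrA.
  by have [f [L [h1 h2 h3]]] := B_local Up pi (hb a); exists f => //; exists L.
exists f => //; have [L hL] := choice (fun a => hf a (mem_enum _ a)).
(* Locally the new elements [e] are the basis sections that occur, and the [r] are coordinates; the
   relations hold coordinatewise by linear independence. *)
pose bs := undup (flatten [seq [seq x.2 | x <- L a] | a <- enum 'I_M]).
have bsL a x : x \in L a -> x.2 \in bs.
  move=> h; rewrite mem_undup; apply/flattenP; exists [seq x.2 | x <- L a]; last exact: map_f.
  by apply/mapP; exists a; rewrite ?mem_enum.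
have bsP x : x \in bs -> nrm x /\ Q (bdg x).
  by rewrite mem_undup => /flattenP[_ /mapP[a _ ->] /mapP[y /(proj1 (hL a)) h ->]].
pose rho a x := \sum_(y <- L a | y.2 == x) y.1.
have comb_rho a : comb i (L a) = \sum_(x <- bs) os (rho a x) * esec U i x.
  transitivity (\sum_(x <- bs) \sum_(y <- L a | y.2 == x) os y.1 * esec U i y.2); last first.
    apply: eq_bigr => x _; rewrite /rho raddf_sum mulr_suml.
    by apply: eq_bigr => y /eqP ->.
  rewrite (exchange_big_dep xpredT) //= /comb [LHS]big_seq [RHS]big_seq.
  apply: eq_bigr => y yL; rewrite (big_rem y.2) ?(bsL a) //= eqxx big_seq_cond big_pred0 ?addr0 //.
  move=> x; rewrite mem_rem_uniq ?undup_uniq // inE eq_sym.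
  by case: eqP; rewrite //= andbF.
have z j x : x \in bs -> \sum_a rho a x * q a j = 0.
  move=> xb; have := @comb_indep i [seq (\sum_a rho a y * q a j, y) | y <- bs] p Up.
  rewrite -map_comp map_id undup_uniq => /(_ isT) h.
  apply: (h _ _ (\sum_a rho a x * q a j, x)); last by apply/mapP; exists x.
    by move=> _ /mapP[y /bsP[? _] ->].
  rewrite /comb big_map /=.
  transitivity (\sum_a os (q a j) * (os f * b a)); last first.
    transitivity (os f * \sum_a os (q a j) * b a); last by rewrite hq mulr0.
    rewrite mulr_sumr; apply: eq_bigr => a _.
    by rewrite !mulrA -!ostrM mulrC.
  transitivity (\sum_a \sum_(y <- bs) os (q a j) * (os (rho a y) * esec U i y)); last first.
    by apply: eq_bigr => a _; rewrite (proj2 (hL a)) comb_rho mulr_sumr.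
  rewrite exchange_big /=; apply: eq_bigr => y _; rewrite raddf_sum mulr_suml.
  by apply: eq_bigr => a _; rewrite mulrA -ostrM mulrC.
exists (size bs), (fun c => esec U i (tnth (in_tuple bs) c)),
  (fun a c => rho a (tnth (in_tuple bs) c)); split.
- move=> c; apply: (dgQW (Q := eq (bdg (tnth (in_tuple bs) c)))); last exact: esec_deg.
  by move=> j <-; have [] := bsP _ (mem_tnth c (in_tuple bs)).
- by move=> a; rewrite (proj2 (hL a)) comb_rho [LHS]big_tnth.
- by move=> c j; apply: z; exact: mem_tnth.
Qed.

End OnU.
End LocalBasis.
End LocalBases.
Export LocalBases.

(** * The sheaf [D] over an affine open subscheme *)

Section Numerators.
Variables (k : fieldType) (n m : nat) (w : potential k n m).
Local Notation S := {mpoly k[n]}.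
Local Notation TS := (malg_falg S 'I_n).

Section AnyT.
Variables (X : falg S 'I_n).
Definition whQ (d : nat) (Q : int -> Prop) (t : X) : Prop :=
  (forall u, fcoef u t \is d.-homog) /\ (forall u, fcoef u t != 0 -> Q (size u)%:Z).

Lemma whQB d Q (a b : X) : whQ d Q a -> whQ d Q b -> whQ d Q (a - b).
Proof.
move=> [h1 h2] [h1' h2']; split=> u; rewrite raddfB /= ?rpredB // => h.
have [e|/h2//] := eqVneq (fcoef u a) 0; apply: h2'; move: h.
by rewrite e sub0r oppr_eq0.
Qed.

Lemma whQ0 d Q : whQ d Q (0 : X).
Proof. by split=> u; rewrite raddf0 ?rpred0 ?eqxx. Qed.

Lemma whQD d Q (a b : X) : whQ d Q a -> whQ d Q b -> whQ d Q (a + b).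
Proof.
move=> ha hb; rewrite -[b]opprK; apply: whQB => //.
by rewrite -sub0r; apply: whQB => //; exact: whQ0.
Qed.

Lemma whQ_word d (Q : int -> Prop) s u : s \is d.-homog -> Q (size u)%:Z ->
  whQ d Q (fcst X s * fword X u).
Proof.
by move=> hs hu; split=> v; rewrite fcoefE; case: (u =P v) => [e|_]; rewrite -?e ?rpred0 ?eqxx.
Qed.

Lemma whQM d e (Q Q' Q'' : int -> Prop) (a b : X) : (forall i j, Q i -> Q' j -> Q'' (i + j)) ->
  whQ d Q a -> whQ e Q' b -> whQ (d + e) Q'' (a * b).
Proof.
move=> h [a1 a2] [b1 b2]; rewrite (fsum a) (fsum b) mulr_suml big_seq.
elim/big_rec: _ => [|u x]; first exact: whQ0.
rewrite fsuppP => /a2 qu hx; apply: whQD => //; rewrite mulr_sumr big_seq.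
elim/big_rec: _ => [|v y]; first exact: whQ0.
rewrite fsuppP => /b2 qv hy; apply: whQD => //.
rewrite (_ : _ * _ = fcst X (fcoef u a * fcoef v b) * fword X (u ++ v)); last first.
  rewrite fwordM rmorphM -!mulrA; congr (_ * _).
  by rewrite [LHS]mulrA -(fcstC (fcoef v b)) -mulrA.
by apply: whQ_word; [exact: dhomogM|rewrite size_cat PoszD; exact: h].
Qed.

Lemma whQ_cst d s : s \is d.-homog -> whQ d (eq 0) (fcst X s).
Proof. by move=> hs; rewrite -[fcst X s]mulr1 -(fword0 X); exact: whQ_word. Qed.

Lemma whQ_bel i b : whQ 0 (eq (bdeg m b)%:Z) (bel w X i b).
Proof.
split=> u; have [h1 h2] := bel_homog w X i b u => // /h2 ->.
by [].
Qed.

End AnyT.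

Definition nQE (d : nat) (Q : int -> Prop) (a : E_galg w) : Prop :=
  exists2 t : TS, a = E_pi w t & whQ d Q t.

Lemma nQE0 d Q : nQE d Q 0.
Proof. by exists 0; [rewrite (rmorph0 (E_pi w))|exact: whQ0]. Qed.

Lemma nQEB d Q a b : nQE d Q a -> nQE d Q b -> nQE d Q (a - b).
Proof.
move=> [t -> ht] [t' -> ht']; exists (t - t'); last exact: whQB.
by rewrite [RHS](rmorphB (E_pi w)).
Qed.

Lemma nQEM d e (Q Q' Q'' : int -> Prop) a b : (forall i j, Q i -> Q' j -> Q'' (i + j)) ->
  nQE d Q a -> nQE e Q' b -> nQE (d + e) Q'' (a * b).
Proof.
move=> h [t -> ht] [t' -> ht']; exists (t * t'); last exact: whQM ht ht'.
by rewrite [RHS](rmorphM (E_pi w)).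
Qed.

Lemma nQEc d s : s \is d.-homog -> nQE d (eq 0) (gcst (E_galg w) s).
Proof. by move=> hs; exists (fcst TS s) => //; exact: whQ_cst. Qed.

Lemma nQE_cdeg d Q a : nQE d Q a -> cdeg d a.
Proof. by move=> [t -> [ht _]]; exists t => // -[u]; exact: ht. Qed.

Lemma cdeg_nQE d (a : E_galg w) : cdeg d a -> nQE d (fun=> True) a.
Proof. by move=> [t -> ht]; exists t => //; split=> // u; exact: (ht (monalg.FMonom u)). Qed.

Lemma nQE_eb i b : nQE 0 (eq (bdeg m b)%:Z) (ebel w i b).
Proof. by exists (bel w TS i b) => //; exact: whQ_bel. Qed.

Lemma nQE_span (m0 : (0 < m)%N) i e Q a : nQE e Q a ->
  exists N (L : seq (S * basis_elt n)), [/\ uniq [seq q.2 | q <- L],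
  (forall q, q \in L -> [/\ q.1 \is (N + e).-homog, bnormal w q.2 & Q (bdeg m q.2)%:Z])
  & gcst (E_galg w) ('X_i ^+ N) * a = \sum_(q <- L) gcst (E_galg w) q.1 * (ebel w i q.2 : E_galg w)].
Proof.
move=> [t -> [h1 h2]].
have [N [L [uL hL eL]]] := E_span w m0 i (Q := fun j => Q j%:Z) h1 h2.
by exists N, L; split=> //; exact: eL.
Qed.

End Numerators.

Section Instances.
Variables (k : fieldType) (n m : nat) (w : potential k n m).
Hypothesis hsyz : syz w (malg_falg k 'I_n).
Hypothesis m0 : (0 < m)%N.
Variable U : opn k n.
Hypothesis aU : affine U.
Local Notation R := (O U).
Local Notation B := (D w U).
Local Notation os := (@ostr k n (E_galg w) U).
Local Notation dQ := (dgQ (@nQE k n m w)).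

Lemma D_degE (W : opn k n) j (t : D w W) : D_deg j t <-> dQ (eq j) t.
Proof.
split=> h p Wp.
  have [y ey [a [ea a1 a2]]] := h p Wp.
  exists (frac_deg y), (num y), (den y); split; [|exact: den_deg|exact: den_out|].
    exists a => //; split=> u; first exact: (a1 (monalg.FMonom u)).
    by move=> hu; rewrite -(a2 (monalg.FMonom u) hu).
  by rewrite ey lfracE.
have [d [a [s [[t' et [h1 h2]] hs ps e]]]] := h p Wp.
have ca : cdeg (g := E_galg w) d a by exists t' => // -[u]; exact: h1.
exists (Frac (A := E_galg w) ca hs ps); first by rewrite lfracE.
by exists t'; split=> // [[u]|[u] hu]; [exact: h1|rewrite (h2 u hu)].
Qed.

Lemma D_deg0 (W : opn k n) j : D_deg j (0 : D w W).
Proof. by apply/D_degE; apply: dgQ0; exact: nQE0. Qed.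

Lemma D_degD (W : opn k n) j (s t : D w W) : D_deg j s -> D_deg j t -> D_deg j (s + t).
Proof.
move=> /D_degE hs /D_degE ht; apply/D_degE.
apply: (dgQD (@nQE0 k n m w) (@nQEB k n m w) (@nQEM k n m w) (@nQEc k n m w) (@nQE_cdeg k n m w)) => //.
Qed.

Lemma D_degM (W : opn k n) i j (s t : D w W) : D_deg i s -> D_deg j t -> D_deg (i + j) (s * t).
Proof.
move=> /D_degE hs /D_degE ht; apply/D_degE.
apply: (dgQM (@nQEM k n m w) (@nQE_cdeg k n m w) _ hs ht) => i' j' <- <- //.
Qed.

Lemma D_degN (W : opn k n) j (s : D w W) : D_deg j s -> D_deg j (- s).
Proof.
move=> hs; rewrite -mulN1r -[j]add0r; apply: D_degM => //.
have -> : -1 = ostr (E_galg w) (-1) :> D w W.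
  apply/eqP; rewrite eq_sym -addr_eq0 -(ostr1 (E_galg w) W) -ostrD addNr.
  by apply/eqP/sect_ext => p Wp /=; rewrite -[RHS](subrr 0) -[LHS]addr0 -{1}(subrr (loc_str (E_galg w) 0)) addrA -loc_strD addr0 !subrr.
exact: D_deg_ostr.
Qed.

Lemma D_ext (W : opn k n) (t : D w W) p : W p -> opn_sub W U ->
  exists f (b : B), [/\ nz f p, forall q, nz f q -> W q &
  forall q (Uq : U q) (Wq : W q), nz f q -> sval b Uq = loc_str (E_galg w) (sval f Uq) * sval t Wq].
Proof.
move=> Wp WU.
have [f [b [h1 h2 _ h3]]] := D_extend (@nQE0 k n m w) (@nQEB k n m w) (@nQEM k n m w) (@nQEc k n m w)
  (@nQE_cdeg k n m w) (@nQE_eb k n m w) (nQE_span m0) aU Wp WU (dgQT (@cdeg_nQE k n m w) t).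
by exists f, b.
Qed.

Lemma D_ext_deg (W : opn k n) (t : D w W) j p : W p -> opn_sub W U -> D_deg j t ->
  exists f (b : B), [/\ nz f p, forall q, nz f q -> W q, D_deg j b &
  forall q (Uq : U q) (Wq : W q), nz f q -> sval b Uq = loc_str (E_galg w) (sval f Uq) * sval t Wq].
Proof.
move=> Wp WU /D_degE ht.
have [f [b [h1 h2 h4 h3]]] := D_extend (@nQE0 k n m w) (@nQEB k n m w) (@nQEM k n m w) (@nQEc k n m w)
  (@nQE_cdeg k n m w) (@nQE_eb k n m w) (nQE_span m0) aU Wp WU ht.
by exists f, b; split=> //; apply/D_degE.
Qed.

Lemma D_zero (t : B) (V : opn k n) p0 : V p0 ->
  (forall q (Uq : U q), V q -> sval t Uq = 0) -> t = 0.
Proof.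
exact: (B_zero (@nQE_cdeg k n m w) (@cdeg_nQE k n m w)
  (@nQE_eb k n m w) (nQE_span m0) (E_indep hsyz) aU).
Qed.

Lemma D_direct (x y : B) (Q Q' : int -> Prop) : (forall j, Q j -> ~ Q' j) ->
  dQ Q x -> dQ Q' y -> x + y = 0 -> x = 0.
Proof.
exact: (B_direct (@nQE_cdeg k n m w) (@cdeg_nQE k n m w)
  (@nQE_eb k n m w) (nQE_span m0) (E_indep hsyz) aU).
Qed.

Lemma D_flat (M N : nat) l (b : 'I_M -> B) (q : 'I_M -> 'I_N -> R) :
  (forall a, D_deg l (b a)) -> (forall j, \sum_a os (q a j) * b a = 0) ->
  exists K (e : 'I_K -> B) (r : 'I_M -> 'I_K -> R), [/\ forall c, D_deg l (e c),
    forall a, b a = \sum_c os (r a c) * e c & forall c j, \sum_a r a c * q a j = 0].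
Proof.
move=> hb hq; have hb' a : dQ (eq l) (b a) by apply/D_degE.
have [K [e [r [h1 h2 h3]]]] := B_flat (@nQE0 k n m w) (@nQEM k n m w) (@nQEc k n m w)
  (@nQE_cdeg k n m w) (@cdeg_nQE k n m w) (@nQE_eb k n m w) (nQE_span m0) (E_indep hsyz) aU hb' hq.
by exists K, e, r; split=> // c; apply/D_degE.
Qed.

(** Near a point some [f t] is a finite combination of homogeneous basis sections; the ideal
    argument removes the multiplier and keeps the number of degrees finite. *)
Lemma D_fin (t : B) : exists L : seq (int * B),
  (forall x, x \in L -> D_deg x.1 x.2) /\ t = \sum_(x <- L) x.2.
Proof.
pose J g := exists L : seq (int * B), (forall x, x \in L -> D_deg x.1 x.2) /\
  os g * t = \sum_(x <- L) x.2.
suff [L [hL eL]] : J 1 by exists L; split=> //; rewrite -eL ostr1 mul1r.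
apply: (ideal_one aU) => [|p Up].
  split=> [|f g [L [hL eL]] [L' [hL' eL']]|f g [L [hL eL]]].
  - by exists [::]; split=> //; rewrite big_nil raddf0 mul0r.
  - exists (L ++ L'); split; first by move=> x; rewrite mem_cat => /orP[/hL|/hL'].
    by rewrite big_cat /= -eL -eL' -mulrDl ostrD.
  - exists [seq (x.1, os f * x.2) | x <- L]; split.
      move=> _ /mapP[x /hL h ->] /=; rewrite -[x.1]add0r.
      by apply: D_degM => //; exact: D_deg_ostr.
    by rewrite big_map ostrM -mulrA eL mulr_sumr.
have [i pi] := pt_relevant p.
have [f [L [h1 h2 h3]]] := B_local (@nQE_cdeg k n m w) (@cdeg_nQE k n m w) (@nQE_eb k n m w) (nQE_span m0) (E_indep hsyz) aU Up pi
  (dgQT (@cdeg_nQE k n m w) t).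
exists f => //.
exists [seq ((bdeg m r.2)%:Z, os r.1 * esec (@nQE_cdeg k n m w) (@nQE_eb k n m w) U i r.2) | r <- L].
split; last by rewrite big_map h3.
move=> _ /mapP[r _ ->] /=; rewrite -[X in D_deg X _]add0r.
by apply: D_degM; [exact: D_deg_ostr|apply/D_degE; exact: esec_deg].
Qed.

Lemma dQ_deg (W : opn k n) Q j (t : D w W) : Q j -> D_deg j t -> dQ Q t.
Proof.
move=> Qj /D_degE; apply: dgQW; first exact: nQEM.
  exact: nQEc.
by move=> _ <-.
Qed.

Definition pr (j : int) (t : B) : B := \sum_(x <- projT1 (cid (D_fin t)) | x.1 == j) x.2.

(** The difference of two candidates for the component has degree [j] and is the negative of a
    section with degrees different from [j], so [D_direct] applies. The choice made in [pr] is thus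
    immaterial. *)
Lemma pr_list (j : int) (t : B) (L : seq (int * B)) :
  (forall x, x \in L -> D_deg x.1 x.2) -> t = \sum_(x <- L) x.2 ->
  pr j t = \sum_(x <- L | x.1 == j) x.2.
Proof.
move=> hL eL; rewrite /pr; case: (cid (D_fin t)) => L' [hL' eL'] /=.
have dj (l : seq (int * B)) : (forall x, x \in l -> D_deg x.1 x.2) ->
    D_deg j (\sum_(x <- l | x.1 == j) x.2).
  move=> hl; rewrite big_seq_cond; elim/big_rec: _ => [|x y /andP[xl /eqP <-] hy].
    exact: D_deg0.
  by apply: D_degD => //; exact: hl.
have dn (l : seq (int * B)) : (forall x, x \in l -> D_deg x.1 x.2) ->
    dQ (fun i => i <> j) (\sum_(x <- l | x.1 != j) x.2).
  move=> hl; rewrite big_seq_cond; elim/big_rec: _ => [|x y /andP[xl /eqP ne] hy].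
    exact/dgQ0/nQE0.
  apply: (dgQD (@nQE0 k n m w) (@nQEB k n m w) (@nQEM k n m w) (@nQEc k n m w) (@nQE_cdeg k n m w)) => //.
  by apply: dQ_deg ne _; exact: hl.
have dN Q (x : B) : dQ Q x -> dQ Q (- x).
  move=> hx; rewrite -mulN1r; apply: (dgQM (@nQEM k n m w) (@nQE_cdeg k n m w) (Q := eq 0) _ _ hx).
    by move=> i i' <-; rewrite add0r.
  by apply/D_degE; rewrite -[-1]opprK; do 2!apply: D_degN; rewrite -(ostr1 (E_galg w)); apply/D_degN/D_deg_ostr.
apply/eqP; rewrite -subr_eq0; apply/eqP.
apply: (D_direct (Q := eq j) (Q' := fun i => i <> j)
  (y := \sum_(x <- L' | x.1 != j) x.2 - \sum_(x <- L | x.1 != j) x.2)).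
- by move=> i <-; apply.
- apply: (dgQD (@nQE0 k n m w) (@nQEB k n m w) (@nQEM k n m w) (@nQEc k n m w) (@nQE_cdeg k n m w)).
    by apply/D_degE; exact: dj.
  by apply: dN; apply/D_degE; exact: dj.
- apply: (dgQD (@nQE0 k n m w) (@nQEB k n m w) (@nQEM k n m w) (@nQEc k n m w) (@nQE_cdeg k n m w)).
    exact: dn.
  exact/dN/dn.
rewrite addrACA -opprD; move: eL'; rewrite eL (bigID (fun x : int * B => x.1 == j)).
by rewrite [RHS](bigID (fun x : int * B => x.1 == j)) /= => ->; rewrite subrr.
Qed.

Lemma pr_id j t : D_deg j t -> pr j t = t.
Proof.
move=> ht; rewrite (pr_list j (L := [:: (j, t)])) ?big_seq1 //.
  by rewrite big_cons eqxx big_nil addr0.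
by move=> x; rewrite inE => /eqP ->.
Qed.

Lemma pr_ne i j t : D_deg i t -> i <> j -> pr j t = 0.
Proof.
move=> ht ne; rewrite (pr_list j (L := [:: (i, t)])) ?big_seq1 //.
  by rewrite big_cons big_nil /=; case: eqP.
by move=> x; rewrite inE => /eqP ->.
Qed.

Lemma prD j s t : pr j (s + t) = pr j s + pr j t.
Proof.
have [L [hL eL]] := D_fin s; have [L' [hL' eL']] := D_fin t.
rewrite (pr_list j hL eL) (pr_list j hL' eL') (pr_list j (L := L ++ L')) ?big_cat //.
  by move=> x; rewrite mem_cat => /orP[/hL|/hL'].
by rewrite eL eL'.
Qed.

Lemma pr_deg j t : D_deg j (pr j t).
Proof.
have [L [hL eL]] := D_fin t; rewrite (pr_list j hL eL) big_seq_cond.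
elim/big_rec: _ => [|x y /andP[xl /eqP <-] hy]; first exact: D_deg0.
by apply: D_degD => //; exact: hL.
Qed.

Lemma pr_sum t : exists2 s : seq int, uniq s & t = \sum_(j <- s) pr j t.
Proof.
have [L [hL eL]] := D_fin t; exists (undup [seq x.1 | x <- L]); first exact: undup_uniq.
rewrite {1}eL; transitivity (\sum_(j <- undup [seq x.1 | x <- L]) \sum_(x <- L | x.1 == j) x.2).
  rewrite (exchange_big_dep xpredT) //= [LHS]big_seq [RHS]big_seq; apply: eq_bigr => x xL.
  rewrite (big_rem x.1) /= ?mem_undup ?map_f // eqxx big_seq_cond big_pred0 ?addr0 // => b.
  by rewrite mem_rem_uniq ?undup_uniq // inE eq_sym; case: eqP; rewrite //= andbF.
by apply: eq_bigr => j _; rewrite (pr_list j hL eL).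
Qed.

End Instances.

(** * Global sections of quasi-coherent modules *)

Lemma iter_scale (A : pzRingType) (V : lmodType A) (a : A) N (v : V) :
  iter N (fun x => a *: x) v = a ^+ N *: v.
Proof. by elim: N => [|N IH]; rewrite ?expr0 ?scale1r // iterS IH exprS scalerA. Qed.

Section Sections.
Variables (k : fieldType) (n m : nat) (w : potential k n m) (U : opn k n).
Hypothesis aU : affine U.
Local Notation R := (O U).
Local Notation gm := (gmod w U).
Local Notation top := (subopn_top U).
Local Notation cap := (@subopn_cap k n U).
Implicit Types (W V : subopn U) (f g : R) (M : gm).
Local Notation sub := (@opn_sub k n).

Definition ro W f : D w W := ostr (E_galg w) (sres (@so_sub _ _ U W) f).

Lemma ro_res V W (h : sub V W) f : sres h (ro W f) = ro V f.
Proof. by apply: sect_ext => p Vp /=; congr (loc_str _ (sval f _)); exact: Prop_irrelevance. Qed.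

Lemma roM W f g : ro W (f * g) = ro W f * ro W g.
Proof. by rewrite /ro -ostrM; congr ostr; apply: sect_ext. Qed.

Lemma ro1 W : ro W 1 = 1.
Proof. by rewrite /ro -[RHS]ostr1; congr ostr; apply: sect_ext. Qed.

Lemma roX W f N : ro W (f ^+ N) = ro W f ^+ N.
Proof. by elim: N => [|N IH]; rewrite ?expr0 ?ro1 // !exprS roM IH. Qed.

Lemma ro_top f : ro top f = ostr (E_galg w) f.
Proof. by rewrite /ro; congr ostr; apply: sect_ext => p Up /=; congr (sval f _); exact: Prop_irrelevance. Qed.

Lemma roC W f a : ro W f * a = a * ro W f. Proof. exact: ostrC. Qed.

Lemma ro_inv W f : (forall q, W q -> nz f q) -> exists a : D w W, a * ro W f = 1.
Proof.
move=> h; have [g e] := inv_section (@so_sub _ _ U W) h.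
by exists (ostr (E_galg w) g); rewrite -ostrM e ostr1.
Qed.

Lemma ro_cancel M W f (s t : M W) : (forall q, W q -> nz f q) ->
  ro W f *: s = ro W f *: t -> s = t.
Proof.
move=> /ro_inv[a e] h; rewrite -[s]scale1r -[t]scale1r -e -!scalerA h //.
Qed.

Lemma gresD M V W (h : sub V W) (s t : M W) : gres h (s + t) = gres h s + gres h t.
Proof. exact: gres_add_subproof. Qed.

Lemma gres0 M V W (h : sub V W) : gres h (0 : M W) = 0.
Proof. exact: gres0_subproof. Qed.

Lemma gres_ro M V W (h : sub V W) f (s : M W) : gres h (ro W f *: s) = ro V f *: gres h s.
Proof. by rewrite gres_act ro_res. Qed.

Lemma gsep M W (s t : M W) : (forall p, W p -> exists V (h : sub V W), V p /\ gres h s = gres h t) ->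
  s = t.
Proof.
move=> hp; apply/eqP; rewrite -subr_eq0; apply/eqP.
pose I := {V : subopn U | exists h : sub V W, gres h s = gres h t}.
have hC (i : I) : sub (projT1 i) W by case: i => V [].
apply: (gsheaf_sep (C := fun i : I => projT1 i) (hC := hC)) => [p Wp|[V [h e]] /=].
  have [V [h [Vp e]]] := hp p Wp.
  by exists (exist _ V (ex_intro _ h e)).
by move: (hC _) => /= hh; rewrite gresB (Prop_irrelevance hh h) e subrr.
Qed.

Lemma gempty M W (s t : M W) : (forall p, ~ W p) -> s = t.
Proof. by move=> h; apply: gsep => p /h. Qed.

Lemma top_sub W : sub W top. Proof. exact: so_sub. Qed.

Lemma qc_local M p : U p -> exists (h : R) (W0 : subopn U), [/\ nz h p, forall q, nz h q -> W0 q &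
  forall (f : R) (V : subopn U) (hV : sub V W0), (forall q, V q <-> W0 q /\ nz f q) ->
   (forall s : M W0, gres hV s = 0 -> exists N, ro W0 (f ^+ N) *: s = 0) /\
   (forall t : M V, exists N s, gres hV s = ro V (f ^+ N) *: t)].
Proof.
move=> Up; have [W0 [W0p _ hW]] := gquasi_coherent M Up.
have [h nh hh] := affine_basis aU Up W0p; exists h, W0; split=> //.
- by exists Up.
- by move=> q [Uq]; exact: hh.
move=> f V hV eV; have nl : nonvanishing_locus (sres (@so_sub _ _ U W0) f) V.
  move=> q; rewrite eV; split=> [[W0q [Uq nq]]|[W0q nq]].
    by exists W0q => /=; rewrite (Prop_irrelevance (so_sub W0q) Uq).
  by split=> //; exists (so_sub W0q).
have [h1 h2] := hW _ V hV nl.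
split=> [s /h1[N]|t]; first by rewrite iter_scale -roX; exists N.
have [N [s e]] := h2 t; exists N, s; rewrite e iter_scale roX; congr (_ ^+ N *: _).
by rewrite -(ro_res hV) /ro ostr_res.
Qed.

(** Quasi-coherence is given only on some neighbourhood of each point. The functions [h] such that
    some [f^N s] vanishes on the part of [V] inside the locus of [h] form an ideal, which contains a
    power of [g]. *)
Lemma gm_zero M V g f (s : M V) : (forall q, V q <-> nz g q) ->
  gres (@cap_subl _ _ U V (dsub f)) s = 0 -> exists N, ro V (f ^+ N) *: s = 0.
Proof.
move=> eV s0.
pose J (h : R) := exists N, forall W (hW : sub W V), (forall q, W q -> nz h q) ->
  gres hW (ro V (f ^+ N) *: s) = 0.
have Jle W (hW : sub W V) N N' : (N <= N')%N -> gres hW (ro V (f ^+ N) *: s) = 0 ->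
    gres hW (ro V (f ^+ N') *: s) = 0.
  move=> le e; rewrite -(subnK le) exprD roM -scalerA gres_ro e scaler0 //.
have [N [M' hM]] : exists N, J (g ^+ N).
  apply: (ideal_pow aU) => [|p Vp].
    split=> [|a b [N hN] [N' hN']|a b [N hN]].
    - by exists 0%N => W hW h; apply: gempty => p /h /nz0.
    - exists (maxn N N') => W hW h; apply: gsep => p Wp.
      have [na|nb] := nzD (h p Wp).
        exists (cap W (dsub a)), (@cap_subl _ _ U W (dsub a)); split=> //.
        rewrite gres0 (gres_comp _ _ (sub_trans hW (@cap_subl _ _ U W (dsub a)))).
        by apply: (Jle _ _ N); [exact: leq_maxl|apply: hN => q []].
      exists (cap W (dsub b)), (@cap_subl _ _ U W (dsub b)); split=> //.
      rewrite gres0 (gres_comp _ _ (sub_trans hW (@cap_subl _ _ U W (dsub b)))).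
      by apply: (Jle _ _ N'); [exact: leq_maxr|apply: hN' => q []].
    - by exists N => W hW h; apply: hN => q /h /nzM[].
  have [h [W0 [nh hW0 qc]]] := qc_local M (nz_in Vp).
  exists h => //.
  have VV : forall q, cap W0 V q <-> W0 q /\ nz g q by move=> q; split=> -[? /eV].
  have [_ ext] := qc g (cap W0 V) (@cap_subl _ _ U W0 V) VV.
  have [N0 [t et]] := ext (gres (@cap_subr _ _ U W0 V) s).
  pose V' := cap (cap W0 V) (dsub f).
  have V'W : sub V' W0 by move=> q [[]].
  have eV' q : V' q <-> W0 q /\ nz (f * g) q.
    by split=> [[[W0q /eV ng] nf]|[W0q /nzM[nf /eV]]]; split=> //; apply/nzM.
  have [zer _] := qc (f * g) V' V'W eV'.
  have V'V : sub V' V by move=> q [[]].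
  have [N1 e1] : exists N, ro W0 ((f * g) ^+ N) *: t = 0.
    apply: zer; rewrite -(gres_comp (@cap_subl _ _ U W0 V) (@cap_subl _ _ U (cap W0 V) (dsub f))) et.
    rewrite gres_ro (gres_comp _ _ V'V).
    have V'c : sub V' (cap V (dsub f)) by move=> q [[]].
    by rewrite -(gres_comp (@cap_subl _ _ U V (dsub f)) V'c) s0 gres0 scaler0.
  exists N1 => W hW h'.
  have WW : sub W (cap W0 V) by move=> q Wq; split; [exact/hW0/h'|exact: hW].
  have ng : forall q, W q -> nz (g ^+ (N1 + N0)) q by move=> q /hW /eV; exact: nzX.
  apply: (ro_cancel ng); rewrite scaler0.
  have := congr1 (fun x => gres WW (gres (@cap_subl _ _ U W0 V) x)) e1.
  rewrite !gres_ro et !gres_ro !gres0 (gres_comp _ _ hW) => e2.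
  rewrite -[RHS]e2 !scalerA -!roM; congr (ro _ _ *: _).
  by rewrite exprMn exprD mulrC mulrA.
exists M'; have := hM V (fun p Vp => Vp); rewrite gres_id; apply=> q /eV; exact: nzX.
Qed.

(** The [h] for which some [f^N s] extends over [dsub h] form an ideal: extensions over [dsub a] and
    [dsub b] agree on the intersection after multiplication by a further power of [f], by [gm_zero],
    and glue over [dsub (a + b)], which the two sets cover. *)
Lemma gm_ext M f (s : M (dsub f)) : exists N (t : M top), forall W (hW : sub W (dsub f)),
  gres (@top_sub W) t = ro W (f ^+ N) *: gres hW s.
Proof.
pose J h := exists N (t : M (dsub h)), forall W (h1 : sub W (dsub h)) (h2 : sub W (dsub f)),
  gres h1 t = ro W (f ^+ N) *: gres h2 s.
have J1 : J 1.
  apply: (ideal_one aU) => [|p Up].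
    split=> [|a b [N [t ht]] [N' [t' ht']]|a b [N [t ht]]].
    - by exists 0%N, 0 => W h1 h2; apply: gempty => p /h1 /nz0.
    - pose ta := gres (@cap_subl _ _ U (dsub a) (dsub b)) (ro _ (f ^+ N') *: t).
      pose tb := gres (@cap_subr _ _ U (dsub a) (dsub b)) (ro _ (f ^+ N) *: t').
      have [K eK] : exists K, ro _ (f ^+ K) *: (ta - tb) = 0.
        apply: (gm_zero (g := a * b)) => [q|]; first by rewrite nzM.
        rewrite gresB /ta /tb.
        pose X := cap (cap (dsub a) (dsub b)) (dsub f).
        have Xa : sub X (dsub a) by move=> q [[]].
        have Xb : sub X (dsub b) by move=> q [[]].
        have Xf : sub X (dsub f) by move=> q [].
        rewrite (gres_comp _ _ Xa) (gres_comp _ _ Xb) !gres_ro (ht X Xa Xf) (ht' X Xb Xf).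
        by rewrite !scalerA -!roM mulrC subrr.
      pose C (i : bool) := cap (dsub (a + b)) (dsub (if i then a else b)).
      pose hC i : sub (C i) (dsub (a + b)) := @cap_subl _ _ U _ _.
      have sa : sub (C true) (dsub a) by move=> q [].
      have sb : sub (C false) (dsub b) by move=> q [].
      pose u : forall i, M (C i) := fun i => if i as i return M (C i)
        then gres sa (ro _ (f ^+ (K + N')) *: t) else gres sb (ro _ (f ^+ (K + N)) *: t').
      have agree V (ha : sub V (dsub a)) (hb : sub V (dsub b)) :
          gres ha (ro _ (f ^+ (K + N')) *: t) = gres hb (ro _ (f ^+ (K + N)) *: t').
        have hab : sub V (cap (dsub a) (dsub b)) by move=> q Vq; split; [exact: ha|exact: hb].
        have := congr1 (gres hab) eK; rewrite gres0 scalerBr gresB => /eqP; rewrite subr_eq0 => /eqP.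
        rewrite !gres_ro (gres_comp _ _ ha) (gres_comp _ _ hb) !gres_ro !scalerA -!roM.
        by rewrite -!exprD.
      have [|[] [] V hi hj|r hr] := gsheaf_glue hC _ (t := u).
      + by move=> q nq; have [na|nb] := nzD nq; [exists true|exists false].
      + by rewrite (Prop_irrelevance hi hj).
      + by rewrite /u !(gres_comp _ _ (sub_trans sa hi)) (gres_comp _ _ (sub_trans sb hj)); exact: agree.
      + by rewrite /u !(gres_comp _ _ (sub_trans sb hi)) (gres_comp _ _ (sub_trans sa hj)); apply/esym/agree.
      + by rewrite (Prop_irrelevance hi hj).
      exists (K + N + N')%N, r => W h1 h2; apply: gsep => p Wp.
      have [na|nb] := nzD (h1 p Wp).
        pose V := cap W (C true); have VW : sub V W by move=> q [].
        have VC : sub V (C true) by move=> q [].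
        have Va : sub V (dsub a) by move=> q [_ []].
        exists V, VW; split; first by split=> //; split=> //; exact: h1.
        rewrite (gres_comp _ _ (sub_trans (hC true) VC)) -(gres_comp (hC true) VC) hr /u.
        rewrite (gres_comp _ _ Va) !gres_ro (ht V Va (sub_trans h2 VW)) (gres_comp _ _ (sub_trans h2 VW)).
        by rewrite scalerA -roM -exprD addnAC.
      pose V := cap W (C false); have VW : sub V W by move=> q [].
      have VC : sub V (C false) by move=> q [].
      have Vb : sub V (dsub b) by move=> q [_ []].
      exists V, VW; split; first by split=> //; split=> //; exact: h1.
      rewrite (gres_comp _ _ (sub_trans (hC false) VC)) -(gres_comp (hC false) VC) hr /u.
      rewrite (gres_comp _ _ Vb) !gres_ro (ht' V Vb (sub_trans h2 VW)) (gres_comp _ _ (sub_trans h2 VW)).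
      by rewrite scalerA -roM -exprD.
    - have hab : sub (dsub (a * b)) (dsub b) by move=> q /nzM[].
      exists N, (gres hab t) => W h1 h2.
      by rewrite (gres_comp _ _ (sub_trans hab h1)); exact: ht.
  have [h [W0 [nh hW0 qc]]] := qc_local M Up; exists h => //.
  have VV q : cap W0 (dsub f) q <-> W0 q /\ nz f q by [].
  have [_ ext] := qc f _ (@cap_subl _ _ U W0 (dsub f)) VV.
  have [N [t et]] := ext (gres (@cap_subr _ _ U W0 (dsub f)) s).
  have hs : sub (dsub h) W0 by move=> q; exact: hW0.
  exists N, (gres hs t) => W h1 h2.
  have Wc : sub W (cap W0 (dsub f)) by move=> q Wq; split; [exact/hs/h1|exact: h2].
  rewrite (gres_comp _ _ (sub_trans hs h1)).
  rewrite -(gres_comp (@cap_subl _ _ U W0 (dsub f)) Wc) et gres_ro.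
  by rewrite (gres_comp _ _ h2).
have [N [t ht]] := J1.
have t1 : sub top (dsub (1 : R)) by move=> q Uq; exact: (nz1 Uq).
exists N, (gres t1 t) => W hW.
by rewrite (gres_comp _ _ (sub_trans t1 (@top_sub W))); exact: ht.
Qed.

Lemma gmZ M (s : M top) W p : W p -> gres (@top_sub W) s = 0 ->
  exists2 f, nz f p & ostr (E_galg w) f *: s = 0.
Proof.
move=> Wp s0; have Up := so_sub Wp; have [f nf fW] := affine_basis aU Up Wp.
have cW : sub (cap top (dsub f)) W by move=> q [_ [Uq]]; exact: fW.
have [||N e] := @gm_zero M top 1 f s.
- by move=> q; split=> [|/nz_in//]; exact: nz1.
- by rewrite -(gres_comp (@top_sub W) cW) s0 gres0.
by exists (f ^+ N); [apply: nzX; exists Up|rewrite -ro_top].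
Qed.

Lemma gmE M W (s : M W) p : W p -> exists (f : R) (t : M top) (hf : sub (dsub f) W), nz f p /\
  gres (@top_sub (dsub f)) t = ro (dsub f) f *: gres hf s.
Proof.
move=> Wp; have Up := so_sub Wp; have [f nf fW] := affine_basis aU Up Wp.
have hf : sub (dsub f) W by move=> q [Uq]; exact: fW.
have [N [t ht]] := gm_ext (gres hf s).
have hfN : sub (dsub (f ^+ N.+1)) (dsub f) by rewrite exprS => q /nzM[].
exists (f ^+ N.+1), (ro top f *: t), (sub_trans hf hfN); split; first by apply: nzX; exists Up.
by rewrite gres_ro (ht _ hfN) scalerA -roM -exprS (gres_comp _ _ (sub_trans hf hfN)).
Qed.

Lemma gmor_faithful M N (F G : gmor M N) : (forall s : M top, F top s = G top s) ->
  forall W (s : M W), F W s = G W s.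
Proof.
move=> e W s; apply: gsep => p Wp; have [f [t [hf [nf et]]]] := gmE s Wp.
exists (dsub f), hf; split=> //; apply: (ro_cancel (f := f)) => //.
have lin (H : gmor M N) : ro (dsub f) f *: gres hf (H W s) = gres (@top_sub (dsub f)) (H top t).
  by rewrite -gfun_res -gmor_act_subproof -et gfun_res.
by rewrite !lin e.
Qed.

(** * Extension of a map of global sections to a morphism of sheaves *)

Section Full.
Variables (M N : gm) (phi : M top -> N top).
Hypothesis phi_lin : forall (a : D w U) s t, phi (a *: s + t) = a *: phi s + phi t.
Hypothesis phi_gr : forall j s, phi (gpart (ggr M top) j s) = gpart (ggr N top) j (phi s).

Lemma phiD s t : phi (s + t) = phi s + phi t.
Proof. by have := phi_lin 1 s t; rewrite !scale1r. Qed.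
Lemma phi0 : phi 0 = 0.
Proof. by apply: (@addrI _ (phi 0)); rewrite -phiD !addr0. Qed.
Lemma phiZ (a : D w U) s : phi (a *: s) = a *: phi s.
Proof. by rewrite -[a *: s]addr0 phi_lin phi0 addr0. Qed.
Lemma phiB s t : phi (s - t) = phi s - phi t.
Proof. by rewrite -scaleN1r addrC phi_lin scaleN1r addrC. Qed.

(** Near each point of [V], the section [z] is killed by a function invertible there, and [phi] is
    linear. *)
Lemma phi_local (z : M top) V : gres (@top_sub V) z = 0 -> gres (@top_sub V) (phi z) = 0.
Proof.
move=> z0; apply: gsep => p Vp; have [f nf fz] := gmZ Vp z0.
exists (cap V (dsub f)), (@cap_subl _ _ U V (dsub f)); split=> //.
apply: (ro_cancel (f := f)) => [q []//|].
rewrite gres0 scaler0 (gres_comp _ _ (@top_sub (cap V (dsub f)))) -gres_ro ro_top.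
by rewrite -phiZ fz phi0 gres0.
Qed.

(** The graph of the extension of [phi] to sections over [W]: locally [s = u / f] with [u] global,
    and [t] must be [phi u / f]. *)
Definition frep W (s : M W) (t : N W) : Prop := forall p, W p ->
  exists (f : R) (u : M top) (V : subopn U) (hV : sub V W), [/\ V p, forall q, V q -> nz f q,
    gres (@top_sub V) u = ro V f *: gres hV s & gres (@top_sub V) (phi u) = ro V f *: gres hV t].

Lemma frepP W (s : M W) t f u V (hV : sub V W) : frep s t -> (forall q, V q -> nz f q) ->
  gres (@top_sub V) u = ro V f *: gres hV s -> gres (@top_sub V) (phi u) = ro V f *: gres hV t.
Proof.
move=> st Vf eu; apply: gsep => p Vp.
have [f1 [u1 [V1 [hV1 [V1p V1f eu1 et1]]]]] := st p (hV p Vp).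
pose V2 := cap V V1; have V2V : sub V2 V by move=> q [].
have V21 : sub V2 V1 by move=> q [].
exists V2, V2V; split=> //; apply: (ro_cancel (f := f1)) => [q /V21/V1f//|].
have z : gres (@top_sub V2) (ro top f1 *: u - ro top f *: u1) = 0.
  rewrite gresB !gres_ro -(gres_comp (@top_sub V) V2V) eu -(gres_comp (@top_sub V1) V21) eu1.
  rewrite !gres_ro !(gres_comp _ _ (sub_trans hV V2V)) (Prop_irrelevance (sub_trans hV V2V) (sub_trans hV1 V21)).
  by rewrite !scalerA roC subrr.
have := phi_local z; rewrite phiB !phiZ gresB !gres_ro => /eqP; rewrite subr_eq0 => /eqP e1.
rewrite (gres_comp _ _ (@top_sub V2)) e1 -(gres_comp (@top_sub V1) V21) et1 !gres_ro.
rewrite (gres_comp hV V2V (sub_trans hV V2V)) (gres_comp hV1 V21 (sub_trans hV1 V21)).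
by rewrite (Prop_irrelevance (sub_trans hV V2V) (sub_trans hV1 V21)) !scalerA roC.
Qed.

Lemma frep_uniq W (s : M W) t t' : frep s t -> frep s t' -> t = t'.
Proof.
move=> st st'; apply: gsep => p Wp; have [f [u [V [hV [Vp Vf eu et]]]]] := st p Wp.
exists V, hV; split=> //; apply: (ro_cancel Vf).
by rewrite -et (frepP st' Vf eu).
Qed.

Lemma frep_ex W (s : M W) : exists t, frep s t.
Proof.
(* The cover consists of all loci over which [f s] is the restriction of a global section; on each
   of them the value is [phi u / f]. *)
pose I := {f : R | exists (hf : sub (dsub f) W) (u : M top),
  gres (@top_sub (dsub f)) u = ro (dsub f) f *: gres hf s}.
pose C (i : I) := dsub (projT1 i).
have hC (i : I) : sub (C i) W by case: i => f [].
have tE (i : I) : {t : N (C i) | exists u : M top,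
    gres (@top_sub (C i)) u = ro (C i) (projT1 i) *: gres (hC i) s /\
    gres (@top_sub (C i)) (phi u) = ro (C i) (projT1 i) *: t}.
  apply: cid; have [hf [u eu]] := projT2 i.
  have [a ea] := ro_inv (W := C i) (f := projT1 i) (fun q h => h).
  exists (a *: gres (@top_sub (C i)) (phi u)), u; split.
    by rewrite (Prop_irrelevance (hC i) hf).
  by rewrite scalerA roC ea scale1r.
have [||t ht] := gsheaf_glue hC _ (t := fun i => projT1 (tE i)).
- move=> p Wp; have [f [u [hf [nf eu]]]] := gmE s Wp.
  by exists (exist _ f (ex_intro _ hf (ex_intro _ u eu))).
- move=> i j V hi hj; case: (tE i) => ti [u [eu et]] /=; case: (tE j) => tj [u' [eu' et']] /=.
  have ni q : V q -> nz (projT1 i * projT1 j) q by move=> Vq; apply/nzM; split; [exact: hi|exact: hj].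
  apply: (ro_cancel ni).
  have z : gres (@top_sub V) (ro top (projT1 j) *: u - ro top (projT1 i) *: u') = 0.
    rewrite gresB !gres_ro -(gres_comp (@top_sub (C i)) hi) eu -(gres_comp (@top_sub (C j)) hj) eu'.
    rewrite !gres_ro (gres_comp _ _ (sub_trans (hC i) hi)) (gres_comp _ _ (sub_trans (hC j) hj)).
    by rewrite (Prop_irrelevance (sub_trans (hC i) hi) (sub_trans (hC j) hj)) !scalerA roC subrr.
  have := phi_local z; rewrite phiB !phiZ gresB !gres_ro => /eqP; rewrite subr_eq0 => /eqP.
  rewrite -(gres_comp (@top_sub (C i)) hi) et -(gres_comp (@top_sub (C j)) hj) et' !gres_ro !scalerA.
  by rewrite -!roM [projT1 j * _]mulrC.
exists t => p Wp; have [f [u [hf [nf eu]]]] := gmE s Wp.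
pose i : I := exist _ f (ex_intro _ hf (ex_intro _ u eu)).
have [u' [eu' et']] := projT2 (tE i).
by exists f, u', (C i), (hC i); split=> //; rewrite (ht i).
Qed.

Variable m0 : (0 < m)%N.
Hypothesis D_ext : forall (W : opn k n) (t : D w W) p, W p -> sub W U ->
  exists f (b : D w U), [/\ nz f p, forall q, nz f q -> W q &
  forall q (Uq : U q) (Wq : W q), nz f q -> sval b Uq = loc_str (E_galg w) (sval f Uq) * sval t Wq].

Definition phi_ext W (s : M W) : N W := projT1 (cid (frep_ex s)).
Lemma phi_extP W (s : M W) : frep s (phi_ext s).
Proof. by rewrite /phi_ext; case: cid. Qed.

Lemma phi_extE W (s : M W) t : frep s t -> phi_ext s = t.
Proof. exact/frep_uniq/phi_extP. Qed.

Lemma phi_full : exists F : gmor M N, forall s : M top, F top s = phi s.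
Proof.
have lin W (a : D w W) s t : phi_ext (a *: s + t) = a *: phi_ext s + phi_ext t.
  apply: phi_extE => p Wp.
  have [f1 [u1 [V1 [h1 [V1p n1 e1 e1']]]]] := phi_extP s Wp.
  have [f2 [u2 [V2 [h2 [V2p n2 e2 e2']]]]] := phi_extP t Wp.
  have [f3 [b [n3 f3W e3]]] := D_ext a Wp (@so_sub _ _ U W).
  pose V := cap V1 (cap V2 (dsub f3)).
  have v1 : sub V V1 by move=> q [].
  have v2 : sub V V2 by move=> q [_ []].
  have v3 q : V q -> nz f3 q by move=> [_ []].
  have hV := sub_trans h1 v1.
  have eb : sres (@top_sub V) (b : D w top) = ro V f3 * sres hV a.
    apply: sect_ext => q Vq /=; rewrite (e3 q _ (hV q Vq) (v3 q Vq)).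
    by congr (loc_str _ (sval f3 _) * _); exact: Prop_irrelevance.
  exists (f1 * f2 * f3), (ro top f2 *: ((b : D w top) *: u1) + ro top (f1 * f3) *: u2), V, hV.
  have r1 (L : gm) (x y : L W) (u u' : L top) : gres (@top_sub V1) u = ro V1 f1 *: gres h1 x ->
      gres (@top_sub V2) u' = ro V2 f2 *: gres h2 y ->
      gres (@top_sub V) (ro top f2 *: ((b : D w top) *: u) + ro top (f1 * f3) *: u') =
      ro V (f1 * f2 * f3) *: gres hV (a *: x + y).
    move=> ex ey; rewrite !gresD !gres_ro !gres_act eb scalerDr.
    rewrite -(gres_comp (@top_sub V1) v1) ex -(gres_comp (@top_sub V2) v2) ey !gres_ro.
    rewrite (gres_comp h1 v1 hV) (gres_comp h2 v2 hV) !scalerA; congr (_ *: _ + _ *: _).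
      by rewrite -(roC f1) !mulrA -!roM.
    by rewrite -roM; congr (ro V _); rewrite -!mulrA; congr (_ * _); rewrite mulrC.
  split.
  - by split=> //; split.
  - by move=> q Vq; apply/nzM; split; [apply/nzM; split; [exact/n1/v1|exact/n2/v2]|exact: v3].
  - exact: r1.
  - by rewrite phiD !phiZ; exact: r1.
have res W W' (h : sub W' W) (s : M W) : phi_ext (gres h s) = gres h (phi_ext s).
  apply: phi_extE => p W'p; have [f [u [V [hV [Vp Vf eu et]]]]] := phi_extP s (h p W'p).
  pose V' := cap W' V; have VV : sub V' V by move=> q [].
  have VW : sub V' W' by move=> q [].
  exists f, u, V', VW; split=> //; first by move=> q /VV/Vf.
    rewrite -(gres_comp (@top_sub V) VV) eu gres_ro (gres_comp _ _ (sub_trans hV VV)).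
    by rewrite (gres_comp _ _ (sub_trans hV VV)).
  rewrite -(gres_comp (@top_sub V) VV) et gres_ro (gres_comp _ _ (sub_trans hV VV)).
  by rewrite (gres_comp _ _ (sub_trans hV VV)).
have gr W j (s : M W) : phi_ext (gpart (ggr M W) j s) = gpart (ggr N W) j (phi_ext s).
  apply: phi_extE => p Wp; have [f [u [V [hV [Vp Vf eu et]]]]] := phi_extP s Wp.
  exists f, (gpart (ggr M top) j u), V, hV; split=> //.
    by rewrite ggr_res eu gpart_scale0 ?ggr_res //; exact: D_deg_ostr.
  by rewrite phi_gr ggr_res et gpart_scale0 ?ggr_res //; exact: D_deg_ostr.
exists (Gmor lin res gr) => s /=; apply: phi_extE => p Up.
exists 1, s, top, (fun q Uq => Uq); split=> //; first by move=> q; exact: nz1.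
  by rewrite ro1 scale1r !gres_id.
by rewrite ro1 scale1r !gres_id.
Qed.

End Full.
End Sections.

(** * Graded modules *)

Module GradedModules.
Section Graded.
Variables (B : pzRingType) (deg : int -> B -> Prop).

Section Theory.
Variables (M : lmodType B) (gr : grading deg M).
Local Notation gp := (gpart gr).

Lemma gp0 j : gp j 0 = 0.
Proof. by apply: (@addrI _ (gp j 0)); rewrite -gpartD !addr0. Qed.

HB.instance Definition _ j := GRing.isNmodMorphism.Build M M (gp j) (gp0 j, gpartD gr j).

Lemma gpN j x : gp j (- x) = - gp j x. Proof. exact: raddfN. Qed.
Lemma gpB j x y : gp j (x - y) = gp j x - gp j y. Proof. exact: raddfB. Qed.

Lemma gp_mul i j b x : deg i b -> gp (i + j) (b *: x) = b *: gp j x.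
Proof.
move=> hb; have [s us es] := gpart_sum gr x.
rewrite {1}es scaler_sumr raddf_sum /= [in RHS]es raddf_sum scaler_sumr /=.
apply: eq_bigr => l _; rewrite [in RHS]gpartK.
have e : gp (i + l) (b *: gp l x) = b *: gp l x by apply: gpart_act => //; rewrite gpartK eqxx.
by rewrite -e gpartK (inj_eq (addrI i)); case: eqP => _; rewrite ?e ?scaler0.
Qed.

Lemma gp_eq0 x : (forall j, gp j x = 0) -> x = 0.
Proof. by move=> h; have [s _ ->] := gpart_sum gr x; rewrite big1. Qed.

Lemma gp_supp x : exists s : seq int, uniq s /\ x = \sum_(i <- s) gp i x /\
  forall j, j \notin s -> gp j x = 0.
Proof.
have [s us es] := gpart_sum gr x; exists s; split=> //; split=> // j js.
rewrite es raddf_sum big1_seq // => i /andP[_ iS] /=; rewrite gpartK.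
by case: eqP => // ji; rewrite ji iS in js.
Qed.

Lemma gp_hom j x : gp j (gp j x) = gp j x. Proof. by rewrite gpartK eqxx. Qed.

End Theory.

Record gsub (M : lmodType B) (gr : grading deg M) := GSub {
  gs :> M -> Prop;
  gs_zero : gs 0;
  gs_lin : forall b x y, gs x -> gs y -> gs (b *: x + y);
  gs_gp : forall j x, gs x -> gs (gpart gr j x)
}.

Section SubModule.
Variables (M : lmodType B) (gr : grading deg M) (X : gsub gr).

Definition gsp : {pred M} := fun x => `[< X x >].
Fact gsp_closed : submod_closed gsp.
Proof.
split=> [|b x y]; first exact/asboolP/gs_zero.
by move=> /asboolP hx /asboolP hy; apply/asboolP/gs_lin.
Qed.
HB.instance Definition _ := GRing.isSubmodClosed.Build B M gsp gsp_closed.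

Record subm := Subm { sub_elt :> M; sub_eltP : sub_elt \in gsp }.
HB.instance Definition _ := [isSub for sub_elt].
HB.instance Definition _ := [Choice of subm by <:].
HB.instance Definition _ := [SubChoice_isSubLmodule of subm by <:].

Lemma subm_mem (x : subm) : X (val x). Proof. exact/asboolP/(valP x). Qed.

Definition mksub x (h : X x) : subm := Subm (introT (asboolP (X x)) h).

Definition sub_gp j (x : subm) : subm := mksub (gs_gp j (subm_mem x)).

Definition sub_gr : grading deg subm.
Proof.
apply: (@Grading _ _ _ sub_gp) => [i x y|i j x|x|i j b x hb e].
- by apply: val_inj; rewrite /= gpartD.
- by apply: val_inj; rewrite /= gpartK; case: eqP.
- have [s us es] := gpart_sum gr (val x); exists s => //.
  by apply: val_inj; rewrite raddf_sum.
- apply: val_inj; rewrite /=; apply: gpart_act => //.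
  by have := congr1 val e.
Defined.

End SubModule.

Section QuotModule.
Variables (M : lmodType B) (gr : grading deg M) (X : gsub gr).

Fact gs_sub x y : X x -> X y -> X (x - y).
Proof. by move=> hx hy; rewrite addrC -scaleN1r; exact: gs_lin. Qed.

Definition quom := zquot (gs_zero X) gs_sub.
HB.instance Definition _ := GRing.Zmodule.on quom.
Definition qpi (x : M) : quom := zq_pi (gs_zero X) gs_sub x.

Lemma qpiD x y : qpi (x + y) = qpi x + qpi y. Proof. by rewrite /qpi raddfD. Qed.
Lemma qpi_eq x y : qpi x = qpi y <-> X (x - y). Proof. exact: zq_piP. Qed.
Lemma qpi_surj z : exists x, z = qpi x. Proof. exact: zq_surj. Qed.
Lemma qpi0 : qpi 0 = 0. Proof. by rewrite /qpi raddf0. Qed.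

Lemma gs_scale b x : X x -> X (b *: x).
Proof. by move=> hx; rewrite -[b *: x]addr0; apply: gs_lin => //; exact: gs_zero. Qed.

Definition qscale b (z : quom) : quom := qpi (b *: repr z).
Lemma qscaleE b x : qscale b (qpi x) = qpi (b *: x).
Proof.
apply/qpi_eq; rewrite -scalerBr; apply: gs_scale; exact: zq_repr.
Qed.

Fact qscaleA a b v : qscale a (qscale b v) = qscale (a * b) v.
Proof. by have [x ->] := qpi_surj v; rewrite !qscaleE scalerA. Qed.
Fact qscale1 : left_id 1 qscale.
Proof. by move=> v; have [x ->] := qpi_surj v; rewrite !qscaleE scale1r. Qed.
Fact qscaleDr : right_distributive qscale +%R.
Proof.
move=> a u v; have [x ->] := qpi_surj u; have [y ->] := qpi_surj v.
by rewrite -qpiD !qscaleE scalerDr qpiD.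
Qed.
Fact qscaleDl v : {morph qscale^~ v : a b / a + b}.
Proof. by move=> a b; have [x ->] := qpi_surj v; rewrite !qscaleE scalerDl qpiD. Qed.
HB.instance Definition _ := GRing.Zmodule_isLmodule.Build B quom qscaleA qscale1 qscaleDr qscaleDl.

Lemma qpiZ b x : qpi (b *: x) = b *: qpi x. Proof. by rewrite -qscaleE. Qed.
Lemma qpi_sum (I : Type) (s : seq I) (F : I -> M) : qpi (\sum_(i <- s) F i) = \sum_(i <- s) qpi (F i).
Proof. by elim: s => [|i s IH]; rewrite ?big_nil ?qpi0 // !big_cons qpiD IH. Qed.

Definition quo_gp j (z : quom) : quom := qpi (gpart gr j (repr z)).
Lemma quo_gpE j x : quo_gp j (qpi x) = qpi (gpart gr j x).
Proof. by apply/qpi_eq; rewrite -gpB; apply: gs_gp; exact: zq_repr. Qed.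

Definition quo_gr : grading deg quom.
Proof.
apply: (@Grading _ _ _ quo_gp) => [i z t|i j z|z|i j b z hb].
- have [x ->] := qpi_surj z; have [y ->] := qpi_surj t.
  by rewrite -qpiD !quo_gpE gpartD qpiD.
- have [x ->] := qpi_surj z; rewrite !quo_gpE gpartK.
  by case: eqP => // _; rewrite qpi0.
- have [x ->] := qpi_surj z; have [s us es] := gpart_sum gr x; exists s => //.
  by rewrite {1}es qpi_sum; apply: eq_bigr => i _; rewrite quo_gpE.
- have [x ->] := qpi_surj z; rewrite quo_gpE => e.
  by rewrite -{1}e -!qpiZ quo_gpE gp_mul // gp_hom qpiZ e qpiZ.
Defined.

End QuotModule.

Section ProdModule.
Variables (M N : lmodType B) (gM : grading deg M) (gN : grading deg N) (r : nat).

Definition prod_gp j (z : M * {ffun 'I_r -> N}) : M * {ffun 'I_r -> N} :=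
  (gpart gM j z.1, [ffun i => gpart gN j (z.2 i)]).

Lemma uniq_sum (V : lmodType B) (gV : grading deg V) (x : V) (s : seq int) :
  uniq s -> (forall j, j \notin s -> gpart gV j x = 0) -> x = \sum_(i <- s) gpart gV i x.
Proof.
move=> us hs; apply/eqP; rewrite -subr_eq0; apply/eqP/(gp_eq0 (gr := gV)) => j.
rewrite gpB raddf_sum /=; have [js|nj] := boolP (j \in s).
  rewrite (bigD1_seq j) //= gp_hom big1 ?addr0 ?subrr // => i ne.
  by rewrite gpartK eq_sym (negPf ne).
rewrite hs // sub0r big1_seq ?oppr0 // => i /andP[_ iS]; rewrite gpartK.
by case: eqP => // ji; rewrite ji iS in nj.
Qed.

Definition prod_gr : grading deg (M * {ffun 'I_r -> N})%type.
Proof.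
apply: (@Grading _ _ _ prod_gp) => [i [x u] [y v]|i j [x u]|[x u]|i j b [x u] hb [e1 e2]].
- congr (_, _) => /=; first exact: gpartD.
  by apply/ffunP => l; rewrite !ffunE gpartD.
- rewrite /prod_gp /= gpartK; case: eqP => [->|ne]; congr (_, _); apply/ffunP => l;
    by rewrite !ffunE gpartK ?eqxx //; case: eqP.
- have [s [us [_ hs]]] := gp_supp gM x.
  have [sv hsv] := choice (fun l => gp_supp gN (u l)).
  pose t := undup (s ++ flatten [seq sv l | l <- enum 'I_r]); exists t; first exact: undup_uniq.
  have ht j : j \notin t -> gpart gM j x = 0 /\ forall l, gpart gN j (u l) = 0.
    rewrite mem_undup mem_cat negb_or => /andP[js jf]; split; first exact: hs.
    move=> l; have [_ [_ h]] := hsv l; apply: h; apply: contra jf => h.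
    by apply/flattenP; exists (sv l) => //; apply/mapP; exists l; rewrite ?mem_enum.
  have e1 (l : seq int) : (\sum_(i <- l) prod_gp i (x, u)).1 = \sum_(i <- l) gpart gM i x.
    by elim: l => [|i l IH]; rewrite ?big_nil // !big_cons /= IH.
  have e2 (l : seq int) q : (\sum_(i <- l) prod_gp i (x, u)).2 q = \sum_(i <- l) gpart gN i (u q).
    elim: l => [|i l IH]; first by rewrite !big_nil ffunE.
    by rewrite !big_cons /= !ffunE IH.
  rewrite [RHS]surjective_pairing; congr (_, _).
    by rewrite e1; apply: uniq_sum; [exact: undup_uniq|move=> j /ht[]].
  by apply/ffunP => q; rewrite e2; apply: uniq_sum; [exact: undup_uniq|move=> j /ht[]].
- congr (_, _) => /=; first exact: gpart_act.
  apply/ffunP => l; rewrite !ffunE; apply: gpart_act => //.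
  by have := congr1 (fun f : {ffun 'I_r -> N} => f l) e2; rewrite ffunE.
Defined.

End ProdModule.
End Graded.
End GradedModules.
Export GradedModules.

(** * Quasi-compactness *)

Lemma nat_subseq (a : nat -> nat) : exists phi : nat -> nat,
  (forall i j, (i < j)%N -> (phi i < phi j)%N) /\ forall i j, (i <= j)%N -> (a (phi i) <= a (phi j))%N.
Proof.
have hmin N : exists i, (N <= i)%N /\ forall j, (N <= j)%N -> (a i <= a j)%N.
  pose P v := `[< exists2 i, (N <= i)%N & a i = v >].
  have exP : exists v, P v by exists (a N); apply/asboolP; exists N.
  case: (ex_minnP exP) => v /asboolP[i Ni <-] hv; exists i; split=> // j Nj.
  by apply: hv; apply/asboolP; exists j.
have [h hh] := choice hmin.
pose phi := fix phi i := if i is j.+1 then h (phi j).+1 else h 0%N.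
have phiP i : exists N, phi i = h N by case: i => [|i]; [exists 0%N|exists (phi i).+1].
have step i : (phi i < phi i.+1)%N by have [] := hh (phi i).+1.
have mono i j : (i < j)%N -> (phi i < phi j)%N.
  elim: j => // j IH; rewrite ltnS leq_eqVlt => /orP[/eqP ->|/IH lt]; first exact: step.
  exact: ltn_trans lt (step j).
exists phi; split=> // i j; rewrite leq_eqVlt => /orP[/eqP -> //|/mono lt].
have [N eN] := phiP i; rewrite eN; have [h1 h2] := hh N; apply: h2.
by apply: leq_trans (ltnW lt); rewrite eN.
Qed.

Lemma dickson_seq n (f : nat -> 'X_{1..n}) : exists i j, (i < j)%N /\ (f i <= f j)%MM.
Proof.
have [phi [mono hphi]] : exists phi : nat -> nat, (forall i j, (i < j)%N -> (phi i < phi j)%N) /\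
    forall v, v \in enum 'I_n -> forall i j, (i <= j)%N -> (f (phi i) v <= f (phi j) v)%N.
  elim: (enum 'I_n) => [|v s [phi [mono hphi]]]; first by exists id.
  have [psi [mono' hpsi]] := nat_subseq (fun i => f (phi i) v).
  have le i j : (i <= j)%N -> (psi i <= psi j)%N.
    by rewrite leq_eqVlt => /orP[/eqP ->//|/mono'/ltnW].
  exists (phi \o psi); split=> [i j /mono'/mono//|u].
  by rewrite inE => /orP[/eqP ->|us] i j ij; [exact: hpsi|apply: hphi => //; exact: le].
exists (phi 0%N), (phi 1%N); split; first exact: mono.
by apply/mnm_lepP => v; apply: hphi; rewrite ?mem_enum.
Qed.

(** Otherwise one could choose successively elements of [L] above none of the earlier ones, against
    [dickson_seq]. *)
Lemma dickson_fin n (L : 'X_{1..n} -> Prop) : exists s : seq 'X_{1..n},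
  (forall x, x \in s -> L x) /\ forall l, L l -> exists2 x, x \in s & (x <= l)%MM.
Proof.
apply: contrapT => none.
have next (s : seq 'X_{1..n}) : exists l, (forall x, x \in s -> L x) ->
    L l /\ forall x, x \in s -> ~ (x <= l)%MM.
  have [hs|nh] := pselect (forall x, x \in s -> L x); last by exists 0%MM => /nh.
  apply: contrapT => h; apply: none; exists s; split=> // l Ll; apply: contrapT => h'.
  by apply: h; exists l => _; split=> // x xs xl; apply: h'; exists x.
have [g hg] := choice next.
pose seqs := fix seqs i := if i is j.+1 then rcons (seqs j) (g (seqs j)) else [::].
have sP i : forall x, x \in seqs i -> L x.
  elim: i => // i IH x; rewrite mem_rcons inE => /orP[/eqP ->|/IH//].
  by have [] := hg _ IH.
have gin i j : (i < j)%N -> g (seqs i) \in seqs j.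
  elim: j => // j IH; rewrite ltnS leq_eqVlt mem_rcons inE => /orP[/eqP ->|/IH ->].
    by rewrite eqxx.
  by rewrite orbT.
have [i [j [ij le]]] := dickson_seq (fun i => g (seqs i)).
by have [_ h] := hg _ (sP j); exact: (h _ (gin i j ij) le).
Qed.

(** * Hilbert's basis theorem and finite covers of open subsets *)

Section Hilbert.
Import Order.LTheory.
Variables (k : fieldType) (n : nat).
Local Notation S := {mpoly k[n]}.

Inductive gen_by (G : S -> Prop) : S -> Prop :=
| gen0 : gen_by G 0
| genD a b c : G b -> gen_by G c -> gen_by G (a * b + c).

Lemma gen_add G a b : gen_by G a -> gen_by G b -> gen_by G (a + b).
Proof.
by elim=> [|c d e Gd _ IH] hb; [rewrite add0r|rewrite -addrA; apply: genD => //; exact: IH].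
Qed.

Lemma gen_mul G a b : gen_by G b -> gen_by G (a * b).
Proof.
elim=> [|c d e Gd _ IH]; first by rewrite mulr0; exact: gen0.
by rewrite mulrDr mulrA; exact: genD.
Qed.

Lemma gen_in (G : S -> Prop) b : G b -> gen_by G b.
Proof. by move=> Gb; rewrite -[b]mul1r -[1 * b]addr0; apply: genD => //; exact: gen0. Qed.

Lemma gen_trans (G H : S -> Prop) a : (forall b, G b -> gen_by H b) -> gen_by G a -> gen_by H a.
Proof.
move=> h; elim=> [|c d e Gd _ IH]; first exact: gen0.
by apply: gen_add => //; apply/gen_mul/h.
Qed.

Lemma gen_fin (G : S -> Prop) a : gen_by G a -> exists s : seq S,
  (forall b, b \in s -> G b) /\ gen_by (fun b => b \in s) a.
Proof.
elim=> [|c d e Gd _ [s [hs ge]]]; first by exists [::]; split=> //; exact: gen0.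
exists (d :: s); split; first by move=> b; rewrite inE => /orP[/eqP ->|/hs].
apply: genD; first by rewrite inE eqxx.
by apply: gen_trans ge => b bs; apply: gen_in; rewrite inE bs orbT.
Qed.

(** Dickson's lemma yields finitely many elements of the ideal whose leading monomials divide every
    leading monomial of the ideal, and each of them involves finitely many members of [G]. Division
    by them terminates because the leading monomial decreases. *)
Lemma hilbert_basis (G : S -> Prop) : exists s : seq S,
  (forall b, b \in s -> G b) /\ forall b, G b -> gen_by (fun b => b \in s) b.
Proof.
pose L (mu : 'X_{1..n}) := exists a, [/\ gen_by G a, a != 0 & mlead a = mu].
have [s [sL sP]] := dickson_fin L.
have hF (mu : 'X_{1..n}) : exists a, mu \in s -> [/\ gen_by G a, a != 0 & mlead a = mu].
  by have [/sL[a ha]|] := boolP (mu \in s); [exists a|exists 0].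
have [F FP] := choice hF.
have fin : forall l : seq 'X_{1..n}, (forall x, x \in l -> x \in s) -> exists s' : seq S,
    (forall b, b \in s' -> G b) /\ forall mu, mu \in l -> gen_by (fun b => b \in s') (F mu).
  elim=> [|mu l IH] hl; first by exists [::].
  have [|s1 [h1 h2]] := IH; first by move=> x xl; apply: hl; rewrite inE xl orbT.
  have [|gF _ _] := FP mu; first by apply: hl; rewrite inE eqxx.
  have [s2 [h3 h4]] := gen_fin gF; exists (s1 ++ s2); split.
    by move=> b; rewrite mem_cat => /orP[/h1|/h3].
  move=> mu'; rewrite inE => /orP[/eqP ->|/h2 h].
    by apply: gen_trans h4 => b bs; apply: gen_in; rewrite mem_cat bs orbT.
  by apply: gen_trans h => b bs; apply: gen_in; rewrite mem_cat bs.
have [|s' [h1 h2]] := fin s; first by [].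
exists s'; split=> // b /gen_in; have [->|b0] := eqVneq b 0; first by move=> _; exact: gen0.
move: {2}(mlead b) (erefl (mlead b)) => mu; move: b b0.
elim/(well_founded_ind (@ltom_wf n)): mu => mu IH b b0 emu gb.
have [nu nus numu] : exists2 x, x \in s & (x <= mu)%MM by apply: sP; exists b.
have [gF F0 eF] := FP nu nus.
pose c := b@_mu / (F nu)@_nu.
have lF0 : (F nu)@_nu != 0 by have := F0; rewrite -mleadc_eq0 eF.
have lX : mlead ('X_[mu - nu] * F nu) = mu.
  have X0 : ('X_[mu - nu] : S) != 0.
    by apply/eqP => /(congr1 (mcoeff (mu - nu)%MM)); rewrite mcoeffX eqxx mcoeff0 => /eqP; rewrite oner_eq0.
  by rewrite mleadM // mleadXm eF submK.
have cX : ('X_[mu - nu] * F nu)@_mu = (F nu)@_nu.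
  have := mleadcM 'X_[mu - nu] (F nu); rewrite mleadXm eF submK // => ->.
  by rewrite mcoeffX eqxx mul1r.
pose d := c *: ('X_[mu - nu] * F nu).
have gd : gen_by (fun b => b \in s') d.
  by rewrite /d -mul_mpolyC; do 2!apply: gen_mul; exact: h2.
rewrite -(subrK d b); apply: gen_add => //.
have [->|r0] := eqVneq (b - d) 0; first exact: gen0.
have gr : gen_by G (b - d).
  apply: gen_add => //; rewrite -mulN1r; apply: gen_mul.
  by rewrite /d -mul_mpolyC; do 2!apply: gen_mul.
apply: (IH (mlead (b - d))) => //; rewrite Order.POrderTheory.lt_neqAle; apply/andP; split.
  apply/eqP => e; have : (b - d)@_(mlead (b - d)) != 0 by rewrite mleadc_eq0.
  by rewrite e mcoeffB mcoeffZ cX mulfVK // subrr eqxx.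
apply: (Order.POrderTheory.le_trans (mleadB_le b d)).
rewrite leUx emu Order.POrderTheory.lexx /= -[X in (_ <= X)%O]lX.
exact: mleadZ_le.
Qed.

(** A prime containing the finitely many generators contains all of [G]. This bounds the degrees
    occurring in a section over an open subset that may fail to be affine. *)
Lemma quasi_compact_cover (W : opn k n) (G : S -> Prop) :
  (forall p, W p -> exists2 s, G s & ~ p s) -> exists s : seq S,
  (forall b, b \in s -> G b) /\ forall p, W p -> exists2 b, b \in s & ~ p b.
Proof.
move=> hG; have [s [h1 h2]] := hilbert_basis G; exists s; split=> // p /hG[b /h2 hb pb].
apply: contrapT => none; apply: pb; have pp := pt_prime p.
elim: hb => [|a c e cs _ IH]; first exact: (prime0 pp).
apply: (primeD pp) => //; apply: (primeMl pp).
by apply: contrapT => h; apply: none; exists c.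
Qed.

End Hilbert.

(** * The quasi-coherent module of a graded module *)

Lemma sum_supp (V : zmodType) (I : eqType) (F : I -> V) (s t : seq I) : uniq s -> uniq t ->
  (forall i, i \notin s -> F i = 0) -> (forall i, i \notin t -> F i = 0) ->
  \sum_(i <- s) F i = \sum_(i <- t) F i.
Proof.
move=> us ut hs ht.
have h (a b : seq I) : (forall i, i \notin b -> F i = 0) ->
    \sum_(i <- a) F i = \sum_(i <- [seq i <- a | i \in b]) F i.
  move=> hb; rewrite big_filter (bigID (mem b)) /= [X in _ + X]big1 ?addr0 //.
rewrite (h s t ht) (h t s hs); apply: perm_big; apply: uniq_perm; rewrite ?filter_uniq //.
by move=> i; rewrite !mem_filter andbC.
Qed.

Module TildeModule.
Section Tilde.
Variables (k : fieldType) (n m : nat) (w : potential k n m) (U : opn k n).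
Hypothesis aU : affine U.
Local Notation R := (O U).
Local Notation B := (D w U).
Local Notation top := (subopn_top U).
Local Notation sub := (@opn_sub k n).
Local Notation os := (fun f => ostr (E_galg w) f : D w U).
Implicit Types (W V : subopn U) (f g h : R) (p q : point k n).

Hypothesis Dz : forall (t : B) (V : opn k n) p0, V p0 ->
  (forall q (Uq : U q), V q -> sval t Uq = 0) -> t = 0.
Hypothesis D_ext : forall (W : opn k n) j (t : D w W) p, W p -> sub W U ->
  exists f (b : B), [/\ nz f p, forall q, nz f q -> W q, D_deg j t -> D_deg j b &
  forall q (Uq : U q) (Wq : W q), nz f q -> sval b Uq = loc_str (E_galg w) (sval f Uq) * sval t Wq].

Lemma D_stalk0 (t : B) p (Up : U p) : sval t Up = 0 -> t = 0.
Proof.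
move=> t0; have [a [s [hf e]]] := loc_lfrac (sval t Up).
have h0 : isfrac p (0 : E_galg w) 1.
  by exists 0%N; split; [exact: cdeg0|exact: homog1|exact: prime1 (pt_prime p)].
have [V [Vp hV]] : exists V : opn k n, V p /\ forall q (Uq : U q), V q ->
    isfrac q (0 : E_galg w) 1 /\ sval t Uq = lfrac q 0 1.
  by apply: (lfrac_local (t := t) (Wp := Up) h0); rewrite t0 (@lfrac0 k n (E_galg w)).
apply: (Dz Vp) => q Uq Vq; have [_ e'] := hV q Uq Vq; exact: (etrans e' (@lfrac0 k n (E_galg w) q 1)).
Qed.

Variables (N : lmodType B) (gr : grading (@D_deg k n m w U) N).

Definition ss f (x : N) : N := os f *: x.
Local Infix "**" := ss (at level 40).

Lemma ssM f g x : f ** (g ** x) = (f * g) ** x.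
Proof. by rewrite /ss scalerA -ostrM. Qed.
Lemma ssDr f x y : f ** (x + y) = f ** x + f ** y. Proof. exact: scalerDr. Qed.
Lemma ssDl f g x : (f + g) ** x = f ** x + g ** x. Proof. by rewrite /ss ostrD scalerDl. Qed.
Lemma ss1 x : 1 ** x = x. Proof. by rewrite /ss ostr1 scale1r. Qed.
Lemma ssb f (b : B) x : f ** (b *: x) = b *: (f ** x).
Proof. by rewrite /ss !scalerA ostrC. Qed.
Lemma ss0 f : f ** 0 = 0. Proof. exact: scaler0. Qed.
Lemma ss0l x : 0 ** x = 0.
Proof. by apply: (@addrI _ (0 ** x)); rewrite -ssDl !addr0. Qed.
Lemma ssB f x y : f ** (x - y) = f ** x - f ** y. Proof. exact: scalerBr. Qed.
Lemma ss_gp f j x : gpart gr j (f ** x) = f ** gpart gr j x.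
Proof. by have := gp_mul gr j x (D_deg_ostr w (W := U) f); rewrite add0r. Qed.

(** * Stalks of the sheaf of a module and the action of sections of [D] on them *)

Section Stalk.
Variable p : point k n.

Record nfr := Nfr { fnum : N; fden : R; fnz : nz fden p }.
HB.instance Definition _ := gen_eqMixin nfr.
HB.instance Definition _ := gen_choiceMixin nfr.

Definition nfr_eq (x y : nfr) : Prop :=
  exists2 h, nz h p & (h * fden y) ** fnum x = (h * fden x) ** fnum y.
Definition nfr_rel : rel nfr := fun x y => `[< nfr_eq x y >].

Lemma nfr_refl : reflexive nfr_rel.
Proof. by move=> x; apply/asboolP; exists (fden x) => //; exact: fnz. Qed.
Lemma nfr_sym : ssrbool.symmetric nfr_rel.
Proof. by move=> x y; apply/asboolP/asboolP => -[h nh e]; exists h. Qed.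
Lemma nfr_trans : transitive nfr_rel.
Proof.
move=> y x z /asboolP[h nh e] /asboolP[h' nh' e']; apply/asboolP.
exists (h * h' * fden y); first by apply/nzM; split; [apply/nzM|exact: fnz].
rewrite (_ : _ * fden z = (h' * fden z) * (h * fden y)); last ring.
rewrite -ssM e ssM (_ : _ * (h * fden x) = (h * fden x) * (h' * fden z)); last ring.
by rewrite -ssM e' ssM; congr (_ ** _); ring.
Qed.

Canonical nfr_equiv := EquivRel nfr_rel nfr_refl nfr_sym nfr_trans.
Definition nst := {eq_quot nfr_equiv}.
HB.instance Definition _ := Choice.on nst.

Definition fr (x : N) f (nf : nz f p) : nst := \pi_nst (Nfr x nf).

Lemma frP x f (nf : nz f p) y g (ng : nz g p) : fr x nf = fr y ng <->
  exists2 h, nz h p & (h * g) ** x = (h * f) ** y.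
Proof. by split=> [/eqmodP/asboolP|h]; [|apply/eqmodP/asboolP]. Qed.

Lemma frE x f (nf : nz f p) y g (ng : nz g p) : g ** x = f ** y -> fr x nf = fr y ng.
Proof. by move=> e; apply/frP; exists f => //; rewrite -!ssM e. Qed.

Lemma fr_surj (z : nst) : exists x f (nf : nz f p), z = fr x nf.
Proof. by exists (fnum (repr z)), (fden (repr z)), (fnz (repr z)); rewrite /fr -[LHS]reprK; case: (repr z). Qed.

Lemma fr_repr x f (nf : nz f p) : exists2 h, nz h p &
  (h * f) ** fnum (repr (fr x nf)) = (h * fden (repr (fr x nf))) ** x.
Proof. by have /eqmodP/asboolP[h nh e] := reprK (fr x nf); exists h. Qed.

Lemma fr_scale x f (nf : nz f p) g (ngf : nz (g * f) p) : fr x nf = fr (g ** x) ngf.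
Proof. by apply: frE; rewrite ssM [g * f]mulrC. Qed.

Lemma fr_irr x f (nf nf' : nz f p) : fr x nf = fr x nf'.
Proof. by rewrite (Prop_irrelevance nf nf'). Qed.

Lemma fr_surj2 (z z' : nst) : exists x x' f (nf : nz f p), z = fr x nf /\ z' = fr x' nf.
Proof.
have [x [f [nf ->]]] := fr_surj z; have [y [g [ng ->]]] := fr_surj z'.
have nfg : nz (g * f) p by apply/nzM.
exists (g ** x), (f ** y), (g * f), nfg; split; first exact: fr_scale.
by apply: frE; rewrite ssM.
Qed.

Definition st_add (z z' : nst) : nst := let x := repr z in let y := repr z' in
  fr (fden y ** fnum x + fden x ** fnum y) (proj2 (nzM (fden x) (fden y) p) (conj (fnz x) (fnz y))).

Lemma st_addE x y f (nf : nz f p) : st_add (fr x nf) (fr y nf) = fr (x + y) nf.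
Proof.
have [h nh e] := fr_repr x nf; have [h' nh' e'] := fr_repr y nf.
rewrite /st_add; move: (repr (fr x nf)) (repr (fr y nf)) e e' => [x1 f1 nf1] [y1 g1 ng1] /= e e'.
apply/frP; exists (h * h'); first by apply/nzM.
rewrite !ssDr !ssM; congr (_ + _).
  rewrite (_ : h * h' * f * g1 = h' * g1 * (h * f)); last ring.
  by rewrite -ssM e ssM; congr (_ ** _); ring.
rewrite (_ : h * h' * f * f1 = h * f1 * (h' * f)); last ring.
by rewrite -ssM e' ssM; congr (_ ** _); ring.
Qed.

Definition st_opp (z : nst) : nst := fr (- fnum (repr z)) (fnz (repr z)).
Lemma st_oppE x f (nf : nz f p) : st_opp (fr x nf) = fr (- x) nf.
Proof.
have [h nh e] := fr_repr x nf; rewrite /st_opp; move: (repr _) e => [x1 f1 nf1] /= e.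
by apply/frP; exists h => //; rewrite /ss !scalerN -/(ss _ _) e.
Qed.

Fact st_addA : associative st_add.
Proof.
move=> z1 z2 z3; have [x1 [x2 [f [nf [-> ->]]]]] := fr_surj2 z1 z2.
have [y [g [ng ->]]] := fr_surj z3.
have nfg : nz (g * f) p by apply/nzM.
rewrite (fr_scale x1 nf nfg) (fr_scale x2 nf nfg).
rewrite (_ : fr y ng = fr (f ** y) nfg); last by apply: frE; rewrite ssM.
by rewrite !st_addE addrA.
Qed.
Fact st_addC : commutative st_add.
Proof.
by move=> z1 z2; have [x1 [x2 [f [nf [-> ->]]]]] := fr_surj2 z1 z2; rewrite !st_addE addrC.
Qed.

Variable Up : U p.
Definition st0 : nst := fr 0 (nz1 Up).
Lemma st0E f (nf : nz f p) : st0 = fr 0 nf. Proof. by apply: frE; rewrite !ss0. Qed.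
Fact st_add0 : left_id st0 st_add.
Proof. by move=> z; have [x [f [nf ->]]] := fr_surj z; rewrite (st0E nf) st_addE add0r. Qed.
Fact st_addN : left_inverse st0 st_opp st_add.
Proof.
by move=> z; have [x [f [nf ->]]] := fr_surj z; rewrite (st0E nf) st_oppE st_addE addNr.
Qed.

Definition smap (phi : N -> N) (z : nst) : nst := fr (phi (fnum (repr z))) (fnz (repr z)).

Lemma smapE phi x f (nf : nz f p) : (forall g y, phi (g ** y) = g ** phi y) ->
  smap phi (fr x nf) = fr (phi x) nf.
Proof.
move=> hphi; have [h nh e] := fr_repr x nf; rewrite /smap; move: (repr _) e => [x1 f1 nf1] /= e.
by apply/frP; exists h => //; rewrite -!hphi e.
Qed.

(** The germ of [a] at [p] is the fraction [b / g] of global sections. Global elements act on [N],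
    so fractions act on its stalks. *)
Definition rep_at W (a : D w W) (Wp : W p) g (b : B) : Prop :=
  nz g p /\ forall Up : U p, sval b Up = loc_str (E_galg w) (sval g Up) * sval a Wp.

Lemma rep_ex W (a : D w W) (Wp : W p) : exists gb, rep_at a Wp gb.1 gb.2.
Proof.
have [g [b [h1 h2 _ h3]]] := D_ext 0 a Wp (@so_sub _ _ U W).
by exists (g, b); split=> //= Uq; rewrite (h3 p Uq Wp).
Qed.

Lemma rep_cross W (a : D w W) (Wp : W p) g b g' b' : rep_at a Wp g b -> rep_at a Wp g' b' ->
  os g' * b = os g * b'.
Proof.
move=> [n1 e1] [n2 e2]; apply/eqP; rewrite -subr_eq0; apply/eqP.
apply: (D_stalk0 (Up := Up)).
rewrite [LHS](_ : _ = loc_str (E_galg w) (sval g' Up) * sval b Up -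
   loc_str (E_galg w) (sval g Up) * sval b' Up) // e1 e2 !mulrA -!loc_strM.
by rewrite [sval g' Up * _]S_locC subrr.
Qed.

Definition tact W (a : D w W) (Wp : W p) (z : nst) : nst :=
  let gb := projT1 (cid (rep_ex a Wp)) in
  fr (gb.2 *: fnum (repr z)) (proj2 (nzM gb.1 (fden (repr z)) p)
    (conj (proj1 (projT2 (cid (rep_ex a Wp)))) (fnz (repr z)))).

Lemma tactE W (a : D w W) (Wp : W p) g b x f (nf : nz f p) (ngf : nz (g * f) p) :
  rep_at a Wp g b -> tact a Wp (fr x nf) = fr (b *: x) ngf.
Proof.
move=> hr; rewrite /tact; case: (cid _) => -[g0 b0] /= h0; have e1 := rep_cross hr h0.
have [h nh e] := fr_repr x nf; move: (repr _) e => [x1 f1 nf1] /= e.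
apply/frP; exists h => //.
transitivity (os g *: (b0 *: ((h * f) ** x1))).
  by rewrite -ssb -/(ss g _) ssM; congr (_ ** _); ring.
transitivity (os g0 *: (b *: ((h * f1) ** x))).
  by rewrite e [LHS]scalerA -e1 -scalerA.
by rewrite -ssb -/(ss g0 _) ssM; congr (_ ** _); ring.
Qed.

Lemma tact_ex W (a : D w W) (Wp : W p) x f (nf : nz f p) : exists g b (ngf : nz (g * f) p),
  rep_at a Wp g b /\ tact a Wp (fr x nf) = fr (b *: x) ngf.
Proof.
have [[g b] /= hr] := rep_ex a Wp.
have ngf : nz (g * f) p by apply/nzM; split=> //; case: hr.
by exists g, b, ngf; split=> //; exact: tactE.
Qed.

Lemma tactD W (a : D w W) (Wp : W p) z z' :
  tact a Wp (st_add z z') = st_add (tact a Wp z) (tact a Wp z').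
Proof.
have [x1 [x2 [f [nf [-> ->]]]]] := fr_surj2 z z'; have [[g b] /= hr] := rep_ex a Wp.
have ngf : nz (g * f) p by apply/nzM; split=> //; case: hr.
by rewrite st_addE !(tactE _ nf ngf hr) st_addE scalerDr.
Qed.

Lemma tact_Dl W (a a' : D w W) (Wp : W p) z :
  tact (a + a') Wp z = st_add (tact a Wp z) (tact a' Wp z).
Proof.
have [x [f [nf ->]]] := fr_surj z; have [[g b] /= hr] := rep_ex a Wp.
have [[g' b'] /= hr'] := rep_ex a' Wp.
have hs : rep_at (a + a') Wp (g * g') (os g' * b + os g * b').
  case: hr hr' => n1 e1 [n2 e2]; split; first by apply/nzM.
  move=> Uq; rewrite [LHS](_ : _ = loc_str (E_galg w) (sval g' Uq) * sval b Uq +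
   loc_str (E_galg w) (sval g Uq) * sval b' Uq) // e1 e2 !mulrA -!loc_strM mulrDr.
  by rewrite [sval g' Uq * _]S_locC.
have [[n1 _] [n2 _]] := (hr, hr').
have c1 : nz (g * f) p by apply/nzM.
have c2 : nz (g' * f) p by apply/nzM.
have c3 : nz (g * g' * f) p by do 2!(apply/nzM; split=> //).
rewrite (tactE _ nf c1 hr) (tactE _ nf c2 hr') (tactE _ nf c3 hs).
have -> : fr (b *: x) c1 = fr (os g' *: (b *: x)) c3.
  by apply: frE; rewrite -/(ss g' _) ssM; congr (_ ** _); ring.
have -> : fr (b' *: x) c2 = fr (os g *: (b' *: x)) c3.
  by apply: frE; rewrite -/(ss g _) ssM; congr (_ ** _); ring.
by rewrite st_addE scalerDl !scalerA.
Qed.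

Lemma tactM W (a a' : D w W) (Wp : W p) z : tact a Wp (tact a' Wp z) = tact (a * a') Wp z.
Proof.
have [x [f [nf ->]]] := fr_surj z; have [[g b] /= hr] := rep_ex a Wp.
have [[g' b'] /= hr'] := rep_ex a' Wp.
have hs : rep_at (a * a') Wp (g * g') (b * b').
  case: hr hr' => n1 e1 [n2 e2]; split; first by apply/nzM.
  move=> Uq; rewrite [LHS](_ : _ = sval b Uq * sval b' Uq) // e1 e2.
  rewrite [sval (a * a') Wp](_ : _ = sval a Wp * sval a' Wp) // [sval (g * g') Uq](_ : _ = sval g Uq * sval g' Uq) //.
  by rewrite loc_strM -!mulrA; congr (_ * _); rewrite !mulrA -loc_strC.
have [[n1 _] [n2 _]] := (hr, hr').
have c2 : nz (g' * f) p by apply/nzM.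
have c1 : nz (g * (g' * f)) p by apply/nzM.
have c3 : nz (g * g' * f) p by do 2!(apply/nzM; split=> //).
rewrite (tactE _ nf c2 hr') (tactE _ c2 c1 hr) (tactE _ nf c3 hs).
by apply: frE; rewrite -scalerA; congr (_ ** _); ring.
Qed.

Lemma tact1 W (Wp : W p) z : tact (1 : D w W) Wp z = z.
Proof.
have [x [f [nf ->]]] := fr_surj z.
have hs : rep_at (1 : D w W) Wp 1 1.
  by split=> [|Uq]; [exact: nz1|rewrite loc_str1 mul1r].
have c : nz (1 * f) p by apply/nzM; split=> //; exact: nz1.
by rewrite (tactE _ nf c hs); apply: frE; rewrite scale1r; congr (_ ** _); ring.
Qed.

(** For [z = x / f], the components of [x] of degree outside [L] vanish only after multiplication by
    functions; a single product [h] serves for the finitely many nonzero ones. *)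
Lemma smap_fin (L : seq int) z : uniq L -> (forall j, j \notin L -> smap (gpart gr j) z = st0) ->
  z = \big[st_add/st0]_(i <- L) smap (gpart gr i) z.
Proof.
have [x [f [nf ->]]] := fr_surj z => uL hL; have [s [us [es hs]]] := gp_supp gr x.
have hm j : smap (gpart gr j) (fr x nf) = fr (gpart gr j x) nf.
  by apply: smapE => g y; exact: ss_gp.
have sumE (l : seq int) (F : int -> N) : \big[st_add/st0]_(i <- l) fr (F i) nf = fr (\sum_(i <- l) F i) nf.
  elim: l => [|i l IH]; first by rewrite !big_nil (st0E nf).
  by rewrite !big_cons IH st_addE.
rewrite (eq_bigr (fun j => fr (gpart gr j x) nf)) // sumE.
have h0 j : j \notin L -> exists2 h, nz h p & h ** gpart gr j x = 0.
  move=> /hL; rewrite hm (st0E nf) => /frP[h nh]; rewrite ss0 => e.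
  by exists (h * f) => //; apply/nzM.
have [h nh hh] : exists2 h, nz h p & forall j, j \in s -> j \notin L -> h ** gpart gr j x = 0.
  elim: (s) => [|j l [h nh hh]]; first by exists 1 => //; exact: nz1.
  have [jL|/h0[h' nh' hh']] := boolP (j \in L).
    exists h => // i; rewrite inE => /orP[/eqP ->|]; first by rewrite jL.
    exact: hh.
  exists (h * h'); first by apply/nzM.
  move=> i; rewrite inE => /orP[/eqP ->|il] iL; first by rewrite -ssM hh' ss0.
  by rewrite mulrC -ssM hh // ss0.
apply/frP; exists h => //; rewrite mulrC -!ssM; congr (_ ** _).
rewrite {1}es /ss !scaler_sumr; apply: sum_supp => // i.
  by move=> /hs ->; rewrite scaler0.
move=> iL; have [is'|/hs ->] := boolP (i \in s); last by rewrite scaler0.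
exact: hh.
Qed.

End Stalk.

Record tsec W := TSec { tv : forall p, W p -> nst p;
  tv_loc : forall p (Wp : W p), exists x f, nz f p /\
    forall q (Wq : W q) (nq : nz f q), tv Wq = fr x nq }.
HB.instance Definition _ W := gen_eqMixin (tsec W).
HB.instance Definition _ W := gen_choiceMixin (tsec W).

Lemma tsec_ext W (s t : tsec W) : (forall p (Wp : W p), tv s Wp = tv t Wp) -> s = t.
Proof.
case: s t => [s hs] [t ht] /= e.
have {}e : s = t by do 2!apply: functional_extensionality_dep => ?.
by rewrite e in hs *; rewrite (Prop_irrelevance hs ht).
Qed.

Fact tadd_loc W (s t : tsec W) p (Wp : W p) : exists x f, nz f p /\
  forall q (Wq : W q) (nq : nz f q), st_add (tv s Wq) (tv t Wq) = fr x nq.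
Proof.
have [x [f [nf hx]]] := tv_loc s Wp; have [y [g [ng hy]]] := tv_loc t Wp.
exists (g ** x + f ** y), (g * f); split; first by apply/nzM.
move=> q Wq nq; have [nq1 nq2] := proj1 (nzM g f q) nq.
rewrite (hx q Wq nq2) (hy q Wq nq1) (fr_scale x nq2 nq).
rewrite (_ : fr y nq1 = fr (f ** y) nq) ?st_addE //.
by apply: frE; rewrite ssM.
Qed.

Fact topp_loc W (s : tsec W) p (Wp : W p) : exists x f, nz f p /\
  forall q (Wq : W q) (nq : nz f q), st_opp (tv s Wq) = fr x nq.
Proof.
have [x [f [nf hx]]] := tv_loc s Wp; exists (- x), f; split=> // q Wq nq.
by rewrite (hx q Wq nq) st_oppE.
Qed.

Fact tcst_loc W (x0 : N) p (Wp : W p) : exists x f, nz f p /\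
  forall q (Wq : W q) (nq : nz f q), fr x0 (nz1 (so_sub Wq)) = fr x nq.
Proof.
exists x0, 1; split=> [|q Wq nq]; first exact/nz1/(so_sub Wp).
exact: fr_irr.
Qed.

Definition tcst W (x : N) : tsec W := TSec (@tcst_loc W x).
Definition tadd W (s t : tsec W) := TSec (tadd_loc s t).
Definition topp W (s : tsec W) := TSec (topp_loc s).

Fact taddA W : associative (@tadd W).
Proof. by move=> s t u; apply: tsec_ext => p Wp; exact: st_addA. Qed.
Fact taddC W : commutative (@tadd W).
Proof. by move=> s t; apply: tsec_ext => p Wp; exact: st_addC. Qed.
Fact tadd0 W : left_id (tcst W 0) (@tadd W).
Proof. by move=> s; apply: tsec_ext => p Wp; exact: st_add0. Qed.
Fact taddN W : left_inverse (tcst W 0) (@topp W) (@tadd W).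
Proof. by move=> s; apply: tsec_ext => p Wp; exact: st_addN. Qed.
HB.instance Definition _ W := GRing.isZmodule.Build (tsec W) (@taddA W) (@taddC W) (@tadd0 W) (@taddN W).

Fact tscale_loc W (a : D w W) (s : tsec W) p (Wp : W p) : exists x f, nz f p /\
  forall q (Wq : W q) (nq : nz f q), tact a Wq (tv s Wq) = fr x nq.
Proof.
have [x [f [nf hx]]] := tv_loc s Wp.
have [g [b [ng _ _ hb]]] := D_ext 0 a Wp (@so_sub _ _ U W).
exists (b *: x), (g * f); split; first by apply/nzM.
move=> q Wq nq; have [nq1 nq2] := proj1 (nzM g f q) nq.
rewrite (hx q Wq nq2); apply: (tactE (so_sub Wq)); split=> // Uq.
exact: hb.
Qed.
Definition tscale W (a : D w W) (s : tsec W) := TSec (tscale_loc a s).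

Fact tscaleA W (a b : D w W) (s : tsec W) : tscale a (tscale b s) = tscale (a * b) s.
Proof. by apply: tsec_ext => p Wp; exact: (tactM (so_sub Wp)). Qed.
Fact tscale1 W : left_id (1 : D w W) (@tscale W).
Proof. by move=> s; apply: tsec_ext => p Wp; exact: (tact1 (so_sub Wp)). Qed.
Fact tscaleDr W : right_distributive (@tscale W) +%R.
Proof. by move=> a s t; apply: tsec_ext => p Wp; exact: (tactD (so_sub Wp)). Qed.
Fact tscaleDl W (s : tsec W) : {morph (@tscale W)^~ s : a b / a + b}.
Proof. by move=> a b; apply: tsec_ext => p Wp; exact: (tact_Dl (so_sub Wp)). Qed.
HB.instance Definition _ W := GRing.Zmodule_isLmodule.Build (D w W) (tsec W)
  (@tscaleA W) (@tscale1 W) (@tscaleDr W) (@tscaleDl W).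

Fact tres_loc W V (h : sub V W) (s : tsec W) p (Vp : V p) : exists x f, nz f p /\
  forall q (Vq : V q) (nq : nz f q), tv s (h q Vq) = fr x nq.
Proof.
have [x [f [nf hx]]] := tv_loc s (h p Vp); by exists x, f; split=> // q Vq nq; exact: hx.
Qed.
Definition tres W V (h : sub V W) (s : tsec W) : tsec V := TSec (tres_loc h s).

Fact tgp_loc j W (s : tsec W) p (Wp : W p) : exists x f, nz f p /\
  forall q (Wq : W q) (nq : nz f q), smap (gpart gr j) (tv s Wq) = fr x nq.
Proof.
have [x [f [nf hx]]] := tv_loc s Wp; exists (gpart gr j x), f; split=> // q Wq nq.
by rewrite (hx q Wq nq) smapE // => g y; exact: ss_gp.
Qed.
Definition tgp j W (s : tsec W) : tsec W := TSec (tgp_loc j s).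

Lemma smap_gp p j x f (nf : nz f p) : smap (gpart gr j) (fr x nf) = fr (gpart gr j x) nf.
Proof. by apply: smapE => g y; exact: ss_gp. Qed.

Lemma tv_sum W (I : Type) (l : seq I) (F : I -> tsec W) p (Wp : W p) :
  tv (\sum_(i <- l) F i) Wp = \big[@st_add p/st0 (so_sub Wp)]_(i <- l) tv (F i) Wp.
Proof. by elim: l => [|i l IH]; rewrite ?big_nil // !big_cons -IH. Qed.

Definition tgr W : grading (@D_deg k n m w W) (tsec W).
Proof.
apply: (@Grading _ _ _ (fun j => @tgp j W)) => [j s t|i j s|s|i j a s ha e].
- apply: tsec_ext => p Wp; rewrite [LHS](_ : _ = smap (gpart gr j) (st_add (tv s Wp) (tv t Wp))) //.
  rewrite [RHS](_ : _ = st_add (smap (gpart gr j) (tv s Wp)) (smap (gpart gr j) (tv t Wp))) //.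
  have [x [y [f [nf [-> ->]]]]] := fr_surj2 (tv s Wp) (tv t Wp).
  by rewrite st_addE !smap_gp gpartD st_addE.
- apply: tsec_ext => p Wp /=; have [x [f [nf e]]] := fr_surj (tv s Wp).
  case: eqP => ij; rewrite /= ?e !smap_gp gpartK; case: eqP => // _.
  by rewrite -(st0E (so_sub Wp) nf).
(* [G] collects the [b] on whose locus finitely many degrees suffice. Finitely many such loci cover
   [W], and their lists of degrees are concatenated. *)
- pose G (b : {mpoly k[n]}) := exists l : seq int, forall j, j \notin l -> forall q (Wq : W q),
    ~ q b -> smap (gpart gr j) (tv s Wq) = st0 (so_sub Wq).
  have [|gs [gsG gsc]] := @quasi_compact_cover k n W G.
    move=> p Wp; have [x [f [nf hx]]] := tv_loc s Wp.
    have [d [b [_ pb hb]]] := opn_open (o := dopn f) nf; exists b => //.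
    have [l [_ [_ hl]]] := gp_supp gr x; exists l => j jl q Wq qb.
    have nq : nz f q := hb q qb.
    by rewrite (hx q Wq nq) smap_gp hl // -(st0E (so_sub Wq) nq).
  have [l hl] : exists l : seq int, forall j, j \notin l -> forall b, b \in gs ->
      forall q (Wq : W q), ~ q b -> smap (gpart gr j) (tv s Wq) = st0 (so_sub Wq).
    elim: (gs) gsG => [|b gs' IH] hG; first by exists [::].
    have [|l1 h1] := IH; first by move=> c cg; apply: hG; rewrite inE cg orbT.
    have [|l2 h2] := hG b; first by rewrite inE eqxx.
    exists (l1 ++ l2) => j; rewrite mem_cat negb_or => /andP[j1 j2] c.
    by rewrite inE => /orP[/eqP -> q Wq|cg q Wq]; [exact: h2|exact: (h1 j j1 c cg)].
  exists (undup l); first exact: undup_uniq.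
  apply: tsec_ext => p Wp; rewrite tv_sum /=.
  have := @smap_fin p (so_sub Wp) (undup l) (tv s Wp) (undup_uniq l); apply=> j.
  by rewrite mem_undup => jl; have [b bg pb] := gsc p Wp; exact: (hl j jl b bg).
- apply: tsec_ext => p Wp; have ep : smap (gpart gr j) (tv s Wp) = tv s Wp.
    by rewrite -{2}e.
  have [g [b [ng _ hdeg hb]]] := D_ext i a Wp (@so_sub _ _ U W).
  have [x [f [nf ex]]] := fr_surj (tv s Wp).
  have ngf : nz (g * f) p by apply/nzM.
  have hr : rep_at a Wp g b by split=> // Uq; exact: hb.
  have e1 y : tact a Wp (fr y nf) = fr (b *: y) ngf by exact: (tactE (so_sub Wp)).
  rewrite [LHS](_ : _ = smap (gpart gr (i + j)) (tact a Wp (tv s Wp))) //.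
  rewrite [RHS](_ : _ = tact a Wp (tv s Wp)) // -[in RHS]ep ex smap_gp !e1 smap_gp.
  by rewrite gp_mul //; exact: hdeg.
Defined.

Lemma fr_eq0 (x : N) f : (forall q (nq : nz f q) (n1 : nz 1 q), fr x n1 = st0 (nz_in nq)) ->
  exists K, (f ^+ K) ** x = 0.
Proof.
move=> h; apply: (ideal_pow aU (I := fun g => g ** x = 0)) => [|q nq].
  split=> [|g g' e e'|g g' e]; first exact: ss0l.
    by rewrite ssDl e e' addr0.
  by rewrite -ssM e ss0.
have := h q nq (nz1 (nz_in nq)) => /frP[g ng]; rewrite ss0 mulr1 => e.
by exists g.
Qed.

(** By [ideal_pow] it suffices to find near each point a function [g] for which [g s] comes from [N]
    on all of [W]. If [s = x / h] near the point, [h^(K+1)] is such a function for large [K]. *)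
Lemma tsec_ext_pow W f (s : tsec W) : (forall q, W q <-> nz f q) -> exists K x,
  forall q (Wq : W q) (nq : nz (f ^+ K) q), tv s Wq = fr x nq.
Proof.
move=> eW.
pose J g := exists x, forall q (Wq : W q) (n1 : nz 1 q), smap (ss g) (tv s Wq) = fr x n1.
have sm p g x f' (nf : nz f' p) : smap (ss g) (fr x nf) = fr (g ** x) nf.
  by apply: smapE => g' y; rewrite !ssM mulrC.
suff [K [x hx]] : exists K, J (f ^+ K).
  exists K, x => q Wq nq; have := hx q Wq (nz1 (so_sub Wq)).
  have [y [g [ng ->]]] := fr_surj (tv s Wq); rewrite sm => /frP[h nh e].
  apply/frP; exists h => //; rewrite -ssM -[(h * g) ** x]e mulr1 ssM //.
apply: (ideal_pow aU) => [|p np].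
  split=> [|g g' [x hx] [x' hx']|g g' [x hx]].
  - exists 0 => q Wq n1; have [y [g [ng ->]]] := fr_surj (tv s Wq); rewrite sm.
    by apply: frE; rewrite ss0 ss1 ss0l.
  - exists (x + x') => q Wq n1; have := hx q Wq n1; have := hx' q Wq n1.
    have [y [h [nh ->]]] := fr_surj (tv s Wq); rewrite !sm => e1 e2.
    by rewrite ssDl -st_addE e1 e2 st_addE.
  - exists (g ** x) => q Wq n1; have := hx q Wq n1.
    have [y [h [nh ->]]] := fr_surj (tv s Wq); rewrite !sm => e1.
    by rewrite -ssM -sm e1 sm.
have Wp := proj2 (eW p) np; have [x [h [nh hx]]] := tv_loc s Wp.
(* The equation [h^(K+1) s = h^K x] is clear on the locus of [h] but is needed on all of [W]. Near
   every other point it holds for some exponent, and a second ideal argument makes the exponent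
   uniform. *)
pose J' g := exists K, forall q (Wq : W q) (n1 : nz 1 q), nz g q ->
   smap (ss (h ^+ K * h)) (tv s Wq) = fr ((h ^+ K) ** x) n1.
have J'le K K' q (Wq : W q) (n1 : nz 1 q) : (K <= K')%N ->
    smap (ss (h ^+ K * h)) (tv s Wq) = fr ((h ^+ K) ** x) n1 ->
    smap (ss (h ^+ K' * h)) (tv s Wq) = fr ((h ^+ K') ** x) n1.
  move=> le; have [y [g [ng ->]]] := fr_surj (tv s Wq); rewrite !sm => e.
  by rewrite -(subnK le) exprD -!mulrA -!ssM -sm ssM e sm.
have [a [K hK]] : exists a, J' (f ^+ a).
  apply: (ideal_pow aU) => [|p' np'].
    split=> [|g g' [K hK] [K' hK']|g g' [K hK]].
    - by exists 0%N => q Wq n1 /nz0.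
    - exists (maxn K K') => q Wq n1 /nzD[nq|nq].
        by apply: (J'le K); [exact: leq_maxl|exact: hK].
      by apply: (J'le K'); [exact: leq_maxr|exact: hK'].
    - by exists K => q Wq n1 /nzM[_]; exact: hK.
  have Wp' := proj2 (eW p') np'; have [x' [h' [nh' hx']]] := tv_loc s Wp'.
  exists h' => //.
  have [K eK] : exists K, ((h * h' * f) ^+ K) ** (h' ** x - h ** x') = 0.
    apply: fr_eq0 => q nq n1; have [/nzM[nq1 nq2] nq3] := proj1 (nzM (h * h') f q) nq.
    have Wq := proj2 (eW q) nq3; have := hx q Wq nq1; rewrite (hx' q Wq nq2) => /frP[g ng e].
    rewrite (st0E (nz_in nq) n1); apply/frP; exists g => //.
    by rewrite mulr1 ss0 ssB !ssM e subrr.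
  exists K => q Wq n1 nq; rewrite (hx' q Wq nq) sm; have nfq := proj1 (eW q) Wq.
  apply/frP; exists ((h' * f) ^+ K); first by apply: nzX; apply/nzM.
  apply/eqP; rewrite mulr1 ssM -subr_eq0 ssM -oppr_eq0 opprB; apply/eqP; rewrite -[RHS]eK ssB.
  rewrite !ssM; congr (_ ** _ - _ ** _); rewrite !exprMn; ring.
exists (h ^+ K * h); last by apply/nzM; split=> //; exact: nzX.
exists ((h ^+ K) ** x) => q Wq n1; apply: hK.
by apply: nzX; exact: (proj1 (eW q)).
Qed.

Fact tglue W (I : Type) (C : I -> subopn U) (hC : forall i, sub (C i) W)
  (cov : forall p, W p -> exists i, C i p) (t : forall i, tsec (C i)) :
  (forall i j V (hi : sub V (C i)) (hj : sub V (C j)), tres hi (t i) = tres hj (t j)) ->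
  exists s : tsec W, forall i, tres (hC i) s = t i.
Proof.
move=> ct; pose v p (Wp : W p) : nst p := tv (t (projT1 (cid (cov p Wp)))) (projT2 (cid (cov p Wp))).
have vE p (Wp : W p) i (Cp : C i p) : v p Wp = tv (t i) Cp.
  rewrite /v; case: (cid _) => j Cj /=; pose V := subopn_cap (C j) (C i).
  have Vp : V p by split.
  have := congr1 (fun s : tsec V => tv s Vp) (ct j i V (@cap_subl _ _ U _ _) (@cap_subr _ _ U _ _)).
  rewrite /=; rewrite (Prop_irrelevance (cap_subl Vp) Cj) (Prop_irrelevance (cap_subr Vp) Cp).
  by move=> <-; congr tv; exact: Prop_irrelevance.
have vloc p (Wp : W p) : exists x f, nz f p /\ forall q (Wq : W q) (nq : nz f q), v q Wq = fr x nq.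
  have [i Cp] := cov p Wp; have [x [f [nf hx]]] := tv_loc (t i) Cp.
  have [g ng gC] := affine_basis aU (so_sub Wp) Cp.
  exists (g ** x), (g * f); split; first by apply/nzM; split=> //; exists (so_sub Wp).
  move=> q Wq nq; have [[Uq nq1] nq2] := proj1 (nzM g f q) nq.
  have Cq := gC q Uq nq1.
  by rewrite (vE q Wq i Cq) (hx q Cq nq2); exact: fr_scale.
exists (TSec vloc) => i; apply: tsec_ext => p Cp /=; exact: vE.
Qed.

Lemma iter_tscale W (a : D w W) K (s : tsec W) : iter K (fun s => a *: s) s = a ^+ K *: s.
Proof. exact: iter_scale. Qed.

Lemma tv_ostr W f (s : tsec W) p (Wp : W p) x g (ng : nz g p) : tv s Wp = fr x ng ->
  tv (ro w W f *: s) Wp = fr (f ** x) ng.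
Proof.
move=> e; have hr : rep_at (ro w W f) Wp 1 (os f).
  split=> [|Uq]; first exact/nz1/(so_sub Wp).
  rewrite loc_str1 mul1r /=; congr (loc_str _ (sval f _)); exact: Prop_irrelevance.
have n1g : nz (1 * g) p by apply/nzM; split=> //; exact/nz1/(so_sub Wp).
rewrite [LHS](_ : _ = tact (ro w W f) Wp (tv s Wp)) // e (tactE (so_sub Wp) _ ng n1g hr).
by apply: frE; rewrite -/(ss _ _) !ssM; congr (_ ** _); ring.
Qed.

Lemma ro_top' (f : O top) : (ostr (E_galg w) f : D w top) = ro w top f.
Proof. by rewrite ro_top. Qed.

Definition tilde : gmod w U.
Proof.
apply: (@Gmod k n m w U (fun W => tsec W) tres _ _ _ _ _ _ _ tgr _).
- by move=> W W' h s t; apply: tsec_ext.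
- move=> W W' h a s; apply: tsec_ext => p W'p.
  rewrite [LHS](_ : _ = tact a (h p W'p) (tv s (h p W'p))) //.
  rewrite [RHS](_ : _ = tact (sres h a) W'p (tv s (h p W'p))) //.
  have [x [f [nf ->]]] := fr_surj (tv s (h p W'p)).
  have [g [b [ngf [hr ->]]]] := tact_ex (so_sub W'p) a (h p W'p) x nf.
  by symmetry; apply: (tactE (so_sub W'p)).
- by move=> W h s; apply: tsec_ext => p Wp /=; congr tv; exact: Prop_irrelevance.
- by move=> W1 W2 W3 h h' h'' s; apply: tsec_ext => p Wp /=; congr tv; exact: Prop_irrelevance.
- move=> W I C hC cov s hs; apply: tsec_ext => p Wp; have [i Cp] := cov p Wp.
  have := congr1 (fun t : tsec (C i) => tv t Cp) (hs i) => /=.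
  rewrite (Prop_irrelevance (hC i p Cp) Wp) => ->; exact: fr_irr.
- by move=> W I C hC cov t ct; exact: tglue.
- move=> p Up; exists top; split=> // f W' h nl.
  have eW q : W' q <-> nz (f : R) q by exact: nl.
  have isos W (V : subopn U) (hV : sub V W) : True by [].
  split=> [s s0|t].
    have [|K0 [x hx]] := @tsec_ext_pow top 1 s; first by move=> q; split=> [|/nz_in//]; exact: nz1.
    have [K eK] : exists K, ((f : R) ^+ K) ** x = 0.
      apply: fr_eq0 => q nq n1; have W'q := proj2 (eW q) nq.
      have := congr1 (fun t : tsec W' => tv t W'q) s0 => /=.
      have n1' : nz ((1 : R) ^+ K0) q by rewrite expr1n.
      rewrite (hx q (h q W'q) n1') => e.
      rewrite (_ : fr x n1 = fr x n1').
        by rewrite e; apply: frE; rewrite !ss0.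
      by apply: frE; rewrite expr1n.
    exists K; rewrite iter_tscale ro_top' -roX; apply: tsec_ext => q Tq.
    have n1' : nz ((1 : R) ^+ K0) q by rewrite expr1n; exact: nz1.
    rewrite (tv_ostr (f ^+ K) (hx q Tq n1')) eK.
    by apply: frE; rewrite !ss0.
  have [K [x hx]] := tsec_ext_pow t eW.
  exists K, (tcst top x); rewrite iter_tscale.
  have er : (ostr (E_galg w) (sres h f) : D w W') = ro w W' f.
    apply: sect_ext => q Wq /=; congr (loc_str _ (sval f _)); exact: Prop_irrelevance.
  rewrite er -roX; apply: tsec_ext => q Wq.
  have nq : nz ((f : R) ^+ K) q by apply: nzX; exact: (proj1 (eW q)).
  rewrite (tv_ostr (f ^+ K) (hx q Wq nq)) /=; apply: frE.
  by rewrite ss1.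
- by move=> W W' h j s; apply: tsec_ext.
Defined.

Lemma tilde_sections : exists phi : N -> tilde top,
  [/\ forall (b : B) x y, phi (b *: x + y) = b *: phi x + phi y,
      forall j x, phi (gpart gr j x) = gpart (ggr tilde top) j (phi x),
      injective phi & forall s, exists x, s = phi x].
Proof.
exists (fun x => tcst top x : tilde top); split.
- move=> b x y; apply: tsec_ext => p Up.
  pose n1 := nz1 (so_sub Up); have hr : rep_at (b : D w top) Up 1 b.
    by split=> [//|Uq]; rewrite loc_str1 mul1r (Prop_irrelevance Uq Up).
  have n11 : nz ((1 : R) * 1) p := proj2 (nzM _ _ _) (conj n1 n1).
  rewrite [RHS](_ : _ = st_add (tact (b : D w top) Up (fr x n1)) (fr y n1)); last by [].
  rewrite (tactE (so_sub Up) _ n1 n11 hr).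
  rewrite (_ : fr (b *: x) n11 = fr (b *: x) n1); last by apply: frE; rewrite mulr1.
  by rewrite st_addE.
- by move=> j x; apply: tsec_ext => p Up /=; rewrite smap_gp.
- move=> x y e; apply/eqP; rewrite -subr_eq0; apply/eqP.
  have [|K] := @fr_eq0 (x - y) 1.
    move=> q nq n1; have := congr1 (fun t : tsec top => tv t (nz_in nq)) e => /= /frP[h nh e'].
    rewrite (st0E (nz_in nq) n1); apply/frP; exists h => //; rewrite mulr1 in e'.
    by rewrite mulr1 ssB e' subrr ss0.
  by rewrite expr1n ss1.
- move=> s; have [|K [x hx]] := @tsec_ext_pow top 1 s; first by move=> q; split=> [|/nz_in//]; exact: nz1.
  exists x; apply: tsec_ext => q Tq /=.
  have nq : nz ((1 : R) ^+ K) q by rewrite expr1n; exact: nz1.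
  by rewrite (hx q Tq nq); apply: frE; rewrite expr1n.
Qed.

End Tilde.
End TildeModule.
Export TildeModule.

(** * Linear categories *)

Local Notation "f =~ g" := (heq f g) (at level 70, no associativity).
Local Notation "g 'oo' f" := (comp g f) (at level 40, left associativity).

#[global] Hint Resolve heq_refl : core.

Section Setoid.
Variables (R : comPzRingType) (C : lincat R).
Implicit Types a b c d : C.

Global Instance heq_equiv a b : Equivalence (@heq R C a b).
Proof. by split; [exact: heq_refl|exact: heq_sym|exact: heq_trans]. Qed.
Global Instance comp_proper a b c :
  Proper (@heq R C b c ==> @heq R C a b ==> @heq R C a c) (@comp R C a b c).
Proof. by move=> g g' eg f f' ef; exact: comp_heq. Qed.
Global Instance hadd_proper a b :
  Proper (@heq R C a b ==> @heq R C a b ==> @heq R C a b) (@hadd R C a b).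
Proof. by move=> g g' eg f f' ef; exact: hadd_heq. Qed.
Global Instance hopp_proper a b : Proper (@heq R C a b ==> @heq R C a b) (@hopp R C a b).
Proof. by move=> f f' ef; exact: hopp_heq. Qed.
Global Instance hscale_proper a b r : Proper (@heq R C a b ==> @heq R C a b) (@hscale R C a b r).
Proof. by move=> f f' ef; exact: hscale_heq. Qed.


Lemma hadd0r a b (f : hom a b) : hadd f (hzero a b) =~ f.
Proof. by rewrite haddC hadd0. Qed.

Lemma haddNr a b (f : hom a b) : hadd f (hopp f) =~ hzero a b.
Proof. by rewrite haddC haddN. Qed.

Lemma hadd_cancel a b (h f g : hom a b) : hadd h f =~ hadd h g -> f =~ g.
Proof.
move=> e; by rewrite -(hadd0 f) -(haddN h) -haddA e haddA haddN hadd0.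
Qed.

Lemma hscale0 a b (f : hom a b) : hscale 0 f =~ hzero a b.
Proof.
apply: (@hadd_cancel _ _ (hscale 0 f)); by rewrite -hscaleDl addr0 hadd0r.
Qed.

Lemma comp0l a b c (f : hom a b) : hzero b c oo f =~ hzero a c.
Proof.
by rewrite -(hscale0 (hzero b c)) compZl hscale0.
Qed.

Lemma comp0r a b c (f : hom b c) : f oo hzero a b =~ hzero a c.
Proof.
by rewrite -(hscale0 (hzero a b)) compZr hscale0.
Qed.

Lemma hopp_eq a b (f g : hom a b) : hadd f g =~ hzero a b -> g =~ hopp f.
Proof.
move=> e; apply: (@hadd_cancel _ _ f); by rewrite e haddNr.
Qed.

Lemma hsub_eq0 a b (f g : hom a b) : hadd f (hopp g) =~ hzero a b -> f =~ g.
Proof.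
move=> e; by rewrite -(hadd0r f) -(haddN g) haddA e hadd0.
Qed.

Lemma compNr a b c (g : hom b c) (f : hom a b) : g oo hopp f =~ hopp (g oo f).
Proof. by apply: hopp_eq; rewrite -compDr haddNr comp0r. Qed.

Lemma compNl a b c (g : hom b c) (f : hom a b) : hopp g oo f =~ hopp (g oo f).
Proof. by apply: hopp_eq; rewrite -compDl haddNr comp0l. Qed.

Lemma mono0 a b (f : hom a b) : mono f <-> forall d (g : hom d a), f oo g =~ hzero d b -> g =~ hzero d a.
Proof.
split=> [h d g e|h d g g' e]; first by apply: h; rewrite e comp0r.
by apply: hsub_eq0; apply: h; by rewrite compDr compNr e haddNr.
Qed.

Lemma epi0 a b (f : hom a b) : epi f <-> forall d (g : hom b d), g oo f =~ hzero a d -> g =~ hzero b d.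
Proof.
split=> [h d g e|h d g g' e]; first by apply: h; rewrite e comp0l.
by apply: hsub_eq0; apply: h; by rewrite compDl compNl e haddNr.
Qed.

(* Enough for the functors [Ext^i_R(X, -)], [i > 0], to be effaceable: a cocycle
   with values in [a'] becomes a coboundary after an epimorphism. *)
Definition effaceable : Prop :=
  forall (P : resolution R) (i : nat) (a : C), exists (a' : C) (u : hom a a'), mono u /\
  forall (c : C) (g : P i.+1 -> hom c a'), linear_to_hom g ->
  (forall y : P i.+2, g (rmap P i.+1 y) =~ hzero _ _) ->
  exists (c' : C) (p : hom c' c) (h : P i -> hom c' a'),
    [/\ epi p, linear_to_hom h & forall y, h (rmap P i y) =~ g y oo p].

(** Effaceability is applied to the tautological cocycle on the object [xZ x'] of cocycles. The
    resulting epimorphism onto [xZ x'] factors through [xB x'], so [xpr x'] is zero and every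
    induced morphism vanishes. *)
Lemma effaceable_flat : abelian C -> effaceable -> flat C.
Proof.
move=> aC eC; split=> // X P eps _ _ i a; have [a' [u [mu hu]]] := eC P i a.
exists a', u; split=> // x x' e [h _ [z ez1 ez2]].
have [xin0 mi _] := xinP x'; have [xpr0 epr _] := xprP x'.
have [_ eprx _] := xprP x.
have lin j : forall r y y', xev x' (j := j) (r *: y + y') =~ hadd (hscale r (xev x' y)) (xev x' y').
  by have [] := xevP x' j.
have uniq j d (f g : hom d (xH x' j)) : (forall y, xev x' y oo f =~ xev x' y oo g) -> f =~ g.
  move=> e'; have [_ univ] := xevP x' j.
  have [|h0 _ hu0] := univ d (fun y => xev x' y oo g).
    by move=> r y y'; rewrite lin compDl compZl.
  by rewrite (hu0 f e') (hu0 g (fun y => heq_refl _)).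
have [||c' [p [h' [ep lh' hh']]]] := hu (xZ x') (fun y => xev x' (j := i.+1) y oo xin x').
- by move=> r y y'; rewrite lin compDl compZl.
- by move=> y; rewrite -(xdP x' y) -compA xin0 comp0r.
have [_ univ] := xevP x' i; have [hh ehh _] := univ c' h' lh'.
have e1 : xd x' i oo hh =~ xin x' oo p.
  by apply: uniq => y; rewrite compA xdP ehh hh' compA.
have e2 : xB x' oo hh =~ p by apply: mi; rewrite compA xBP e1.
have pr0 : xpr x' =~ hzero _ _.
  apply: (proj1 (epi0 _) ep); by rewrite -e2 compA xpr0 comp0l.
apply: (proj1 (epi0 _) eprx); by rewrite ez2 pr0 comp0l.
Qed.

End Setoid.

(** * Linear categories equivalent to a category of graded modules *)

Section Concrete.
Variables (R : comPzRingType) (C : lincat R).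
Variables (B : pzRingType) (deg : int -> B -> Prop) (rho : R -> B).

(** An equivalence with the category of graded [B]-modules, kept as data so that kernels, cokernels
    and products in [C] can be computed on elements. *)
Record concrete := Concrete {
  el : C -> lmodType B;
  egr : forall a, grading deg (el a);
  ap : forall a b, hom a b -> el a -> el b;
  ap_lin : forall a b (f : hom a b) t x y, ap f (t *: x + y) = t *: ap f x + ap f y;
  ap_gp : forall a b (f : hom a b) j x, ap f (gpart (egr a) j x) = gpart (egr b) j (ap f x);
  ap_eq : forall a b (f g : hom a b), f =~ g <-> forall x, ap f x = ap g x;
  ap_id : forall a x, ap (idm a) x = x;
  ap_comp : forall a b c (g : hom b c) (f : hom a b) x, ap (g oo f) x = ap g (ap f x);
  ap_zero : forall a b x, ap (hzero a b) x = 0;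
  ap_hadd : forall a b (f g : hom a b) x, ap (hadd f g) x = ap f x + ap g x;
  ap_scale : forall a b r (f : hom a b) x, ap (hscale r f) x = rho r *: ap f x;
  ap_full : forall a b (phi : el a -> el b), (forall t x y, phi (t *: x + y) = t *: phi x + phi y) ->
    (forall j x, phi (gpart (egr a) j x) = gpart (egr b) j (phi x)) ->
    exists f : hom a b, forall x, ap f x = phi x;
  ap_obj : forall (N : lmodType B) (g : grading deg N), exists a (phi : N -> el a),
    [/\ forall t x y, phi (t *: x + y) = t *: phi x + phi y,
        forall j x, phi (gpart g j x) = gpart (egr a) j (phi x),
        injective phi & forall y, exists x, y = phi x]
}.

Arguments ap c {a b} f _ : rename.
Variable K : concrete.
Implicit Types a b c d : C.
Local Notation E := (el K).
Local Notation "f $ x" := (ap K f x) (at level 45, right associativity).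
Local Notation gp a := (gpart (egr K a)).

Lemma lin0 (M N : lmodType B) (phi : M -> N) :
  (forall t x y, phi (t *: x + y) = t *: phi x + phi y) -> phi 0 = 0.
Proof.
by move=> pl; apply: (@addrI _ (phi 0)); rewrite addr0 -{1}(scale1r (phi 0)) -pl scale1r addr0.
Qed.

Lemma apD a b (f : hom a b) x y : f $ (x + y) = f $ x + f $ y.
Proof. by have := ap_lin f 1 x y; rewrite !scale1r. Qed.
Lemma ap0 a b (f : hom a b) : f $ 0 = 0.
Proof. by apply: (@addrI _ (f $ 0)); rewrite -apD !addr0. Qed.
Lemma apZ a b (f : hom a b) t x : f $ (t *: x) = t *: (f $ x).
Proof. by rewrite -[t *: x]addr0 ap_lin ap0 addr0. Qed.
Lemma apN a b (f : hom a b) x : f $ (- x) = - (f $ x).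
Proof. by rewrite -scaleN1r apZ scaleN1r. Qed.
Lemma apB a b (f : hom a b) x y : f $ (x - y) = f $ x - f $ y.
Proof. by rewrite apD apN. Qed.

Lemma heq_ap a b (f g : hom a b) : (forall x, f $ x = g $ x) -> f =~ g.
Proof. by move=> h; apply/(ap_eq K). Qed.
Lemma ap_heq a b (f g : hom a b) x : f =~ g -> f $ x = g $ x.
Proof. by move=> /(ap_eq K). Qed.
Lemma heq0_ap a b (f : hom a b) : f =~ hzero a b <-> forall x, f $ x = 0.
Proof. by rewrite (ap_eq K); split=> h x; rewrite h ap_zero. Qed.

Definition inj a b (f : hom a b) := forall x, f $ x = 0 -> x = 0.
Definition surj a b (f : hom a b) := forall y, exists x, f $ x = y.

Lemma injI a b (f : hom a b) x y : inj f -> f $ x = f $ y -> x = y.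
Proof. by move=> i e; apply/eqP; rewrite -subr_eq0; apply/eqP/i; rewrite apB e subrr. Qed.

Definition ker_sub a b (f : hom a b) : gsub (egr K a).
Proof.
exists (fun x => f $ x = 0) => [|t x y ex ey|j x ex]; first exact: ap0.
  by rewrite ap_lin ex ey scaler0 addr0.
by rewrite ap_gp ex gp0.
Defined.

Definition im_sub a b (f : hom a b) : gsub (egr K b).
Proof.
exists (fun y => exists x, f $ x = y) => [|t _ _ [x <-] [y <-]|j _ [x <-]].
- by exists 0; rewrite ap0.
- by exists (t *: x + y); rewrite ap_lin.
- by exists (gp a j x); rewrite ap_gp.
Defined.

Lemma obj_sub a (X : gsub (egr K a)) : exists z (i : hom z a), inj i /\
  forall x, X x <-> exists y, i $ y = x.
Proof.
have [z [phi [pl pg pi ps]]] := ap_obj K (sub_gr X).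
have [psi psiK] := choice ps.
have phiK x : psi (phi x) = x by apply: pi; rewrite -psiK.
have [||i hi] := @ap_full K z a (fun y => val (psi y)).
- move=> t x y; have -> : psi (t *: x + y) = t *: psi x + psi y by apply: pi; rewrite pl -!psiK.
  by [].
- move=> j x; have -> : psi (gp z j x) = gpart (sub_gr X) j (psi x).
    by apply: pi; rewrite pg -!psiK.
  by [].
exists z, i; split=> [y|x].
  rewrite hi => e; rewrite [y]psiK (_ : psi y = 0); last exact: val_inj.
  exact: lin0 pl.
split=> [Xx|[y <-]]; last by rewrite hi; exact: subm_mem.
by exists (phi (mksub Xx)); rewrite hi phiK.
Qed.

Lemma obj_quo a (X : gsub (egr K a)) : exists z (q : hom a z), surj q /\
  forall x, q $ x = 0 <-> X x.
Proof.
have [z [phi [pl pg pi ps]]] := ap_obj K (quo_gr X).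
have phi0 := lin0 pl.
have [||q hq] := @ap_full K a z (fun x => phi (qpi X x)).
- by move=> t x y; rewrite qpiD qpiZ pl.
- by move=> j x; rewrite -pg /= quo_gpE.
exists z, q; split=> [y|x].
  by have [v ->] := ps y; have [x ->] := qpi_surj v; exists x; rewrite hq.
rewrite hq -phi0; split=> [/pi|h]; last by congr phi; rewrite -qpi0; apply/qpi_eq; rewrite subr0.
by rewrite -qpi0 => /qpi_eq; rewrite subr0.
Qed.

Lemma obj_prod a b r : exists c (p : hom c a) (q : 'I_r -> hom c b),
  (forall x (u : 'I_r -> E b), exists z, p $ z = x /\ forall i, q i $ z = u i) /\
  (forall z, p $ z = 0 -> (forall i, q i $ z = 0) -> z = 0).
Proof.
have [c [phi [pl pg pi ps]]] := ap_obj K (prod_gr (egr K a) (egr K b) r).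
have phi0 := lin0 pl.
have [psi psiK] := choice ps.
have phiK x : psi (phi x) = x by apply: pi; rewrite -psiK.
have psiL t x y : psi (t *: x + y) = t *: psi x + psi y by apply: pi; rewrite pl -!psiK.
have psiG j x : psi (gp c j x) = gpart (prod_gr (egr K a) (egr K b) r) j (psi x).
  by apply: pi; rewrite pg -!psiK.
have [||p hp] := @ap_full K c a (fun z => (psi z).1).
- by move=> t x y; rewrite psiL.
- by move=> j x; rewrite psiG.
have hq i : exists q : hom c b, forall z, q $ z = (psi z).2 i.
  apply: ap_full => [t x y|j x]; first by rewrite psiL /= !ffunE.
  by rewrite psiG /= ffunE.
have [q {}hq] := choice hq; exists c, p, q; split=> [x u|z e1 e2].
  exists (phi (x, [ffun i => u i])); rewrite hp phiK; split=> // i.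
  by rewrite hq phiK ffunE.
rewrite [z]psiK -phi0; congr phi; rewrite [psi z]surjective_pairing -hp e1; congr (_, _).
by apply/ffunP => i; rewrite -hq e2 ffunE.
Qed.

Lemma obj_pair a b : exists c (p : hom c a) (q : hom c b),
  (forall x y, exists z, p $ z = x /\ q $ z = y) /\ (forall z, p $ z = 0 -> q $ z = 0 -> z = 0).
Proof.
have [c [p [q [h1 h2]]]] := obj_prod a b 1; exists c, p, (q ord0); split=> [x y|z e1 e2].
  by have [z [e1 e2]] := h1 x (fun=> y); exists z.
by apply: h2 => // i; rewrite ord1.
Qed.

Lemma lift_along a b d (i : hom a b) (f : hom d b) : inj i -> (forall x, exists y, i $ y = f $ x) ->
  exists h : hom d a, i oo h =~ f.
Proof.
move=> ii h; have [phi hphi] := choice h.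
have [||g hg] := @ap_full K d a phi.
- by move=> t x y; apply: (injI ii); rewrite ap_lin !hphi ap_lin.
- by move=> j x; apply: (injI ii); rewrite hphi !ap_gp hphi.
by exists g; apply: heq_ap => x; rewrite ap_comp hg hphi.
Qed.

Lemma colift_surj a z b (q : hom a z) (f : hom a b) : surj q -> (forall x, q $ x = 0 -> f $ x = 0) ->
  exists h : hom z b, h oo q =~ f.
Proof.
move=> qs h; have [s hs] := choice qs.
have fE x y : q $ x = q $ y -> f $ x = f $ y.
  by move=> e; apply/eqP; rewrite -subr_eq0 -apB; apply/eqP/h; rewrite apB e subrr.
have [||g hg] := @ap_full K z b (fun y => f $ s y).
- by move=> t x y; rewrite -ap_lin; apply: fE; rewrite hs ap_lin !hs.
- by move=> j x; rewrite -ap_gp; apply: fE; rewrite hs ap_gp hs.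
by exists g; apply: heq_ap => x; rewrite ap_comp hg; apply: fE; rewrite hs.
Qed.

Lemma mono_injP a b (f : hom a b) : mono f <-> inj f.
Proof.
split=> [fm x fx|fi d g h e].
  have [z [i [ii hi]]] := obj_sub (ker_sub f).
  have e0 : f oo i =~ f oo hzero z a.
    apply: heq_ap => y; rewrite !ap_comp ap_zero ap0.
    by have : ker_sub f (i $ y) by apply/hi; exists y.
  have [y <-] := proj1 (hi x) fx.
  by rewrite (ap_heq y (fm _ _ _ e0)) ap_zero.
by apply: heq_ap => x; apply: (injI fi); rewrite -!ap_comp; exact: ap_heq.
Qed.

Lemma epi_surjP a b (f : hom a b) : epi f <-> surj f.
Proof.
split=> [fe y|fs d g h e].
  have [z [q [qs hq]]] := obj_quo (im_sub f).
  have e0 : q oo f =~ hzero b z oo f.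
    by apply: heq_ap => x; rewrite !ap_comp ap_zero; apply/hq; exists x.
  by apply: (proj1 (hq y)); rewrite (ap_heq y (fe _ _ _ e0)) ap_zero.
by apply: heq_ap => y; have [x <-] := fs y; rewrite -!ap_comp; exact: ap_heq.
Qed.

Lemma kernel_el a b c (g : hom b c) (f : hom a b) : is_kernel g f <->
  inj f /\ forall y, g $ y = 0 <-> exists x, f $ x = y.
Proof.
split=> [[gf0 /mono_injP fi fk]|[fi hk]].
  split=> // y; split=> [gy|[x <-]]; last by rewrite -ap_comp; exact: (proj1 (heq0_ap _)).
  have [z [i [ii hi]]] := obj_sub (ker_sub g).
  have [|h eh] := fk z i.
    by apply/heq0_ap => x; rewrite ap_comp; apply: (proj2 (hi _)); exists x.
  by have [v <-] := proj1 (hi y) gy; exists (h $ v); rewrite -ap_comp; exact: ap_heq.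
split; first by apply/heq0_ap => x; rewrite ap_comp; apply/hk; exists x.
  exact/mono_injP.
move=> d h e; apply: lift_along => // x; apply/hk.
by rewrite -ap_comp; exact: (proj1 (heq0_ap _)).
Qed.

Lemma cokernel_el a b c (f : hom a b) (g : hom b c) : is_cokernel f g <->
  surj g /\ forall y, g $ y = 0 <-> exists x, f $ x = y.
Proof.
split=> [[gf0 /epi_surjP gs gk]|[gs hk]].
  split=> // y; split=> [gy|[x <-]]; last by rewrite -ap_comp; exact: (proj1 (heq0_ap _)).
  have [z [q [qs hq]]] := obj_quo (im_sub f).
  have [|h eh] := gk z q.
    by apply/heq0_ap => x; rewrite ap_comp; apply/hq; exists x.
  by apply: (proj1 (hq y)); rewrite -(ap_heq y eh) ap_comp gy ap0.
split; first by apply/heq0_ap => x; rewrite ap_comp; apply/hk; exists x.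
  exact/epi_surjP.
move=> d h e; apply: colift_surj => // y /hk[x <-].
by rewrite -ap_comp; exact: (proj1 (heq0_ap _)).
Qed.

Lemma concrete_kernel b c (g : hom b c) : exists a (f : hom a b), is_kernel g f.
Proof.
by have [z [i [ii hi]]] := obj_sub (ker_sub g); exists z, i; apply/kernel_el.
Qed.

Lemma concrete_cokernel a b (f : hom a b) : exists c (g : hom b c), is_cokernel f g.
Proof.
by have [z [q [qs hq]]] := obj_quo (im_sub f); exists z, q; apply/cokernel_el.
Qed.

Lemma concrete_biproduct a b : exists c (i : hom a c) (j : hom b c) p q, is_biproduct i j p q.
Proof.
have [c [p [q [h1 h2]]]] := obj_pair a b.
have eqz z z' : p $ z = p $ z' -> q $ z = q $ z' -> z = z'.
  by move=> e e'; apply/eqP; rewrite -subr_eq0; apply/eqP/h2; rewrite apB ?e ?e' subrr.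
have [f hf] := choice (fun x => h1 x 0); have [g hg] := choice (fun y => h1 0 y).
have [||i hi] := @ap_full K a c f.
- by move=> t x y; apply: eqz; rewrite ap_lin ?(proj1 (hf _)) ?(proj2 (hf _)) ?scaler0 ?addr0.
- by move=> l x; apply: eqz; rewrite !ap_gp ?(proj1 (hf _)) ?(proj2 (hf _)) ?gp0.
have [||j hj] := @ap_full K b c g.
- by move=> t x y; apply: eqz; rewrite ap_lin ?(proj1 (hg _)) ?(proj2 (hg _)) ?scaler0 ?addr0.
- by move=> l x; apply: eqz; rewrite !ap_gp ?(proj1 (hg _)) ?(proj2 (hg _)) ?gp0.
exists c, i, j, p, q; split; apply: heq_ap => x.
- by rewrite ap_comp hi ap_id; case: (hf x).
- by rewrite ap_comp hj ap_id; case: (hg x).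
- by rewrite ap_comp hj ap_zero; case: (hg x).
- by rewrite ap_comp hi ap_zero; case: (hf x).
- rewrite ap_hadd !ap_comp ap_id hi hj; apply: eqz; rewrite apD.
    by rewrite (proj1 (hf _)) (proj1 (hg _)) addr0.
  by rewrite (proj2 (hf _)) (proj2 (hg _)) add0r.
Qed.

Lemma concrete_zero (a : C) : exists z : C, idm z =~ hzero z z.
Proof.
have [z [i [ii hi]]] := obj_sub (ker_sub (idm a)); exists z; apply/heq0_ap => x.
rewrite ap_id; apply: ii; have : ker_sub (idm a) (i $ x) by apply/hi; exists x.
by rewrite /= ap_id.
Qed.

Lemma concrete_abelian (a0 : C) : abelian C.
Proof.
split; [exact: concrete_zero a0|exact: concrete_biproduct|exact: concrete_kernel|exact: concrete_cokernel| |].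
- move=> a b f /mono_injP fi; have [c [g hg]] := concrete_cokernel f; exists c, g.
  by move/cokernel_el: hg => [_ h]; apply/kernel_el.
- move=> b c g /epi_surjP gs; have [a [f hf]] := concrete_kernel g; exists a, f.
  by move/kernel_el: hf => [_ h]; apply/cokernel_el.
Qed.

End Concrete.

Arguments ap {R C B deg rho} c {a b} f _ : rename.

Module DivisibleGroup.
(** * Characters *)

Fact int_rat0 : exists z : int, 0 = z%:~R :> rat. Proof. by exists 0. Qed.
Fact int_ratB (x y : rat) : (exists z : int, x = z%:~R) -> (exists z : int, y = z%:~R) ->
  exists z : int, x - y = z%:~R.
Proof. by move=> [z ->] [t ->]; exists (z - t); rewrite rmorphB. Qed.

Definition QZ := zquot int_rat0 int_ratB.
HB.instance Definition _ := GRing.Zmodule.on QZ.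
Definition qz (x : rat) : QZ := zq_pi int_rat0 int_ratB x.

Lemma qz_mul x (z : int) : qz x *~ z = qz (x *~ z).
Proof. by rewrite /qz raddfMz. Qed.

Lemma QZ_div (y : QZ) (n : nat) : (0 < n)%N -> exists x, x *~ n = y.
Proof.
move=> n0; have [r ->] := zq_surj y; exists (qz (r / n%:R)).
rewrite qz_mul; congr (qz _); rewrite -mulrzr -pmulrn divfK //.
by rewrite Num.Theory.pnatr_eq0 -lt0n.
Qed.

Lemma QZ_order (n : nat) : n != 1%N -> exists2 y : QZ, y != 0 & y *~ n = 0.
Proof.
(* For [n = 0] the torsion condition is empty and any nonzero class serves, here that of [1/2]. *)
move=> n1; exists (qz ((if n == 0 then 2 else n)%:R)^-1).
  apply/eqP => h; have [z ez] : exists z : int, (if n == 0 then 2 else n)%:R^-1 = z%:~R :> rat.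
    have /(zq_piP int_rat0 int_ratB) := etrans h (esym (raddf0 (zq_pi int_rat0 int_ratB))).
    by rewrite subr0.
  set N := (if n == 0 then 2 else n)%N in ez.
  have N1 : (1 < N)%N by rewrite /N; case: (n) n1 => [|[|]].
  have e : (z * N%:Z)%:~R = 1 :> rat.
    by rewrite rmorphM /= -ez mulVf // Num.Theory.pnatr_eq0 -lt0n (ltn_trans _ N1).
  have e' : z * N%:Z = 1 by apply: (@mulrIz rat 1 (oner_neq0 _)).
  have := congr1 absz e'; rewrite abszM /= => /eqP; rewrite muln_eq1 => /andP[_ /eqP h1].
  by rewrite h1 in N1.
rewrite qz_mul; case: eqP => [->|/eqP n0]; first by rewrite mulr0z /qz raddf0.
rewrite -mulrzr -pmulrn mulVf ?Num.Theory.pnatr_eq0 //.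
have -> : 0 = qz 0 by rewrite /qz raddf0.
by apply/(zq_piP int_rat0 int_ratB); exists 1; rewrite subr0.
Qed.

Lemma int_ideal (I : int -> Prop) : I 0 -> (forall a b, I a -> I b -> I (a - b)) ->
  exists n : nat, I n /\ forall z, I z -> exists q, z = q * n%:Z.
Proof.
move=> I0 IB; have IN a : I a -> I (- a) by rewrite -sub0r; exact: IB.
have IM (a : int) (q : nat) : I a -> I (a *+ q).
  move=> Ia; elim: q => [|q IH]; first by rewrite mulr0n.
  by have := IB (a *+ q) (- a) IH (IN _ Ia); rewrite opprK mulrSr.
have IZ (a q : int) : I a -> I (q * a).
  move=> Ia; case: q => q; first by rewrite mulrC -[Posz q]natz mulr_natr; exact: IM.
  by rewrite NegzE mulNr mulrC -[Posz q.+1]natz mulr_natr; apply/IN/IM.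
have [[n0 /andP[n0p /asboolP n0I]]|none] := pselect (exists n, (0 < n)%N && `[< I (Posz n) >]).
  have ex : exists n, (0 < n)%N && `[< I (Posz n) >].
    by exists n0; rewrite n0p; apply/asboolP.
  case: (ex_minnP ex) => n /andP[np /asboolP nI] nmin; exists n; split=> // z Iz.
  exists (z %/ n%:Z)%Z; have := divz_eq z n%:Z => e.
  suff r0 : (z %% n%:Z)%Z = 0 by rewrite {1}e r0 addr0.
  have nz : n%:Z != 0 by rewrite eqz_nat -lt0n.
  have rI : I (z %% n%:Z)%Z.
    have e1 : (z %% n%:Z)%Z = z - (z %/ n%:Z)%Z * n%:Z by apply/eqP; rewrite eq_sym subr_eq addrC -e.
    by rewrite e1; apply: (IB) => //; exact: IZ.
  have := modz_ge0 z nz; case er : (z %% n%:Z)%Z => [r|//] _.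
  have : (r%:Z < n%:Z)%R by rewrite -er -[X in (_ < X)%R]/(`|n%:Z|%R); exact: ltz_mod.
  rewrite ltz_nat => rn; case: (posnP r) => [->//|r0].
  have := nmin r; rewrite r0 /= => h; have : (n <= r)%N.
    by apply: h; apply/asboolP; rewrite -er.
  by rewrite leqNgt rn.
exists 0%N; split=> // -[[|z]|z] Iz; first by exists 0; rewrite mul0r.
  by case: none; exists z.+1; apply/asboolP.
by case: none; exists z.+1; apply/asboolP; move/IN: Iz; rewrite NegzE opprK.
Qed.

(** Baer's argument, with partial homomorphisms represented by their graphs: [P] is a subgroup
    meeting the second factor in [0]. A maximal such graph is total because [QZ] is divisible. *)
Lemma char_extend (G : zmodType) (P : G * QZ -> Prop) : P 0 ->
  (forall x y, P x -> P y -> P (x - y)) -> (forall y, P (0, y) -> y = 0) ->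
  exists f : G -> QZ, (forall x y, f (x + y) = f x + f y) /\ forall z, P z -> f z.1 = z.2.
Proof.
move=> P0 PB Pf.
pose good (X : G * QZ -> Prop) := [/\ forall z, P z -> X z, forall x y, X x -> X y -> X (x - y)
  & forall y, X (0, y) -> y = 0].
have [|A [PA maxA]] := @classical_sets.Zorn_bigcup (G * QZ)
    (fun X => good X \/ forall x, ~ X x).
  move=> F FP tot; have [[X [FX [x Xx]]]|none] := pselect (exists X, F X /\ exists x, X x).
    2:{ by right => x [X FX Xx]; apply: none; exists X; split=> //; exists x. }
  have gX Y : F Y -> (exists y, Y y) -> good Y.
    by move=> /FP[//|h] [y /h].
  left; split.
  - by move=> z Pz; have [h _ _] := gX X FX (ex_intro _ x Xx); exists X => //; exact: h.
  - move=> a b [Y FY Ya] [Z FZ Zb]; have [YZ|ZY] := tot Y Z FY FZ.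
      have [_ h _] := gX Z FZ (ex_intro _ b Zb).
      by exists Z => //; apply: h => //; apply: YZ.
    have [_ h _] := gX Y FY (ex_intro _ a Ya).
    by exists Y => //; apply: h => //; apply: ZY.
  - by move=> y [Y FY Yy]; have [_ _ h] := gX Y FY (ex_intro _ _ Yy); exact: h.
have gA : good A.
  case: PA => // A0; exfalso; apply: (maxA P); last by left; split.
  by split=> [x /A0//|h]; apply: (A0 0); apply: h.
have [PsubA AB Af] := gA; have A0 : A 0 by exact: PsubA.
have AN z : A z -> A (- z) by rewrite -sub0r; exact: AB.
have AD z t : A z -> A t -> A (z + t) by move=> hz /AN ht; rewrite -[t]opprK; exact: AB.
have AM z (q : int) : A z -> A (z *~ q).
  move=> Az; have h (j : nat) : A (z *+ j).
    by elim: j => [|j IH]; rewrite ?mulr0n // mulrSr; exact: AD.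
  by case: q => q; rewrite ?NegzE ?mulrNz; [exact: h|apply: AN; exact: h].
have fstM (z : G * QZ) (q : int) : (z *~ q).1 = z.1 *~ q.
  by rewrite (raddfMz (@fst G QZ)).
have sndM (z : G * QZ) (q : int) : (z *~ q).2 = z.2 *~ q.
  by rewrite (raddfMz (@snd G QZ)).
have total x : exists y, A (x, y).
  apply: contrapT => none.
  (* The integers [q] with [x *~ q] in the domain are the multiples of [n], and [v] is the value at
     [x *~ n]; an extension may send [x] to any [y] with [y *~ n = v]. *)
  have [||n [[v Av] hn]] := @int_ideal (fun q => exists v, A (x *~ q, v)).
  - by exists 0; rewrite mulr0z.
  - by move=> a b [v Av] [v' Av']; exists (v - v'); rewrite mulrzBr; exact: (AB _ _ Av Av').
  have [y ey] : exists y, y *~ n = v.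
    case: (posnP n) => [n0|n0]; last exact: QZ_div.
    by exists 0; rewrite n0 !mulr0z in Av *; rewrite (Af _ Av).
  pose A' z := exists h (q : int), A h /\ z = h + (x *~ q, y *~ q).
  apply: (maxA A'); last first.
    left; split.
    - by move=> z /PsubA Az; exists z, 0; rewrite !mulr0z addr0.
    - move=> _ _ [h [q [Ah ->]]] [h' [q' [Ah' ->]]]; exists (h - h'), (q - q').
      split; first exact: AB.
      by rewrite opprD addrACA; congr (_ + _); congr (_, _); rewrite mulrzBr.
    - move=> t [[h1 h2] [q [Ah [e1 e2]]]].
      have Ah' : A (x *~ q, - h2).
        have -> : (x *~ q, - h2) = - (h1, h2); last exact: AN.
        by congr (_, _); apply/eqP; rewrite -addr_eq0 addrC -e1.
      have [q' eq] := hn q (ex_intro _ _ Ah').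
      rewrite e2 eq [q' * _]mulrC mulrzA ey; apply/eqP; rewrite addrC addr_eq0; apply/eqP.
      have e3 : (x *~ n, v) *~ q' - (x *~ q, - h2) = (0, v *~ q' + h2).
        apply: injective_projections; rewrite /= ?fstM ?sndM /= ?opprK //.
        by rewrite eq -mulrzA [n%:Z * _]mulrC subrr.
      have := AB _ _ (AM _ q' Av) Ah'; rewrite e3 => /Af/eqP.
      by rewrite addr_eq0 => /eqP.
  split=> [z Az|h]; first by exists z, 0; rewrite !mulr0z addr0.
  apply: none; exists y; apply: h; exists 0, 1; split=> //.
  by rewrite add0r !mulr1z.
have [f hf] := choice total; exists f.
have fu x y : A (x, y) -> f x = y.
  move=> Axy; apply/eqP; rewrite -subr_eq0; apply/eqP/Af.
  have := AB _ _ (hf x) Axy; rewrite (_ : (x, f x) - (x, y) = (0, f x - y)) //.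
  by apply: injective_projections; rewrite /= ?subrr.
split=> [x y|[x y] /PsubA/fu//]; apply: fu; exact: (AD _ _ (hf x) (hf y)).
Qed.

(** The annihilator of [x] in the integers is generated by some [n] different from [1]. Sending [x]
    to a nonzero [y] killed by [n] is a character of the subgroup generated by [x], and it
    extends. *)
Lemma char_separate (G : zmodType) (x : G) : x != 0 ->
  exists f : G -> QZ, (forall x y, f (x + y) = f x + f y) /\ f x != 0.
Proof.
move=> x0; have [||n [nx hn]] := @int_ideal (fun q => x *~ q = 0).
- by rewrite mulr0z.
- by move=> a b ea eb; rewrite mulrzBr ea eb subrr.
have n1 : n != 1%N by apply: contraNneq x0 => e; rewrite e mulr1z in nx; rewrite nx.
have [y y0 ny] := QZ_order n1.
have [|||f [fD fP]] := @char_extend G (fun z => exists q : int, z = (x *~ q, y *~ q)).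
- by exists 0; rewrite !mulr0z.
- by move=> _ _ [q ->] [q' ->]; exists (q - q'); rewrite !mulrzBr.
- move=> t [q [/esym/hn[q' ->] ->]].
  by rewrite mulrC mulrzA ny mul0rz.
exists f; split=> //; have := fP (x, y) => /= -> //.
by exists 1; rewrite !mulr1z.
Qed.
End DivisibleGroup.
Export DivisibleGroup.

(** * Effaceability for graded modules *)

Module DualBasis.
Section DualBasis.
Variables (R : pzRingType) (P : lmodType R).

Section Comb.
Variables (N : nat) (s : 'I_N -> P).
Definition comb_gen (v : 'rV[R]_N) : P := \sum_r v 0 r *: s r.
Fact comb_gen_linear : linear comb_gen.
Proof.
move=> c x y; rewrite /comb_gen scaler_sumr -big_split /=; apply: eq_bigr => r _.
by rewrite !mxE scalerDl scalerA.
Qed.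
HB.instance Definition _ := GRing.isLinear.Build R 'rV[R]_N P _ comb_gen comb_gen_linear.
End Comb.

(** The [phi r] are the coordinates of a linear section of the surjection from the free module on
    the generators. *)
Lemma dual_basis : projective P -> fin_gen P -> exists N (s : 'I_N -> P) (phi : 'I_N -> P -> R),
  (forall r c x y, phi r (c *: x + y) = c * phi r x + phi r y) /\
  forall q, q = \sum_r phi r q *: s r.
Proof.
move=> pP [N [s hs]].
have [|l hl] := pP _ _ (comb_gen s : {linear 'rV[R]_N -> P}) (idfun : {linear P -> P}).
  move=> y; have [c ->] := hs y; exists (\row_r c r).
  by apply: eq_bigr => r _; rewrite mxE.
exists N, s, (fun r q => l q 0 r); split=> [r c x y|q]; last by rewrite -[LHS]hl.
by rewrite linearP !mxE.
Qed.

End DualBasis.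
End DualBasis.
Export DualBasis.

Module Effaceable.
Section Components.
Variables (B : pzRingType) (deg : int -> B -> Prop) (pr : int -> B -> B).
Hypothesis degM : forall i j a b, deg i a -> deg j b -> deg (i + j) (a * b).
Hypothesis prD : forall j a b, pr j (a + b) = pr j a + pr j b.
Hypothesis pr_deg : forall j a, deg j (pr j a).
Hypothesis pr_id : forall j a, deg j a -> pr j a = a.
Hypothesis pr_ne : forall i j a, deg i a -> i <> j -> pr j a = 0.
Hypothesis pr_sum : forall a, exists2 s : seq int, uniq s & a = \sum_(j <- s) pr j a.

Lemma pr0 j : pr j 0 = 0.
Proof. by apply: (@addrI _ (pr j 0)); rewrite -prD !addr0. Qed.

Lemma pr_big j (I : Type) (s : seq I) (F : I -> B) : pr j (\sum_(i <- s) F i) = \sum_(i <- s) pr j (F i).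
Proof. by elim: s => [|i s IH]; rewrite ?big_nil ?pr0 // !big_cons prD IH. Qed.

Lemma prN j a : pr j (- a) = - pr j a.
Proof. by apply/eqP; rewrite -addr_eq0 -prD addNr pr0. Qed.

Lemma pr_pr i j a : pr i (pr j a) = if i == j then pr j a else 0.
Proof.
case: eqP => [->|ne]; first exact: pr_id.
by apply: (pr_ne (pr_deg j a)) => e; apply: ne.
Qed.

Lemma pr_mulr l i c b : deg i b -> pr (l + i) (c * b) = pr l c * b.
Proof.
move=> hb; have [s us es] := pr_sum c; rewrite {1}es mulr_suml pr_big.
have e1 : pr l c = \sum_(j <- s) pr l (pr j c) by rewrite {1}es pr_big.
rewrite e1 mulr_suml; apply: eq_bigr => j _; rewrite pr_pr.
case: eqP => [->|ne]; first by apply: pr_id; exact: degM.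
rewrite mul0r; apply: (pr_ne (i := j + i)); first exact: degM.
by move=> /addIr e; apply: ne.
Qed.

Section Mod.
Variables (M : lmodType B) (gr : grading deg M).

Lemma gp_prl e j b x : gpart gr j x = x -> gpart gr e (b *: x) = pr (e - j) b *: x.
Proof.
move=> hx; have [s us es] := pr_sum b.
have e1 : pr (e - j) b = \sum_(l <- s) pr (e - j) (pr l b) by rewrite {1}es pr_big.
rewrite {1}es scaler_suml raddf_sum e1 scaler_suml; apply: eq_bigr => l _ /=.
rewrite pr_pr -{1}[e](subrK j); case: eqP => [<-|ne].
  by rewrite gp_mul // hx.
rewrite scale0r subrK -hx -(gp_mul gr j x (pr_deg l b)) gpartK; case: eqP => // e2.
by case: ne; rewrite e2 addrK.
Qed.

End Mod.

(** ** Coinduced modules *)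

Section Coind.
Variable X : Type.

(* The functions [b |-> v (e, x) b] of the component of degree [j] are supported
   on the component of degree [e - j] of [B]. *)
Record coind := Coind {
  cv : int * X -> B -> QZ;
  cvD : forall x b c, cv x (b + c) = cv x b + cv x c;
  cv_supp : exists s : seq int, forall x b, (forall j, j \in s -> pr (x.1 - j) b = 0) -> cv x b = 0
}.
HB.instance Definition _ := gen_eqMixin coind.
HB.instance Definition _ := gen_choiceMixin coind.

Lemma coind_ext (u v : coind) : (forall x b, cv u x b = cv v x b) -> u = v.
Proof.
case: u v => [u u1 u2] [v v1 v2] /= e.
have {}e : u = v by do 2!apply: functional_extensionality_dep => ?.
by rewrite e in u1 u2 *; rewrite (Prop_irrelevance u1 v1) (Prop_irrelevance u2 v2).
Qed.

Definition coind0 : coind.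
Proof. by apply: (@Coind (fun _ _ => 0)) => [x b c|]; [rewrite addr0|exists [::]]. Defined.
Definition coind_add (u v : coind) : coind.
Proof.
apply: (@Coind (fun x b => cv u x b + cv v x b)) => [x b c|]; first by rewrite !cvD addrACA.
have [s hs] := cv_supp u; have [t ht] := cv_supp v; exists (s ++ t) => x b h.
by rewrite hs ?ht ?addr0 // => j jl; apply: h; rewrite mem_cat jl ?orbT.
Defined.
Definition coind_opp (u : coind) : coind.
Proof.
apply: (@Coind (fun x b => - cv u x b)) => [x b c|]; first by rewrite !cvD opprD.
by have [s hs] := cv_supp u; exists s => x b /hs ->; rewrite oppr0.
Defined.
Fact coind_addA : associative coind_add.
Proof. by move=> u v z; apply: coind_ext => x b; exact: addrA. Qed.
Fact coind_addC : commutative coind_add.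
Proof. by move=> u v; apply: coind_ext => x b; exact: addrC. Qed.
Fact coind_add0 : left_id coind0 coind_add.
Proof. by move=> u; apply: coind_ext => x b; exact: add0r. Qed.
Fact coind_addN : left_inverse coind0 coind_opp coind_add.
Proof. by move=> u; apply: coind_ext => x b; exact: addNr. Qed.
HB.instance Definition _ := GRing.isZmodule.Build coind coind_addA coind_addC coind_add0 coind_addN.

Lemma cv0 u x : cv u x 0 = 0.
Proof. by apply: (@addrI _ (cv u x 0)); rewrite -cvD !addr0. Qed.

Lemma cv_sum u x (I : Type) (s : seq I) (F : I -> B) :
  cv u x (\sum_(i <- s) F i) = \sum_(i <- s) cv u x (F i).
Proof. by elim: s => [|i s IH]; rewrite ?big_nil ?cv0 // !big_cons cvD IH. Qed.

Definition coind_scale (a : B) (u : coind) : coind.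
Proof.
apply: (@Coind (fun x b => cv u x (b * a))) => [x b c|]; first by rewrite mulrDl cvD.
have [s hs] := cv_supp u; have [t ut et] := pr_sum a.
exists [seq i + j | i <- t, j <- s] => x b h.
rewrite et mulr_sumr cv_sum big1_seq // => i /andP[_ it]; apply: hs => j js.
rewrite -[x.1 - j](subrK i) pr_mulr; last exact: pr_deg.
by rewrite -addrA -opprD h ?mul0r // addrC; apply: allpairs_f.
Defined.
Fact coind_scaleA a b u : coind_scale a (coind_scale b u) = coind_scale (a * b) u.
Proof. by apply: coind_ext => x c /=; rewrite mulrA. Qed.
Fact coind_scale1 : left_id 1 coind_scale.
Proof. by move=> u; apply: coind_ext => x c /=; rewrite mulr1. Qed.
Fact coind_scaleDr : right_distributive coind_scale +%R.
Proof. by move=> a u v; apply: coind_ext. Qed.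
Fact coind_scaleDl u : {morph coind_scale^~ u : a b / a + b}.
Proof. by move=> a b; apply: coind_ext => x c /=; rewrite mulrDr cvD. Qed.
HB.instance Definition _ := GRing.Zmodule_isLmodule.Build B coind
  coind_scaleA coind_scale1 coind_scaleDr coind_scaleDl.

Definition coind_gp (j : int) (u : coind) : coind.
Proof.
apply: (@Coind (fun x b => cv u x (pr (x.1 - j) b))) => [x b c|]; first by rewrite prD cvD.
by exists [:: j] => x b h; rewrite h ?inE // cv0.
Defined.

Lemma cv_bigl (I : Type) (s : seq I) (F : I -> coind) x b :
  cv (\sum_(i <- s) F i) x b = \sum_(i <- s) cv (F i) x b.
Proof. by elim: s => [|i s IH]; rewrite ?big_nil // !big_cons -IH. Qed.

Definition coind_gr : grading deg coind.
Proof.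
apply: (@Grading _ _ _ coind_gp) => [i u v|i j u|u|i j b u hb e].
- by apply: coind_ext.
- apply: coind_ext => x b /=; case: eqP => [->|ne] /=; rewrite pr_pr.
    by rewrite eqxx.
  by case: eqP => [/addrI/oppr_inj e|_]; [case: ne|rewrite cv0].
- have [s hs] := cv_supp u; exists (undup s); first exact: undup_uniq.
  apply: coind_ext => x b; apply/eqP; rewrite -subr_eq0 cv_bigl /=.
  rewrite -cv_sum.
  have -> : cv u x b - cv u x (\sum_(j <- undup s) pr (x.1 - j) b) =
     cv u x (b - \sum_(j <- undup s) pr (x.1 - j) b).
    apply/eqP; rewrite subr_eq -cvD subrK //.
  apply/eqP/hs => j js; rewrite prD prN pr_big (bigD1_seq j) ?undup_uniq ?mem_undup //=.
  rewrite pr_pr eqxx big1 ?addr0 ?subrr // => i ne; rewrite pr_pr.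
  by case: eqP => // /addrI/oppr_inj e; rewrite e eqxx in ne.
- apply: coind_ext => x c /=.
  rewrite -[in RHS]e /= -[x.1 - j](subrK i) pr_mulr // -addrA [- j + _ in RHS]addrC.
  by rewrite opprD.
Defined.

End Coind.

(** ** The embedding into a coinduced module *)

Section Eff.
Variables (R : comPzRingType) (C : lincat R) (rho : R -> B) (K : concrete C deg rho).
Local Notation E := (el K).
Local Notation "f $ x" := (ap K f x) (at level 45, right associativity).
Local Notation gp a := (gpart (egr K a)).
Hypothesis rhoD : forall r s, rho (r + s) = rho r + rho s.
Hypothesis rhoM : forall r s, rho (r * s) = rho r * rho s.
Hypothesis rho1 : rho 1 = 1.
Hypothesis rhoC : forall r b, rho r * b = b * rho r.
Hypothesis rho_deg : forall r, deg 0 (rho r).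
Hypothesis flatB : forall (M N : nat) l (b : 'I_M -> B) (q : 'I_M -> 'I_N -> R),
  (forall a, deg l (b a)) -> (forall j, \sum_a rho (q a j) * b a = 0) ->
  exists L (e : 'I_L -> B) (r : 'I_M -> 'I_L -> R), [/\ forall c, deg l (e c),
    forall a, b a = \sum_c rho (r a c) * e c & forall c j, \sum_a r a c * q a j = 0].

Definition chr (M : zmodType) := {f : M -> QZ | forall x y, f (x + y) = f x + f y}.

Lemma chr0 (M : zmodType) (f : chr M) : proj1_sig f 0 = 0.
Proof. by apply: (@addrI _ (proj1_sig f 0)); rewrite -(proj2_sig f) !addr0. Qed.

Lemma coind_obj (X : Type) : exists (a' : C) (ev : E a' -> coind X), 
  [/\ forall t u v, ev (t *: u + v) = t *: ev u + ev v,
      forall j u, ev (gp a' j u) = gpart (coind_gr X) j (ev u),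
      injective ev & forall v, exists u, ev u = v].
Proof.
have [a' [phi [pl pg pi ps]]] := ap_obj K (coind_gr X); have [ev evK] := choice ps.
exists a', ev; split.
- by move=> t u v; apply: pi; rewrite pl -!evK.
- by move=> j u; apply: pi; rewrite pg -!evK.
- by move=> u v e; rewrite [u]evK [v]evK e.
- by move=> v; exists (phi v); apply: pi; rewrite -evK.
Qed.

(** An element [x] goes to the functions sending [b] to [f] of the component of degree [e] of
    [b *: x], for all degrees [e] and characters [f]. Characters separate elements, as seen at
    [b = 1]. *)
Lemma embed_coind a a' (ev : E a' -> coind (chr (E a))) :
  (forall t u v, ev (t *: u + v) = t *: ev u + ev v) ->
  (forall j u, ev (gp a' j u) = gpart (coind_gr (chr (E a))) j (ev u)) ->
  injective ev -> (forall v, exists u, ev u = v) -> exists u : hom a a', inj K u.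
Proof.
move=> el eg ei es.
have mk x : exists v : coind (chr (E a)), forall e (f : chr (E a)) b,
    cv v (e, f) b = proj1_sig f (gp a e (b *: x)).
  apply: (ex_intro _ (@Coind _ (fun y b => proj1_sig y.2 (gp a y.1 (b *: x))) _ _)) => //.
    by move=> y b c; rewrite scalerDl gpartD (proj2_sig y.2).
  have [s us es'] := gpart_sum (egr K a) x; exists s => -[e f] b /= h.
  rewrite es' scaler_sumr raddf_sum big1_seq ?chr0 // => j /andP[_ js] /=.
  by rewrite (gp_prl e b (gp_hom (egr K a) j x)) h // scale0r.
have {}mk x : exists u, forall e (f : chr (E a)) b, cv (ev u) (e, f) b = proj1_sig f (gp a e (b *: x)).
  by have [v hv] := mk x; have [u eu] := es v; exists u; rewrite eu.
have [phi hphi] := choice mk.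
have [||u hu] := @ap_full _ _ _ _ _ K a a' phi.
- move=> t x y; apply: ei; apply: coind_ext => -[e f] b; rewrite hphi el.
  rewrite [RHS](_ : _ = cv (ev (phi x)) (e, f) (b * t) + cv (ev (phi y)) (e, f) b) //.
  by rewrite !hphi scalerDr gpartD (proj2_sig f) scalerA.
- move=> j x; apply: ei; apply: coind_ext => -[e f] b; rewrite hphi eg /= hphi.
  congr (proj1_sig f _); rewrite (gp_prl e b (gp_hom (egr K a) j x)).
  by rewrite -{2}[e](subrK j) gp_mul.
exists u => x; rewrite hu => e0; apply: (gp_eq0 (gr := egr K a)) => e; apply: contrapT => /eqP nz.
have [f [fD fx]] := char_separate nz.
have := hphi x e (exist _ f fD) 1; rewrite e0 scale1r /= => h; case/eqP: fx; rewrite -h.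
by rewrite (_ : ev 0 = 0) //; have := lin0 el.
Qed.

Section Resolution.
Variables (P : resolution R) (i : nat).
Variables (N : nat) (s : 'I_N -> P i) (phi : 'I_N -> P i -> R).
Hypothesis phi_lin : forall r c x y, phi r (c *: x + y) = c * phi r x + phi r y.
Hypothesis phi_s : forall q, q = \sum_r phi r q *: s r.
Local Notation d := (rmap P i).

Lemma phi0' r : phi r 0 = 0.
Proof. by apply: (@addrI _ (phi r 0)); rewrite addr0 -{1}(mul1r (phi r 0)) -phi_lin scale1r addr0. Qed.

Lemma phi_sum r (I : Type) (l : seq I) (c : I -> R) (x : I -> P i) :
  phi r (\sum_(j <- l) c j *: x j) = \sum_(j <- l) c j * phi r (x j).
Proof. by elim: l => [|j l IH]; rewrite ?big_nil ?phi0' // !big_cons phi_lin IH. Qed.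

Variables (X : Type) (a' c : C) (ev : E a' -> coind X).
Hypothesis ev_lin : forall t u v, ev (t *: u + v) = t *: ev u + ev v.
Hypothesis ev_gp : forall j u, ev (gp a' j u) = gpart (coind_gr X) j (ev u).
Hypothesis ev_inj : injective ev.
Hypothesis ev_surj : forall v, exists u, ev u = v.
Variable g : P i.+1 -> hom c a'.
Hypothesis g_lin : linear_to_hom g.
Hypothesis g_d : forall y : P i.+2, g (rmap P i.+1 y) =~ hzero _ _.

Lemma g_ap r y y' x : g (r *: y + y') $ x = rho r *: (g y $ x) + (g y' $ x).
Proof. by rewrite (ap_heq x (g_lin r y y')) ap_hadd ap_scale. Qed.

Lemma g_ap0 x : g 0 $ x = 0.
Proof.
have := g_ap 1 0 0 x; rewrite scale1r addr0 rho1 scale1r => /eqP.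
by rewrite -subr_eq0 opprD addrA subrr sub0r oppr_eq0 => /eqP.
Qed.

Lemma g_sum x (I : Type) (l : seq I) (t : I -> R) (y : I -> P i.+1) :
  g (\sum_(j <- l) t j *: y j) $ x = \sum_(j <- l) rho (t j) *: (g (y j) $ x).
Proof. by elim: l => [|j l IH]; rewrite ?big_nil ?g_ap0 // !big_cons g_ap IH. Qed.

Lemma g_bdry x (y : P i.+1) : d y = 0 -> g y $ x = 0.
Proof.
by move=> /(proj1 (rmap_exact (r := P) y))[z ->]; rewrite (ap_heq x (g_d z)) ap_zero.
Qed.

Lemma cv_evZ r u x b : cv (ev (rho r *: u)) x b = cv (ev u) x (b * rho r).
Proof. by rewrite -[rho r *: u]addr0 ev_lin (lin0 ev_lin) addr0. Qed.

Lemma ev_sum (I : Type) (l : seq I) (F : I -> E a') :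
  ev (\sum_(j <- l) F j) = \sum_(j <- l) ev (F j).
Proof.
elim: l => [|j l IH]; first by rewrite !big_nil (lin0 ev_lin).
by rewrite !big_cons -IH -[F j in LHS]scale1r ev_lin scale1r.
Qed.

(* The character of [B^N] defining the extension of [d y |-> g y $ x] to [P i] at
   the coordinate [(e, z)]; it is well defined by the flatness of [B_l]. *)
Lemma ext_char x e z l : exists th : {ffun 'I_N -> B} -> QZ,
  (forall u v, th (u + v) = th u + th v) /\
  forall y b, deg l b -> th [ffun r => rho (phi r (d y)) * b] = cv (ev (g y $ x)) (e, z) b.
Proof.
pose G (w : {ffun 'I_N -> B} * QZ) := exists (M : nat) (y : 'I_M -> P i.+1) (b : 'I_M -> B),
  [/\ forall a, deg l (b a), w.1 = \sum_a [ffun r => rho (phi r (d (y a))) * b a]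
    & w.2 = \sum_a cv (ev (g (y a) $ x)) (e, z) (b a)].
have dN b : deg l b -> deg l (- b).
  by move=> hb; rewrite -(pr_id hb) -prN; exact: pr_deg.
have [|||th [thD thG]] := @char_extend _ G.
- by exists 0%N, (fun=> 0), (fun=> 0); split=> [[]//||]; rewrite big_ord0.
- move=> [u1 u2] [v1 v2] [M [y [b [h1 /= -> ->]]]] [M' [y' [b' [h1' /= -> ->]]]].
  exists (M + M')%N, (fun a => match split a with inl j => y j | inr j => y' j end),
    (fun a => match split a with inl j => b j | inr j => - b' j end); split.
  + by move=> a; case: split => j //; exact: dN.
  + rewrite /= big_split_ord /=; congr (_ + _).
      by apply: eq_bigr => j _; rewrite (unsplitK (inl j)).
    rewrite -sumrN; apply: eq_bigr => j _; rewrite (unsplitK (inr j)).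
    by apply/ffunP => r; rewrite !ffunE mulrN.
  + rewrite /= big_split_ord /=; congr (_ + _).
      by apply: eq_bigr => j _; rewrite (unsplitK (inl j)).
    rewrite -sumrN; apply: eq_bigr => j _; rewrite (unsplitK (inr j)).
    by apply/eqP; rewrite eq_sym -addr_eq0 -cvD addNr cv0.
- move=> t [M [y [b [hb e1 /= ->]]]].
  (* If the vectors add up to [0], flatness factors the [b a] through elements [f q] in such a way
     that each [\sum_a r a q *: y a] has zero differential. By exactness it is a boundary, hence
     killed by [g], so the prescribed values add up to [0] too. *)
  have [|L [f [r [hf hr hq]]]] := @flatB M N l b (fun a j => phi j (d (y a))) hb.
    move=> j; have := congr1 (fun w : {ffun 'I_N -> B} => w j) e1.
    by rewrite sum_ffunE ffunE => /= e2; rewrite [RHS]e2; apply: eq_bigr => a _; rewrite ffunE.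
  rewrite (eq_bigr (fun a => \sum_q cv (ev (g (r a q *: y a) $ x)) (e, z) (f q))); last first.
    move=> a _; rewrite hr cv_sum; apply: eq_bigr => q _.
    by rewrite -[r a q *: y a]addr0 g_ap g_ap0 addr0 cv_evZ rhoC.
  rewrite exchange_big big1 // => q _.
  rewrite -cv_bigl -ev_sum.
  have -> : \sum_a (g (r a q *: y a) $ x) = g (\sum_a r a q *: y a) $ x.
    rewrite g_sum; apply: eq_bigr => a _.
    by rewrite -[r a q *: y a]addr0 g_ap g_ap0 addr0.
  rewrite g_bdry ?(lin0 ev_lin) //.
  rewrite [LHS]phi_s big1 // => j _.
  rewrite linear_sum /= (eq_bigr (fun a => r a q *: d (y a))); last by move=> a _; rewrite linearZ.
  by rewrite phi_sum hq scale0r.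
exists th; split=> // y b hb; apply: (thG (_, _)).
by exists 1%N, (fun=> y), (fun=> b); split=> //; rewrite big_ord1.
Qed.

Lemma ext_hom j x : gp c j x = x -> exists psi : P i -> E a',
  (forall r q q', psi (r *: q + q') = rho r *: psi q + psi q') /\
  forall y, psi (d y) = g y $ x.
Proof.
(* For [x] of degree [j], the coordinate [(e, z)] of its image sees only [b] of degree [e - j], so
   one character per coordinate is enough. *)
move=> hx; have [th hth] := choice (fun ez : int * X => ext_char x ez.1 ez.2 (ez.1 - j)).
have thD ez u v : th ez (u + v) = th ez u + th ez v by have [h _] := hth ez; exact: h.
have mk q : exists u, forall ez b,
    cv (ev u) ez b = th ez [ffun r => rho (phi r q) * pr (ez.1 - j) b].
  have h1 ez b b' : th ez [ffun r => rho (phi r q) * pr (ez.1 - j) (b + b')] =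
     th ez [ffun r => rho (phi r q) * pr (ez.1 - j) b] + th ez [ffun r => rho (phi r q) * pr (ez.1 - j) b'].
    by rewrite -thD; congr (th ez _); apply/ffunP => r; rewrite !ffunE prD mulrDr.
  have h2 : exists s : seq int, forall (ez : int * X) b, (forall j, j \in s -> pr (ez.1 - j) b = 0) ->
      th ez [ffun r => rho (phi r q) * pr (ez.1 - j) b] = 0.
    exists [:: j] => ez b h; rewrite (_ : [ffun r => _] = 0).
      by apply: (@addrI _ (th ez 0)); rewrite -thD !addr0.
    by apply/ffunP => r; rewrite !ffunE h ?inE // mulr0.
  by have [u eu] := ev_surj (Coind h1 h2); exists u; rewrite eu.
have [psi hpsi] := choice mk; exists psi; split=> [r q q'|y].
  apply: ev_inj; apply: coind_ext => ez b; rewrite ev_lin.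
  rewrite [RHS](_ : _ = cv (ev (psi q)) ez (b * rho r) + cv (ev (psi q')) ez b) //.
  rewrite !hpsi -thD; congr (th ez _); apply/ffunP => t; rewrite !ffunE phi_lin rhoD rhoM mulrDl.
  congr (_ + _); rewrite -[ez.1 - j in RHS]addr0 pr_mulr // -(rhoC r (pr (ez.1 - j) b)).
  by rewrite mulrA -!rhoM [r * _]mulrC.
apply: ev_inj; apply: coind_ext => -[e z] b; rewrite hpsi.
have [_ ->] := hth (e, z); last exact: pr_deg.
rewrite /= -{2}hx ap_gp ev_gp //.
Qed.

(** For each homogeneous [x] the cocycle extends to [P i], but by a choice that need not be linear
    in [x]. The object [c'] of pairs of an [x] and the values of an extension at the generators
    [s r] makes the choice part of the data; [ext_hom] shows that it maps onto [c]. *)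
Lemma eff_step : exists c' (p : hom c' c) (h : P i -> hom c' a'),
  [/\ surj K p, linear_to_hom h & forall y, h (d y) =~ g y oo p].
Proof.
have [t [p [q [pq1 pq2]]]] := obj_prod K c a' N.
pose good w := exists psi : P i -> E a', [/\ forall r x y, psi (r *: x + y) = rho r *: psi x + psi y,
  forall r, psi (s r) = q r $ w & forall y, psi (d y) = g y $ (p $ w)].
have good0 : good 0.
  exists (fun=> 0); split=> [r x y|r|y]; rewrite ?ap0 //.
  by rewrite scaler0 addr0.
have good_lin b x y : good x -> good y -> good (b *: x + y).
  move=> [f [f1 f2 f3]] [f' [f1' f2' f3']]; exists (fun v => b *: f v + f' v); split.
  - by move=> r v v'; rewrite f1 f1' !scalerDr !scalerA rhoC addrACA.
  - by move=> r; rewrite f2 f2' ap_lin.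
  - by move=> v; rewrite f3 f3' !ap_lin.
have good_gp j x : good x -> good (gp t j x).
  move=> [f [f1 f2 f3]]; exists (fun v => gp a' j (f v)); split.
  - by move=> r v v'; rewrite f1 gpartD -[in LHS](add0r j) gp_mul // add0r.
  - by move=> r; rewrite f2 ap_gp.
  - by move=> v; rewrite f3 !ap_gp.
have [c' [k [ki hk]]] := obj_sub (K := K) (GSub good0 good_lin good_gp).
have surj_p : surj K (p oo k).
  move=> x; suff [w gw ew] : exists2 w, good w & p $ w = x.
    by have [v ev'] := proj1 (hk w) gw; exists v; rewrite ap_comp ev'.
  have hom_case j : exists2 w, good w & p $ w = gp c j x.
    have [psi [h1 h2]] := ext_hom (gp_hom (egr K c) j x).
    have [w [w1 w2]] := pq1 (gp c j x) (fun r => psi (s r)); exists w => //.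
    by exists psi; split=> // y; rewrite w1.
  have [l _ ex] := gpart_sum (egr K c) x; rewrite ex.
  elim: l {ex} => [|j l [w gw ew]]; first by exists 0; rewrite ?big_nil ?ap0.
  have [w' gw' ew'] := hom_case j; exists (w' + w); last by rewrite big_cons apD ew' ew.
  by rewrite -[w']scale1r; exact: (good_lin).
have hh v : exists h : hom c' a', forall w, h $ w = \sum_r rho (phi r v) *: (q r $ (k $ w)).
  apply: ap_full => [b x y|j x].
    rewrite scaler_sumr -big_split; apply: eq_bigr => r _ /=.
    by rewrite !ap_lin scalerDr !scalerA rhoC.
  rewrite raddf_sum; apply: eq_bigr => r _ /=.
  by rewrite !ap_gp -[in RHS](add0r j) gp_mul // add0r.
have [h {}hh] := choice hh; exists c', (p oo k), h; split=> //.
- move=> r v v'; apply: (heq_ap (K := K)) => w; rewrite ap_hadd ap_scale !hh scaler_sumr -big_split /=.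
  by apply: eq_bigr => u _; rewrite phi_lin rhoD rhoM scalerDl scalerA.
- move=> y; apply: (heq_ap (K := K)) => w; rewrite hh !ap_comp.
  have [psi [f1 f2 f3]] : good (k $ w) by apply/hk; exists w.
  rewrite -f3 [in RHS](phi_s (d y)).
  have f0 : psi 0 = 0.
    have := f1 1 0 0; rewrite scale1r addr0 rho1 scale1r => /eqP.
    by rewrite -subr_eq0 opprD addrA subrr sub0r oppr_eq0 => /eqP.
  elim: (index_enum _) => [|r l IH]; first by rewrite !big_nil f0.
  by rewrite !big_cons f1 -IH f2.
Qed.

End Resolution.

Lemma concrete_effaceable : effaceable C.
Proof.
move=> P i a; have [a' [ev [el eg ei es]]] := coind_obj (chr (E a)).
have [u ui] := embed_coind el eg ei es; exists a', u; split; first exact: (proj2 (mono_injP K u) ui).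
move=> c g gl gd.
have [N [s [phi [h1 h2]]]] := dual_basis (@rmod_proj _ P i) (@rmod_fin_gen _ P i).
have [c' [p [h [p1 p2 p3]]]] := eff_step h1 h2 el eg ei es gl gd.
by exists c', p, h; split=> //; exact: (proj2 (epi_surjP K p) p1).
Qed.

End Eff.
End Components.
End Effaceable.
Export Effaceable.

(** * Morphisms in the quotient category *)

Section Localize.
Variables (R : comPzRingType) (C : lincat R) (B : pzRingType) (deg : int -> B -> Prop).
Variables (rho : R -> B) (K : concrete C deg rho).
Local Notation E := (el K).
Local Notation "f $ x" := (ap K f x) (at level 45, right associativity).
Local Notation gp a := (gpart (egr K a)).
Hypothesis rho_deg : forall r, deg 0 (rho r).
Hypothesis rhoD : forall r s, rho (r + s) = rho r + rho s.
Hypothesis rhoM : forall r s, rho (r * s) = rho r * rho s.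
Hypothesis rho1 : rho 1 = 1.
Hypothesis rhoC : forall r b, rho r * b = b * rho r.
Hypothesis degM : forall i j a b, deg i a -> deg j b -> deg (i + j) (a * b).

(* [F] is a Gabriel topology on [B], restricted to the homogeneous elements: [I l]
   is the part of degree [l] of a left ideal. *)
Definition lid (I : int -> B -> Prop) : Prop :=
  (forall l a b, deg l a -> deg l b -> I l a -> I l b -> I l (a + b)) /\
  (forall l j a c, deg l a -> deg j c -> I l a -> I (j + l) (c * a)).
Variable F : (int -> B -> Prop) -> Prop.
Hypothesis F_sub : forall I J, F I -> (forall l b, deg l b -> I l b -> J l b) -> F J.
Hypothesis F_all : F (fun _ _ => True).
Hypothesis F_colon : forall I j b, F I -> deg j b -> F (fun l c => I (l + j) (c * b)).
Hypothesis F_loc : forall I J, lid I -> F J ->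
  (forall j e, deg j e -> J j e -> F (fun l c => I (l + j) (c * e))) -> F I.

(** For [e] in [I], the colon by [e] of the intersection contains the colon of [J], which belongs to
    [F]; so [F_loc] applies relative to [I]. *)
Lemma F_cap I J : lid I -> lid J -> F I -> F J -> F (fun l b => I l b /\ J l b).
Proof.
move=> lI lJ fI fJ; apply: (F_loc _ fI) => [|j e de Ie].
  split=> [l a b da db [h1 h2] [h3 h4]|l j a c da dc [h1 h2]].
    by split; [exact: (proj1 lI)|exact: (proj1 lJ)].
  by split; [exact: (proj2 lI)|exact: (proj2 lJ)].
apply: F_sub (F_colon fJ de) _ => l b db Jb; split=> //.
exact: (proj2 lI).
Qed.

Definition hm a d (x : E a) : Prop := gp a d x = x.
Definition tor a (x : E a) : Prop := F (fun _ b => b *: x = 0).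

Lemma lid_ann a (x : E a) : lid (fun _ b => b *: x = 0).
Proof.
split=> [l b c _ _ e1 e2|l j b c _ _ e]; first by rewrite scalerDl e1 e2 addr0.
by rewrite -scalerA e scaler0.
Qed.

Lemma hm_scale a d l b (x : E a) : deg l b -> hm d x -> hm (l + d) (b *: x).
Proof. by move=> db hx; rewrite /hm gp_mul // hx. Qed.

Lemma hm_ap a c d (f : hom a c) (x : E a) : hm d x -> hm d (f $ x).
Proof. by move=> hx; rewrite /hm -ap_gp hx. Qed.

Lemma hmD a d (x y : E a) : hm d x -> hm d y -> hm d (x + y).
Proof. by move=> hx hy; rewrite /hm gpartD hx hy. Qed.

Lemma hm0 a d : hm d (0 : E a). Proof. exact: gp0. Qed.

Lemma hmZ a d r (x : E a) : hm d x -> hm d (rho r *: x).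
Proof. by move=> hx; rewrite -[d]add0r; exact: hm_scale. Qed.

Lemma tor0 a : tor (0 : E a).
Proof. by apply: F_sub F_all _ => l b _ _; rewrite scaler0. Qed.

Lemma tor_scale a l b (x : E a) : deg l b -> tor x -> tor (b *: x).
Proof. by move=> db tx; apply: F_sub (F_colon tx db) _ => j c _; rewrite scalerA. Qed.

Lemma tor_loc a (x : E a) J : F J -> (forall l b, deg l b -> J l b -> tor (b *: x)) -> tor x.
Proof.
move=> fJ h; apply: (F_loc (lid_ann x) fJ) => j e de Je.
by apply: F_sub (h j e de Je) _ => l b _; rewrite scalerA.
Qed.

Lemma torD a (x y : E a) : tor x -> tor y -> tor (x + y).
Proof.
move=> tx ty; apply: F_sub (F_cap (lid_ann x) (lid_ann y) tx ty) _ => l b _ [e1 e2].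
by rewrite scalerDr e1 e2 addr0.
Qed.

Lemma torN a (x : E a) : tor x -> tor (- x).
Proof. by move=> tx; apply: F_sub tx _ => l b _ e; rewrite scalerN e oppr0. Qed.

Lemma torZ a r (x : E a) : tor x -> tor (rho r *: x).
Proof. exact: tor_scale. Qed.

Lemma tor_ap a c (f : hom a c) (x : E a) : tor x -> tor (f $ x).
Proof. by move=> tx; apply: F_sub tx _ => l b _ e; rewrite -apZ e ap0. Qed.

Lemma tor_inj a c (f : hom a c) (x : E a) : inj K f -> tor (f $ x) -> tor x.
Proof. by move=> fi tx; apply: F_sub tx _ => l b _ e; apply: fi; rewrite apZ. Qed.

Variable T : C -> Prop.
Hypothesis T_el : forall a, T a <-> forall d (x : E a), hm d x -> tor x.
Local Notation Sigma := (fun a b s => @serre_iso R C T a b s).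

(** On elements, torsion of the cokernel says that each homogeneous [y] is carried into the image of
    [s] by an ideal belonging to [F]. *)
Lemma sigmaP a c (s : hom a c) : serre_iso T s <->
  (forall d (x : E a), hm d x -> s $ x = 0 -> tor x) /\
  (forall d (y : E c), hm d y -> F (fun l b => exists x, s $ x = b *: y)).
Proof.
split=> [[[z [i [/(kernel_el K)[ii hi] Tz]]] [v [q [/(cokernel_el K)[qs hq] Tv]]]]|[h1 h2]].
  split=> [d x hx /hi[u eu]|d y hy].
    rewrite -eu; apply: tor_ap; apply: (proj1 (T_el z) Tz d).
    by apply: (injI (K := K) ii); rewrite ap_gp eu.
  apply: F_sub (proj1 (T_el v) Tv d _ (hm_ap q hy)) _ => l b _.
  by rewrite -apZ => /hq.
split.
  have [z [i hi]] := concrete_kernel K s; exists z, i; split=> //; apply/T_el => d x hx.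
  move/(kernel_el K): hi => [ii hi]; apply: (tor_inj ii); apply: (h1 d); first exact: hm_ap.
  by apply/hi; exists x.
have [z [q hq]] := concrete_cokernel K s; exists z, q; split=> //; apply/T_el => d x hx.
move/(cokernel_el K): hq => [qs hq]; have [y ey] := qs x.
have ey' : q $ gp c d y = x by rewrite ap_gp ey.
rewrite -ey'; have hy : hm d (gp c d y) by exact: gp_hom.
by apply: F_sub (h2 d _ hy) _ => l b _ h; rewrite -apZ; apply/hq.
Qed.

Lemma lid_im a c (s : hom a c) (y : E c) : lid (fun l b => exists x, s $ x = b *: y).
Proof.
split=> [l b b' _ _ [x ex] [x' ex']|l j b t _ _ [x ex]].
  by exists (x + x'); rewrite apD ex ex' scalerDl.
by exists (t *: x); rewrite apZ ex scalerA.
Qed.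

Lemma im_hm a c (s : hom a c) d (y : E c) x : hm d y -> s $ x = y -> exists x', hm d x' /\ s $ x' = y.
Proof. by move=> hy e; exists (gp a d x); split; [exact: gp_hom|rewrite ap_gp e]. Qed.

Lemma sigma_id a : serre_iso T (idm a).
Proof.
apply/sigmaP; split=> [d x _|d y _]; first by rewrite ap_id => ->; exact: tor0.
by apply: F_sub F_all _ => l b _ _; exists (b *: y); rewrite ap_id.
Qed.

Lemma sigma_comp a b c (s : hom a b) (t : hom b c) :
  serre_iso T s -> serre_iso T t -> serre_iso T (t oo s).
Proof.
move=> /sigmaP[s1 s2] /sigmaP[t1 t2]; apply/sigmaP; split=> [d x hx|d y hy].
  rewrite ap_comp => /(t1 d _ (hm_ap s hx)) h; apply: (tor_loc h) => l e de; rewrite -apZ => e0.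
  by apply: (s1 (l + d)) => //; exact: hm_scale.
apply: (F_loc (lid_im _ _) (t2 d y hy)) => j e de [x ex].
have [x' [hx' ex']] := im_hm (hm_scale de hy) ex.
apply: F_sub (s2 _ x' hx') _ => l f _ [u eu]; exists u.
by rewrite ap_comp eu apZ ex' scalerA.
Qed.

(** [r] is the pullback of [q] and [s], a submodule of the product of [a] and [b]. *)
Lemma ore a b c (q : hom a c) (s : hom b c) : serre_iso T s ->
  exists r (p1 : hom r a) (p2 : hom r b), serre_iso T p1 /\ q oo p1 =~ s oo p2.
Proof.
move=> /sigmaP[s1 s2]; have [ab [pa [pb [h1 h2]]]] := obj_pair K a b.
pose good w := q $ (pa $ w) = s $ (pb $ w).
have g0 : good 0 by rewrite /good !ap0.
have gL t x y : good x -> good y -> good (t *: x + y) by rewrite /good !ap_lin => -> ->.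
have gG j x : good x -> good (gp ab j x) by rewrite /good !ap_gp => ->.
have [r [k [ki hk]]] := obj_sub (K := K) (GSub g0 gL gG).
exists r, (pa oo k), (pb oo k); split; last first.
  apply: (heq_ap (K := K)) => x; rewrite !ap_comp.
  by have : good (k $ x) by apply/hk; exists x.
apply/sigmaP; split=> [d x hx|d y hy].
  rewrite ap_comp => e; have gx : good (k $ x) by apply/hk; exists x.
  have tb : tor (pb $ (k $ x)).
    by apply: (s1 d); [do 2!apply: hm_ap|rewrite -gx e ap0].
  apply: F_sub tb _ => l b' _ e'; apply: ki; rewrite apZ; apply: h2; rewrite apZ ?e ?scaler0 //.
apply: F_sub (s2 d _ (hm_ap q hy)) _ => l b' _ [v ev].
have [z [z1 z2]] := h1 (b' *: y) v.
have gz : good z by rewrite /good z1 z2 ev apZ.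
by have [x ex] := proj1 (hk z) gz; exists x; rewrite ap_comp ex.
Qed.

(** [r] is the pushout, the quotient of the biproduct of [b] and [c] by the image of [(s, -f)]. *)
Lemma ore_left a b c (s : hom a b) (f : hom a c) : serre_iso T s ->
  exists r (i1 : hom b r) (i2 : hom c r), serre_iso T i2 /\ i1 oo s =~ i2 oo f.
Proof.
move=> /sigmaP[s1 s2].
have [bc [ib [ic [pb [pc [/(ap_eq K) e1 /(ap_eq K) e2 /(ap_eq K) e3 /(ap_eq K) e4 /(ap_eq K) e5]]]]]] :=
  concrete_biproduct K b c.
have {e1}e1 x : pb $ (ib $ x) = x by rewrite -ap_comp e1 ap_id.
have {e2}e2 x : pc $ (ic $ x) = x by rewrite -ap_comp e2 ap_id.
have {e3}e3 x : pb $ (ic $ x) = 0 by rewrite -ap_comp e3 ap_zero.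
have {e4}e4 x : pc $ (ib $ x) = 0 by rewrite -ap_comp e4 ap_zero.
have {e5}e5 x : x = ib $ (pb $ x) + ic $ (pc $ x).
  by have := e5 x; rewrite ap_hadd !ap_comp ap_id.
pose phi := hadd (ib oo s) (hopp (ic oo f)).
have phiE x : phi $ x = ib $ (s $ x) - (ic $ (f $ x)).
  rewrite ap_hadd ap_comp; congr (_ + _); apply/eqP; rewrite -addr_eq0 addrC -ap_comp -ap_hadd.
  by rewrite (ap_heq _ (haddNr (ic oo f))) ap_zero.
have [r [q [qs hq]]] := obj_quo (K := K) (im_sub K phi).
exists r, (q oo ib), (q oo ic); split; last first.
  apply: (heq_ap (K := K)) => x; rewrite !ap_comp; apply/eqP; rewrite -subr_eq0 -apB; apply/eqP.
  by apply/hq; exists x; rewrite phiE.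
apply/sigmaP; split=> [d y hy|d z hz].
  rewrite ap_comp => /hq[x]; rewrite phiE => ex.
  have hx1 : hm d (gp a d x) by exact: gp_hom.
  have e6 : y = - (f $ x).
    by have := congr1 (fun v => pc $ v) ex; rewrite apB e4 !e2 sub0r => ->.
  have ey : y = - (f $ gp a d x) by rewrite ap_gp -gpN -e6 hy.
  rewrite ey; apply/torN/tor_ap; apply: (s1 d) => //; rewrite ap_gp.
  by have := congr1 (fun v => pb $ v) ex; rewrite apB !e3 e1 subr0 => ->; rewrite gp0.
have [v ev] := qs z; have hx : hm d (gp b d (pb $ v)) by exact: gp_hom.
have ez : z = q $ (ib $ (gp b d (pb $ v))) + (q $ (ic $ (gp c d (pc $ v)))).
  by rewrite -apD -hz -ev -ap_gp {1}[v]e5 gpartD !ap_gp.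
apply: F_sub (s2 d _ hx) _ => l t _ [u eu].
exists (t *: gp c d (pc $ v) + f $ u); rewrite ap_comp ez scalerDr apD apD -!apZ addrC.
congr (_ + _); rewrite -eu; apply/eqP; rewrite eq_sym -subr_eq0 -apB; apply/eqP/hq.
by exists u; rewrite phiE.
Qed.

(** ** The relation defined by a morphism of the localization *)

Local Notation lt := (lterm Sigma).

(* A morphism of the localization acts on homogeneous elements as a partially
   defined multivalued map. Its domain is [F]-dense and its indeterminacy is
   torsion, so that congruent terms define the same map up to torsion: this is how
   a morphism of [C] is shown to be nonzero in the quotient. *)
Fixpoint rel a b (t : lt a b) (d : int) {struct t} : E a -> E b -> Prop :=
  match t in lterm _ a b return E a -> E b -> Prop with
  | lhom _ _ f => fun x y => y = f $ x
  | linv _ _ s _ => fun y x => hm d x /\ s $ x = y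
  | lcomp _ _ _ g f => fun x z => exists y, rel f d x y /\ rel g d y z
  | lzero _ _ => fun x y => y = 0
  | ladd _ _ f g => fun x y => exists y1 y2, [/\ rel f d x y1, rel g d x y2 & y = y1 + y2]
  | lopp _ _ f => fun x y => exists2 y1, rel f d x y1 & y = - y1
  | lscale _ _ r f => fun x y => exists2 y1, rel f d x y1 & y = rho r *: y1
  end.

Lemma rel_hm a b (t : lt a b) d x y : hm d x -> rel t d x y -> hm d y.
Proof.
elim: t x y => {a b} [a b f|a b s Ss|a b c g IHg f IHf|a b|a b f IHf g IHg|a b f IHf|a b r f IHf] x y hx /=.
- by move=> ->; exact: hm_ap.
- by case.
- by move=> [z [/(IHf _ _ hx) hz /(IHg _ _ hz)]].
- by move=> ->; exact: hm0.
- by move=> [y1 [y2 [/(IHf _ _ hx) h1 /(IHg _ _ hx) h2 ->]]]; exact: hmD.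
- by move=> [y1 /(IHf _ _ hx) h1 ->]; rewrite /hm gpN h1.
- by move=> [y1 /(IHf _ _ hx) h1 ->]; exact: hmZ.
Qed.

Lemma relD a b (t : lt a b) d x y x' y' : rel t d x y -> rel t d x' y' -> rel t d (x + x') (y + y').
Proof.
elim: t x y x' y' => {a b} [a b f|a b s Ss|a b c g IHg f IHf|a b|a b f IHf g IHg|a b f IHf|a b r f IHf] x y x' y' /=.
- by move=> -> ->; rewrite apD.
- by move=> [h <-] [h' <-]; rewrite apD; split=> //; exact: hmD.
- by move=> [z [h1 h2]] [z' [h1' h2']]; exists (z + z'); split; [exact: IHf|exact: IHg].
- by move=> -> ->; rewrite addr0.
- move=> [y1 [y2 [h1 h2 ->]]] [y1' [y2' [h1' h2' ->]]]; exists (y1 + y1'), (y2 + y2').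
  by split; [exact: IHf|exact: IHg|rewrite addrACA].
- by move=> [y1 h ->] [y1' h' ->]; exists (y1 + y1'); [exact: IHf|rewrite opprD].
- by move=> [y1 h ->] [y1' h' ->]; exists (y1 + y1'); [exact: IHf|rewrite scalerDr].
Qed.

Lemma rel_scale a b (t : lt a b) d l e x y : deg l e -> rel t d x y -> rel t (l + d) (e *: x) (e *: y).
Proof.
move=> de.
elim: t x y => {a b} [a b f|a b s Ss|a b c g IHg f IHf|a b|a b f IHf g IHg|a b f IHf|a b r f IHf] x y /=.
- by move=> ->; rewrite apZ.
- by move=> [h <-]; rewrite apZ; split=> //; exact: hm_scale.
- by move=> [z [h1 h2]]; exists (e *: z); split; [exact: IHf|exact: IHg].
- by move=> ->; rewrite scaler0.
- move=> [y1 [y2 [h1 h2 ->]]]; exists (e *: y1), (e *: y2).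
  by split; [exact: IHf|exact: IHg|rewrite scalerDr].
- by move=> [y1 h ->]; exists (e *: y1); [exact: IHf|rewrite scalerN].
- by move=> [y1 h ->]; exists (e *: y1); [exact: IHf|rewrite !scalerA rhoC].
Qed.

Lemma relZ a b (t : lt a b) d r x y : rel t d x y -> rel t d (rho r *: x) (rho r *: y).
Proof. by move=> h; rewrite -[d]add0r; exact: rel_scale. Qed.

Lemma rhoN1 : rho (-1) = -1.
Proof.
have e0 : rho 0 = 0 by apply: (@addrI _ (rho 0)); rewrite -rhoD !addr0.
by apply/eqP; rewrite -addr_eq0 -rho1 -rhoD addNr e0.
Qed.

Lemma relB a b (t : lt a b) d x y x' y' : rel t d x y -> rel t d x' y' -> rel t d (x - x') (y - y').
Proof.
move=> h /(relZ (-1)); rewrite rhoN1 !scaleN1r => h'; exact: relD.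
Qed.

Lemma lid_dom a b (t : lt a b) d x : lid (fun l e => exists y, rel t (l + d) (e *: x) y).
Proof.
split=> [l e e' _ _ [y h] [y' h']|l j e c _ dc [y h]].
  by exists (y + y'); rewrite scalerDl; exact: relD.
by exists (c *: y); rewrite -addrA -scalerA; exact: rel_scale.
Qed.

Lemma rel_small a b (t : lt a b) d y : rel t d 0 y -> tor y.
Proof.
elim: t d y => {a b} [a b f|a b s Ss|a b c g IHg f IHf|a b|a b f IHf g IHg|a b f IHf|a b r f IHf] d y /=.
- by move=> ->; rewrite ap0; exact: tor0.
- by move=> [hy ey]; have [h _] := proj1 (sigmaP s) Ss; exact: (h d).
- move=> [z [/IHf tz h]]; apply: (tor_loc tz) => l e de e0.
  by apply: (IHg (l + d)); rewrite -e0; exact: rel_scale.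
- by move=> ->; exact: tor0.
- by move=> [y1 [y2 [/IHf h1 /IHg h2 ->]]]; exact: torD.
- by move=> [y1 /IHf h ->]; exact: torN.
- by move=> [y1 /IHf h ->]; exact: torZ.
Qed.

Lemma rel_dense a b (t : lt a b) d x : hm d x -> F (fun l e => exists y, rel t (l + d) (e *: x) y).
Proof.
elim: t d x => {a b} [a b f|a b s Ss|a b c g IHg f IHf|a b|a b f IHf g IHg|a b f IHf|a b r f IHf] d x hx /=.
- by apply: F_sub F_all _ => l e _ _; exists (f $ (e *: x)).
- have [_ h] := proj1 (sigmaP s) Ss; apply: F_sub (h d x hx) _ => l e de [y ey].
  exact: im_hm (hm_scale de hx) ey.
- apply: (F_loc (lid_dom (lcomp g f) d x) (IHf d x hx)) => j e de [y hy].
  have hmy := rel_hm (hm_scale de hx) hy.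
  apply: F_sub (IHg _ y hmy) _ => l c' dc [z hz]; exists z, (c' *: y); split.
    by rewrite -scalerA -addrA; exact: rel_scale.
  by rewrite -addrA.
- by apply: F_sub F_all _ => l e _ _; exists 0.
- apply: F_sub (F_cap (lid_dom f d x) (lid_dom g d x) (IHf d x hx) (IHg d x hx)) _.
  by move=> l e _ [[y1 h1] [y2 h2]]; exists (y1 + y2), y1, y2.
- by apply: F_sub (IHf d x hx) _ => l e _ [y h]; exists (- y), y.
- by apply: F_sub (IHf d x hx) _ => l e _ [y h]; exists (rho r *: y), y.
Qed.

Definition req a b (t t' : lt a b) : Prop :=
  forall d x y y', hm d x -> rel t d x y -> rel t' d x y' -> tor (y - y').

Lemma req_incl a b (t t' : lt a b) :
  (forall d x y, hm d x -> rel t d x y -> rel t' d x y) -> req t t'.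
Proof.
move=> h d x y y' hx /(h d x y hx) h1 h2; apply: (@rel_small _ _ t' d).
by rewrite -(subrr x); exact: relB.
Qed.

Lemma req_sym a b (t t' : lt a b) : req t t' -> req t' t.
Proof. by move=> h d x y y' hx h1 h2; rewrite -opprB; apply: torN; exact: (h d x). Qed.

Lemma lcong_req a b (t t' : lt a b) : lcong t t' -> req t t'.
Proof.
elim=> {a b t t'}.
- by move=> a b f; exact: req_incl.
- by move=> a b f g _; exact: req_sym.
- move=> a b f g h _ IH1 _ IH2 d x y y' hx h1 h2.
  (* The middle term [g] may be undefined at [x]. It is defined at [e *: x] for [e] in an ideal
     belonging to [F], where the comparison can be made, and torsion may be tested on such an
     ideal. *)
  apply: (tor_loc (rel_dense g hx)) => l e de [z hz].
  rewrite scalerBr -[e *: y](subrK z) -addrA; apply: torD.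
    by apply: (IH1 _ _ _ _ (hm_scale de hx)) => //; exact: rel_scale.
  by apply: (IH2 _ _ _ _ (hm_scale de hx)) => //; exact: rel_scale.
- move=> a b c g g' f f' _ IHg _ IHf d x z z' hx [y [h1 h2]] [y' [h1' h2']].
  apply: (tor_loc (IHf d x y y' hx h1 h1')) => l e de; rewrite scalerBr => /eqP.
  rewrite subr_eq0 => /eqP ey; rewrite scalerBr.
  apply: (IHg (l + d) (e *: y)); first exact: hm_scale (rel_hm hx h1).
    exact: rel_scale.
  by rewrite ey; exact: rel_scale.
- move=> a b f f' g g' _ IH1 _ IH2 d x _ _ hx [y1 [y2 [h1 h2 ->]]] [y1' [y2' [h1' h2' ->]]].
  by rewrite opprD addrACA; apply: torD; [exact: (IH1 d x)|exact: (IH2 d x)].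
- move=> a b f f' _ IH d x _ _ hx [y1 h1 ->] [y1' h1' ->].
  by rewrite -opprD; apply: torN; exact: (IH d x).
- move=> a b r f f' _ IH d x _ _ hx [y1 h1 ->] [y1' h1' ->].
  by rewrite -scalerBr; apply: torZ; exact: (IH d x).
- move=> a b c d0 h g f; apply: req_incl => d x y hx [z [[v [h1 h2]] h3]].
  by exists v; split=> //; exists z.
- by move=> a b f; apply: req_incl => d x y hx [z [h1 /= ->]]; rewrite ap_id.
- by move=> a b f; apply: req_incl => d x y hx [z [/= -> ]]; rewrite ap_id.
- move=> a b f g h; apply: req_incl => d x y hx [y1 [y2 [h1 [y3 [y4 [h3 h4 ->]]] ->]]].
  by exists (y1 + y3), y4; split=> //; [exists y1, y3|rewrite addrA].
- move=> a b f g; apply: req_incl => d x y hx [y1 [y2 [h1 h2 ->]]].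
  by exists y2, y1; rewrite addrC.
- by move=> a b f; apply: req_incl => d x y hx [y1 [y2 [/= -> h2 ->]]]; rewrite add0r.
(* The two summands may use different values of the multivalued map of [f]; their difference is a
   value at [0], hence torsion. *)
- move=> a b f d x y y' hx [_ [y2 [[y1 h1 ->] h2 ->]]] /= ->; rewrite subr0.
  by rewrite addrC; apply: (@rel_small _ _ f d); rewrite -(subrr x); exact: relB.
- move=> a b r f g; apply: req_incl => d x y hx [_ [y1 [y2 [h1 h2 ->]]] ->].
  exists (rho r *: y1), (rho r *: y2).
  by split; [exists y1|exists y2|rewrite scalerDr].
- move=> a b r s f; apply: req_incl => d x y hx [y1 h1 ->].
  by exists (rho r *: y1), (rho s *: y1); split; [exists y1|exists y1|rewrite rhoD scalerDl].
- move=> a b r s f; apply: req_incl => d x y hx [_ [y1 h1 ->] ->].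
  by exists y1 => //; rewrite scalerA rhoM.
- by move=> a b f; apply: req_incl => d x y hx [y1 h1 ->]; rewrite rho1 scale1r.
- move=> a b c g g' f; apply: req_incl => d x y hx [z [h1 [y1 [y2 [h2 h3 ->]]]]].
  by exists y1, y2; split=> //; exists z.
- move=> a b c g f f'; apply: req_sym; apply: req_incl => d x y hx [y1 [y2 [[z1 [h1 h2]] [z2 [h3 h4]] ->]]].
  by exists (z1 + z2); split; [exists z1, z2|exact: relD].
- move=> a b c r g f; apply: req_incl => d x y hx [z [h1 [y1 h2 ->]]].
  by exists y1 => //; exists z.
- move=> a b c r g f; apply: req_sym; apply: req_incl => d x y hx [y1 [z [h1 h2]] ->].
  by exists (rho r *: z); split; [exists z|exact: relZ].
- by move=> a b f f' e; apply: req_incl => d x y hx /= ->; exact: ap_heq.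
- by move=> a b c g f; apply: req_incl => d x y hx /= ->; exists (f $ x); split=> //; rewrite ap_comp.
- by move=> a b f g; apply: req_incl => d x y hx /= ->; exists (f $ x), (g $ x); rewrite ap_hadd.
- by move=> a b r f; apply: req_incl => d x y hx /= ->; exists (f $ x); rewrite ?ap_scale.
- move=> a b s Ss; apply: req_sym; apply: req_incl => d x y hx /= ->; rewrite ap_id.
  by exists (s $ x).
- by move=> a b s Ss; apply: req_incl => d x y hx [z [[hz ez] /= ->]]; rewrite /= ap_id.
Qed.

Lemma lhom_eq0 a b (f : hom a b) : lcong (lhom Sigma f) (lzero Sigma a b) ->
  forall d (x : E a), hm d x -> tor (f $ x).
Proof.
by move=> /lcong_req h d x hx; rewrite -[f $ x]subr0; apply: (h d x).
Qed.

Lemma lhom_eq0_right a b (f : hom a b) : lcong (lhom Sigma f) (lzero Sigma a b) ->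
  exists r (s : hom r a), serre_iso T s /\ f oo s =~ hzero r b.
Proof.
move=> /lhom_eq0 h; have [r [s [si hs]]] := obj_sub (K := K) (ker_sub K f).
exists r, s; split; last by apply/(heq0_ap K) => x; rewrite ap_comp; apply: (proj2 (hs _)); exists x.
apply/sigmaP; split=> [d x hx /si ->|d y hy]; first exact: tor0.
by apply: F_sub (h d y hy) _ => l b' _ e; apply/hs; rewrite /= apZ.
Qed.

Lemma lhom_eq0_left a b (f : hom a b) : lcong (lhom Sigma f) (lzero Sigma a b) ->
  exists r (s : hom b r), serre_iso T s /\ s oo f =~ hzero a r.
Proof.
move=> /lhom_eq0 h; have [r [s [ss hs]]] := obj_quo (K := K) (im_sub K f).
exists r, s; split; last by apply/(heq0_ap K) => x; rewrite ap_comp; apply/hs; exists x.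
apply/sigmaP; split=> [d y hy /hs[x ex]|d y hy].
  by have [x' [hx' <-]] := im_hm hy ex; exact: (h d).
apply: F_sub F_all _ => l b' _ _; have [x ex] := ss y.
by exists (b' *: x); rewrite apZ ex.
Qed.

End Localize.

(** * Calculus of fractions *)

Section Transport.
Variables (R : comPzRingType) (C : lincat R).
Implicit Types a b c d : C.

Definition isom a b (s : hom a b) := exists s' : hom b a, s' oo s =~ idm a /\ s oo s' =~ idm b.

Lemma isom_comp a b c (s : hom a b) (t : hom b c) : isom s -> isom t -> isom (t oo s).
Proof.
move=> [s' [s1 s2]] [t' [t1 t2]]; exists (s' oo t'); split.
  by rewrite -compA (compA t') t1 comp_idl s1.
by rewrite -compA (compA s) s2 comp_idl t2.
Qed.

Lemma isom_epi a b (s : hom a b) : isom s -> epi s.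
Proof.
move=> [s' [s1 s2]] d g h e.
by rewrite -(comp_idr g) -s2 compA e -compA s2 comp_idr.
Qed.

Lemma isom_mono a b (s : hom a b) : isom s -> mono s.
Proof.
move=> [s' [s1 s2]] d g h e.
by rewrite -(comp_idl g) -s1 -compA e compA s1 comp_idl.
Qed.

Lemma mono_comp a b c (s : hom a b) (t : hom b c) : mono s -> mono t -> mono (t oo s).
Proof. by move=> hs ht d g h; rewrite -!compA => /ht/hs. Qed.

Lemma epi_comp a b c (s : hom a b) (t : hom b c) : epi s -> epi t -> epi (t oo s).
Proof. by move=> hs ht d g h; rewrite !compA => /hs/ht. Qed.

Lemma is_kernel_heq a b c (g g' : hom b c) (f f' : hom a b) :
  g =~ g' -> f =~ f' -> is_kernel g f -> is_kernel g' f'.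
Proof.
move=> eg ef [k1 k2 k3]; split; first by rewrite -eg -ef.
  by move=> d h h'; rewrite -ef; exact: k2.
by move=> d h; rewrite -eg => /k3[h' e]; exists h'; rewrite -ef.
Qed.

Lemma is_cokernel_heq a b c (f f' : hom a b) (g g' : hom b c) :
  f =~ f' -> g =~ g' -> is_cokernel f g -> is_cokernel f' g'.
Proof.
move=> ef eg [k1 k2 k3]; split; first by rewrite -eg -ef.
  by move=> d h h'; rewrite -eg; exact: k2.
by move=> d h; rewrite -ef => /k3[h' e]; exists h'; rewrite -eg.
Qed.

Lemma kernel_pre a b r c (t : hom b c) (s : hom r b) (k : hom a r) :
  isom s -> is_kernel (t oo s) k -> is_kernel t (s oo k).
Proof.
move=> si [k1 k2 k3]; have [s' [s1 s2]] := si; split; first by rewrite compA.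
  exact: mono_comp (isom_mono si).
move=> d h e; have [|h' eh] := k3 d (s' oo h).
  by rewrite -compA (compA s) s2 comp_idl.
by exists h'; rewrite -compA eh compA s2 comp_idl.
Qed.

Lemma cokernel_post a b r c (t : hom a b) (s : hom b r) (k : hom r c) :
  isom s -> is_cokernel (s oo t) k -> is_cokernel t (k oo s).
Proof.
move=> si [k1 k2 k3]; have [s' [s1 s2]] := si; split; first by rewrite -compA.
  exact: epi_comp (isom_epi si) k2.
move=> d h e; have [|h' eh] := k3 d (h oo s').
  by rewrite -compA (compA s') s1 comp_idl.
by exists h'; rewrite compA eh -compA s1 comp_idr.
Qed.

Lemma kernel_isom a a' b c (g : hom b c) (j : hom a b) (e : hom a' a) :
  isom e -> is_kernel g j -> is_kernel g (j oo e).
Proof.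
move=> ei [k1 k2 k3]; have [e' [e1 e2]] := ei; split; first by rewrite compA k1 comp0l.
  exact: mono_comp (isom_mono ei) k2.
move=> d h /k3[h' eh]; exists (e' oo h').
by rewrite -compA (compA e) e2 comp_idl.
Qed.

Lemma cokernel_isom a b c c' (g : hom a b) (j : hom b c) (e : hom c c') :
  isom e -> is_cokernel g j -> is_cokernel g (e oo j).
Proof.
move=> ei [k1 k2 k3]; have [e' [e1 e2]] := ei; split; first by rewrite -compA k1 comp0r.
  exact: epi_comp k2 (isom_epi ei).
move=> d h /k3[h' eh]; exists (h' oo e').
by rewrite -compA (compA e') e1 comp_idl.
Qed.

Lemma kernel0_isom a b c (g : hom b c) (f : hom a b) : g =~ hzero b c -> is_kernel g f -> isom f.
Proof.
move=> g0 [_ fm fk]; have [|f' e] := fk b (idm b); first by rewrite g0 comp0l.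
exists f'; split=> //; apply: fm; by rewrite compA e comp_idl comp_idr.
Qed.

Lemma cokernel0_isom a b c (f : hom a b) (g : hom b c) : f =~ hzero a b -> is_cokernel f g -> isom g.
Proof.
move=> f0 [_ ge gk]; have [|g' e] := gk b (idm b); first by rewrite f0 comp0r.
exists g'; split=> //; apply: ge; by rewrite -compA e comp_idl comp_idr.
Qed.

Lemma linear_to_hom0 (X : lmodType R) a c (g : X -> hom c a) : linear_to_hom g -> g 0 =~ hzero c a.
Proof.
move=> gl; apply: (@hadd_cancel _ _ _ _ (g 0)); rewrite hadd0r.
by have := gl 1 0 0; rewrite hscale1 scale1r addr0 => <-.
Qed.

End Transport.

(** * Exactness of the localization functor and transfer of effaceability *)

Section Quotient.
Variables (R : comPzRingType) (C : lincat R).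
Variable Sigma : forall a b : C, hom a b -> Prop.
Local Notation Q := (localize Sigma).
Local Notation LH f := (lhom Sigma f : @hom R Q _ _).
Hypothesis aC : abelian C.
Hypothesis image : forall (a b : C) (f : hom a b), exists i (e : hom a i) (j : hom i b) z (k : hom z a)
  v (c : hom b v), [/\ j oo e =~ f, is_kernel f k, is_cokernel k e, is_cokernel f c & is_kernel c j].
Hypothesis S_id : forall a, Sigma (idm a).
Hypothesis S_comp : forall a b c (s : hom a b) (t : hom b c), Sigma s -> Sigma t -> Sigma (t oo s).
Hypothesis S_ore : forall a b c (q : hom a c) (s : hom b c), Sigma s ->
  exists r (p1 : hom r a) (p2 : hom r b), Sigma p1 /\ q oo p1 =~ s oo p2.
Hypothesis S_ore_left : forall a b c (s : hom a b) (f : hom a c), Sigma s ->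
  exists r (i1 : hom b r) (i2 : hom c r), Sigma i2 /\ i1 oo s =~ i2 oo f.
Hypothesis S_right : forall a b (f : hom a b), LH f =~ hzero (a : Q) b ->
  exists r (s : hom r a), Sigma s /\ f oo s =~ hzero r b.
Hypothesis S_left : forall a b (f : hom a b), LH f =~ hzero (a : Q) b ->
  exists r (s : hom b r), Sigma s /\ s oo f =~ hzero a r.

Lemma LH_heq (a b : C) (f g : hom a b) : f =~ g -> LH f =~ LH g.
Proof. exact: lc_hom. Qed.
Lemma LH_comp (a b c : C) (g : hom b c) (f : hom a b) : LH (g oo f) =~ LH g oo LH f.
Proof. exact: lc_hom_comp. Qed.
Lemma LH_add (a b : C) (f g : hom a b) : LH (hadd f g) =~ hadd (LH f) (LH g).
Proof. exact: lc_hom_add. Qed.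
Lemma LH_scale (a b : C) r (f : hom a b) : LH (hscale r f) =~ hscale r (LH f).
Proof. exact: lc_hom_scale. Qed.
Lemma LH_id (a : C) : LH (idm a) =~ idm (a : Q).
Proof. exact: heq_refl. Qed.
Lemma LH0 (a b : C) : LH (hzero a b) =~ hzero (a : Q) b.
Proof. by rewrite -(LH_heq (hscale0 (hzero a b))) LH_scale hscale0. Qed.
Lemma LH_opp (a b : C) (f : hom a b) : LH (hopp f) =~ hopp (LH f).
Proof. by apply: hopp_eq; rewrite -LH_add (LH_heq (haddNr f)) LH0. Qed.

Lemma LH_isom (a b : C) (s : hom a b) : Sigma s -> isom (LH s).
Proof. by move=> Ss; exists (linv Ss); split; [exact: lc_invl|exact: lc_invr]. Qed.

Lemma right_fraction (a b : C) (t : @hom R Q a b) : exists r (p : hom r a) (q : hom r b),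
  Sigma p /\ t oo LH p =~ LH q.
Proof.
elim: t => {a b} [a b f|a b s Ss|a b c g [r [p [q [Sp e]]]] f [r' [p' [q' [Sp' e']]]]|a b
  |a b f [r [p [q [Sp e]]]] g [r' [p' [q' [Sp' e']]]]|a b f [r [p [q [Sp e]]]]
  |a b x f [r [p [q [Sp e]]]]].
- by exists a, (idm a), f; split=> //; rewrite -LH_comp; apply: LH_heq; exact: comp_idr.
- by exists a, s, (idm a); split=> //; exact: lc_invl.
- have [v [v1 [v2 [Sv ev]]]] := S_ore q' Sp.
  exists v, (p' oo v1), (q oo v2); split; first exact: S_comp.
  change ((g : @hom R Q b c) oo f oo LH (p' oo v1) =~ LH (q oo v2)).
  rewrite !LH_comp compA -(compA _ _ (LH p')) e' -compA -LH_comp (LH_heq ev) LH_comp compA.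
  by rewrite e.
- by exists a, (idm a), (hzero a b); split=> //; rewrite LH0 comp0l.
- have [v [v1 [v2 [Sv ev]]]] := S_ore p Sp'.
  exists v, (p oo v1), (hadd (q oo v1) (q' oo v2)); split; first exact: S_comp.
  change (hadd (f : @hom R Q a b) g oo LH (p oo v1) =~ LH (hadd (q oo v1) (q' oo v2))).
  rewrite compDl LH_add !LH_comp compA e -(LH_comp p v1) (LH_heq ev) LH_comp compA.
  by rewrite e'.
- exists r, p, (hopp q); split=> //.
  change (hopp (f : @hom R Q a b) oo LH p =~ LH (hopp q)).
  by rewrite compNl LH_opp e.
- exists r, p, (hscale x q); split=> //.
  change (hscale x (f : @hom R Q a b) oo LH p =~ LH (hscale x q)).
  by rewrite compZl LH_scale e.
Qed.

Lemma left_fraction (a b : C) (t : @hom R Q a b) : exists r (p : hom b r) (q : hom a r),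
  Sigma p /\ LH p oo t =~ LH q.
Proof.
have [r [p [q [Sp e]]]] := right_fraction t.
have [v [i1 [i2 [Si ei]]]] := S_ore_left q Sp.
exists v, i2, i1; split=> //; apply: (isom_epi (LH_isom Sp)).
by rewrite -compA e -!LH_comp; apply: LH_heq; rewrite ei.
Qed.

Lemma LH_mono (a b : C) (f : hom a b) : mono f -> mono (LH f).
Proof.
move=> fm; apply/mono0 => d t e.
have [r [p [q [Sp ep]]]] := right_fraction t.
have [|v [s [Ss es]]] := @S_right _ _ (f oo q).
  by rewrite LH_comp -ep compA e comp0l.
have e0 : q oo s =~ hzero v a by apply: fm; rewrite compA es comp0r.
apply: (isom_epi (isom_comp (LH_isom Ss) (LH_isom Sp))).
by rewrite compA ep -LH_comp (LH_heq e0) LH0 comp0l.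
Qed.

Lemma LH_epi (a b : C) (f : hom a b) : epi f -> epi (LH f).
Proof.
move=> fe; apply/epi0 => d t e.
have [r [p [q [Sp ep]]]] := left_fraction t.
have [|v [s [Ss es]]] := @S_left _ _ (q oo f).
  by rewrite LH_comp -ep -compA e comp0r.
have e0 : s oo q =~ hzero b v by apply: fe; rewrite -compA es comp0l.
apply: (isom_mono (isom_comp (LH_isom Sp) (LH_isom Ss))).
by rewrite -compA ep -LH_comp (LH_heq e0) LH0 comp0r.
Qed.

Lemma LH_kernel (a b c : C) (g : hom b c) (f : hom a b) : is_kernel g f -> is_kernel (LH g) (LH f).
Proof.
move=> [k1 k2 k3]; split; [by rewrite -LH_comp (LH_heq k1) LH0|exact: LH_mono|].
move=> d t e; have [r [p [q [Sp ep]]]] := right_fraction t.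
have [|v [s [Ss es]]] := @S_right _ _ (g oo q); first by rewrite LH_comp -ep compA e comp0l.
have [|h eh] := k3 v (q oo s); first by rewrite compA.
have [p' [p1 p2]] := LH_isom Sp; have [s' [s1 s2]] := LH_isom Ss.
exists (LH h oo s' oo p'); rewrite !compA -LH_comp (LH_heq eh) LH_comp -(compA (LH q)) s2 comp_idr.
by rewrite -ep -compA p2 comp_idr.
Qed.

Lemma LH_cokernel (a b c : C) (f : hom a b) (g : hom b c) : is_cokernel f g -> is_cokernel (LH f) (LH g).
Proof.
move=> [k1 k2 k3]; split; [by rewrite -LH_comp (LH_heq k1) LH0|exact: LH_epi|].
move=> d t e; have [r [p [q [Sp ep]]]] := left_fraction t.
have [|v [s [Ss es]]] := @S_left _ _ (q oo f); first by rewrite LH_comp -ep -compA e comp0r.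
have [|h eh] := k3 v (s oo q); first by rewrite -compA.
have [p' [p1 p2]] := LH_isom Sp; have [s' [s1 s2]] := LH_isom Ss.
exists (p' oo (s' oo LH h)); rewrite -!compA -LH_comp (LH_heq eh) LH_comp (compA s') s1 comp_idl.
by rewrite -ep compA p1 comp_idl.
Qed.

Lemma quotient_abelian : abelian Q.
Proof.
split.
- have [z ez] := ab_zero aC; exists z.
  by rewrite -LH_id (LH_heq ez) LH0.
- move=> a b; have [c [i [j [p [q [e1 e2 e3 e4 e5]]]]]] := ab_biproduct aC a b.
  exists c, (LH i), (LH j), (LH p), (LH q).
  split; rewrite -!LH_comp -?LH_id -?LH0 -?LH_add; exact: LH_heq.
- move=> b c t; have [r [p [q [Sp e]]]] := right_fraction t.
  have [z [k hk]] := ab_kernel aC q; exists z, (LH p oo LH k); apply: kernel_pre (LH_isom Sp) _.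
  by apply: is_kernel_heq (LH_kernel hk); [symmetry|].
- move=> a b t; have [r [p [q [Sp e]]]] := left_fraction t.
  have [z [k hk]] := ab_cokernel aC q; exists z, (LH k oo LH p); apply: cokernel_post (LH_isom Sp) _.
  by apply: is_cokernel_heq (LH_cokernel hk); [symmetry|].
(* As [q] becomes a monomorphism, its kernel [k] becomes zero and the map [e0] onto the image an
   isomorphism. Up to isomorphisms [f] is then the inclusion [j] of the image, which is the kernel
   of [c]. *)
- move=> a b f fm; have [r [p [q [Sp e]]]] := right_fraction f.
  have [i [e0 [j [z [k [v [c [h1 h2 h3 h4 h5]]]]]]]] := image q.
  have qm : mono (LH q).
    by move=> d g h; rewrite -e; exact: (mono_comp (isom_mono (LH_isom Sp)) fm).
  have k0 : LH k =~ hzero _ _.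
    by apply: qm; rewrite comp0r -LH_comp -LH0; apply: LH_heq; case: h2.
  have ei := cokernel0_isom k0 (LH_cokernel h3).
  have [p' [p1 p2]] := LH_isom Sp.
  exists v, (LH c); apply: (@is_kernel_heq _ _ _ _ _ (LH c) _ (LH j oo (LH e0 oo p'))) => //.
    by rewrite compA -LH_comp (LH_heq h1) -e -compA p2 comp_idr.
  apply: kernel_isom (LH_kernel h5); apply: isom_comp ei.
  by exists (LH p); split.
- move=> b c f fe; have [r [p [q [Sp e]]]] := right_fraction f.
  have [i [e0 [j [z [k [v [c0 [h1 h2 h3 h4 h5]]]]]]]] := image q.
  have qe : epi (LH q).
    by move=> d g h; rewrite -e; exact: (epi_comp (isom_epi (LH_isom Sp)) fe).
  have k0 : LH c0 =~ hzero _ _.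
    by apply: qe; rewrite comp0l -LH_comp -LH0; apply: LH_heq; case: h4.
  have ji := kernel0_isom k0 (LH_kernel h5).
  have [p' [p1 p2]] := LH_isom Sp.
  have pi : isom p' by exists (LH p).
  exists z, (LH p oo LH k).
  apply: (@is_cokernel_heq _ _ _ _ _ (LH p oo LH k) _ (LH j oo LH e0 oo p')) => //.
    by rewrite -LH_comp (LH_heq h1) -e -compA p2 comp_idr.
  apply: cokernel_post pi _; apply: is_cokernel_heq (cokernel_isom ji (LH_cokernel h3)) => //.
  by rewrite compA p1 comp_idl.
Qed.

Lemma common_denominator (a b : C) (t : nat -> @hom R Q a b) N : exists r (p : hom r a), Sigma p /\
  forall j, (j < N)%N -> exists q : hom r b, t j oo LH p =~ LH q.
Proof.
elim: N => [|N [r [p [Sp h]]]]; first by exists a, (idm a); split.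
have [r' [p' [q' [Sp' e']]]] := right_fraction (t N oo LH p).
exists r', (p oo p'); split; first exact: S_comp.
move=> j; rewrite ltnS leq_eqVlt => /orP[/eqP ->|/h[q e]].
  by exists q'; rewrite LH_comp compA.
by exists (q oo p'); rewrite !LH_comp compA e.
Qed.

Lemma common_annihilator (a b : C) (t : nat -> @hom R C a b) N : (forall j, LH (t j) =~ hzero _ _) ->
  exists r (p : hom r a), Sigma p /\ forall j, (j < N)%N -> t j oo p =~ hzero r b.
Proof.
move=> t0; elim: N => [|N [r [p [Sp h]]]]; first by exists a, (idm a); split.
have [|r' [p' [Sp' e']]] := @S_right _ _ (t N oo p); first by rewrite LH_comp t0 comp0l.
exists r', (p oo p'); split; first exact: S_comp.
move=> j; rewrite ltnS leq_eqVlt => /orP[/eqP ->|/h e]; first by rewrite compA.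
by rewrite compA e comp0l.
Qed.

Lemma quotient_effaceable : effaceable C -> effaceable Q.
Proof.
move=> eC P i a; have [a' [u [um hu]]] := eC P i a.
exists a', (LH u); split; first exact: LH_mono.
move=> c g gl gd.
have [N [s [phi [phi_lin phi_s]]]] := dual_basis (@rmod_proj _ P i.+1) (@rmod_fin_gen _ P i.+1).
have [c1 [p [Sp hp]]] := common_denominator (fun j => if insub j is Some r then g (s r) else hzero _ _) N.
have /choice[f hf] : forall r : 'I_N, exists q : hom c1 a', g (s r) oo LH p =~ LH q.
  by move=> r; have [q hq] := hp r (ltn_ord r); exists q; rewrite valK in hq.
(* The lifts [f r] are chosen only at the generators. Extending them through the dual basis makes
   [g1] linear in [C] itself, and not only up to morphisms that vanish in the quotient. *)
pose sm (l : seq 'I_N) y : hom c1 a' := foldr (fun r h => hadd (hscale (phi r y) (f r)) h) (hzero _ _) l.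
have sm_lin l : linear_to_hom (sm l).
  move=> r x y; elim: l => [|j l IH] /=; first by rewrite hadd0r; rewrite -{2}(hscale0 (hzero c1 a')) hscaleA mulr0 hscale0.
  rewrite IH phi_lin hscaleDl hscaleDr hscaleA -!haddA.
  apply: hadd_heq => //; rewrite !haddA; apply: hadd_heq => //; exact: haddC.
have LH_sm l y : LH (sm l y) =~ g (\sum_(r <- l) phi r y *: s r) oo LH p.
  elim: l => [|j l IH].
    change (sm [::] y) with (hzero c1 a').
    by rewrite big_nil LH0 (linear_to_hom0 gl) comp0l.
  change (sm (j :: l) y) with (hadd (hscale (phi j y) (f j)) (sm l y)).
  by rewrite big_cons gl LH_add LH_scale -hf IH compDl compZl.
pose g1 := sm (index_enum 'I_N).
have g1E y : LH (g1 y) =~ g y oo LH p by rewrite LH_sm -phi_s.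
have [M [t ht]] := @rmod_fin_gen _ P i.+2.
(* The cocycle condition for [g1] holds only in the quotient. It involves finitely many generators
   of the next module of the resolution, so a single further denominator [p2] makes it hold in
   [C]. *)
have [|c2 [p2 [Sp2 hp2]]] := @common_annihilator _ _
  (fun j => g1 (if insub j is Some r then rmap P i.+1 (t r) else 0)) M.
  move=> j; rewrite g1E; case: insub => [r|]; last by rewrite (linear_to_hom0 gl) comp0l.
  by rewrite gd comp0l.
have g2l : linear_to_hom (fun y => g1 y oo p2).
  move=> r x y; have e : g1 (r *: x + y) =~ hadd (hscale r (g1 x)) (g1 y) := sm_lin _ r x y.
  by rewrite e compDl compZl.
have [|c' [p3 [h [pe hl hh]]]] := hu c2 (fun y => g1 y oo p2) g2l.
  move=> y; have [cf ->] := ht y; elim: (index_enum _) => [|r l IH].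
    by rewrite big_nil linear0; exact: (linear_to_hom0 g2l).
  rewrite big_cons linearP; have /= := g2l (cf r) (rmap P i.+1 (t r)) => ->; rewrite IH hadd0r.
  by have := hp2 r (ltn_ord r); rewrite valK => ->; rewrite -(hscale0 (hzero c2 a')) hscaleA mulr0.
exists c', (LH p oo LH p2 oo LH p3), (fun y => LH (h y)); split.
- exact: epi_comp (LH_epi pe) (isom_epi (isom_comp (LH_isom Sp2) (LH_isom Sp))).
- by move=> r x y; rewrite (LH_heq (hl r x y)) LH_add LH_scale.
- by move=> y; rewrite (LH_heq (hh y)) !LH_comp g1E -!compA.
Qed.

End Quotient.

(** * Ideals of finite colength at all points *)

Section Nil.
Variables (n : nat) (R : comPzRingType) (B : pzRingType) (deg : int -> B -> Prop) (rho : R -> B).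
Variables (pt : Type) (nz : R -> pt -> Prop) (X : seq 'I_n -> B).
Hypothesis rho_deg : forall r, deg 0 (rho r).
Hypothesis rhoM : forall r s, rho (r * s) = rho r * rho s.
Hypothesis rho1 : rho 1 = 1.
Hypothesis rhoC : forall r b, rho r * b = b * rho r.
Hypothesis deg0 : forall j, deg j 0.
Hypothesis degD : forall j a b, deg j a -> deg j b -> deg j (a + b).
Hypothesis degN : forall j a, deg j a -> deg j (- a).
Hypothesis degM : forall i j a b, deg i a -> deg j b -> deg (i + j) (a * b).
Hypothesis nz1 : forall x, nz 1 x.
Hypothesis nzM : forall f g x, nz (f * g) x <-> nz f x /\ nz g x.
Hypothesis X_deg : forall s, deg (size s)%:Z (X s).
Hypothesis X_cat : forall s t, X (s ++ t) = X s * X t.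
Hypothesis X_span : forall (l : nat) b x, deg l%:Z b -> exists f (L : seq (R * l.-tuple 'I_n)),
  nz f x /\ rho f * b = \sum_(q <- L) rho q.1 * X q.2.

Lemma deg_rho l g b : deg l b -> deg l (rho g * b).
Proof. by move=> db; have := degM (rho_deg g) db; rewrite add0r. Qed.

(* The part of degree [l] of [m_x B]. *)
Inductive mpart (x : pt) (l : int) : B -> Prop :=
| mpart0 : mpart x l 0
| mpartD f b t : ~ nz f x -> deg l b -> mpart x l t -> mpart x l (rho f * b + t).

Lemma mpart_deg x l t : mpart x l t -> deg l t.
Proof.
elim=> [|f b {}t _ db _ IH]; first exact: deg0.
by apply: degD => //; exact: deg_rho.
Qed.

Lemma mpart_add x l s t : mpart x l s -> mpart x l t -> mpart x l (s + t).
Proof.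
by move=> hs ht; elim: hs => [|f b r nf db _ IH]; rewrite ?add0r // -addrA; exact: mpartD.
Qed.

Lemma mpart_mull x j l c t : deg j c -> mpart x l t -> mpart x (j + l) (c * t).
Proof.
move=> dc; elim=> [|f b r nf db _ IH]; first by rewrite mulr0; exact: mpart0.
by rewrite mulrDr mulrA -rhoC -mulrA; apply: mpartD => //; exact: degM.
Qed.

Lemma mpart_mulr x j l c t : deg j c -> mpart x l t -> mpart x (l + j) (t * c).
Proof.
move=> dc; elim=> [|f b r nf db _ IH]; first by rewrite mul0r; exact: mpart0.
by rewrite mulrDl -mulrA; apply: mpartD => //; exact: degM.
Qed.

(** Says that [b] is zero in the degree [l] part of the fiber of [B / I] at [x]; [f] is a
    denominator invertible at [x]. *)
Definition ngood (x : pt) (I : int -> B -> Prop) (l : nat) (b : B) : Prop :=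
  exists f t, [/\ nz f x, mpart x l%:Z t & I l%:Z (rho f * b - t)].

(* The fiber at [x] of [B / I] is finite dimensional. *)
Definition fin_at (x : pt) (I : int -> B -> Prop) : Prop :=
  exists L : nat, forall l : nat, (L <= l)%N -> forall b, deg l%:Z b -> ngood x I l b.

Definition filt (I : int -> B -> Prop) : Prop :=
  forall j b x, deg j b -> fin_at x (fun l c => I (l + j) (c * b)).

Lemma filt_sub I J : filt I -> (forall l b, deg l b -> I l b -> J l b) -> filt J.
Proof.
move=> fI IJ j b x db; have [L hL] := fI j b x db; exists L => l Ll c dc.
have [f [t [nf mt It]]] := hL l Ll c dc; exists f, t; split=> //; apply: IJ It.
apply: degM => //; apply: degD; last exact: degN (mpart_deg mt).
exact: deg_rho.
Qed.

Lemma filt_all : filt (fun _ _ => True).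
Proof. by move=> j b x _; exists 0%N => l _ c _; exists 1, 0; split=> //; exact: mpart0. Qed.

Lemma filt_colon I j b : filt I -> deg j b -> filt (fun l c => I (l + j) (c * b)).
Proof.
move=> fI db j' b' x db'; have [L hL] := fI _ _ x (degM db' db); exists L => l Ll c dc.
have [f [t [nf mt It]]] := hL l Ll c dc; exists f, t; split=> //.
by rewrite -addrA -mulrA.
Qed.

Section Good.
Variables (x : pt) (I : int -> B -> Prop) (l : nat).
Hypothesis lI : lid deg I.

Lemma ngood_add b b' : deg l%:Z b -> deg l%:Z b' -> ngood x I l b -> ngood x I l b' -> ngood x I l (b + b').
Proof.
move=> db db' [f [t [nf mt It]]] [f' [t' [nf' mt' It']]].
exists (f * f'), (rho f' * t + rho f * t'); split; first exact/nzM.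
  have mr g s : mpart x l%:Z s -> mpart x l%:Z (rho g * s).
    by move=> /(mpart_mull (rho_deg g)); rewrite add0r.
  by apply: mpart_add; exact: mr.
rewrite (_ : _ - _ = rho f' * (rho f * b - t) + rho f * (rho f' * b' - t')); last first.
  rewrite !mulrBr mulrDr opprD addrACA; congr (_ + _).
    by rewrite [f * _]mulrC rhoM mulrA.
  by rewrite rhoM mulrA.
have dB g c s : deg l%:Z c -> mpart x l%:Z s -> deg l%:Z (rho g * c - s).
  by move=> dc ms; apply: degD; [exact: deg_rho|exact: degN (mpart_deg ms)].
have [lI1 lI2] := lI.
have lr g c : deg l%:Z c -> I l%:Z c -> I l%:Z (rho g * c).
  by move=> dc /(lI2 _ _ _ _ dc (rho_deg g)); rewrite add0r.
have d1 := dB f b t db mt; have d2 := dB f' b' t' db' mt'.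
by apply: lI1; [exact: deg_rho|exact: deg_rho|exact: lr|exact: lr].
Qed.

Lemma ngood_div g b : nz g x -> ngood x I l (rho g * b) -> ngood x I l b.
Proof.
move=> ng [f [t [nf mt It]]]; exists (f * g), t; split=> //; first exact/nzM.
by rewrite rhoM -mulrA.
Qed.

End Good.

Lemma lid0 I l0 l b : lid deg I -> deg l0 b -> I l0 b -> I l 0.
Proof. by move=> [_ h] db /(h l0 (l - l0) b 0 db (deg0 _)); rewrite mul0r subrK. Qed.

(** Up to denominators and [m_x B], each word [t] of length [L] is an element [e] of [J], and the
    fiber of [B / (I : e)] vanishes beyond some degree. A word of length at least [L] plus the
    largest of these degrees ends in such a [t] behind a long enough prefix, so it lies in [I] up to
    [m_x B]. *)
Lemma nil_loc x I J : lid deg I -> fin_at x J ->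
  (forall j e, deg j e -> J j e -> fin_at x (fun l c => I (l + j) (c * e))) -> fin_at x I.
Proof.
move=> lI [L hL] hJ.
(* [lid] does not say that [0] lies in each [I l]: some element of [I] is produced and multiplied by
   [0], taken in the degree that lands in [l]. *)
have I0 l : I l 0.
  have [f1 [t1 [h1 h2 h3]]] := hL L (leqnn L) 0 (deg0 _).
  have de1 : deg L%:Z (rho f1 * 0 - t1).
    by rewrite mulr0 sub0r; exact: degN (mpart_deg h2).
  have [L0 hL0] := hJ _ _ de1 h3.
  have [f2 [t2 [k1 k2 k3]]] := hL0 _ (leqnn L0) 0 (deg0 _).
  apply: (lid0 _ lI _ k3); apply: degM de1; rewrite mulr0 sub0r; exact: degN (mpart_deg k2).
have /choice[g hg] : forall t : L.-tuple 'I_n, exists ft : R * B, [/\ nz ft.1 x, mpart x L%:Z ft.2 &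
    J L%:Z (rho ft.1 * X t - ft.2)].
  move=> t; have [|f [s [h1 h2 h3]]] := hL L (leqnn L) (X t).
    by rewrite -[in X in deg X](size_tuple t); exact: X_deg.
  by exists (f, s).
have de t : deg L%:Z (rho (g t).1 * X t - (g t).2).
  have [_ h _] := hg t; apply: degD; last exact: degN (mpart_deg h).
  by apply: deg_rho; rewrite -[in X in deg X](size_tuple t); exact: X_deg.
have /choice[Lt hLt] : forall t : L.-tuple 'I_n, exists Lt : nat, forall l : nat, (Lt <= l)%N ->
    forall b, deg l%:Z b -> ngood x (fun l c => I (l + L%:Z) (c * (rho (g t).1 * X t - (g t).2))) l b.
  by move=> t; have [_ _ h] := hg t; exact: hJ (de t) h.
exists (L + \max_t Lt t)%N => l hl b db.
have lL : (L <= l)%N by exact: leq_trans (leq_addr _ _) hl.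
have el : l = (l - L + L)%N by rewrite subnK.
have [f [Q [nf eQ]]] := X_span x db.
apply: (ngood_div nf); rewrite eQ.
have gword r (s : l.-tuple 'I_n) : ngood x I l (rho r * X s).
  pose s1 := take (l - L) s; pose s2 := drop (l - L) s.
  have z1 : size s1 = (l - L)%N by rewrite size_takel // size_tuple leq_subr.
  have z2 : size s2 == L by rewrite size_drop size_tuple subKn.
  pose t : L.-tuple 'I_n := Tuple z2.
  have dc : deg (l - L)%N%:Z (rho r * X s1).
    by apply: deg_rho; rewrite -z1; exact: X_deg.
  have lt : (Lt t <= l - L)%N.
    by rewrite leq_subRL //; apply: leq_trans hl; rewrite leq_add2l; exact: leq_bigmax.
  have [f' [b' [nf' mb' Ib']]] := hLt t _ lt _ dc.
  have [ng mg Jg] := hg t.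
  have elz : l%:Z = (l - L)%N%:Z + L%:Z by rewrite -PoszD -el.
  exists (f' * (g t).1), (b' * (rho (g t).1 * X t - (g t).2) + rho f' * (rho r * X s1) * (g t).2).
  split; first exact/nzM.
    rewrite elz; apply: mpart_add; first exact: mpart_mulr.
    by apply: mpart_mull => //; exact: deg_rho.
  rewrite elz (_ : _ - _ = (rho f' * (rho r * X s1) - b') * (rho (g t).1 * X t - (g t).2)) //.
  rewrite mulrBl opprD addrCA addrC; congr (_ - _); rewrite mulrBr; congr (_ - _).
  rewrite -(cat_take_drop (l - L) s) X_cat -/s1 -[drop _ _]/(tval t) rhoM -!mulrA; congr (_ * _).
  by rewrite [in RHS]mulrA [in RHS]mulrA -(rhoC (g t).1) -!mulrA.
have dword r (s : l.-tuple 'I_n) : deg l%:Z (rho r * X s).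
  by apply: deg_rho; rewrite -[in X in deg X](size_tuple s); exact: X_deg.
elim: Q {eQ} => [|q Q IH].
  by rewrite big_nil; exists 1, 0; split=> //; [exact: mpart0|rewrite mulr0 subr0].
rewrite big_cons; apply: (ngood_add lI) => //.
by elim: (Q) => [|q' Q' IH']; rewrite ?big_nil ?big_cons //; exact: degD.
Qed.

Lemma filt_loc I J : lid deg I -> filt J ->
  (forall j e, deg j e -> J j e -> filt (fun l c => I (l + j) (c * e))) -> filt I.
Proof.
move=> lI fJ h j b x db; apply: (nil_loc _ (fJ j b x db)) => [|j' e de Je].
  have [lI1 lI2] := lI; split=> [l a c da dc|l i a c da dc Ia].
    by rewrite mulrDl; apply: lI1; exact: degM.
  by rewrite -mulrA -addrA; apply: lI2 => //; exact: degM.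
have d1 : deg 0 1 by rewrite -rho1.
have [L hL] := h _ _ (degM de db) Je 0 1 x d1.
exists L => l Ll c dc; have [f [t [h1 h2 h3]]] := hL l Ll c dc; exists f, t; split=> //.
by rewrite addr0 mulr1 in h3; rewrite -mulrA -addrA.
Qed.

End Nil.

(** * Torsion modules form a Serre subcategory *)

Section Serre.
Variables (R : comPzRingType) (C : lincat R) (B : pzRingType) (deg : int -> B -> Prop).
Variables (rho : R -> B) (K : concrete C deg rho).
Local Notation E := (el K).
Local Notation "f $ x" := (ap K f x) (at level 45, right associativity).
Variable F : (int -> B -> Prop) -> Prop.
Hypothesis F_sub : forall I J, F I -> (forall l b, deg l b -> I l b -> J l b) -> F J.
Hypothesis F_loc : forall I J, lid deg I -> F J ->
  (forall j e, deg j e -> J j e -> F (fun l c => I (l + j) (c * e))) -> F I.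

Lemma tor_serre : serre_subcategory (fun a : C => forall d (x : E a), hm d x -> tor F x).
Proof.
move=> a b c f g [/(kernel_el K)[fi fk] /(cokernel_el K)[gs gk]]; split=> [h|[ha hc] d x hx].
  split=> [d x hx|d y hy].
    by apply: (tor_inj F_sub fi); apply: (h d); exact: hm_ap.
  have [x ex] := gs y; have [x' [hx' <-]] := im_hm hy ex.
  by apply: (tor_ap F_sub); exact: (h d).
apply: (tor_loc F_sub F_loc (hc d _ (hm_ap g hx))) => l e de; rewrite -apZ => /fk[y ey].
have [y' [hy' <-]] := im_hm (hm_scale de hx) ey.
by apply: (tor_ap F_sub); exact: (ha (l + d)).
Qed.

End Serre.

(** * Words as sections of [D] *)

Lemma O_frac (k : fieldType) (n : nat) (U : opn k n) (aU : affine U) p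
    (s a : {mpoly k[n]}) d : U p -> a \is d.-homog -> s \is d.-homog -> ~ p s ->
  exists f r : O U, nz f p /\ forall Up : U p,
    sval r Up = sval f Up * lfrac (A := @S_galg k n) p a s.
Proof.
move=> Up ha hs ps.
have zo : zariski_open (fun q => U q /\ ~ q s).
  move=> q [/(opn_open (o := U))[e [u [hu qu uU]]] qs].
  exists (e + d)%N, (u * s); split; [exact: dhomogM|exact: primeM_out|].
  move=> q' h; split; [apply: uU|] => hq; apply: h; last exact: primeMl (pt_prime q') _ _ hq.
  by rewrite mulrC; exact: primeMl (pt_prime q') _ _ hq.
pose W := Opn zo; have Wp : W p by [].
have loc : locally_fraction (A := @S_galg k n) (fun q (_ : W q) => lfrac (A := @S_galg k n) q a s).
  move=> q Wq; exists W, d, a, s, (ha : cdeg (g := @S_galg k n) d a), hs; split=> // q' Wq' _.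
  by exists (proj2 Wq'); rewrite lfracE.
have WU : opn_sub W U by move=> q [].
have [f [r [nf fW hr]]] := O_local aU (Sect loc) Wp Up WU.
by exists f, r; split=> // Up'; rewrite (hr p Up' Wp nf).
Qed.

Section Combination.
Variables (k : fieldType) (n : nat) (U : opn k n) (A : galg k n) (I : eqType) (J : Type).
Hypothesis aU : affine U.
Local Notation os := (@ostr k n A U).
Variables (e : I -> A) (X : J -> sect A U) (c : I -> {mpoly k[n]}) (d : nat) (s : {mpoly k[n]}).
Variables (p : point k n) (Up : U p) (P : I -> J -> Prop).
Hypothesis c_homog : forall u, c u \is d.-homog.
Hypothesis s_homog : s \is d.-homog.
Hypothesis ps : ~ p s.
Hypothesis e_deg : forall u, cdeg 0 (e u).
Hypothesis X_e : forall u j, P u j -> sval (X j) Up = lfrac p (e u) 1.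

Lemma frac_comb (us : seq I) : (forall u, u \in us -> exists j, P u j) ->
  exists f (L : seq (O U * J)), nz f p /\
  sval (os f) Up * \sum_(u <- us) lfrac p (gcst A (c u) * e u) s =
  sval (\sum_(q <- L) os q.1 * X q.2) Up.
Proof.
elim: us => [|u us IH] hP.
  by exists 1, [::]; split; [exact: nz1|rewrite !big_nil mulr0].
have [|f [L [nf eL]]] := IH; first by move=> v hv; apply: hP; rewrite inE hv orbT.
have [g [r [ng hr]]] := O_frac aU Up (c_homog u) s_homog ps.
have [j hj] := hP u (mem_head u us).
exists (f * g), ((f * r, j) :: [seq (g * q.1, q.2) | q <- L]); split; first exact/nzM.
have sfg (a b : O U) : sval (os (a * b)) Up = loc_str A (sval a Up) * loc_str A (sval b Up).
  by rewrite -loc_strM.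
rewrite !big_cons big_map mulrDr.
rewrite [RHS](_ : _ = sval (os (f * r)) Up * sval (X j) Up +
  sval (\sum_(q <- L) os (g * q.1) * X q.2) Up) //; congr (_ + _).
  have f1 : isfrac (A := @S_galg k n) p (c u) s by exists d; split=> //; exact: (c_homog u).
  have f3 : isfrac p (e u) 1.
    by exists 0%N; split; [exact: e_deg|exact: homog1|exact: prime1 (pt_prime p)].
  rewrite !sfg hr loc_strM -!mulrA; congr (_ * (_ * _)).
  have [-> f2] := loc_str_lfrac A f1.
  by rewrite (X_e hj) (lfracM f2 f3) mulr1.
have -> : \sum_(q <- L) os (g * q.1) * X q.2 = os g * \sum_(q <- L) os q.1 * X q.2.
  by rewrite mulr_sumr; apply: eq_bigr => q _; rewrite ostrM mulrA.
rewrite [RHS](_ : _ = loc_str A (sval g Up) * sval (\sum_(q <- L) os q.1 * X q.2) Up) //.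
by rewrite -eL sfg mulrA; congr (_ * _); rewrite -!loc_strM S_locC.
Qed.

End Combination.

Section Words.
Variables (k : fieldType) (n m : nat) (w : potential k n m).
Hypothesis hsyz : syz w (malg_falg k 'I_n).
Hypothesis m0 : (0 < m)%N.
Variable U : opn k n.
Hypothesis aU : affine U.
Local Notation S := {mpoly k[n]}.
Local Notation TS := (malg_falg S 'I_n).
Local Notation R := (O U).
Local Notation B := (D w U).
Local Notation os := (fun f => ostr (E_galg w) f : D w U).

Definition wordE (s : seq 'I_n) : E_galg w := E_pi w (fword TS s).

Lemma wordE_nQE s : nQE (w := w) 0 (eq (size s)%:Z) (wordE s).
Proof.
exists (fword TS s) => //; have := @whQ_word _ _ TS 0 (eq (size s)%:Z) 1 s (homog1 k n) erefl.
by rewrite rmorph1 mul1r.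
Qed.

Lemma wordE_cdeg s : cdeg 0 (wordE s).
Proof. exact: nQE_cdeg (wordE_nQE s). Qed.

Lemma wordE_cat s t : wordE (s ++ t) = wordE s * wordE t.
Proof. by rewrite /wordE fwordM [LHS](rmorphM (E_pi w)). Qed.

Lemma wordE_isfrac p s : isfrac p (wordE s) 1.
Proof.
by exists 0%N; split; [exact: wordE_cdeg|exact: homog1|exact: prime1 (pt_prime p)].
Qed.

Fact wordX_local s : locally_fraction (fun p (_ : U p) => lfrac p (wordE s) 1).
Proof.
move=> p Up; exists U, 0%N, (wordE s), 1, (wordE_cdeg s), (homog1 k n); split=> // q _ _.
by exists (prime1 (pt_prime q)); rewrite lfracE.
Qed.

Definition wordX s : B := Sect (wordX_local s).

Lemma wordX_deg s : D_deg (size s)%:Z (wordX s).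
Proof.
apply/D_degE => p Up; exists 0%N, (wordE s), 1.
split; [exact: wordE_nQE|exact: homog1|exact: prime1 (pt_prime p)|by []].
Qed.

Lemma wordX_cat s t : wordX (s ++ t) = wordX s * wordX t.
Proof.
apply: sect_ext => p Up /=; have := lfracM (wordE_isfrac p s) (wordE_isfrac p t).
by rewrite -wordE_cat mulr1 => ->.
Qed.

Lemma E_pi_fsum (t : TS) : E_pi w t = \sum_(u <- fsupp t) gcst (E_galg w) (fcoef u t) * wordE u.
Proof.
rewrite {1}[t]fsum [LHS](rmorph_sum (E_pi w)); apply: eq_bigr => u _.
by rewrite [LHS](rmorphM (E_pi w)).
Qed.

Lemma D_deg_neg j (b : B) : j < 0 -> D_deg j b -> b = 0.
Proof.
move=> j0 /D_degE hb; apply: sect_ext => p Up; have [d [a [s [[t ea [_ h2]] hs ps e]]]] := hb p Up.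
have a0 : a = 0.
  rewrite ea E_pi_fsum big_seq big1 // => u; rewrite fsuppP => /h2 eu.
  by move: j0; rewrite eu.
exact: (etrans e (etrans (congr1 (fun a => lfrac p a s) a0) (@lfrac0 k n (E_galg w) p s))).
Qed.

(** Equal germs at one point give equality on a nonempty open subset, which suffices by [D_zero]. *)
Lemma D_stalk_eq (a b : B) p (Up : U p) : sval a Up = sval b Up -> a = b.
Proof.
move=> e; have [a1 [s1 [f1 e1]]] := loc_lfrac (sval a Up).
have e2 : sval b Up = lfrac p a1 s1 by rewrite -e.
have [V [Vp hV]] := lfrac_local f1 e1; have [V' [Vp' hV']] := lfrac_local f1 e2.
apply/eqP; rewrite -subr_eq0; apply/eqP.
apply: (D_zero hsyz m0 aU (V := opn_cap V V') (p0 := p)); first by split.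
move=> q Uq [Vq Vq']; have [_ h1] := hV q Uq Vq; have [_ h2] := hV' q Uq Vq'.
by rewrite /= h1 h2 subrr.
Qed.

Lemma wordX_span (l : nat) (b : B) p : U p -> D_deg l%:Z b ->
  exists f (L : seq (R * l.-tuple 'I_n)), nz f p /\ os f * b = \sum_(q <- L) os q.1 * wordX q.2.
Proof.
move=> Up /D_degE hb; have [d [a [s [[t ea [h1 h2]] hs ps e]]]] := hb p Up.
have eb : sval b Up = \sum_(u <- fsupp t) lfrac p (gcst (E_galg w) (fcoef u t) * wordE u : E_galg w) s.
  rewrite e ea E_pi_fsum lfrac_sum // => u; exists d; split=> //.
  by rewrite -[d]addn0; apply: cdegM (wordE_cdeg u); apply: cdeg_cst.
suff [f [L [nf eL]]] : exists f (L : seq (R * l.-tuple 'I_n)), nz f p /\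
    sval (os f * b) Up = sval (\sum_(q <- L) os q.1 * wordX q.2) Up.
  by exists f, L; split=> //; exact: (@D_stalk_eq _ _ p Up eL).
have [||f [L [nf eL]]] := @frac_comb k n U (E_galg w) (seq 'I_n) (l.-tuple 'I_n) aU
  wordE (fun s => wordX s) (fun u => fcoef u t) d s p Up
  (fun u j => u = j) h1 hs ps wordE_cdeg _ (fsupp t).
- by move=> u j ->.
- move=> u; rewrite fsuppP => /h2 [zu]; have z : size u == l by rewrite -zu.
  by exists (Tuple z).
exists f, L; split=> //; apply: etrans eL; rewrite [LHS](_ : _ = sval (os f) Up * sval b Up) //.
by rewrite eb.
Qed.

End Words.

(** * Fibers of quasi-coherent modules *)

Section Residue.
Variables (k : fieldType) (n : nat) (A : galg k n) (U : opn k n) (x : ptin U).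
Local Notation SG := (@S_galg k n).

Lemma ostr_ostr (W : opn k n) (f : O W) : ostr A (ostr SG f : O W) = ostr A f.
Proof.
apply: sect_ext => p Wp /=; have [a ->] := loc_surj (sval f Wp).
by rewrite !loc_strE; exact: frac_eqW.
Qed.

Lemma residue_strE (W : subopn U) (Wx : W x) (s : O W) :
  residue_str A (@germ_class _ _ U x (galg_Omod SG U) W Wx s) =
  @germ_class _ _ U x (galg_Omod A U) W Wx (ostr A s).
Proof.
have := @germ_repr _ _ U x (galg_Omod SG U) W Wx s; rewrite /residue_str.
move: (repr _) => [W1 W1x s1] [V [Vx [h [h' e]]]]; rewrite /= in h h' e *.
apply/germ_classP; exists V, Vx, h, h' => /=.
have ostrB (a b : O V) : ostr A (a - b) = ostr A a - ostr A b.
  by apply/eqP; rewrite eq_sym subr_eq -ostrD subrK.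
rewrite -!ostr_res -ostrB.
have hz : forall z : galg_Omod SG U V, max_ideal_span Vx z ->
  @max_ideal_span _ _ U x (galg_Omod A U) V Vx (ostr A (z : O V)).
  move=> z; elim=> [|a b _ IHa _ IHb|f a hf].
  - have -> : ostr A (0 : O V) = 0 by rewrite -(subrr 0) ostrB subrr.
    exact: mis0.
  - by rewrite ostrB; exact: misB.
  - rewrite [ostr A _](_ : _ = ostr A f * ostr A (a : O V)); last by rewrite -(ostr_ostr f) -ostrM.
    exact: (@mis_act _ _ U x (galg_Omod A U)).
exact: hz.
Qed.

Lemma residue_strD (c c' : residue x) : residue_str A (c + c') = residue_str A c + residue_str A c'.
Proof.
have [W [Wx [s [t [-> ->]]]]] := germ_surj2 c c'.
by rewrite [_ + _ in LHS]fiber_addE !residue_strE ostrD [RHS]fiber_addE.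
Qed.

Lemma residue_strM (c c' : residue x) : residue_str A (c * c') = residue_str A c * residue_str A c'.
Proof.
have [W [Wx [s [t [-> ->]]]]] := germ_surj2 c c'.
by rewrite [_ * _ in LHS]afiber_mulE !residue_strE ostrM [RHS]afiber_mulE.
Qed.

End Residue.

Section Fibers.
Variables (k : fieldType) (n m : nat) (w : potential k n m) (U : opn k n).
Hypothesis aU : affine U.
Local Notation R := (O U).
Local Notation B := (D w U).
Local Notation top := (subopn_top U).
Local Notation sub := (@opn_sub k n).
Local Notation os := (fun f => ostr (E_galg w) f : D w U).
Hypothesis D_ext : forall (W : opn k n) (t : D w W) p, W p -> sub W U ->
  exists f (b : B), [/\ nz f p, forall q, nz f q -> W q &
  forall q (Uq : U q) (Wq : W q), nz f q -> sval b Uq = loc_str (E_galg w) (sval f Uq) * sval t Wq].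
Variables (M : gmod w U) (x : ptin U).
Local Notation Df := (Dfiber w x).
Local Notation mf := (mfiber M x).
Implicit Types (W V : subopn U) (f g : R).

Definition gD W (Wx : W x) (a : D w W) : Df := @germ_class _ _ U x (galg_Omod (E_galg w) U) W Wx a.
Definition gM W (Wx : W x) (s : M W) : mf := @germ_class _ _ U x (gmod_Omod M) W Wx s.
Definition dcl (b : B) : Df := @gD top (ptin_in x) b.
Definition cls (t : M top) : mf := @gM top (ptin_in x) t.
Definition rcl f : residue x := @germ_class _ _ U x (galg_Omod (@S_galg k n) U) top (ptin_in x) f.
Local Notation rs := (residue_str (E_galg w) (x := x) : residue x -> Df).

Lemma gM_res W V (h : sub V W) (Wx : W x) (Vx : V x) (s : M W) : gM Wx s = gM Vx (gres h s).
Proof. exact: (@germ_res _ _ U x (gmod_Omod M) W V h Wx Vx s). Qed.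
Lemma gD_res W V (h : sub V W) (Wx : W x) (Vx : V x) (a : D w W) : gD Wx a = gD Vx (sres h a).
Proof. exact: (@germ_res _ _ U x (galg_Omod (E_galg w) U) W V h Wx Vx a). Qed.
Lemma gDM W (Wx : W x) (a b : D w W) : gD Wx a * gD Wx b = gD Wx (a * b).
Proof. exact: afiber_mulE. Qed.
Lemma gD_scale W (Wx : W x) (a : D w W) (s : M W) : gD Wx a *: gM Wx s = gM Wx (a *: s).
Proof. exact: mfiber_scaleE. Qed.

Lemma dclM a b : dcl (a * b) = dcl a * dcl b. Proof. by symmetry; exact: gDM. Qed.
Lemma dclD a b : dcl (a + b) = dcl a + dcl b. Proof. by symmetry; exact: fiber_addE. Qed.
Lemma dcl0 : dcl 0 = 0. Proof. by apply: (@addrI _ (dcl 0)); rewrite -dclD !addr0. Qed.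
Lemma clsD s t : cls (s + t) = cls s + cls t. Proof. by symmetry; exact: fiber_addE. Qed.
Lemma cls0 : cls 0 = 0. Proof. by apply: (@addrI _ (cls 0)); rewrite -clsD !addr0. Qed.
Lemma cls_scale b s : cls (b *: s) = dcl b *: cls s. Proof. by rewrite [RHS]gD_scale. Qed.
Lemma clsB s t : cls (s - t) = cls s - cls t.
Proof. by apply/eqP; rewrite eq_sym subr_eq -clsD subrK. Qed.

Lemma sval_in (A : galg k n) (W : opn k n) (f : sect A W) p (Wp Wp' : W p) : sval f Wp = sval f Wp'.
Proof. by rewrite (Prop_irrelevance Wp Wp'). Qed.

Lemma gres2 (W1 W2 W3 : subopn U) (h : sub W2 W1) (h' : sub W3 W2) (h'' : sub W3 W1) (s : M W1) :
  gres h'' s = gres h' (gres h s).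
Proof. by symmetry; exact: gres_comp. Qed.

Lemma gres_zero W V (h : sub V W) : gres h (0 : M W) = 0.
Proof. exact: gres0. Qed.

Lemma gresN W V (h : sub V W) (s : M W) : gres h (- s) = - gres h s.
Proof. exact: (@oresN _ _ U (gmod_Omod M)). Qed.

Lemma os_res f V (h : sub V top) : sres h (os f) = ro w V f.
Proof. by have := ro_res w h f; rewrite ro_top. Qed.

Lemma dcl_os f V (Vx : V x) : dcl (os f) = gD Vx (ro w V f).
Proof. by rewrite /dcl (gD_res (@top_sub _ _ U V) _ Vx) os_res. Qed.

Lemma fib_glob (v : mf) : exists f (t : M top), nz f x /\ dcl (os f) *: v = cls t.
Proof.
have [W [Wx [s ->]]] := germ_surj v.
have [f [t [hf [nf e]]]] := gmE aU s Wx; exists f, t; split=> //.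
have Vx : dsub f x by [].
rewrite (dcl_os _ Vx) -/(gM Wx s) (gM_res hf Wx Vx) gD_scale.
by rewrite /cls (gM_res (@top_sub _ _ U _) _ Vx) e.
Qed.

Lemma dfib_glob (c : Df) : exists f (b : B), nz f x /\ dcl (os f) * c = dcl b.
Proof.
have [W [Wx [s ->]]] := germ_surj c.
have [f [b [nf fW e]]] := D_ext s Wx (@so_sub _ _ U W); exists f, b; split=> //.
have Vx : dsub f x by []; have hf : sub (dsub f) W by move=> q; exact: fW.
rewrite (dcl_os _ Vx) -/(gD Wx s) (gD_res hf Wx Vx) gDM.
rewrite /dcl (gD_res (@top_sub _ _ U _) _ Vx); congr gD; apply: sect_ext => q Vq.
rewrite [RHS](_ : _ = sval b (nz_in Vq)); last exact: (sval_in (b : sect (E_galg w) U)).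
by rewrite (e q _ (hf q Vq) Vq) (sval_in f (nz_in Vq) (@so_sub _ _ U (dsub f) q Vq)).
Qed.

Lemma rs_rcl f : rs (rcl f) = dcl (os f).
Proof. exact: residue_strE. Qed.

Lemma res_glob (c : residue x) : exists f r, nz f x /\ dcl (os f) * rs c = dcl (os r).
Proof.
have [W [Wx [s ->]]] := germ_surj c.
have [f [r [nf fW e]]] := O_local aU (s : O W) Wx (ptin_in x) (@so_sub _ _ U W).
exists f, r; split=> //; rewrite residue_strE.
have Vx : dsub f x by []; have hf : sub (dsub f) W by move=> q; exact: fW.
rewrite (dcl_os f Vx) (dcl_os r Vx) -/(gD Wx _) (gD_res hf Wx Vx) gDM; congr gD.
rewrite -ostr_res /ro -ostrM; congr ostr; apply: sect_ext => q Vq /=.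
rewrite -(sval_in r (nz_in Vq)) (e q _ (hf q Vq) Vq); congr (_ * _); exact: sval_in.
Qed.

Lemma dcl_unit f : nz f x -> exists c : residue x, rs c * dcl (os f) = 1.
Proof.
move=> nf; have Vx : dsub f x by [].
have [g e] := inv_section (@so_sub _ _ U (dsub f)) (f := f) (fun p h => h).
exists (@germ_class _ _ U x (galg_Omod (@S_galg k n) U) (dsub f) Vx g).
rewrite residue_strE (dcl_os f Vx) -/(gD Vx _) gDM /ro -ostrM e ostr1.
by symmetry; exact: afiber1E.
Qed.

Lemma dcl_van f : ~ nz f x -> dcl (os f) = 0.
Proof.
move=> nf; have v : vanishes (sval f (ptin_in x)).
  by apply: contrapT => h; apply: nf; exists (ptin_in x).
rewrite -dcl0; apply: germ_span; rewrite subr0.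
have := @mis_act _ _ U x (galg_Omod (E_galg w) U) top (ptin_in x) f (1 : B) v.
by rewrite /= mulr1.
Qed.

(* The submodule [m_x M] of the global sections. *)
Inductive mM : M top -> Prop :=
| mM0 : mM 0
| mMD f t u : ~ nz f x -> mM u -> mM ((os f : D w top) *: t + u).

Lemma mM_add s t : mM s -> mM t -> mM (s + t).
Proof. by move=> hs ht; elim: hs => [|f b r nf _ IH]; rewrite ?add0r // -addrA; exact: mMD. Qed.

Lemma mM_scale (b : D w top) t : mM t -> mM (b *: t).
Proof.
elim=> [|f a r nf _ IH]; first by rewrite scaler0; exact: mM0.
by rewrite scalerDr scalerA -ostrC -scalerA; exact: mMD.
Qed.

Definition repr_on W (s : M W) f (t : M top) : Prop := nz f x /\ exists hf : sub (dsub f) W,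
  gres (@top_sub _ _ U (dsub f)) t = ro w (dsub f) f *: gres hf s.

Lemma repr_mul W (s : M W) f t g : repr_on s f t -> nz g x -> repr_on s (g * f) ((os g : D w top) *: t).
Proof.
move=> [nf [hf e]] ng; split; first exact/nzM.
have h1 : sub (dsub (g * f)) (dsub f) by move=> q /nzM[].
exists (sub_trans hf h1); rewrite (gres2 hf h1) (gres2 (@top_sub _ _ U (dsub f)) h1).
rewrite !gres_act e gres_ro.
have -> : sres h1 (sres (@top_sub _ _ U (dsub f)) (os g : D w top)) = ro w (dsub (g * f)) g.
  by rewrite os_res ro_res.
by rewrite scalerA -roM.
Qed.

(** A generator of [m_x M] over a neighbourhood is a function vanishing at [x] times a section.
    After multiplication by functions invertible at [x] both factors become global, and the function
    still vanishes at [x]. *)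
Lemma mis_glob W (Wx : W x) (s : gmod_Omod M W) : max_ideal_span Wx s ->
  exists f t, mM t /\ repr_on (s : M W) f t.
Proof.
elim=> [|a b _ [f [t [mt rt]]] _ [f' [t' [mt' rt']]]|f0 a hf].
- have [f [t [hf [nf e]]]] := gmE aU (0 : M W) Wx; exists f, 0; split; first exact: mM0.
  by split=> //; exists hf; rewrite !gres0 scaler0.
- have [nf _] := rt; have [nf' _] := rt'.
  have [n1 [h1 e1]] := repr_mul rt nf'; have [n2 [h2 e2]] := repr_mul rt' nf.
  exists (f' * f), ((os f' : D w top) *: t + (-1 : D w top) *: ((os f : D w top) *: t')).
  split; first by apply: mM_add; [exact: mM_scale|do 2!apply: mM_scale].
  split=> //; exists h1; rewrite gresD scaleN1r gresN e1 gresB scalerBr; congr (_ - _).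
  move: h2 e2; rewrite mulrC => h2 ->.
  by rewrite (Prop_irrelevance h1 h2).
- have [g [t [hg [ng e]]]] := gmE aU (a : M W) Wx.
  have [h [r [nh hW er]]] := O_local aU f0 Wx (ptin_in x) (@so_sub _ _ U W).
  have nr : ~ nz r x.
    move=> [Ux]; rewrite (er x Ux Wx nh); apply; apply/vanM; right; exact: hf.
  exists (h * g), ((os r : D w top) *: t); split.
    by rewrite -[_ *: t]addr0; apply: mMD => //; exact: mM0.
  split; first exact/nzM.
  have h1 : sub (dsub (h * g)) (dsub g) by move=> q /nzM[].
  exists (sub_trans hg h1).
  rewrite (gres2 hg h1) (gres2 (@top_sub _ _ U (dsub g)) h1).
  rewrite !gres_act e !gres_ro.
  have -> : sres h1 (sres (@top_sub _ _ U (dsub g)) (os r : D w top)) = ro w (dsub (h * g)) r.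
    by rewrite os_res ro_res.
  rewrite !scalerA; congr (_ *: _).
  rewrite /ro -!ostr_res -!ostrM; congr ostr; apply: sect_ext => q Vq.
  have [nhq ngq] := proj1 (nzM _ _ _) Vq.
  pose uq := @so_sub _ _ U (dsub (h * g)) q Vq; pose wq := hg q (h1 q Vq).
  rewrite [LHS](_ : _ = sval r uq * sval g uq) // [RHS](_ : _ = (sval h uq * sval g uq) * sval f0 wq) //.
  by rewrite (er q uq wq nhq) -!mulrA; congr (_ * _); exact: S_locC.
Qed.

(** Membership in [m_x M] is known only on a neighbourhood of [x]; by [gmZ] the discrepancy is
    killed by a function invertible at [x]. *)
Lemma cls_eq0 t : cls t = 0 -> exists f, nz f x /\ mM ((os f : D w top) *: t).
Proof.
rewrite [0](fiber0E (gmod_Omod M) (ptin_in x : top x)) => /germ_classP[W [Wx [hg [hh h]]]].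
have {h} /mis_glob[f [u [mu [nf [hf e]]]]] :
    @max_ideal_span _ _ U x (gmod_Omod M) W Wx (gres (hg : sub W top) t).
  have := h; rewrite [X in max_ideal_span _ X](_ : _ = gres (hg : sub W top) t) //.
  by rewrite -[RHS]subr0 -[X in _ = _ - X](@gres_zero top W hh).
have [|g ng eg] := @gmZ _ _ _ _ _ aU M ((os f : D w top) *: t - u) (dsub f) x nf.
  rewrite gresB gres_act e os_res; apply/eqP; rewrite subr_eq0; apply/eqP; congr (_ *: _).
  exact: (@gres2 top W (dsub f) hg hf).
exists (g * f); split; first exact/nzM.
move: eg; rewrite scalerBr => /eqP; rewrite subr_eq0 => /eqP eg.
by rewrite ostrM -scalerA eg; exact: mM_scale.
Qed.

End Fibers.

(** * Torsion at a point *)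

Section TorsionFiber.
Variables (k : fieldType) (n m : nat) (w : potential k n m).
Hypothesis hsyz : syz w (malg_falg k 'I_n).
Hypothesis m0 : (0 < m)%N.
Variable U : opn k n.
Hypothesis aU : affine U.
Local Notation R := (O U).
Local Notation B := (D w U).
Local Notation top := (subopn_top U).
Local Notation os := (fun f => ostr (E_galg w) f : D w U).
Variables (M : gmod w U) (x : ptin U).
Local Notation Df := (Dfiber w x).
Local Notation mf := (mfiber M x).
Local Notation rs := (residue_str (E_galg w) (x := x) : residue x -> Df).
Local Notation dcl := (dcl (w := w) x : B -> Df).
Local Notation cls := (cls (M := M) x : M top -> mf).
Local Notation nzx := (fun f (x : ptin U) => nz f x).
Local Notation mp := (mpart (@D_deg k n m w U) os nzx x).
Local Notation nil := (fin_at (@D_deg k n m w U) os nzx x).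
Local Notation pr := (pr hsyz m0 aU : int -> B -> B).
Local Notation gp := (gpart (ggr M top)).
Local Notation "b ** t" := ((b : D w top) *: (t : M top)) (at level 40).

Lemma rs1 : rs (rcl x 1) = 1.
Proof. by rewrite rs_rcl ostr1. Qed.

Lemma rs0 : rs 0 = 0.
Proof. by apply: (@addrI _ (rs 0)); rewrite -residue_strD !addr0. Qed.

Lemma dcl_osC f (c : Df) : dcl (os f) * c = c * dcl (os f).
Proof.
have [g [b [ng e]]] := dfib_glob (D_ext m0 aU) c; have [u eu] := dcl_unit w ng.
have ec : c = rs u * dcl b by rewrite -e mulrA eu mul1r.
have [h [r [nh eh]]] := res_glob w aU u; have [v ev] := dcl_unit w nh.
have cb (a : B) (f' : R) : dcl (os f') * dcl a = dcl a * dcl (os f') by rewrite -!dclM ostrC.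
have cu : dcl (os f) * rs u = rs u * dcl (os f).
  have h1 : dcl (os h) * (dcl (os f) * rs u) = dcl (os h) * (rs u * dcl (os f)).
    by rewrite !mulrA eh cb -mulrA eh cb.
  by rewrite -[LHS]mul1r -ev -mulrA h1 mulrA ev mul1r.
by rewrite ec mulrA cu -!mulrA cb.
Qed.

Inductive rsp (v : seq mf) : mf -> Prop :=
| rsp0 : rsp v 0
| rspD c a u : a \in v -> rsp v u -> rsp v (rs c *: a + u).

Lemma rsp_add v a b : rsp v a -> rsp v b -> rsp v (a + b).
Proof. by move=> ha hb; elim: ha => [|c e u he _ IH]; rewrite ?add0r // -addrA; exact: rspD. Qed.

Lemma rsp_scale v c a : rsp v a -> rsp v (rs c *: a).
Proof.
elim=> [|c' e u he _ IH]; first by rewrite scaler0; exact: rsp0.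
by rewrite scalerDr scalerA -residue_strM; exact: rspD.
Qed.

Lemma rsp_mem v a : a \in v -> rsp v a.
Proof. by move=> h; rewrite -[a]scale1r -rs1 -[_ *: _]addr0; apply: rspD => //; exact: rsp0. Qed.

Lemma rsp_mono v v' a : {subset v <= v'} -> rsp v a -> rsp v' a.
Proof. by move=> h; elim=> [|c e u he _ IH]; [exact: rsp0|apply: rspD => //; exact: h]. Qed.

Lemma rsp_os v r a : rsp v a -> rsp v (dcl (os r) *: a).
Proof. by rewrite -rs_rcl; exact: rsp_scale. Qed.

Lemma rsp_div v f a : nz f x -> rsp v (dcl (os f) *: a) -> rsp v a.
Proof.
move=> nf h; have [c e] := dcl_unit w nf.
by rewrite -[a]scale1r -e -scalerA; exact: rsp_scale.
Qed.

Lemma rsp_coef v u : rsp v u -> exists c : 'I_(size v) -> residue x,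
  u = \sum_(i < size v) (rs (c i) : Df) *: v`_i.
Proof.
elim=> [|c a {}u av _ [d ->]].
  by exists (fun=> 0); rewrite big1 // => i _; rewrite rs0 scale0r.
have ia : (index a v < size v)%N by rewrite index_mem.
exists (fun i => (if i == Ordinal ia then c else 0) + d i).
rewrite [RHS](eq_bigr (fun i : 'I_(size v) => rs (if i == Ordinal ia then c else 0) *: v`_i + rs (d i) *: v`_i)).
  rewrite big_split /=; congr (_ + _).
  rewrite (bigD1 (Ordinal ia)) //= eqxx nth_index // big1 ?addr0 // => i /negPf ->.
  by rewrite rs0 scale0r.
by move=> i _; rewrite residue_strD scalerDl.
Qed.

Lemma rsp_sum v (I : Type) (s : seq I) (F : I -> mf) : (forall i, rsp v (F i)) -> rsp v (\sum_(i <- s) F i).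
Proof. by move=> h; elim/big_ind: _ => //; [exact: rsp0|exact: rsp_add]. Qed.

Lemma dcl_sum (I : Type) (s : seq I) (F : I -> B) : dcl (\sum_(i <- s) F i) = \sum_(i <- s) dcl (F i).
Proof. by elim: s => [|i s IH]; rewrite ?big_nil ?dcl0 // !big_cons dclD IH. Qed.

Lemma cls_sum (I : Type) (s : seq I) (F : I -> M top) : cls (\sum_(i <- s) F i) = \sum_(i <- s) cls (F i).
Proof. by elim: s => [|i s IH]; rewrite ?big_nil ?cls0 // !big_cons clsD IH. Qed.

Lemma mpart_dcl l b : mp l b -> dcl b = 0.
Proof. by elim=> [|f b' t nf _ _ IH]; rewrite ?dcl0 // dclD dclM dcl_van // mul0r add0r. Qed.

Definition short_words (L : nat) : seq (seq 'I_n) :=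
  flatten [seq [seq tval t | t <- enum {: l.-tuple 'I_n}] | l <- iota 0 L].

Lemma short_wordsP L s : (size s < L)%N -> s \in short_words L.
Proof.
move=> h; apply/flattenP; exists [seq tval t | t <- enum {: (size s).-tuple 'I_n}].
  by apply: (map_f (fun l => [seq tval t | t <- enum {: l.-tuple 'I_n}])); rewrite mem_iota.
by apply/mapP; exists (in_tuple s); rewrite ?mem_enum.
Qed.

(** Elements of degree at least [L] send [y] into [m_x M] after multiplication by a function
    invertible at [x]. Those of smaller degree are, up to a denominator, combinations of words
    shorter than [L], of which there are finitely many. *)
Lemma short_span (y : M top) : nil (fun _ c => c ** y = 0) -> exists L, forall c : Df,
  rsp [seq dcl (wordX w U s) *: cls y | s <- short_words L] (c *: cls y).
Proof.
move=> [L hL]; exists L => c; set v := [seq _ | s <- _].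
have [f [b [nf e]]] := dfib_glob (D_ext m0 aU) c.
apply: (rsp_div nf); rewrite scalerA e.
have [Lb [hb ->]] := D_fin hsyz m0 aU b; rewrite dcl_sum scaler_suml big_seq.
elim/big_ind: _ => [||q /hb]; [exact: rsp0|exact: rsp_add|].
case: q => -[l|j] b' /= db; last first.
  by rewrite (D_deg_neg _ db) // dcl0 scale0r; exact: rsp0.
have [hl|hl] := ltnP l L.
  have [g [Q [ng eQ]]] := wordX_span hsyz m0 aU (ptin_in x) db.
  apply: (rsp_div ng); rewrite scalerA -dclM eQ dcl_sum scaler_suml; apply: rsp_sum => q.
  rewrite dclM -scalerA; apply: rsp_os; apply: rsp_mem; apply/mapP; exists (tval q.2) => //.
  by apply: short_wordsP; rewrite size_tuple.
have [g [t [ng mt e0]]] := hL l hl b' db.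
apply: (rsp_div ng); rewrite scalerA -dclM -cls_scale.
have -> : (os g * b') ** y = t ** y.
  by apply/eqP; rewrite -subr_eq0 -scalerBl; apply/eqP.
by rewrite cls_scale (mpart_dcl mt) scale0r; exact: rsp0.
Qed.

(** Up to a denominator, [u] is the class of a global section, a finite sum of homogeneous ones;
    each of these generates over [D_x] a submodule spanned by the images of short words. *)
Lemma tors_fiber_of_nil : (forall d (y : M top), gp d y = y -> nil (fun _ c => c ** y = 0)) ->
  tors_fiber M x.
Proof.
move=> h u; have [f [t [nf et]]] := fib_glob aU u; have [c ec] := dcl_unit w nf.
have [s us es] := gpart_sum (ggr M top) t.
exists (size s), (fun i => rs c *: cls (gp s`_i t)), (fun i u => exists a : Df, u = a *: cls (gp s`_i t)).
split=> [i|]; last first.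
  rewrite -scaler_sumr -[LHS]scale1r -ec -scalerA et {1}es cls_sum; congr (_ *: _).
  by rewrite (big_nth 0) big_mkord.
split; last by exists (rs c).
split.
- by exists 0; rewrite scale0r.
- by move=> a _ _ [b ->] [b' ->]; exists (a * b + b'); rewrite scalerDl scalerA.
have [|L hL] := @short_span (gp s`_i t); first by apply: (h s`_i); exact: gp_hom.
set v := [seq _ | s <- _] in hL.
exists (size v), (fun j => v`_j); split=> [j|_ [a ->]]; last exact: rsp_coef.
have : v`_j \in v by rewrite mem_nth.
by move=> /mapP[z _ ->]; exists (dcl (wordX w U z)).
Qed.

Lemma D_pr0 l : pr l 0 = 0.
Proof. by apply: (@addrI _ (pr l 0)); rewrite -prD !addr0. Qed.

Lemma D_prB l a b : pr l (a - b) = pr l a - pr l b.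
Proof. by apply/eqP; rewrite eq_sym subr_eq -prD subrK. Qed.

Lemma pr_os l f b : pr l (os f * b) = os f * pr l b.
Proof.
have := @pr_mulr _ _ _ (@D_degM k n m w U) (@prD _ _ _ _ hsyz m0 _ aU) (@pr_deg _ _ _ _ hsyz m0 _ aU)
  (@pr_id _ _ _ _ hsyz m0 _ aU) (@pr_ne _ _ _ _ hsyz m0 _ aU) (@pr_sum _ _ _ _ hsyz m0 _ aU) l 0 b (os f) (D_deg_ostr w f).
by rewrite addr0 -!ostrC.
Qed.

Lemma gp_pr e j b (y : M top) : gp j y = y -> gp e (b ** y) = pr (e - j) b ** y.
Proof.
exact: (@gp_prl _ _ _ (@prD _ _ _ _ hsyz m0 _ aU) (@pr_deg _ _ _ _ hsyz m0 _ aU)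
  (@pr_id _ _ _ _ hsyz m0 _ aU) (@pr_ne _ _ _ _ hsyz m0 _ aU) (@pr_sum _ _ _ _ hsyz m0 _ aU)).
Qed.

Lemma pr_bound (b : B) : exists L : nat, forall l : nat, (L <= l)%N -> pr l%:Z b = 0.
Proof.
have [s _ ->] := pr_sum hsyz m0 aU b; elim: s => [|j s [L hL]].
  by exists 0%N => l _; rewrite big_nil D_pr0.
exists (maxn L `|j|.+1) => l; rewrite geq_max => /andP[/hL e hj].
rewrite big_cons prD e addr0; apply: (pr_ne hsyz m0 aU (pr_deg hsyz m0 aU j b)) => ej.
by move: hj; rewrite ej /= ltnn.
Qed.

Section Cyclic.
Variables (d : int) (y : M top).
Hypothesis hy : gp d y = y.
Hypothesis gen : forall z : M top, exists b : B, z = b ** y.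

Lemma cyclic_rsp : tors_fiber M x -> exists vs : seq mf, forall c : Df, rsp vs (c *: cls y).
Proof.
move=> /(_ (cls y))[r [v [N [hN ->]]]].
elim: (index_enum _) => [|i s [vs hvs]].
  by exists [::] => c; rewrite big_nil scaler0; exact: rsp0.
have [[N0 NL [r' [g [hg hs]]]] Nv] := hN i.
exists (codom g ++ vs) => c; rewrite big_cons scalerDr; apply: rsp_add.
  have [e ->] : exists e : 'I_r' -> residue x, c *: v i = \sum_j rs (e j) *: g j.
    by apply: hs; rewrite -[_ *: _]addr0; exact: NL.
  apply: rsp_sum => j; apply: rsp_scale; apply: rsp_mem.
  by rewrite mem_cat codom_f.
by apply: rsp_mono (hvs c) => z hz; rewrite mem_cat hz orbT.
Qed.

(** As [y] generates the global sections, the finitely many [vs] are represented by elements of [B],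
    which have components in finitely many degrees; [L] lies beyond all of these, and scalars from
    the residue field preserve the bound. *)
Lemma rsp_glob (vs : seq mf) : exists L : nat, forall u, rsp vs u -> exists f (e : B),
  [/\ nz f x, forall l : nat, (L <= l)%N -> pr l%:Z e = 0 & dcl (os f) *: u = cls (e ** y)].
Proof.
have [L hL] : exists L : nat, forall a, a \in vs -> exists f (e : B),
    [/\ nz f x, forall l : nat, (L <= l)%N -> pr l%:Z e = 0 & dcl (os f) *: a = cls (e ** y)].
  elim: vs => [|a vs [L hL]]; first by exists 0%N.
  have [f [t [nf et]]] := fib_glob aU a; have [b eb] := gen t; have [L' hL'] := pr_bound b.
  exists (maxn L L') => a'; rewrite inE => /orP[/eqP ->|/hL[g [e [ng he eg]]]].
    exists f, b; split=> // [l|]; last by rewrite et eb.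
    by rewrite geq_max => /andP[_ /hL'].
  by exists g, e; split=> // l; rewrite geq_max => /andP[/he].
exists L => u; elim=> [|c a {}u av _ [F [e [nF he eF]]]].
  by exists 1, 0; split=> [|l _|]; [exact: nz1 (ptin_in x)|exact: D_pr0|rewrite scaler0 scale0r cls0].
have [f [b [nf hb ef]]] := hL a av; have [g [r [ng eg]]] := res_glob w aU c.
exists (F * (f * g)), (os (F * r) * b + os (f * g) * e); split.
- by apply/nzM; split=> //; apply/nzM.
- by move=> l Ll; rewrite prD !pr_os hb // he // !mulr0 addr0.
rewrite scalerDr scalerDl clsD; congr (_ + _).
  rewrite -scalerA cls_scale -ef scalerA !ostrM !dclM scalerA -!mulrA eg.
  by congr (_ *: _); congr (_ * _); exact: dcl_osC.
by rewrite -scalerA cls_scale -eF scalerA -dclM -ostrM mulrC.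
Qed.

Lemma mM_cyclic t : mM x t -> exists b : B, t = b ** y /\ forall l, mp l (pr l b).
Proof.
elim=> [|f s u nf _ [b [-> hb]]].
  by exists 0; split=> [|l]; [rewrite scale0r|rewrite D_pr0; exact: mpart0].
have [b' ->] := gen s; exists (os f * b' + b); split; first by rewrite scalerDl scalerA.
by move=> l; rewrite prD pr_os; apply: mpartD => //; exact: pr_deg.
Qed.

(** For [b] of degree [l >= L], a multiple of the class of [b ** y] is also represented by some [e]
    without component of degree [l]. Lifting this equality to global sections modulo [m_x M] and
    taking the component of degree [l + d] removes [e]. *)
Lemma nil_of_tors_fiber : tors_fiber M x -> nil (fun _ c => c ** y = 0).
Proof.
move=> /cyclic_rsp[vs hvs]; have [L hL] := rsp_glob vs; exists L => l Ll b db.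
have [f [e [nf he ef]]] := hL _ (hvs (dcl b)).
have e0 : cls ((os f * b - e) ** y) = 0.
  by rewrite scalerBl clsB -ef cls_scale scalerA -dclM subrr.
have [g [ng]] := cls_eq0 aU e0 => /mM_cyclic[b' [eb hb']].
exists (g * f), (pr l%:Z b'); split; [exact/nzM|exact: hb'|].
have := congr1 (gp (l%:Z + d)) eb; rewrite scalerA !(gp_pr _ _ hy) addrK pr_os D_prB pr_os he // subr0.
rewrite (pr_id hsyz m0 aU db) mulrA -ostrM => e1.
by rewrite scalerBl e1 subrr.
Qed.

End Cyclic.
End TorsionFiber.

(** * The category [QGr] *)

Lemma concrete_image (R : comPzRingType) (C : lincat R) (B : pzRingType) (deg : int -> B -> Prop)
    (rho : R -> B) (K : concrete C deg rho) (a b : C) (f : hom a b) :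
  exists i (e : hom a i) (j : hom i b) z (k : hom z a) v (c : hom b v),
    [/\ j oo e =~ f, is_kernel f k, is_cokernel k e, is_cokernel f c & is_kernel c j].
Proof.
have [i [j [ji hj]]] := obj_sub (K := K) (im_sub K f).
have [|e he] := @lift_along _ _ _ _ _ K _ _ _ j f ji; first by move=> x; apply/hj; exists x.
have eE x : ap K j (ap K e x) = ap K f x by rewrite -ap_comp; exact: ap_heq.
have [z [k hk]] := concrete_kernel K f; have [v [c hc]] := concrete_cokernel K f.
exists i, e, j, z, k, v, c; split=> //.
  move/(kernel_el K): hk => [_ hk]; apply/(cokernel_el K); split=> [y|y].
    have [x ex] := proj2 (hj (ap K j y)) (ex_intro _ y erefl).
    by exists x; apply: (injI ji); rewrite eE.
  by rewrite -hk -eE; split=> [->|/ji //]; rewrite ap0.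
move/(cokernel_el K): hc => [_ hc]; apply/(kernel_el K); split=> // y.
by rewrite hc; exact: hj.
Qed.

Section Instance.
Variables (k : fieldType) (n m : nat) (w : potential k n m).
Hypothesis hsyz : syz w (malg_falg k 'I_n).
Hypothesis m0 : (0 < m)%N.
Variable U : opn k n.
Hypothesis aU : affine U.
Local Notation R := (O U).
Local Notation B := (D w U).
Local Notation top := (subopn_top U).
Local Notation os := (fun f => ostr (E_galg w) f : D w U).
Local Notation deg := (@D_deg k n m w U).
Local Notation nzx := (fun f (x : ptin U) => nz f x).

(** The classical case distinction yields a single lift that is homogeneous whenever [t] is. *)
Lemma D_ext_all (W : opn k n) j (t : D w W) p : W p -> opn_sub W U ->
  exists f (b : B), [/\ nz f p, forall q, nz f q -> W q, D_deg j t -> D_deg j b &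
  forall q (Uq : U q) (Wq : W q), nz f q -> sval b Uq = loc_str (E_galg w) (sval f Uq) * sval t Wq].
Proof.
move=> Wp WU; have [h|h] := EM (D_deg j t).
  by have [f [b [h1 h2 h3 h4]]] := D_ext_deg m0 aU Wp WU h; exists f, b.
by have [f [b [h1 h2 h3]]] := D_ext m0 aU t Wp WU; exists f, b; split.
Qed.

Definition Gr_concrete : concrete (Gr w U) deg os.
Proof.
apply: (@Concrete (O U) (Gr w U) (D w U) deg os (fun M : gmod w U => M top : lmodType (D w U))
  (fun M => ggr M top) (fun M N f => (f : gmor M N) top)).
- by move=> M N f t x y; exact: gfun_lin.
- by move=> M N f j x; exact: gfun_gr.
- by move=> M N f g; split=> [h x|h W s]; [exact: h|exact: (gmor_faithful aU h)].
- by [].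
- by [].
- by [].
- by [].
- move=> M N r f x /=; congr ((ostr _ _ : D w top) *: _).
  by apply: sect_ext => p Up /=; congr (sval r _); exact: Prop_irrelevance.
- by move=> M N phi pl pg; apply: (phi_full aU pl pg) => W t p; exact: (D_ext m0 aU).
- move=> N g; exists (tilde aU (@D_zero _ _ _ _ hsyz m0 _ aU) D_ext_all g); exact: tilde_sections.
Defined.

Local Notation K := Gr_concrete.
Local Notation F := (filt deg os nzx).
Local Notation T := (@serre_core R (Gr w U) (@Tors k n m w U)).

Lemma nz1_pt (x : ptin U) : nz (1 : R) x. Proof. exact: nz1 (ptin_in x). Qed.

Lemma F_sub I J : F I -> (forall l b, deg l b -> I l b -> J l b) -> F J.
Proof.
exact: (filt_sub (@D_deg_ostr k n m w U) (@D_deg0 k n m w U) (@D_degD k n m w U) (@D_degN k n m w U)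
  (@D_degM k n m w U)).
Qed.

Lemma F_all : F (fun _ _ => True). Proof. exact: (filt_all _ nz1_pt). Qed.

Lemma F_colon I j b : F I -> deg j b -> F (fun l c => I (l + j) (c * b)).
Proof. exact: (filt_colon (@D_degM k n m w U)). Qed.

Lemma os_D f g : os (f + g) = os f + os g. Proof. exact: ostrD. Qed.
Lemma os_M f g : os (f * g) = os f * os g. Proof. exact: ostrM. Qed.
Lemma os_1 : os 1 = 1. Proof. exact: ostr1. Qed.
Lemma os_C f (b : B) : os f * b = b * os f. Proof. exact: ostrC. Qed.

Lemma F_loc I J : lid deg I -> F J ->
  (forall j e, deg j e -> J j e -> F (fun l c => I (l + j) (c * e))) -> F I.
Proof.
apply: (filt_loc (@D_deg_ostr k n m w U) os_M os_1 os_C (@D_deg0 k n m w U) (@D_degD k n m w U)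
  (@D_degN k n m w U) (@D_degM k n m w U) nz1_pt _ (X := wordX w U)).
- by move=> f g x; exact: nzM.
- exact: wordX_deg.
- exact: wordX_cat.
- by move=> l b x db; exact: (wordX_span hsyz m0 aU (ptin_in x) db).
Qed.

(** The modules with torsion homogeneous elements form a Serre subcategory contained in [Tors],
    hence lie in the core. Conversely, the colon by [b] of the annihilator of [y] is the annihilator
    of [b *: y], and it is controlled by the fibers of the submodule that [b *: y] generates. *)
Lemma core_el (a : Gr w U) : T a <-> forall d (x : el K a), hm d x -> tor F x.
Proof.
split=> [[P [sP PT Pa]] d y hy j b x db|h]; last first.
  exists (fun a : Gr w U => forall d (x : el K a), hm d x -> tor F x); split=> //.
    exact: (tor_serre K F_sub F_loc).
  move=> c hc x; apply: (tors_fiber_of_nil hsyz m0 aU) => d y hy.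
  have d1 : deg 0 (1 : B) by rewrite -os_1; exact: D_deg_ostr.
  have [L hL] := hc d y hy 0 1 x d1.
  exists L => l Ll b db; have [f [t [h1 h2 h3]]] := hL l Ll b db; exists f, t; split=> //.
  by rewrite mulr1 in h3.
have hy' : hm (j + d) (b *: y) := hm_scale db hy.
(* The cyclic submodule is a subobject of [a], so it belongs to the Serre subcategory [P] and
   thereby to [Tors]; being cyclic, it meets the hypotheses of [nil_of_tors_fiber]. *)
pose X (z : el K a) := exists c : B, z = c *: (b *: y).
have X0 : X 0 by exists 0; rewrite scale0r.
have XL c u v : X u -> X v -> X (c *: u + v).
  by move=> [c1 ->] [c2 ->]; exists (c * c1 + c2); rewrite scalerDl scalerA.
have Xg l u : X u -> X (gpart (egr K a) l u).
  move=> [c ->]; exists (pr hsyz m0 aU (l - (j + d)) c).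
  exact: (gp_pr hsyz m0 aU (M := a) l c hy').
have [z [i [ii hi]]] := obj_sub (K := K) (GSub X0 XL Xg).
have Pz : P z.
  have [c [q hq]] := concrete_cokernel K i.
  have ker : is_kernel q i by apply/(kernel_el K); split=> //; move/(cokernel_el K): hq => [].
  by apply: (proj1 (proj1 (sP _ _ _ i q _) Pa)); split.
have [y0 ey0] := proj1 (hi (b *: y)) (ex_intro _ 1 (esym (scale1r _))).
have hy0 : gpart (egr K z) (j + d) y0 = y0.
  by apply: (injI ii); rewrite ap_gp ey0.
have gen (v : el K z) : exists c : B, v = c *: y0.
  have [c ec] := proj2 (hi (ap K i v)) (ex_intro _ v erefl).
  by exists c; apply: (injI ii); rewrite ec apZ ey0.
have [L hL] := nil_of_tors_fiber hsyz m0 aU hy0 gen (PT z Pz x).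
exists L => l Ll c dc; have [f [t [h1 h2 h3]]] := hL l Ll c dc; exists f, t; split=> //.
by rewrite -scalerA -ey0 -apZ [X in ap K i X]h3 ap0.
Qed.

(** Provides an object of the category, from which [concrete_abelian] constructs the zero object as
    a subobject. *)
Lemma trivial_grading : exists (N : lmodType B), inhabited (grading deg N).
Proof.
have e0 (v : 'rV[B]_0) : v = 0 by apply/matrixP => i j; case: j.
exists ('rV[B]_0 : lmodType B); constructor.
apply: (@Grading _ _ _ (fun _ v => v)) => //.
- by move=> i j v; rewrite (e0 v) if_same.
- by move=> v; exists [::] => //; rewrite big_nil.
Qed.

Lemma quotient_flat : flat (QGr w U).
Proof.
have Sid := sigma_id F_sub F_all core_el.
have Sc := fun a b c s t => @sigma_comp _ _ _ _ _ K _ F_sub F_loc _ core_el a b c s t.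
have So := fun a b c q s => @ore _ _ _ _ _ K _ F_sub _ core_el a b c q s.
have Sol := fun a b c s f => @ore_left _ _ _ _ _ K _ F_sub _ core_el a b c s f.
have Sr := fun a b f => @lhom_eq0_right _ _ _ _ _ K (@D_deg_ostr k n m w U) os_D os_M os_1 os_C _
  F_sub F_all F_colon F_loc _ core_el a b f.
have Sl := fun a b f => @lhom_eq0_left _ _ _ _ _ K (@D_deg_ostr k n m w U) os_D os_M os_1 os_C _
  F_sub F_all F_colon F_loc _ core_el a b f.
have [N [g]] := trivial_grading; have [a0 _] := ap_obj K g.
apply: effaceable_flat.
  exact: (quotient_abelian (concrete_abelian K a0) (concrete_image K) Sid Sc So Sol Sr Sl).
apply: (quotient_effaceable Sid Sc So Sol Sr Sl).
apply: (concrete_effaceable (pr := pr hsyz m0 aU) (@D_degM k n m w U) _ _ _ _ _ K os_D os_M os_1 os_C).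
- exact: prD.
- exact: pr_deg.
- exact: pr_id.
- exact: pr_ne.
- exact: pr_sum.
- exact: D_deg_ostr.
- exact: (D_flat hsyz m0 aU).
Qed.

End Instance.

Theorem theorem1p5 (k : fieldType) (n m : nat) (w : potential k n m)
    (hm : (2 <= m)%N) (hw : superpotential w)
    (hA : calabi_yau (@A_cst k n m w) (@A_deg k n m w) 3)
    (U : opn k n) (hU : affine U) :
  flat (QGr w U).
Proof.
exact: (quotient_flat (calabi_yau_syz hw hA) (ltnW hm) hU).
Qed.
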